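(* Let $m\in\mathbb{N}_0$ and let $\eta,\tilde\eta$ be two positive functions in $W_2^{m+3}[0,1]$, each satisfying $\eta(1)=1$, $\eta^{(u)}(1)=0$ for $u=1,\dots,m+1$, $\eta^{(m+2)}(1)\neq0$ (and likewise for $\tilde\eta$), and suppose $a:=\int_0^1\sqrt{\eta(r)}\,dr>1$. Let $\varepsilon\in(0,1)$ be defined by $\int_\varepsilon^1\sqrt{\eta(r)}\,dr=\frac{a-1}{2}$. Suppose that $\tilde\eta(r)=\eta(r)$ for all $r\in[\varepsilon,1]$, and that the characteristic functions $d$ and $\tilde d$ (of $\eta$ and $\tilde\eta$ respectively) have the same zeros counted with multiplicity. Then $\tilde\eta=\eta$ on $[0,1]$. In other words, $\eta$ on $[0,1]$ is uniquely determined by its values on $[\varepsilon,1]$ together with all zeros of $d$ (real and non-real, including multiplicities).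
   Context: For a positive function $\eta$ on $[0,1]$ with $\eta(1)=1$, $\eta'(1)=0$: let $y(r,k)$ be the solution of $y''+k^2\eta(r)y=0$ with $y(0,k)=0$, $y'(0,k)=1$, and define the characteristic function $d(k):=y'(1,k)\frac{\sin k}{k}-y(1,k)\cos k$, an entire function of $k$; $\tilde d$ is defined in the same way from $\tilde\eta$. The squares of the zeros of $d$ are the transmission eigenvalues of the problem $y''+k^2\eta y=0$, $0<r<1$, $y(0)=0=y'(1)\frac{\sin k}{k}-y(1)\cos k$. *)

(* Defs.v *)
From Stdlib Require Import Reals.
Open Scope R_scope.

Definition in01 (x : R) : Prop := 0 <= x <= 1.

Definition deriv01 (f f' : R -> R) : Prop :=
  forall x, in01 x -> forall eps, 0 < eps -> exists delta, 0 < delta /\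
    forall h, h <> 0 -> in01 (x + h) -> Rabs h < delta ->
      Rabs ((f (x + h) - f x) / h - f' x) < eps.

(* W_2^1[0,1] via F. Riesz's characterisation: f is (a.e. equal to) an absolutely
   continuous function with square-integrable derivative iff the quotient sums
   sum |f(x_{i+1})-f(x_i)|^2/(x_{i+1}-x_i) over partitions of [0,1] are bounded. *)
Definition W21 (f : R -> R) : Prop :=
  exists Cst, forall (n : nat) (p : nat -> R),
    p O = 0 -> p (S n) = 1 -> (forall i, (i <= n)%nat -> p i < p (S i)) ->
    sum_f_R0 (fun i => (f (p (S i)) - f (p i)) ^ 2 / (p (S i) - p i)) n <= Cst.

Definition W2_derivs (m : nat) (eta : R -> R) (D : nat -> R -> R) : Prop :=
  (forall x, in01 x -> D O x = eta x) /\
  (forall j, (j < m + 2)%nat -> deriv01 (D j) (D (S j))) /\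
  W21 (D (m + 2)%nat).

Definition Cx : Type := (R * R)%type.
Definition RtoC (x : R) : Cx := (x, 0).
Definition C0 : Cx := (0, 0).
Definition C1 : Cx := (1, 0).
Definition Cadd (z w : Cx) : Cx := (fst z + fst w, snd z + snd w).
Definition Copp (z : Cx) : Cx := (- fst z, - snd z).
Definition Csub (z w : Cx) : Cx := Cadd z (Copp w).
Definition Cmul (z w : Cx) : Cx :=
  (fst z * fst w - snd z * snd w, fst z * snd w + snd z * fst w).
Definition Cinv (z : Cx) : Cx :=
  (fst z / (fst z ^ 2 + snd z ^ 2), - snd z / (fst z ^ 2 + snd z ^ 2)).
Definition Cdiv (z w : Cx) : Cx := Cmul z (Cinv w).
Definition Cnorm (z : Cx) : R := sqrt (fst z ^ 2 + snd z ^ 2).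
Fixpoint Cpow (z : Cx) (n : nat) : Cx :=
  match n with O => C1 | S n' => Cmul z (Cpow z n') end.
Definition Csin (z : Cx) : Cx := (sin (fst z) * cosh (snd z), cos (fst z) * sinh (snd z)).
Definition Ccos (z : Cx) : Cx := (cos (fst z) * cosh (snd z), - (sin (fst z) * sinh (snd z))).
Definition Csinc (z : Cx) : Cx := if Req_EM_T (Cnorm z) 0 then C1 else Cdiv (Csin z) z.

Definition Cderiv01 (f f' : R -> Cx) : Prop :=
  deriv01 (fun r => fst (f r)) (fun r => fst (f' r)) /\
  deriv01 (fun r => snd (f r)) (fun r => snd (f' r)).

Definition is_sol (eta : R -> R) (y yp : R -> Cx -> Cx) : Prop :=
  forall k : Cx,
    y 0 k = C0 /\ yp 0 k = C1 /\
    Cderiv01 (fun r => y r k) (fun r => yp r k) /\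
    Cderiv01 (fun r => yp r k)
             (fun r => Copp (Cmul (Cmul k k) (Cmul (RtoC (eta r)) (y r k)))).

Definition charfun (y yp : R -> Cx -> Cx) (k : Cx) : Cx :=
  Csub (Cmul (yp 1 k) (Csinc k)) (Cmul (y 1 k) (Ccos k)).

Definition Cdifferentiable (f : Cx -> Cx) (z : Cx) : Prop :=
  exists L : Cx, forall eps, 0 < eps -> exists delta, 0 < delta /\
    forall h : Cx, h <> C0 -> Cnorm h < delta ->
      Cnorm (Csub (Cdiv (Csub (f (Cadd z h)) (f z)) h) L) < eps.

Definition entire (f : Cx -> Cx) : Prop := forall z, Cdifferentiable f z.

Definition zero_order_ge (f : Cx -> Cx) (z0 : Cx) (n : nat) : Prop :=
  exists g : Cx -> Cx, entire g /\ forall z, f z = Cmul (Cpow (Csub z z0) n) (g z).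

Definition same_zeros_mult (f g : Cx -> Cx) : Prop :=
  forall z0 n, zero_order_ge f z0 n <-> zero_order_ge g z0 n.

(* Main.v *)
Require Import Defs.
From Stdlib Require Import Reals Lra Lia Classical ClassicalEpsilon FunctionalExtensionality List ZArith Factorial.
From Coquelicot Require Import Coquelicot.
Open Scope R_scope.

(** As functions of k, solutions of the equation with fixed Cauchy data are even entire functions
    of exponential type, real on both axes. The substitution behind the Liouville-Green
    approximation (q = eta^(1/4), phase(r) = int_0^r sqrt eta) bounds them on both axes, and the
    first nonvanishing derivative of eta at 1 gives a lower bound for d(it), of size
    exp(t (a + 1)) up to a power of t.

    Removing the common zeros of d and d~ in a disc of radius r leaves zero-free quotients P, Q
    with log|P| and log|Q| of size O(r), so the second derivatives of log P and log Q at a fixed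
    point are O(1/r), and (log d)'' = (log d~)''. Since d and d~ are even and real on the
    imaginary axis, d = c d~ for a real c, and comparing growth gives a = a~.

    Put Y = y(1,.) - c y~(1,.) and Y' = y'(1,.) - c y~'(1,.). From d = c d~ it follows that
    Y = F sin k / k and Y' = F cos k for an entire F, and F d is c times the Wronskian of y and y~.
    That Wronskian is constant on [eps,1], where eta = eta~; evaluated at eps it has type
    2 * (a + 1)/2 = a + 1, no more than that of d. So F has polynomial growth on the imaginary axis
    and is bounded on the real one: it is constant, and the real-axis asymptotics, oscillating
    like cos(k (a - 1)), force F = 0. At k = 0 this gives c = 1, so y and y~ have the same Cauchy
    data at eps for every k.

    For r < eps choose r' with phase(r) = phase~(r'), and let u, z be the solutions of the first
    equation with data (1,0), (0,1) at eps, and u~, z~ those of the second. Then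
    E = u(r) z~(r') - z(r) u~(r') is even and entire in k. Multiplied by y(eps,.) or y'(eps,.) it
    becomes a combination such as y(r) z~(r') - z(r) y~(r') in which the growth cancels, so E is
    bounded on both axes and decays on the real one; hence E = 0. At k = 0, E = r' - r. So the
    phases agree on [0,eps], and eta = (phase')^2. *)

(** * Complex series *)

(** Exponential type is carried by Taylor coefficients bounded by A B^n / n!, so that derivatives,
    products and division by z - z1 stay elementary; integrals appear only as means over circles.

    Two derivatives of log d are taken because log|P| may grow linearly in r: a single one would
    leave a term of order 1. The ambiguity that remains is a factor exp(B z), which evenness
    removes; Hadamard factorisation is never invoked.

    The equation for eps says that the phase at eps is a - (a - 1)/2 = (a + 1)/2. The lower bound
    for d(it) is delicate because the coefficient of exp(t) in it is a multiple of y'(1) - t y(1),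
    in which the dominant growth of y cancels; what survives is the reflection caused by the first
    nonzero derivative of eta at 1, smaller by a power of t. That loss only leaves F with polynomial
    growth, and boundedness on the real axis disposes of the polynomial. The hypothesis a > 1 makes
    cos(k (a - 1)) oscillate, so that a constant asymptotic to a multiple of it must vanish. *)

Definition cser (a : nat -> C) (s : C) : Prop :=
  is_series (fun n => fst (a n)) (fst s) /\ is_series (fun n => snd (a n)) (snd s).

Lemma C_eq (z w : C) : fst z = fst w -> snd z = snd w -> z = w.
Proof. destruct z, w; simpl; intros; subst; reflexivity. Qed.

Lemma fst_le_Cmod (z : C) : Rabs (fst z) <= Cmod z.
Proof. apply Rle_trans with (2 := Rmax_Cmod z). apply Rmax_l. Qed.

Lemma snd_le_Cmod (z : C) : Rabs (snd z) <= Cmod z.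
Proof. apply Rle_trans with (2 := Rmax_Cmod z). apply Rmax_r. Qed.

Lemma Cmod_le_abs (z : C) : Cmod z <= Rabs (fst z) + Rabs (snd z).
Proof.
  replace z with ((fst z, 0) + Ci * (snd z, 0))%C at 1.
  - apply Rle_trans with (1 := Cmod_triangle _ _).
    rewrite Cmod_mult, Cmod_Ci.
    change (fst z, 0) with (RtoC (fst z)). change (snd z, 0) with (RtoC (snd z)).
    rewrite 2!Cmod_R. lra.
  - apply C_eq; simpl; ring.
Qed.

Lemma Cmod_sqr (z : C) : Cmod z ^ 2 = fst z ^ 2 + snd z ^ 2.
Proof. unfold Cmod. rewrite pow2_sqrt; nra. Qed.

Lemma Cmod_minus_sym (z w : C) : Cmod (z - w) = Cmod (w - z).
Proof. rewrite <- Cmod_opp. f_equal. ring. Qed.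

Lemma Cmod_triangle_inv (z w : C) : Cmod z - Cmod w <= Cmod (z - w).
Proof.
  pose proof (Cmod_triangle (z - w) w) as H.
  replace (z - w + w)%C with z in H by ring. lra.
Qed.

Lemma is_series_eq (a : nat -> R) (s s' : R) : is_series a s -> s = s' -> is_series a s'.
Proof. intros H <-. exact H. Qed.

Lemma cser_unique (a : nat -> C) (s s' : C) : cser a s -> cser a s' -> s = s'.
Proof.
  intros [H1 H2] [H3 H4]. apply C_eq.
  - rewrite <- (is_series_unique _ _ H1). apply is_series_unique. exact H3.
  - rewrite <- (is_series_unique _ _ H2). apply is_series_unique. exact H4.
Qed.

Lemma cser_ext (a b : nat -> C) (s : C) : (forall n, a n = b n) -> cser a s -> cser b s.
Proof.
  intros E [H1 H2]. split; eapply is_series_ext; try eassumption;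
  intros n; simpl; rewrite E; reflexivity.
Qed.

Lemma cser_plus (a b : nat -> C) (s t : C) :
  cser a s -> cser b t -> cser (fun n => a n + b n)%C (s + t)%C.
Proof.
  intros [H1 H2] [H3 H4]. split; simpl.
  - exact (is_series_plus _ _ _ _ H1 H3).
  - exact (is_series_plus _ _ _ _ H2 H4).
Qed.

Lemma cser_scal (c : C) (a : nat -> C) (s : C) :
  cser a s -> cser (fun n => c * a n)%C (c * s)%C.
Proof.
  intros [H1 H2]. split; simpl.
  - exact (is_series_minus _ _ _ _ (is_series_scal (fst c) _ _ H1) (is_series_scal (snd c) _ _ H2)).
  - exact (is_series_plus _ _ _ _ (is_series_scal (fst c) _ _ H2) (is_series_scal (snd c) _ _ H1)).
Qed.

Lemma cser_minus (a b : nat -> C) (s t : C) :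
  cser a s -> cser b t -> cser (fun n => a n - b n)%C (s - t)%C.
Proof.
  intros H1 H2.
  replace (s - t)%C with (s + (-(1)) * t)%C by ring.
  apply cser_ext with (fun n => a n + (-(1)) * b n)%C. { intros n. ring. }
  apply cser_plus; [exact H1|]. apply cser_scal, H2.
Qed.

Lemma cser_incr (a : nat -> C) (s : C) :
  cser a s -> cser (fun n => a (S n)) (s - a O)%C.
Proof.
  intros [H1 H2]. split; simpl.
  - apply (is_series_incr_1 (fun n => fst (a n))). refine (is_series_eq _ _ _ H1 _).
    unfold plus, opp; simpl. ring.
  - apply (is_series_incr_1 (fun n => snd (a n))). refine (is_series_eq _ _ _ H2 _).
    unfold plus, opp; simpl. ring.
Qed.

Lemma cser_decr (a : nat -> C) (s : C) :
  cser (fun n => a (S n)) s -> cser a (a O + s)%C.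
Proof.
  intros [H1 H2]. split; simpl.
  - apply (is_series_decr_1 (fun n => fst (a n))). refine (is_series_eq _ _ _ H1 _).
    unfold plus, opp; simpl. ring.
  - apply (is_series_decr_1 (fun n => snd (a n))). refine (is_series_eq _ _ _ H2 _).
    unfold plus, opp; simpl. ring.
Qed.

Lemma ex_series_abs_le (a b : nat -> R) :
  (forall n, Rabs (a n) <= b n) -> ex_series b -> ex_series a.
Proof. intros H1 H2. exact (ex_series_le (K := R_AbsRing) (V := R_CompleteNormedModule) a b H1 H2). Qed.

Lemma cser_ex (a : nat -> C) (b : nat -> R) :
  (forall n, Cmod (a n) <= b n) -> ex_series b -> exists s, cser a s.
Proof.
  intros H Hb.
  destruct (ex_series_abs_le (fun n => fst (a n)) b) as [s1 H1]; [|exact Hb|].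
  { intros n. apply Rle_trans with (2 := H n). apply fst_le_Cmod. }
  destruct (ex_series_abs_le (fun n => snd (a n)) b) as [s2 H2]; [|exact Hb|].
  { intros n. apply Rle_trans with (2 := H n). apply snd_le_Cmod. }
  exists (s1, s2). split; assumption.
Qed.

Lemma is_series_le (a b : nat -> R) (s t : R) :
  (forall n, a n <= b n) -> is_series a s -> is_series b t -> s <= t.
Proof.
  intros H H1 H2.
  apply (is_lim_seq_le (sum_n a) (sum_n b) s t); [|exact H1|exact H2].
  intros n. apply sum_n_m_le. exact H.
Qed.

(** Estimating the two components separately would only give twice the bound, so the comparison is
    made on a single rotated real series. *)
Lemma cser_le (a : nat -> C) (s : C) (b : nat -> R) (t : R) :
  cser a s -> (forall n, Cmod (a n) <= b n) -> is_series b t -> Cmod s <= t.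
Proof.
  intros Ha H Hb.
  destruct (Req_dec (Cmod s) 0) as [E|E].
  { rewrite E. apply (is_series_le (fun _ => 0) b); [| |exact Hb].
    - intros n. apply Rle_trans with (2 := H n). apply Cmod_ge_0.
    - apply filterlim_ext with (fun _ => 0).
      + intros n. symmetry. rewrite sum_n_const. ring.
      + apply filterlim_const. }
  (* rotate so that the sum is a nonnegative real *)
  set (w := (Cconj s / Cmod s)%C).
  assert (Es : RtoC (Cmod s) <> RtoC 0) by (intros K; apply E; exact (RtoC_inj _ _ K)).
  assert (Hw : Cmod w = 1).
  { unfold w. rewrite Cmod_div by exact Es. rewrite Cmod_conj, Cmod_R, Rabs_pos_eq by apply Cmod_ge_0.
    field. exact E. }
  assert (Hs : (w * s)%C = Cmod s).
  { unfold w. replace (Cconj s / Cmod s * s)%C with ((s * Cconj s) / Cmod s)%C by (field; exact Es).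
    rewrite <- Cmod2_conj. rewrite RtoC_pow. field. exact Es. }
  destruct (cser_scal w a s Ha) as [H1 _]. rewrite Hs in H1. change (fst (RtoC (Cmod s))) with (Cmod s) in H1.
  refine (is_series_le _ b _ _ _ H1 Hb).
  intros n. apply Rle_trans with (1 := Rle_abs _).
  apply Rle_trans with (1 := fst_le_Cmod _).
  rewrite Cmod_mult, Hw, Rmult_1_l. exact (H n).
Qed.

Lemma sum_C_fst (u : nat -> C) n : fst (sum_n u n) = sum_f_R0 (fun k => fst (u k)) n.
Proof.
  induction n. { rewrite sum_O. reflexivity. }
  rewrite sum_Sn. transitivity (fst (sum_n u n) + fst (u (S n))); [reflexivity|].
  rewrite IHn. reflexivity.
Qed.

Lemma sum_C_snd (u : nat -> C) n : snd (sum_n u n) = sum_f_R0 (fun k => snd (u k)) n.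
Proof.
  induction n. { rewrite sum_O. reflexivity. }
  rewrite sum_Sn. transitivity (snd (sum_n u n) + snd (u (S n))); [reflexivity|].
  rewrite IHn. reflexivity.
Qed.

(** The complex Cauchy product splits into four real ones; the majorants [u] and [v] supply the
    absolute convergence that each of them requires. *)
Lemma cser_mult (a b : nat -> C) (s t : C) (u v : nat -> R) :
  cser a s -> cser b t ->
  (forall n, Cmod (a n) <= u n) -> ex_series u ->
  (forall n, Cmod (b n) <= v n) -> ex_series v ->
  cser (fun n => sum_n (fun k => a k * b (n - k)%nat)%C n) (s * t)%C.
Proof.
  intros [H1 H2] [H3 H4] Ha Hu Hb Hv.
  assert (Hf : forall (x : nat -> C) y, (forall n, Cmod (x n) <= y n) -> ex_series y ->
     ex_series (fun n => Rabs (fst (x n))) /\ ex_series (fun n => Rabs (snd (x n)))).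
  { intros x y Hx Hy. split; apply ex_series_abs_le with y; auto; intros n; rewrite Rabs_Rabsolu;
    apply Rle_trans with (2 := Hx n); [apply fst_le_Cmod | apply snd_le_Cmod]. }
  destruct (Hf a u Ha Hu) as [A1 A2]. destruct (Hf b v Hb Hv) as [B1 B2].
  split.
  - pose proof (is_series_minus _ _ _ _ (is_series_mult _ _ _ _ H1 H3 A1 B1) (is_series_mult _ _ _ _ H2 H4 A2 B2)) as K.
    refine (is_series_ext _ _ _ _ K). intros n. cbv beta. rewrite sum_C_fst. simpl.
    symmetry. apply minus_sum.
  - pose proof (is_series_plus _ _ _ _ (is_series_mult _ _ _ _ H1 H4 A1 B2) (is_series_mult _ _ _ _ H2 H3 A2 B1)) as K.
    refine (is_series_ext _ _ _ _ K). intros n. cbv beta. rewrite sum_C_snd. simpl.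
    symmetry. apply plus_sum.
Qed.

Lemma exp_series (x : R) : is_series (fun n => x ^ n / INR (fact n)) (exp x).
Proof.
  pose proof (is_exp_Reals x) as H. unfold is_pseries in H.
  refine (is_series_ext _ _ _ _ H). intros n.
  rewrite pow_n_pow. unfold scal; simpl. unfold mult; simpl. reflexivity.
Qed.

Lemma exp_series_scal (A x : R) : is_series (fun n => A * (x ^ n / INR (fact n))) (A * exp x).
Proof. exact (is_series_scal A _ _ (exp_series x)). Qed.

Lemma exp_mono (x y : R) : x <= y -> exp x <= exp y.
Proof. intros [H| ->]; [left; apply exp_increasing, H | right; reflexivity]. Qed.

Lemma cser_zero (a : nat -> C) : (forall n, a n = 0) -> cser a 0.
Proof.
  intros H. apply cser_ext with (fun _ => RtoC 0). { intros n. symmetry. apply H. }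
  split; apply filterlim_ext with (fun _ => 0); try (intros n; symmetry; simpl; rewrite sum_n_const; ring);
  apply filterlim_const.
Qed.

(** * Rules for differentiating real functions *)

Lemma Rd_eq (f : R -> R) (x l l' : R) : is_derive f x l -> l = l' -> is_derive f x l'.
Proof. intros H <-. exact H. Qed.

Lemma Rd_mult (f g : R -> R) (x l m : R) : is_derive f x l -> is_derive g x m ->
  is_derive (fun t => f t * g t) x (l * g x + f x * m).
Proof. rewrite !is_derive_Reals. intros. apply (derivable_pt_lim_mult f g); assumption. Qed.

Lemma Rd_plus (f g : R -> R) (x l m : R) : is_derive f x l -> is_derive g x m ->
  is_derive (fun t => f t + g t) x (l + m).
Proof. rewrite !is_derive_Reals. intros. apply (derivable_pt_lim_plus f g); assumption. Qed.

Lemma Rd_minus (f g : R -> R) (x l m : R) : is_derive f x l -> is_derive g x m ->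
  is_derive (fun t => f t - g t) x (l - m).
Proof. rewrite !is_derive_Reals. intros. apply (derivable_pt_lim_minus f g); assumption. Qed.

Lemma Rd_opp (f : R -> R) (x l : R) : is_derive f x l -> is_derive (fun t => - f t) x (- l).
Proof. rewrite !is_derive_Reals. intros. apply (derivable_pt_lim_opp f); assumption. Qed.

Lemma Rd_const (a x : R) : is_derive (fun _ => a) x 0.
Proof. rewrite is_derive_Reals. apply derivable_pt_lim_const. Qed.

Lemma Rd_id (x : R) : is_derive (fun t => t) x 1.
Proof. rewrite is_derive_Reals. apply derivable_pt_lim_id. Qed.

Lemma Rd_scal (a : R) (f : R -> R) (x l : R) : is_derive f x l -> is_derive (fun t => a * f t) x (a * l).
Proof. rewrite !is_derive_Reals. intros. apply (derivable_pt_lim_scal f); assumption. Qed.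

Lemma Rd_comp (f g : R -> R) (x l m : R) : is_derive g x m -> is_derive f (g x) l ->
  is_derive (fun t => f (g t)) x (l * m).
Proof. rewrite !is_derive_Reals. intros. apply (derivable_pt_lim_comp g f); assumption. Qed.

Lemma Rd_exp (f : R -> R) (x l : R) : is_derive f x l -> is_derive (fun t => exp (f t)) x (exp (f x) * l).
Proof. intros H. apply (Rd_comp exp f x); [exact H|]. apply is_derive_Reals, derivable_pt_lim_exp. Qed.

Lemma Rd_sin (f : R -> R) (x l : R) : is_derive f x l -> is_derive (fun t => sin (f t)) x (cos (f x) * l).
Proof. intros H. apply (Rd_comp sin f x); [exact H|]. apply is_derive_Reals, derivable_pt_lim_sin. Qed.

Lemma Rd_cos (f : R -> R) (x l : R) : is_derive f x l -> is_derive (fun t => cos (f t)) x (- sin (f x) * l).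
Proof. intros H. apply (Rd_comp cos f x); [exact H|]. apply is_derive_Reals, derivable_pt_lim_cos. Qed.

Lemma Rd_ext (f g : R -> R) (x l : R) : (forall t, f t = g t) -> is_derive f x l -> is_derive g x l.
Proof. intros E H. exact (is_derive_ext f g x l E H). Qed.

(** * Entire functions of exponential type, as power series *)

(** Exponential type expressed on the Taylor coefficients. The growth A exp(B |z|) and closure under
    the operations used later are read off the factorial bound, without Cauchy's integral
    formula. *)
Definition Ent (f : C -> C) : Prop := exists (c : nat -> C) (A B : R),
  0 <= A /\ 0 <= B /\ (forall n, Cmod (c n) <= A * (B ^ n / INR (fact n))) /\
  forall z, cser (fun n => c n * z ^ n)%C (f z).

Lemma fact_pos n : 0 < INR (fact n).
Proof. apply INR_fact_lt_0. Qed.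

Lemma term_bound (c : C) (A B r : R) (n : nat) (z : C) :
  0 <= A -> 0 <= B -> Cmod c <= A * (B ^ n / INR (fact n)) -> Cmod z <= r ->
  Cmod (c * z ^ n) <= A * ((B * r) ^ n / INR (fact n)).
Proof.
  intros HA HB Hc Hz. rewrite Cmod_mult, Cmod_pow, Rpow_mult_distr.
  pose proof (fact_pos n) as Hf.
  replace (A * (B ^ n * r ^ n / INR (fact n))) with (A * (B ^ n / INR (fact n)) * r ^ n) by (field; lra).
  apply Rmult_le_compat; [apply Cmod_ge_0 | apply pow_le, Cmod_ge_0 | exact Hc |].
  apply pow_incr. split; [apply Cmod_ge_0 | exact Hz].
Qed.

Lemma ex_exp_series (A x : R) : ex_series (fun n => A * (x ^ n / INR (fact n))).
Proof. eexists. apply exp_series_scal. Qed.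

Lemma Ent_of_coeff (c : nat -> C) (A B : R) :
  0 <= A -> 0 <= B -> (forall n, Cmod (c n) <= A * (B ^ n / INR (fact n))) ->
  exists f, Ent f /\ forall z, cser (fun n => c n * z ^ n)%C (f z).
Proof.
  intros HA HB Hc.
  assert (H : forall z : C, exists s, cser (fun n => c n * z ^ n)%C s).
  { intros z. apply cser_ex with (fun n => A * ((B * Cmod z) ^ n / INR (fact n))).
    - intros n. apply term_bound; auto. apply Rle_refl.
    - apply ex_exp_series. }
  exists (fun z => proj1_sig (constructive_indefinite_description _ (H z))).
  assert (Hs : forall z, cser (fun n => c n * z ^ n)%C
    (proj1_sig (constructive_indefinite_description _ (H z)))).
  { intros z. exact (proj2_sig (constructive_indefinite_description _ (H z))). }
  split; [|exact Hs]. exists c, A, B. auto.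
Qed.

Lemma Ent_ext (f g : C -> C) : (forall z, f z = g z) -> Ent f -> Ent g.
Proof.
  intros E (c & A & B & HA & HB & Hc & Hs). exists c, A, B.
  repeat split; auto; rewrite <- E; apply Hs.
Qed.

Lemma Ent_growth (f : C -> C) : Ent f ->
  exists A B, 0 <= A /\ 0 <= B /\ forall z, Cmod (f z) <= A * exp (B * Cmod z).
Proof.
  intros (c & A & B & HA & HB & Hc & Hs). exists A, B. repeat split; auto.
  intros z. apply (cser_le _ _ (fun n => A * ((B * Cmod z) ^ n / INR (fact n))) _ (Hs z)).
  - intros n. apply term_bound; auto. apply Rle_refl.
  - apply exp_series_scal.
Qed.

Lemma Ent_bounded (f : C -> C) (r : R) : Ent f ->
  exists M, 0 <= M /\ forall z, Cmod z <= r -> Cmod (f z) <= M.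
Proof.
  intros Hf. destruct (Ent_growth f Hf) as (A & B & HA & HB & H).
  exists (A * exp (B * r)). split.
  - apply Rmult_le_pos; [exact HA | left; apply exp_pos].
  - intros z Hz. apply Rle_trans with (1 := H z). apply Rmult_le_compat_l; [exact HA|].
    apply exp_mono. apply Rmult_le_compat_l; assumption.
Qed.

Lemma fact_mono_term (A B B' : R) n : 0 <= A -> 0 <= B -> B <= B' ->
  A * (B ^ n / INR (fact n)) <= A * (B' ^ n / INR (fact n)).
Proof.
  intros HA HB HBB. apply Rmult_le_compat_l; [exact HA|].
  apply Rmult_le_compat_r. { left; apply Rinv_0_lt_compat, fact_pos. }
  apply pow_incr. lra.
Qed.

Lemma Ent_plus (f g : C -> C) : Ent f -> Ent g -> Ent (fun z => f z + g z)%C.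
Proof.
  intros (c & A & B & HA & HB & Hc & Hs) (c' & A' & B' & HA' & HB' & Hc' & Hs').
  exists (fun n => c n + c' n)%C, (A + A'), (B + B'). repeat split; try lra.
  - intros n. apply Rle_trans with (1 := Cmod_triangle _ _).
    rewrite Rmult_plus_distr_r. apply Rplus_le_compat.
    + apply Rle_trans with (1 := Hc n). apply fact_mono_term; lra.
    + apply Rle_trans with (1 := Hc' n). apply fact_mono_term; lra.
  - apply (cser_ext (fun n => c n * z ^ n + c' n * z ^ n)%C).
    + intros n. ring.
    + apply (cser_plus _ _ _ _ (Hs z) (Hs' z)).
  - apply (cser_ext (fun n => c n * z ^ n + c' n * z ^ n)%C).
    + intros n. ring.
    + apply (cser_plus _ _ _ _ (Hs z) (Hs' z)).
Qed.

Lemma Ent_scal (a : C) (f : C -> C) : Ent f -> Ent (fun z => a * f z)%C.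
Proof.
  intros (c & A & B & HA & HB & Hc & Hs).
  exists (fun n => a * c n)%C, (Cmod a * A), B. split; [|split; [exact HB|split]].
  - apply Rmult_le_pos; [apply Cmod_ge_0 | exact HA].
  - intros n. rewrite Cmod_mult, Rmult_assoc. apply Rmult_le_compat_l; [apply Cmod_ge_0 | apply Hc].
  - intros z. apply (cser_ext (fun n => a * (c n * z ^ n))%C).
    + intros n. ring.
    + apply cser_scal, Hs.
Qed.

Lemma Ent_minus (f g : C -> C) : Ent f -> Ent g -> Ent (fun z => f z - g z)%C.
Proof.
  intros Hf Hg. apply (Ent_ext (fun z => f z + (-(1)) * g z)%C).
  - intros z. ring.
  - apply Ent_plus; [exact Hf | apply Ent_scal, Hg].
Qed.

Lemma Ent_rot (a : C) (f : C -> C) : Ent f -> Ent (fun z => f (a * z)%C).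
Proof.
  intros (c & A & B & HA & HB & Hc & Hs).
  exists (fun n => c n * a ^ n)%C, A, (B * Cmod a). split; [exact HA|split; [|split]].
  - apply Rmult_le_pos; [exact HB | apply Cmod_ge_0].
  - intros n. apply term_bound; auto. apply Rle_refl.
  - intros z. apply (cser_ext (fun n => c n * (a * z) ^ n)%C).
    + intros n. rewrite Cpow_mult_l. ring.
    + apply Hs.
Qed.

Lemma Ent_const (a : C) : Ent (fun _ => a).
Proof.
  destruct (Ent_of_coeff (fun n => match n with O => a | S _ => 0 end) (Cmod a) 0) as (f & Hf & Hs).
  - apply Cmod_ge_0.
  - apply Rle_refl.
  - intros [|n]; simpl.
    + right. field.
    + rewrite Cmod_0. right. unfold Rdiv. ring.
  - apply Ent_ext with f; [|exact Hf]. intros z.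
    apply (cser_unique _ _ _ (Hs z)).
    pose proof (cser_decr (fun n => match n with O => a | S _ => 0 end * z ^ n)%C 0) as H.
    cbv beta iota in H. replace (a * z ^ 0 + 0)%C with a in H by (simpl; ring). apply H.
    apply cser_zero. intros n. simpl. ring.
Qed.

Lemma fact_mult_le (i j : nat) : INR (fact i) * INR (fact j) <= INR (fact (i + j)).
Proof.
  induction i as [|i IH]. { simpl. lra. }
  change (S i + j)%nat with (S (i + j)).
  rewrite 2!fact_simpl, 2!mult_INR, Rmult_assoc.
  apply Rmult_le_compat; [apply pos_INR | | apply le_INR; lia | exact IH].
  left. apply Rmult_lt_0_compat; apply fact_pos.
Qed.

(* Polynomial division of the power series by [z - z1], using tail sums as coefficients. *)
Lemma Ent_div (f : C -> C) (z1 : C) : Ent f ->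
  exists q, Ent q /\ forall z, f z = (f z1 + (z - z1) * q z)%C.
Proof.
  intros (c & A & B & HA & HB & Hc & Hs).
  set (w := Cmod z1).
  set (T := fun j => A * (B ^ (S j) / INR (fact (S j)))).
  assert (HT : forall j, 0 <= T j).
  { intros j. apply Rmult_le_pos; [exact HA|]. apply Rmult_le_pos; [apply pow_le, HB|].
    left; apply Rinv_0_lt_compat, fact_pos. }
  assert (Hb : forall j i, Cmod (c (S j + i)%nat * z1 ^ i)%C <= T j * ((B * w) ^ i / INR (fact i))).
  { intros j i. rewrite Cmod_mult, Cmod_pow.
    apply Rle_trans with (A * (B ^ (S j + i) / INR (fact (S j + i))) * w ^ i).
    { apply Rmult_le_compat_r; [apply pow_le, Cmod_ge_0 | apply Hc]. }
    unfold T. rewrite Rpow_mult_distr, pow_add.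
    assert (Hp : 0 <= A * B ^ S j * B ^ i * w ^ i).
    { repeat apply Rmult_le_pos; auto; try apply pow_le; auto. apply Cmod_ge_0. }
    pose proof (fact_pos (S j + i)). pose proof (fact_pos (S j)). pose proof (fact_pos i).
    replace (A * (B ^ S j * B ^ i / INR (fact (S j + i))) * w ^ i)
      with (A * B ^ S j * B ^ i * w ^ i * / INR (fact (S j + i))) by (field; lra).
    replace (A * (B ^ S j / INR (fact (S j))) * (B ^ i * w ^ i / INR (fact i)))
      with (A * B ^ S j * B ^ i * w ^ i * / (INR (fact (S j)) * INR (fact i))) by (field; lra).
    apply Rmult_le_compat_l; [exact Hp|]. apply Rinv_le_contravar.
    - apply Rmult_lt_0_compat; assumption.
    - apply fact_mult_le. }
  assert (H : forall j, exists s, cser (fun i => c (S j + i)%nat * z1 ^ i)%C s).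
  { intros j. apply cser_ex with (1 := Hb j). apply ex_exp_series. }
  set (b := fun j => proj1_sig (constructive_indefinite_description _ (H j))).
  assert (Hbs : forall j, cser (fun i => c (S j + i)%nat * z1 ^ i)%C (b j)).
  { intros j. exact (proj2_sig (constructive_indefinite_description _ (H j))). }
  assert (Hrec : forall j, b j = (c (S j) + z1 * b (S j))%C).
  { intros j. apply (cser_unique _ _ _ (Hbs j)).
    replace (c (S j)) with (c (S j + 0)%nat * z1 ^ 0)%C by (rewrite Nat.add_0_r; simpl; ring).
    apply (cser_decr (fun i => c (S j + i)%nat * z1 ^ i)%C).
    apply (cser_ext (fun i => z1 * (c (S (S j) + i)%nat * z1 ^ i))%C).
    - intros i. replace (S j + S i)%nat with (S (S j) + i)%nat by lia. simpl. ring.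
    - apply cser_scal, Hbs. }
  assert (H0 : f z1 = (c O + z1 * b O)%C).
  { apply (cser_unique _ _ _ (Hs z1)).
    replace (c O) with (c O * z1 ^ 0)%C by (simpl; ring).
    apply (cser_decr (fun i => c i * z1 ^ i)%C).
    apply (cser_ext (fun i => z1 * (c (1 + i)%nat * z1 ^ i))%C).
    - intros i. simpl. ring.
    - apply cser_scal, Hbs. }
  destruct (Ent_of_coeff b (A * B * exp (B * w)) B) as (q & Hq & Hqs).
  - apply Rmult_le_pos; [nra | left; apply exp_pos].
  - exact HB.
  - intros j.
    apply Rle_trans with (T j * exp (B * w)).
    + apply (cser_le _ _ _ _ (Hbs j) (Hb j)). apply exp_series_scal.
    + unfold T. pose proof (fact_pos j). pose proof (fact_pos (S j)).
      replace (A * B * exp (B * w) * (B ^ j / INR (fact j)))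
        with (A * (B ^ S j / INR (fact j)) * exp (B * w)) by (simpl; field; lra).
      apply Rmult_le_compat_r; [left; apply exp_pos|]. apply Rmult_le_compat_l; [exact HA|].
      apply Rmult_le_compat_l; [apply pow_le, HB|]. apply Rinv_le_contravar; [assumption|].
      apply le_INR, fact_le. lia.
  - exists q. split; [exact Hq|]. intros z.
    assert (K : cser (fun n => b n * z ^ S n - z1 * (b n * z ^ n))%C ((z - z1) * q z)%C).
    { replace ((z - z1) * q z)%C with (z * q z - z1 * q z)%C by ring. apply cser_minus.
      - apply (cser_ext (fun n => z * (b n * z ^ n))%C). { intros n; simpl; ring. }
        apply cser_scal, Hqs.
      - apply cser_scal, Hqs. }
    (* summation by parts *)
    assert (K2 : cser (fun n => c n * z ^ n)%C (f z1 + (z - z1) * q z)%C).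
    { assert (E1 : cser (fun n => b n * z ^ S n - z1 * (b (S n) * z ^ S n))%C (z * q z - z1 * (q z - b O))%C).
      { apply cser_minus.
        - apply (cser_ext (fun n => z * (b n * z ^ n))%C). { intros n; simpl; ring. }
          apply cser_scal, Hqs.
        - apply cser_scal. replace (b O) with (b O * z ^ 0)%C by (simpl; ring).
          apply (cser_incr (fun n => b n * z ^ n)%C), Hqs. }
      rewrite H0.
      replace (c O + z1 * b O + (z - z1) * q z)%C with (c O * z ^ 0 + (z * q z - z1 * (q z - b O)))%C by (simpl; ring).
      apply (cser_decr (fun n => c n * z ^ n)%C).
      refine (cser_ext _ _ _ _ E1). intros n. rewrite (Hrec n). ring. }
    exact (cser_unique _ _ _ (Hs z) K2).
Qed.

Lemma binom_fact (n k : nat) : (k <= n)%nat ->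
  Binomial.C n k / INR (fact n) = / INR (fact k) * / INR (fact (n - k)).
Proof.
  intros Hk. unfold Binomial.C. pose proof (fact_pos n). pose proof (fact_pos k). pose proof (fact_pos (n - k)).
  field. repeat split; lra.
Qed.

Lemma Cmod_sum_le (u : nat -> C) n : Cmod (sum_n u n) <= sum_f_R0 (fun k => Cmod (u k)) n.
Proof.
  induction n. { rewrite sum_O. apply Rle_refl. }
  rewrite sum_Sn. apply Rle_trans with (1 := Cmod_triangle _ _). simpl. lra.
Qed.

Lemma sum_C_scal (u : nat -> C) (a : C) n : (sum_n u n * a)%C = sum_n (fun k => u k * a)%C n.
Proof.
  induction n. { rewrite 2!sum_O. reflexivity. }
  rewrite 2!sum_Sn, <- IHn. change plus with Cplus. ring.
Qed.

(** The types add: by the binomial theorem the convolution of B^k / k! and B'^k / k! is (B + B')^n /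
    n!. *)
Lemma Ent_mult (f g : C -> C) : Ent f -> Ent g -> Ent (fun z => f z * g z)%C.
Proof.
  intros (c & A & B & HA & HB & Hc & Hs) (c' & A' & B' & HA' & HB' & Hc' & Hs').
  exists (fun n => sum_n (fun k => c k * c' (n - k)%nat)%C n), (A * A'), (B + B').
  split; [nra|]. split; [lra|]. split.
  - intros n. apply Rle_trans with (1 := Cmod_sum_le _ n).
    rewrite binomial.
    unfold Rdiv. rewrite (Rmult_comm (sum_f_R0 _ _)), scal_sum, scal_sum.
    apply sum_Rle. intros k Hk. rewrite Cmod_mult.
    replace (Binomial.C n k * B ^ k * B' ^ (n - k) * / INR (fact n) * (A * A'))
      with (A * B ^ k * (A' * B' ^ (n - k)) * (Binomial.C n k / INR (fact n))) by (unfold Rdiv; ring).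
    rewrite binom_fact by exact Hk.
    replace (A * B ^ k * (A' * B' ^ (n - k)) * (/ INR (fact k) * / INR (fact (n - k))))
      with ((A * (B ^ k / INR (fact k))) * (A' * (B' ^ (n - k) / INR (fact (n - k))))) by (unfold Rdiv; ring).
    apply Rmult_le_compat; auto using Cmod_ge_0.
  - intros z.
    apply (cser_ext (fun n => sum_n (fun k => (c k * z ^ k) * (c' (n - k)%nat * z ^ (n - k)))%C n)).
    + intros n. rewrite sum_C_scal. apply sum_n_ext_loc. intros k Hk.
      replace (z ^ n)%C with (z ^ k * z ^ (n - k))%C.
      { change (@eq C (c k * z ^ k * (c' (n - k)%nat * z ^ (n - k)))%C
                 (c k * c' (n - k)%nat * (z ^ k * z ^ (n - k)))%C). ring. }
      rewrite <- Cpow_add_r. f_equal. lia.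
    + apply (cser_mult (fun n => c n * z ^ n)%C (fun n => c' n * z ^ n)%C (f z) (g z)
        (fun n => A * ((B * Cmod z) ^ n / INR (fact n)))
        (fun n => A' * ((B' * Cmod z) ^ n / INR (fact n)))); try apply ex_exp_series; try apply Hs; try apply Hs'.
      * intros n. apply term_bound; auto. apply Rle_refl.
      * intros n. apply term_bound; auto. apply Rle_refl.
Qed.

Lemma Ent_id : Ent (fun z => z).
Proof.
  destruct (Ent_of_coeff (fun n => match n with 1%nat => 1 | _ => 0 end) 1 1) as (f & Hf & Hs); try lra.
  - intros [|[|n]]; simpl fact; rewrite ?Cmod_0, ?Cmod_1; rewrite pow1.
    + simpl; lra.
    + simpl; lra.
    + rewrite Rmult_1_l. left. apply Rmult_lt_0_compat; [lra|]. apply Rinv_0_lt_compat. apply (fact_pos (S (S n))).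
  - apply Ent_ext with f; [|exact Hf]. intros z.
    apply (cser_unique _ _ _ (Hs z)).
    pose proof (cser_decr (fun n => match n with 1%nat => 1 | _ => 0 end * z ^ n)%C z) as H.
    cbv beta iota in H. replace (0 * z ^ 0 + z)%C with z in H by (simpl; ring). apply H.
    pose proof (cser_decr (fun n => match S n with 1%nat => 1 | _ => 0 end * z ^ (S n))%C 0) as H'.
    cbv beta iota in H'. replace (1 * z ^ 1 + 0)%C with z in H' by (simpl; ring). apply H'.
    apply cser_zero. intros n. simpl. ring.
Qed.

(** Taylor remainder of a monomial, by induction on the degree. The crude factor n^2 is harmless, as
    [sqr_le_pow4] absorbs it into a geometric one. *)
Lemma pow_remainder (z h : C) (r : R) (n : nat) : 1 <= r -> Cmod z <= r -> Cmod (z + h) <= r ->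
  Cmod ((z + h) ^ n - z ^ n - INR n * h * z ^ (pred n)) <= Cmod h ^ 2 * INR n ^ 2 * r ^ n.
Proof.
  intros Hr Hz Hzh. induction n as [|n IH].
  { simpl. replace (1 - 1 - 0 * h * 1)%C with (RtoC 0) by ring. rewrite Cmod_0. lra. }
  assert (E : ((z + h) ^ S n - z ^ S n - INR (S n) * h * z ^ pred (S n))%C
    = ((z + h) * ((z + h) ^ n - z ^ n - INR n * h * z ^ pred n) + INR n * (h * h) * z ^ pred n)%C).
  { rewrite S_INR, RtoC_plus. destruct n; simpl; ring. }
  rewrite E. apply Rle_trans with (1 := Cmod_triangle _ _).
  rewrite !Cmod_mult, Cmod_pow, Cmod_R, Rabs_pos_eq by apply pos_INR.
  pose proof (Cmod_ge_0 h) as Hh. pose proof (pos_INR n) as Hn.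
  assert (Hp : Cmod z ^ pred n <= r ^ S n).
  { apply Rle_trans with (r ^ pred n). { apply pow_incr. split; [apply Cmod_ge_0|exact Hz]. }
    apply Rle_pow; [exact Hr | lia]. }
  assert (Hp0 : 0 <= Cmod z ^ pred n) by apply pow_le, Cmod_ge_0.
  assert (Hrn : 0 <= r ^ S n) by (apply pow_le; lra).
  apply Rle_trans with (r * (Cmod h ^ 2 * INR n ^ 2 * r ^ n) + INR n * (Cmod h * Cmod h) * r ^ S n).
  - apply Rplus_le_compat.
    + apply Rmult_le_compat; auto using Cmod_ge_0.
    + apply Rmult_le_compat_l; [|exact Hp]. nra.
  - rewrite S_INR. replace (r * (Cmod h ^ 2 * INR n ^ 2 * r ^ n)) with (Cmod h ^ 2 * INR n ^ 2 * r ^ S n) by (simpl; ring).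
    replace ((Cmod h ^ 2 * INR n ^ 2 * r ^ S n + INR n * (Cmod h * Cmod h) * r ^ S n))
      with ((Cmod h ^ 2 * r ^ S n) * (INR n ^ 2 + INR n)) by ring.
    replace (Cmod h ^ 2 * (INR n + 1) ^ 2 * r ^ S n) with ((Cmod h ^ 2 * r ^ S n) * (INR n + 1) ^ 2) by ring.
    apply Rmult_le_compat_l; [|nra]. apply Rmult_le_pos; [nra | exact Hrn].
Qed.

Lemma sqr_le_pow4 (n : nat) : INR n ^ 2 <= 4 ^ n.
Proof.
  assert (H : INR n <= 2 ^ n).
  { induction n. { simpl; lra. } rewrite S_INR. simpl.
    assert (1 <= 2 ^ n) by (apply pow_R1_Rle; lra). lra. }
  replace 4 with (2 ^ 2) by ring. rewrite <- pow_mult, Nat.mul_comm, pow_mult.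
  apply pow_incr. split; [apply pos_INR | exact H].
Qed.

(** A quadratic remainder, uniform on discs, is what summing the series term by term yields
    directly; complex differentiability is then a corollary. *)
Definition quad_approx (f f' : C -> C) : Prop :=
  forall r, exists K, 0 <= K /\ forall z h : C, Cmod z <= r -> Cmod h <= 1 ->
    Cmod (f (z + h) - f z - h * f' z)%C <= K * Cmod h ^ 2.

(** Summing [pow_remainder] against the coefficients: the factor n^2 becomes 4^n, so the constant is
    again a value of the exponential series, at 4 B r. *)
Lemma series_quad_approx (c : nat -> C) (A B : R) (f f' : C -> C) :
  0 <= A -> 0 <= B -> (forall n, Cmod (c n) <= A * (B ^ n / INR (fact n))) ->
  (forall z, cser (fun n => c n * z ^ n)%C (f z)) ->
  (forall z, cser (fun n => INR (S n) * c (S n) * z ^ n)%C (f' z)) ->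
  quad_approx f f'.
Proof.
  intros HA HB Hc Hs Hs' r0.
  (* Leaves room for |h| <= 1 and is at least 1, as [pow_remainder] requires. *)
  set (r := Rmax r0 0 + 1).
  assert (Hr1 : 1 <= r) by (unfold r; pose proof (Rmax_r r0 0); lra).
  exists (A * exp (B * (4 * r))). split.
  { apply Rmult_le_pos; [exact HA | left; apply exp_pos]. }
  intros z h Hz Hh.
  assert (Hz' : Cmod z + 1 <= r) by (unfold r; pose proof (Rmax_l r0 0); lra).
  assert (K : cser (fun n => c n * ((z + h) ^ n - z ^ n - INR n * h * z ^ (pred n)))%C
                   (f (z + h) - f z - h * f' z)%C).
  { apply (cser_ext (fun n => (c n * (z + h) ^ n - c n * z ^ n) - h * (INR n * c n * z ^ pred n))%C).
    { intros n. ring. }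
    apply cser_minus; [apply cser_minus; apply Hs|]. apply cser_scal.
    replace (f' z) with (INR 0 * c O * z ^ pred 0 + f' z)%C by (simpl; ring).
    apply (cser_decr (fun n => INR n * c n * z ^ pred n)%C). exact (Hs' z). }
  replace (A * exp (B * (4 * r)) * Cmod h ^ 2) with ((A * Cmod h ^ 2) * exp (B * (4 * r))) by ring.
  refine (cser_le _ _ _ _ K _ (exp_series_scal _ _)).
  intros n. rewrite Cmod_mult.
  apply Rle_trans with (A * (B ^ n / INR (fact n)) * (Cmod h ^ 2 * INR n ^ 2 * r ^ n)).
  - apply Rmult_le_compat; auto using Cmod_ge_0. apply pow_remainder; [exact Hr1 | lra |].
    apply Rle_trans with (1 := Cmod_triangle _ _). lra.
  - rewrite !Rpow_mult_distr. pose proof (fact_pos n).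
    replace (A * (B ^ n / INR (fact n)) * (Cmod h ^ 2 * INR n ^ 2 * r ^ n))
      with ((A * (B ^ n / INR (fact n)) * Cmod h ^ 2 * r ^ n) * INR n ^ 2) by ring.
    replace (A * Cmod h ^ 2 * (B ^ n * (4 ^ n * r ^ n) / INR (fact n)))
      with ((A * (B ^ n / INR (fact n)) * Cmod h ^ 2 * r ^ n) * 4 ^ n) by (field; lra).
    apply Rmult_le_compat_l; [|apply sqr_le_pow4].
    repeat apply Rmult_le_pos; auto; try apply pow_le; auto using Cmod_ge_0; try lra.
    left; apply Rinv_0_lt_compat; assumption.
Qed.

Lemma Ent_der (f : C -> C) : Ent f -> exists f', Ent f' /\ quad_approx f f'.
Proof.
  intros (c & A & B & HA & HB & Hc & Hs).
  destruct (Ent_of_coeff (fun n => INR (S n) * c (S n))%C (A * B) B) as (f' & Hf' & Hs').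
  - nra.
  - exact HB.
  - intros n. rewrite Cmod_mult, Cmod_R, Rabs_pos_eq by apply pos_INR.
    apply Rle_trans with (INR (S n) * (A * (B ^ S n / INR (fact (S n))))).
    + apply Rmult_le_compat_l; [apply pos_INR | apply Hc].
    + right. rewrite fact_simpl, mult_INR. pose proof (fact_pos n). simpl pow.
      assert (INR (S n) <> 0) by (apply not_0_INR; lia). field. split; lra.
  - exists f'. split; [exact Hf'|]. exact (series_quad_approx c A B f f' HA HB Hc Hs Hs').
Qed.

(** * Complex derivatives *)

Definition cder (f : R -> C) (t : R) (l : C) : Prop :=
  is_derive (fun x => fst (f x)) t (fst l) /\ is_derive (fun x => snd (f x)) t (snd l).

(** The remainder form has no quotient, so increments h = 0 need no separate treatment when
    derivatives are composed. *)
Definition Cder (f : C -> C) (z l : C) : Prop :=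
  forall eps, 0 < eps -> exists delta, 0 < delta /\
    forall h, Cmod h < delta -> Cmod (f (z + h) - f z - h * l)%C <= eps * Cmod h.

Lemma is_derive_eps (f : R -> R) (t l : R) : is_derive f t l <->
  forall eps, 0 < eps -> exists delta, 0 < delta /\
    forall s, Rabs s < delta -> Rabs (f (t + s) - f t - s * l) <= eps * Rabs s.
Proof.
  rewrite is_derive_Reals. split.
  - intros H eps He. destruct (H eps He) as [d Hd]. exists d. split; [apply cond_pos|].
    intros s Hs. destruct (Req_dec s 0) as [->|Hs0].
    { rewrite Rplus_0_r. replace (f t - f t - 0 * l) with 0 by ring. rewrite Rabs_R0. lra. }
    pose proof (Hd s Hs0 Hs) as K.
    replace (f (t + s) - f t - s * l) with (((f (t + s) - f t) / s - l) * s) by (field; exact Hs0).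
    rewrite Rabs_mult. apply Rmult_le_compat_r; [apply Rabs_pos | lra].
  - intros H eps He. destruct (H (eps / 2)) as (d & Hd & K); [lra|]. exists (mkposreal d Hd).
    intros s Hs0 Hs. simpl in Hs. pose proof (K s Hs) as K'.
    replace ((f (t + s) - f t) / s - l) with ((f (t + s) - f t - s * l) / s) by (field; exact Hs0).
    unfold Rdiv. rewrite Rabs_mult, Rabs_inv.
    assert (0 < Rabs s) by (apply Rabs_pos_lt, Hs0).
    apply Rle_lt_trans with (eps / 2 * Rabs s * / Rabs s).
    + apply Rmult_le_compat_r; [left; apply Rinv_0_lt_compat; assumption | exact K'].
    + field_simplify; lra.
Qed.

Lemma cder_eps (f : R -> C) (t : R) (l : C) : cder f t l <->
  forall eps, 0 < eps -> exists delta, 0 < delta /\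
    forall s : R, Rabs s < delta -> Cmod (f (t + s)%R - f t - s * l)%C <= eps * Rabs s.
Proof.
  unfold cder. rewrite 2!is_derive_eps. split.
  - intros [H1 H2] eps He.
    destruct (H1 (eps / 2)) as (d1 & Hd1 & K1); [lra|].
    destruct (H2 (eps / 2)) as (d2 & Hd2 & K2); [lra|].
    exists (Rmin d1 d2). split. { apply Rmin_glb_lt; assumption. }
    intros s Hs. pose proof (Rmin_l d1 d2). pose proof (Rmin_r d1 d2).
    apply Rle_trans with (1 := Cmod_le_abs _).
    specialize (K1 s ltac:(lra)). specialize (K2 s ltac:(lra)).
    replace (fst (f (t + s)%R - f t - s * l)%C) with (fst (f (t + s)) - fst (f t) - s * fst l) by (simpl; ring).
    replace (snd (f (t + s)%R - f t - s * l)%C) with (snd (f (t + s)) - snd (f t) - s * snd l) by (simpl; ring).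
    lra.
  - intros H. split; intros eps He; destruct (H eps He) as (d & Hd & K); exists d; (split; [exact Hd|]);
    intros s Hs; apply Rle_trans with (2 := K s Hs).
    + replace (fst (f (t + s)) - fst (f t) - s * fst l) with (fst (f (t + s)%R - f t - s * l)%C) by (simpl; ring).
      apply fst_le_Cmod.
    + replace (snd (f (t + s)) - snd (f t) - s * snd l) with (snd (f (t + s)%R - f t - s * l)%C) by (simpl; ring).
      apply snd_le_Cmod.
Qed.

Lemma quad_approx_Cder (f f' : C -> C) : quad_approx f f' -> forall z, Cder f z (f' z).
Proof.
  intros H z eps He. destruct (H (Cmod z)) as (K & HK & Hq).
  exists (Rmin 1 (eps / (K + 1))). split.
  { apply Rmin_glb_lt; [lra|]. apply Rdiv_lt_0_compat; lra. }
  intros h Hh. pose proof (Rmin_l 1 (eps / (K + 1))). pose proof (Rmin_r 1 (eps / (K + 1))).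
  apply Rle_trans with (1 := Hq z h (Rle_refl _) ltac:(lra)).
  pose proof (Cmod_ge_0 h).
  replace (K * Cmod h ^ 2) with ((K * Cmod h) * Cmod h) by ring.
  apply Rmult_le_compat_r; [assumption|].
  apply Rle_trans with ((K + 1) * (eps / (K + 1))).
  - apply Rmult_le_compat; lra.
  - right. field. lra.
Qed.

Lemma Cder_bound (f : C -> C) (z l : C) : Cder f z l ->
  exists delta, 0 < delta /\ forall h, Cmod h < delta -> Cmod (f (z + h) - f z)%C <= (Cmod l + 1) * Cmod h.
Proof.
  intros H. destruct (H 1 Rlt_0_1) as (d & Hd & K). exists d. split; [exact Hd|].
  intros h Hh. replace (f (z + h) - f z)%C with ((f (z + h) - f z - h * l) + h * l)%C by ring.
  apply Rle_trans with (1 := Cmod_triangle _ _). rewrite Cmod_mult. specialize (K h Hh). lra.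
Qed.

Lemma Cder_cont (f : C -> C) (z l : C) : Cder f z l ->
  forall eps, 0 < eps -> exists delta, 0 < delta /\ forall h, Cmod h < delta -> Cmod (f (z + h) - f z)%C < eps.
Proof.
  intros H eps He. destruct (Cder_bound f z l H) as (d & Hd & K).
  pose proof (Cmod_ge_0 l).
  exists (Rmin d (eps / (Cmod l + 1))). split.
  { apply Rmin_glb_lt; [lra|]. apply Rdiv_lt_0_compat; lra. }
  intros h Hh. pose proof (Rmin_l d (eps / (Cmod l + 1))). pose proof (Rmin_r d (eps / (Cmod l + 1))).
  apply Rle_lt_trans with (1 := K h ltac:(lra)).
  apply Rlt_le_trans with ((Cmod l + 1) * (eps / (Cmod l + 1))).
  - apply Rmult_lt_compat_l; lra.
  - right. field. lra.
Qed.

Lemma cder_bound (g : R -> C) (t : R) (l : C) : cder g t l ->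
  exists delta, 0 < delta /\ forall s, Rabs s < delta -> Cmod (g (t + s)%R - g t)%C <= (Cmod l + 1) * Rabs s.
Proof.
  rewrite cder_eps. intros H. destruct (H 1 Rlt_0_1) as (d & Hd & K). exists d. split; [exact Hd|].
  intros h Hh. replace (g (t + h)%R - g t)%C with ((g (t + h)%R - g t - h * l) + h * l)%C by ring.
  apply Rle_trans with (1 := Cmod_triangle _ _). rewrite Cmod_mult, Cmod_R. specialize (K h Hh). lra.
Qed.

Lemma chain_estimate (A B a b e1 e2 v : R) : 0 <= A -> 0 <= B -> 0 <= v -> 0 <= a -> 0 <= e1 ->
  a <= B * v -> b <= e2 * v -> e1 * a + A * b <= (e1 * B + A * e2) * v.
Proof. intros. nra. Qed.

Lemma Cder_curve (f : C -> C) (g : R -> C) (t : R) (l v : C) :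
  cder g t v -> Cder f (g t) l -> cder (fun x => f (g x)) t (v * l)%C.
Proof.
  intros Hg Hf. apply cder_eps. intros eps He.
  destruct (cder_bound g t v Hg) as (d1 & Hd1 & K1).
  rewrite cder_eps in Hg.
  pose proof (Cmod_ge_0 l) as Hl. pose proof (Cmod_ge_0 v) as Hv.
  destruct (Hf (eps / 2 / (Cmod v + 1))) as (d2 & Hd2 & K2). { repeat apply Rdiv_lt_0_compat; lra. }
  destruct (Hg (eps / 2 / (Cmod l + 1))) as (d3 & Hd3 & K3). { repeat apply Rdiv_lt_0_compat; lra. }
  exists (Rmin (Rmin d1 d3) (d2 / (Cmod v + 1))). split.
  { repeat apply Rmin_glb_lt; try assumption. apply Rdiv_lt_0_compat; lra. }
  intros s Hs.
  pose proof (Rmin_l (Rmin d1 d3) (d2 / (Cmod v + 1))). pose proof (Rmin_r (Rmin d1 d3) (d2 / (Cmod v + 1))).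
  pose proof (Rmin_l d1 d3). pose proof (Rmin_r d1 d3).
  set (D := (g (t + s)%R - g t)%C).
  assert (HD : Cmod D <= (Cmod v + 1) * Rabs s) by (apply K1; lra).
  assert (HD2 : Cmod D < d2).
  { apply Rle_lt_trans with (1 := HD). apply Rlt_le_trans with ((Cmod v + 1) * (d2 / (Cmod v + 1))).
    - apply Rmult_lt_compat_l; lra.
    - right; field; lra. }
  replace (f (g (t + s)%R) - f (g t) - s * (v * l))%C
    with ((f (g t + D) - f (g t) - D * l) + l * (D - s * v))%C.
  2:{ replace (g t + D)%C with (g (t + s)%R) by (unfold D; ring). ring. }
  apply Rle_trans with (1 := Cmod_triangle _ _). rewrite Cmod_mult.
  specialize (K2 D HD2). specialize (K3 s ltac:(lra)). fold D in K3.
  apply Rle_trans with (eps / 2 / (Cmod v + 1) * Cmod D + Cmod l * Cmod (D - s * v)); [lra|].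
  apply Rle_trans with ((eps / 2 / (Cmod v + 1) * (Cmod v + 1) + Cmod l * (eps / 2 / (Cmod l + 1))) * Rabs s).
  - apply chain_estimate; auto using Cmod_ge_0, Rabs_pos; try lra.
    left. repeat apply Rdiv_lt_0_compat; lra.
  - apply Rmult_le_compat_r; [apply Rabs_pos|].
    replace (eps / 2 / (Cmod v + 1) * (Cmod v + 1)) with (eps / 2) by (field; lra).
    replace (Cmod l * (eps / 2 / (Cmod l + 1))) with (eps / 2 * (Cmod l / (Cmod l + 1))) by (field; lra).
    assert (Cmod l / (Cmod l + 1) <= 1).
    { apply Rmult_le_reg_r with (Cmod l + 1); [lra|]. field_simplify; lra. }
    nra.
Qed.

Lemma Cder_comp (f g : C -> C) (t l v : C) :
  Cder g t v -> Cder f (g t) l -> Cder (fun x => f (g x)) t (v * l)%C.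
Proof.
  intros Hg Hf eps He.
  destruct (Cder_bound g t v Hg) as (d1 & Hd1 & K1).
  pose proof (Cmod_ge_0 l) as Hl. pose proof (Cmod_ge_0 v) as Hv.
  destruct (Hf (eps / 2 / (Cmod v + 1))) as (d2 & Hd2 & K2). { repeat apply Rdiv_lt_0_compat; lra. }
  destruct (Hg (eps / 2 / (Cmod l + 1))) as (d3 & Hd3 & K3). { repeat apply Rdiv_lt_0_compat; lra. }
  exists (Rmin (Rmin d1 d3) (d2 / (Cmod v + 1))). split.
  { repeat apply Rmin_glb_lt; try assumption. apply Rdiv_lt_0_compat; lra. }
  intros s Hs.
  pose proof (Rmin_l (Rmin d1 d3) (d2 / (Cmod v + 1))). pose proof (Rmin_r (Rmin d1 d3) (d2 / (Cmod v + 1))).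
  pose proof (Rmin_l d1 d3). pose proof (Rmin_r d1 d3).
  set (D := (g (t + s) - g t)%C).
  assert (HD : Cmod D <= (Cmod v + 1) * Cmod s) by (apply K1; lra).
  assert (HD2 : Cmod D < d2).
  { apply Rle_lt_trans with (1 := HD). apply Rlt_le_trans with ((Cmod v + 1) * (d2 / (Cmod v + 1))).
    - apply Rmult_lt_compat_l; lra.
    - right; field; lra. }
  replace (f (g (t + s)%C) - f (g t) - s * (v * l))%C
    with ((f (g t + D) - f (g t) - D * l) + l * (D - s * v))%C.
  2:{ replace (g t + D)%C with (g (t + s)%C) by (unfold D; ring). ring. }
  apply Rle_trans with (1 := Cmod_triangle _ _). rewrite Cmod_mult.
  specialize (K2 D HD2). specialize (K3 s ltac:(lra)). fold D in K3.
  apply Rle_trans with (eps / 2 / (Cmod v + 1) * Cmod D + Cmod l * Cmod (D - s * v)); [lra|].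
  apply Rle_trans with ((eps / 2 / (Cmod v + 1) * (Cmod v + 1) + Cmod l * (eps / 2 / (Cmod l + 1))) * Cmod s).
  - apply chain_estimate; auto using Cmod_ge_0, Rabs_pos; try lra.
    left. repeat apply Rdiv_lt_0_compat; lra.
  - apply Rmult_le_compat_r; [apply Cmod_ge_0|].
    replace (eps / 2 / (Cmod v + 1) * (Cmod v + 1)) with (eps / 2) by (field; lra).
    replace (Cmod l * (eps / 2 / (Cmod l + 1))) with (eps / 2 * (Cmod l / (Cmod l + 1))) by (field; lra).
    assert (Cmod l / (Cmod l + 1) <= 1).
    { apply Rmult_le_reg_r with (Cmod l + 1); [lra|]. field_simplify; lra. }
    nra.
Qed.

Lemma Cder_ext (f g : C -> C) (z l : C) : (forall x, f x = g x) -> Cder f z l -> Cder g z l.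
Proof.
  intros E H eps He. destruct (H eps He) as (d & Hd & K). exists d. split; [exact Hd|].
  intros h Hh. rewrite <- 2!E. apply K, Hh.
Qed.

Lemma Cder_eq (f : C -> C) (z l l' : C) : Cder f z l -> l = l' -> Cder f z l'.
Proof. intros H <-. exact H. Qed.

Lemma cder_eq (f : R -> C) (z : R) (l l' : C) : cder f z l -> l = l' -> cder f z l'.
Proof. intros H <-. exact H. Qed.

Lemma Cder_mult (f g : C -> C) (z l m : C) :
  Cder f z l -> Cder g z m -> Cder (fun x => f x * g x)%C z (l * g z + f z * m)%C.
Proof.
  intros Hf Hg eps He.
  destruct (Cder_bound g z m Hg) as (d1 & Hd1 & K1).
  pose proof (Cmod_ge_0 l) as Hl. pose proof (Cmod_ge_0 m) as Hm.
  pose proof (Cmod_ge_0 (f z)) as Hfz. pose proof (Cmod_ge_0 (g z)) as Hgz.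
  set (e := eps / (3 * (Cmod (f z) + Cmod (g z) + Cmod m + Cmod l + 1))).
  assert (Hepos : 0 < e). { apply Rdiv_lt_0_compat; lra. }
  assert (Heq : 3 * e * (Cmod (f z) + Cmod (g z) + Cmod m + Cmod l + 1) = eps) by (unfold e; field; lra).
  destruct (Hf e Hepos) as (d2 & Hd2 & K2).
  destruct (Hg e Hepos) as (d3 & Hd3 & K3).
  exists (Rmin (Rmin d1 d2) (Rmin d3 (Rmin 1 (e / (Cmod l + 1))))). split.
  { repeat apply Rmin_glb_lt; try assumption; try lra. apply Rdiv_lt_0_compat; lra. }
  intros h Hh.
  pose proof (Rmin_l (Rmin d1 d2) (Rmin d3 (Rmin 1 (e / (Cmod l + 1))))).
  pose proof (Rmin_r (Rmin d1 d2) (Rmin d3 (Rmin 1 (e / (Cmod l + 1))))).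
  pose proof (Rmin_l d1 d2). pose proof (Rmin_r d1 d2).
  pose proof (Rmin_l d3 (Rmin 1 (e / (Cmod l + 1)))). pose proof (Rmin_r d3 (Rmin 1 (e / (Cmod l + 1)))).
  pose proof (Rmin_l 1 (e / (Cmod l + 1))). pose proof (Rmin_r 1 (e / (Cmod l + 1))).
  specialize (K1 h ltac:(lra)). specialize (K2 h ltac:(lra)). specialize (K3 h ltac:(lra)).
  pose proof (Cmod_ge_0 h) as Hh0.
  assert (Hle : Cmod l * Cmod h <= e).
  { apply Rle_trans with ((Cmod l + 1) * (e / (Cmod l + 1))).
    - apply Rmult_le_compat; lra.
    - right; field; lra. }
  replace (f (z + h)%C * g (z + h)%C - f z * g z - h * (l * g z + f z * m))%C
    with ((f (z + h) - f z - h * l) * (g z + (g (z + h) - g z)) + (f z * (g (z + h) - g z - h * m) + (h * l) * (g (z + h) - g z)))%C by ring.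
  apply Rle_trans with (1 := Cmod_triangle _ _).
  pose proof (Cmod_triangle (f z * (g (z + h) - g z - h * m))%C ((h * l) * (g (z + h) - g z))%C) as T1.
  pose proof (Cmod_triangle (g z) (g (z + h) - g z)%C) as T2.
  rewrite !Cmod_mult in *.
  set (a := Cmod (f (z + h) - f z - h * l)%C) in *. set (b := Cmod (g (z + h) - g z - h * m)%C) in *.
  set (c := Cmod (g (z + h) - g z)%C) in *. set (gg := Cmod (g z + (g (z + h) - g z))%C) in *.
  assert (0 <= a) by apply Cmod_ge_0. assert (0 <= b) by apply Cmod_ge_0.
  assert (0 <= c) by apply Cmod_ge_0. assert (0 <= gg) by apply Cmod_ge_0.
  assert (gg <= Cmod (g z) + Cmod m + 1) by nra.
  assert (a * gg <= e * (Cmod (g z) + Cmod m + 1) * Cmod h).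
  { apply Rle_trans with (e * Cmod h * (Cmod (g z) + Cmod m + 1)); [|right; ring].
    apply Rmult_le_compat; assumption. }
  assert (Cmod (f z) * b <= e * Cmod (f z) * Cmod h) by nra.
  assert (Cmod h * Cmod l * c <= e * (Cmod m + 1) * Cmod h).
  { apply Rle_trans with (e * ((Cmod m + 1) * Cmod h)); [|right; ring].
    apply Rmult_le_compat; try assumption; nra. }
  assert (0 <= e * Cmod h) by nra.
  rewrite <- Heq. nra.
Qed.

Lemma Cder_plus (f g : C -> C) (z l m : C) :
  Cder f z l -> Cder g z m -> Cder (fun x => f x + g x)%C z (l + m)%C.
Proof.
  intros Hf Hg eps He.
  destruct (Hf (eps / 2)) as (d2 & Hd2 & K2); [lra|].
  destruct (Hg (eps / 2)) as (d3 & Hd3 & K3); [lra|].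
  exists (Rmin d2 d3). split. { apply Rmin_glb_lt; assumption. }
  intros h Hh. pose proof (Rmin_l d2 d3). pose proof (Rmin_r d2 d3).
  specialize (K2 h ltac:(lra)). specialize (K3 h ltac:(lra)).
  replace (f (z + h) + g (z + h) - (f z + g z) - h * (l + m))%C
    with ((f (z + h) - f z - h * l) + (g (z + h) - g z - h * m))%C by ring.
  apply Rle_trans with (1 := Cmod_triangle _ _). lra.
Qed.

Lemma Cder_const (a z : C) : Cder (fun _ => a) z 0.
Proof.
  intros eps He. exists 1. split; [lra|]. intros h _.
  replace (a - a - h * 0)%C with (RtoC 0) by ring. rewrite Cmod_0.
  apply Rmult_le_pos; [lra | apply Cmod_ge_0].
Qed.

Lemma Cder_id (z : C) : Cder (fun x => x) z 1.
Proof.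
  intros eps He. exists 1. split; [lra|]. intros h _.
  replace (z + h - z - h * 1)%C with (RtoC 0) by ring. rewrite Cmod_0.
  apply Rmult_le_pos; [lra | apply Cmod_ge_0].
Qed.

Lemma cder_line_x (x y : R) : cder (fun t => (t, y)) x 1.
Proof. split; simpl; auto_derive; auto. Qed.

Lemma cder_line_y (x y : R) : cder (fun t => (x, t)) y Ci.
Proof. split; simpl; auto_derive; auto. Qed.

Definition c2d (h : C -> C) (s : C) : Prop :=
  continuity_2d_pt (fun x y => fst (h (x, y))) (fst s) (snd s) /\
  continuity_2d_pt (fun x y => snd (h (x, y))) (fst s) (snd s).

Lemma Cder_c2d (h : C -> C) (s l : C) : Cder h s l -> c2d h s.
Proof.
  intros H. pose proof (Cder_cont h s l H) as K.
  split; intros eps; destruct (K eps (cond_pos eps)) as (d & Hd & K');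
  (assert (Hd2 : 0 < d / 2) by lra); exists (mkposreal _ Hd2); intros u v Hu Hv; simpl in Hu, Hv;
  specialize (K' ((u, v) - s)%C);
  replace (s + ((u, v) - s))%C with ((u, v) : C) in K' by (apply C_eq; simpl; ring);
  (assert (Hlt : Cmod ((u, v) - s) < d)
    by (apply Rle_lt_trans with (1 := Cmod_le_abs _); simpl; unfold Rminus in *; lra));
  specialize (K' Hlt); destruct s as [s1 s2]; cbn [fst snd] in *.
  - apply Rle_lt_trans with (2 := K'). apply Rle_trans with (2 := fst_le_Cmod _). simpl. right. f_equal.
  - apply Rle_lt_trans with (2 := K'). apply Rle_trans with (2 := snd_le_Cmod _). simpl. right. f_equal.
Qed.

(** * Maximum principle and Phragmen-Lindelof *)

(** The nearest point of [a, b]. Composing with it turns continuity on the interval into two-sided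
    continuity at its end points. *)
Definition clamp (a b x : R) : R := Rmax a (Rmin b x).

Lemma clamp_in a b x : a <= b -> a <= clamp a b x <= b.
Proof. intros H. unfold clamp, Rmax, Rmin. repeat destruct Rle_dec; lra. Qed.

Lemma clamp_id a b x : a <= x <= b -> clamp a b x = x.
Proof. intros H. unfold clamp, Rmax, Rmin. repeat destruct Rle_dec; lra. Qed.

Lemma clamp_lip a b x y : a <= b -> Rabs (clamp a b x - clamp a b y) <= Rabs (x - y).
Proof.
  intros H. unfold clamp, Rmax, Rmin, Rabs. repeat destruct Rle_dec; repeat destruct Rcase_abs; lra.
Qed.

(** For each x a maximiser in y is chosen; uniform continuity makes the partial maximum continuous
    in x, and it is maximised in turn. *)
Lemma max_2d (f : R -> R -> R) (a b c d : R) : a <= b -> c <= d ->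
  (forall x y, a <= x <= b -> c <= y <= d -> continuity_2d_pt f x y) ->
  exists x0 y0, a <= x0 <= b /\ c <= y0 <= d /\
    forall x y, a <= x <= b -> c <= y <= d -> f x y <= f x0 y0.
Proof.
  intros Hab Hcd Hf.
  pose proof (uniform_continuity_2d f a b c d Hf) as Hu.
  assert (Hy : forall x, exists y, a <= x <= b -> c <= y <= d /\ forall y', c <= y' <= d -> f x y' <= f x y).
  { intros x. destruct (classic (a <= x <= b)) as [Hx|Hx]; [|exists 0; tauto].
    destruct (continuity_ab_maj (fun y => f x (clamp c d y)) c d Hcd) as (y & K1 & K2).
    - intros y Hy eps He. destruct (Hu (mkposreal eps He)) as [dl Hd].
      exists dl. split; [apply cond_pos|]. intros y' [_ Hy'].
      unfold dist, R_dist in *; simpl in *. unfold R_dist in *. apply Hd; auto using clamp_in.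
      + replace (x - x) with 0 by ring. rewrite Rabs_R0. apply cond_pos.
      + apply Rle_lt_trans with (2 := Hy'). apply clamp_lip, Hcd.
    - exists y. intros _. split; [exact K2|]. intros y' Hy'. specialize (K1 y' Hy').
      rewrite !clamp_id in K1; auto. }
  set (Y := fun x => proj1_sig (constructive_indefinite_description _ (Hy x))).
  assert (HY : forall x, a <= x <= b -> c <= Y x <= d /\ forall y', c <= y' <= d -> f x y' <= f x (Y x)).
  { intros x. exact (proj2_sig (constructive_indefinite_description _ (Hy x))). }
  set (m := fun x => f (clamp a b x) (Y (clamp a b x))).
  destruct (continuity_ab_maj m a b Hab) as (x0 & K1 & K2).
  - intros x Hx eps He. destruct (Hu (mkposreal eps He)) as [dl Hd].
    exists dl. split; [apply cond_pos|]. intros x' [_ Hx'].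
    unfold dist, R_dist in *; simpl in *. unfold R_dist in *. unfold m.
    pose proof (clamp_in a b x Hab) as P. pose proof (clamp_in a b x' Hab) as P'.
    destruct (HY _ P) as [Q1 Q2]. destruct (HY _ P') as [Q1' Q2'].
    assert (L : Rabs (clamp a b x' - clamp a b x) < dl).
    { apply Rle_lt_trans with (2 := Hx'). apply clamp_lip, Hab. }
    assert (Z : forall y, Rabs (y - y) < dl).
    { intros y. replace (y - y) with 0 by ring. rewrite Rabs_R0. apply cond_pos. }
    pose proof (Hd _ _ _ _ P Q1 P' Q1 L (Z _)) as E1.
    pose proof (Hd _ _ _ _ P Q1' P' Q1' L (Z _)) as E2.
    specialize (Q2 _ Q1'). specialize (Q2' _ Q1).
    apply Rabs_def2 in E1. apply Rabs_def2 in E2. apply Rabs_def1; lra.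
  - exists x0, (Y x0). split; [exact K2|]. split; [apply HY, K2|].
    intros x y Hx Hy'. apply Rle_trans with (f x (Y x)). { apply HY; assumption. }
    specialize (K1 x Hx). unfold m in K1. rewrite !clamp_id in K1; auto.
Qed.

(** The first derivative vanishes at the maximum; if the second were positive, p would increase
    strictly just to the right of it. *)
Lemma second_derivative_test (p p1 : R -> R) (a b x0 p2 : R) :
  a < x0 < b -> (forall x, is_derive p x (p1 x)) -> is_derive p1 x0 p2 ->
  (forall x, a <= x <= b -> p x <= p x0) -> p2 <= 0.
Proof.
  intros Hx0 Hp Hp1 Hmax. apply Rnot_lt_le. intros Hpos.
  assert (H0 : p1 x0 = 0).
  { pose proof (proj1 (is_derive_Reals _ _ _) (Hp x0)) as D.
    set (pr := exist _ (p1 x0) D : derivable_pt p x0).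
    replace (p1 x0) with (derive_pt p x0 pr) by reflexivity.
    apply (deriv_maximum p a b x0 pr); try lra. intros x H1 H2. apply Hmax. lra. }
  pose proof (proj1 (is_derive_eps _ _ _) Hp1) as Hq1. destruct (Hq1 (p2 / 2)) as (d & Hd & K); [lra|].
  set (s := Rmin (d / 2) (b - x0)).
  assert (Hs : 0 < s) by (apply Rmin_glb_lt; lra).
  assert (Hs1 : s <= d / 2) by apply Rmin_l. assert (Hs2 : s <= b - x0) by apply Rmin_r.
  destruct (MVT_cor2 p p1 x0 (x0 + s)) as (c & E & Hc); [lra| |].
  { intros c _. apply is_derive_Reals, Hp. }
  specialize (K (c - x0)). replace (x0 + (c - x0)) with c in K by ring.
  rewrite H0, (Rabs_pos_eq (c - x0)) in K by lra. specialize (K ltac:(lra)).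
  apply Rabs_le_between in K.
  assert (0 < p1 c) by nra.
  specialize (Hmax (x0 + s) ltac:(lra)). nra.
Qed.

(** The Cauchy-Riemann equations in the form needed for a Laplacian: derivative [h1] along the real
    direction and i [h1] along the imaginary one. *)
Definition hol (h h1 : C -> C) (s : C) : Prop :=
  cder (fun x => h (x, snd s)) (fst s) (h1 s) /\
  cder (fun y => h (fst s, y)) (snd s) (Ci * h1 s)%C.

Lemma Cder_hol (h h1 : C -> C) (s : C) : Cder h s (h1 s) -> hol h h1 s.
Proof.
  destruct s as [x y]. intros H. split; simpl.
  - eapply cder_eq; [apply (Cder_curve h (fun t => (t, y)) x _ _ (cder_line_x x y) H)|]. ring.
  - apply (Cder_curve h (fun t => (x, t)) y _ _ (cder_line_y x y) H).
Qed.

Lemma sq_sum_derive (u v : R -> R) (x u1 v1 : R) :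
  is_derive u x u1 -> is_derive v x v1 ->
  is_derive (fun t => u t ^ 2 + v t ^ 2) x (2 * (u x * u1 + v x * v1)).
Proof.
  intros Hu Hv. apply Rd_ext with (fun t => u t * u t + v t * v t). { intros; ring. }
  eapply Rd_eq; [apply Rd_plus; apply Rd_mult; eassumption|]. ring.
Qed.

Lemma prod_sum_derive (u v w z : R -> R) (x u1 v1 w1 z1 : R) :
  is_derive u x u1 -> is_derive v x v1 -> is_derive w x w1 -> is_derive z x z1 ->
  is_derive (fun t => 2 * (u t * w t + v t * z t)) x (2 * (u1 * w x + u x * w1 + v1 * z x + v x * z1)).
Proof.
  intros Hu Hv Hw Hz.
  eapply Rd_eq; [apply Rd_scal, Rd_plus; apply Rd_mult; eassumption|]. ring.
Qed.

(* The perturbed function [|h|^2 + eps x^2] has positive Laplacian, hence no interior maximum. *)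
Lemma max_rect (h h1 h2 : C -> C) (a b c d M : R) : a <= b -> c <= d ->
  (forall s, hol h h1 s) -> (forall s, hol h1 h2 s) -> (forall s, c2d h s) ->
  (forall x y, a <= x <= b -> c <= y <= d -> (x = a \/ x = b \/ y = c \/ y = d) -> Cmod (h (x, y)) <= M) ->
  forall x y, a <= x <= b -> c <= y <= d -> Cmod (h (x, y)) <= M.
Proof.
  intros Hab Hcd H1 H2 Hc Hbd x y Hx Hy.
  assert (HM : 0 <= M).
  { apply Rle_trans with (Cmod (h (a, c))); [apply Cmod_ge_0|]. apply Hbd; lra. }
  set (X := a ^ 2 + b ^ 2).
  assert (HX : forall t, a <= t <= b -> t ^ 2 <= X).
  { intros t Ht. unfold X. destruct (Rle_dec 0 t) as [K|K].
    - assert (0 <= (b - t) * (b + t)) by (apply Rmult_le_pos; lra). nra.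
    - assert (0 <= (t - a) * (- t - a)) by (apply Rmult_le_pos; lra). nra. }
  assert (Hall : forall eps, 0 < eps -> Cmod (h (x, y)) ^ 2 <= M ^ 2 + eps * X).
  { intros eps He.
    set (F := fun x y => (fst (h (x, y)) ^ 2 + snd (h (x, y)) ^ 2) + eps * (x * x)).
    assert (FE : forall x y, F x y = Cmod (h (x, y)) ^ 2 + eps * x ^ 2).
    { intros u v. unfold F. rewrite Cmod_sqr. ring. }
    destruct (max_2d F a b c d Hab Hcd) as (x0 & y0 & Hx0 & Hy0 & Hmax).
    { intros u v _ _. destruct (Hc (u, v)) as [C1 C2]. simpl in C1, C2. unfold F. simpl pow.
      repeat first [apply continuity_2d_pt_plus | apply continuity_2d_pt_mult | assumption
        | apply continuity_2d_pt_const | apply continuity_2d_pt_id1]. }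
    assert (Hb0 : F x0 y0 <= M ^ 2 + eps * X).
    { destruct (classic (x0 = a \/ x0 = b \/ y0 = c \/ y0 = d)) as [B|B].
      - rewrite FE. apply Rplus_le_compat.
        + apply pow_incr. split; [apply Cmod_ge_0 | apply Hbd; assumption].
        + apply Rmult_le_compat_l; [lra | apply HX, Hx0].
      - exfalso.
        assert (Hxi : a < x0 < b) by lra. assert (Hyi : c < y0 < d) by lra.
        set (u := fun s => fst (h s)) in *. set (v := fun s => snd (h s)).
        pose proof (fun x => proj1 (H1 (x, y0))) as Dx. pose proof (fun x => proj1 (H2 (x, y0))) as Dx2.
        pose proof (fun y => proj2 (H1 (x0, y))) as Dy. pose proof (fun y => proj2 (H2 (x0, y))) as Dy2.
        simpl in Dx, Dx2, Dy, Dy2.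
        assert (P1 : 2 * (fst (h1 (x0, y0)) * fst (h1 (x0, y0)) + fst (h (x0, y0)) * fst (h2 (x0, y0))
            + snd (h1 (x0, y0)) * snd (h1 (x0, y0)) + snd (h (x0, y0)) * snd (h2 (x0, y0))) + 2 * eps <= 0).
        { apply (second_derivative_test (fun x => F x y0)
            (fun x => 2 * (fst (h (x, y0)) * fst (h1 (x, y0)) + snd (h (x, y0)) * snd (h1 (x, y0))) + 2 * eps * x)
            a b x0); auto.
          - intros t. destruct (Dx t) as [E1 E2]. unfold F.
            eapply Rd_eq; [apply Rd_plus; [apply sq_sum_derive; eassumption | apply Rd_scal, Rd_mult; apply Rd_id]|]. simpl; ring.
          - destruct (Dx x0) as [E1 E2]. destruct (Dx2 x0) as [E3 E4].
            eapply Rd_eq; [apply Rd_plus; [apply prod_sum_derive; eassumption | apply Rd_scal; apply Rd_id]|]. simpl; ring. }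
        assert (P2 : 2 * ((0 * fst (h1 (x0, y0)) - 1 * snd (h1 (x0, y0))) * (0 * fst (h1 (x0, y0)) - 1 * snd (h1 (x0, y0)))
            + fst (h (x0, y0)) * (- fst (h2 (x0, y0)))
            + (0 * snd (h1 (x0, y0)) + 1 * fst (h1 (x0, y0))) * (0 * snd (h1 (x0, y0)) + 1 * fst (h1 (x0, y0)))
            + snd (h (x0, y0)) * (- snd (h2 (x0, y0)))) <= 0).
        { apply (second_derivative_test (fun y => F x0 y)
            (fun y => 2 * (fst (h (x0, y)) * (0 * fst (h1 (x0, y)) - 1 * snd (h1 (x0, y)))
                          + snd (h (x0, y)) * (0 * snd (h1 (x0, y)) + 1 * fst (h1 (x0, y)))))
            c d y0); auto.
          - intros t. destruct (Dy t) as [E1 E2]. unfold F.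
            eapply Rd_eq; [apply Rd_plus; [apply sq_sum_derive; eassumption | apply Rd_const]|]. simpl; ring.
          - destruct (Dy y0) as [E1 E2]. destruct (Dy2 y0) as [E3 E4]. simpl in E1, E2, E3, E4.
            eapply Rd_eq.
            + apply prod_sum_derive; [exact E1 | exact E2 | |].
              * apply Rd_minus; apply Rd_scal; [exact E3 | exact E4].
              * apply Rd_plus; apply Rd_scal; [exact E4 | exact E3].
            + simpl. ring. }
        (* In the sum of the two inequalities the terms with [h2] cancel, because the second
           derivatives along the axes are [h2] and - [h2]; what remains is 4 |h1|^2 + 2 eps <= 0. *)
        nra. }
    specialize (Hmax x y Hx Hy). rewrite (FE x y) in Hmax. nra. }
  assert (Hsq : Cmod (h (x, y)) ^ 2 <= M ^ 2).
  { apply Rle_plus_epsilon. intros eps He.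
    assert (0 <= X) by (unfold X; nra).
    apply Rle_trans with (1 := Hall (eps / (X + 1)) ltac:(apply Rdiv_lt_0_compat; lra)).
    apply Rplus_le_compat_l. apply Rle_trans with (eps / (X + 1) * (X + 1)).
    - apply Rmult_le_compat_l; [left; apply Rdiv_lt_0_compat; lra | lra].
    - right; field; lra. }
  apply pow_incr_1 in Hsq || (apply Rnot_lt_le; intros L; pose proof (Cmod_ge_0 (h (x, y))); nra).
Qed.

(** * Complex-valued curves and the complex exponential *)

Lemma cder_mult (f g : R -> C) (t : R) (l m : C) :
  cder f t l -> cder g t m -> cder (fun x => f x * g x)%C t (l * g t + f t * m)%C.
Proof.
  intros [H1 H2] [H3 H4]. split; simpl.
  - eapply Rd_eq; [apply Rd_minus; apply Rd_mult; eassumption|]. simpl. ring.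
  - eapply Rd_eq; [apply Rd_plus; apply Rd_mult; eassumption|]. simpl. ring.
Qed.

Lemma cder_plus (f g : R -> C) (t : R) (l m : C) :
  cder f t l -> cder g t m -> cder (fun x => f x + g x)%C t (l + m)%C.
Proof.
  intros [H1 H2] [H3 H4]. split; simpl; apply Rd_plus; assumption.
Qed.

Lemma cder_const (a : C) (t : R) : cder (fun _ => a) t 0.
Proof. split; apply Rd_const. Qed.

Lemma cder_scal (a : C) (f : R -> C) (t : R) (l : C) :
  cder f t l -> cder (fun x => a * f x)%C t (a * l)%C.
Proof.
  intros H. eapply cder_eq; [apply cder_mult; [apply cder_const | exact H]|]. cbv beta. ring.
Qed.

Lemma cder_minus (f g : R -> C) (t : R) (l m : C) :
  cder f t l -> cder g t m -> cder (fun x => f x - g x)%C t (l - m)%C.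
Proof.
  intros [H1 H2] [H3 H4]. split; simpl; apply Rd_minus; assumption.
Qed.

Lemma R_zero_derive_const (f : R -> R) (a b : R) :
  (forall x, a < x < b -> is_derive f x 0) -> (forall x, a <= x <= b -> continuity_pt f x) -> a <= b -> f b = f a.
Proof.
  intros H Hc Hab. destruct (Req_dec a b) as [->|N]; [reflexivity|].
  destruct (MVT_gen f a b (fun _ => 0)) as (c & _ & E).
  - rewrite Rmin_left, Rmax_right by lra. exact H.
  - rewrite Rmin_left, Rmax_right by lra. exact Hc.
  - lra.
Qed.

Lemma is_derive_continuity_pt (f : R -> R) (x l : R) : is_derive f x l -> continuity_pt f x.
Proof.
  intros H. apply is_derive_Reals in H. apply derivable_continuous_pt. exists l. exact H.
Qed.

Lemma cder_zero_const (f : R -> C) : (forall t, cder f t 0) -> forall a b, f a = f b.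
Proof.
  intros H. assert (K : forall a b, a <= b -> f b = f a).
  { intros a b Hab. apply C_eq.
    - apply (R_zero_derive_const (fun x => fst (f x))); auto; intros x _.
      + apply H.
      + apply is_derive_continuity_pt with 0, H.
    - apply (R_zero_derive_const (fun x => snd (f x))); auto; intros x _.
      + apply H.
      + apply is_derive_continuity_pt with 0, H. }
  intros a b. destruct (Rle_dec a b); [symmetry|]; apply K; lra.
Qed.

Definition cexp (z : C) : C := (exp (fst z) * cos (snd z), exp (fst z) * sin (snd z)).

Lemma Cmod_cexp (z : C) : Cmod (cexp z) = exp (fst z).
Proof.
  unfold Cmod, cexp; simpl fst; simpl snd.
  replace ((exp (fst z) * cos (snd z)) ^ 2 + (exp (fst z) * sin (snd z)) ^ 2) with (exp (fst z) ^ 2).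
  - apply sqrt_pow2. left; apply exp_pos.
  - pose proof (sin2_cos2 (snd z)) as H. unfold Rsqr in H.
    transitivity (exp (fst z) ^ 2 * (sin (snd z) * sin (snd z) + cos (snd z) * cos (snd z))); [rewrite H|]; ring.
Qed.

Lemma cexp_plus (z w : C) : cexp (z + w) = (cexp z * cexp w)%C.
Proof.
  apply C_eq; simpl; rewrite exp_plus; [rewrite cos_plus | rewrite sin_plus]; ring.
Qed.

Lemma cexp_0 : cexp 0 = 1.
Proof. apply C_eq; simpl; rewrite exp_0, ?cos_0, ?sin_0; ring. Qed.

Lemma cder_ext (f g : R -> C) (t : R) (l : C) : (forall x, f x = g x) -> cder f t l -> cder g t l.
Proof.
  intros E [H1 H2]. split; eapply Rd_ext; try eassumption; intros x; simpl; rewrite E; reflexivity.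
Qed.

Lemma cder_cexp (g : R -> C) (t : R) (l : C) : cder g t l -> cder (fun x => cexp (g x)) t (l * cexp (g t))%C.
Proof.
  intros [H1 H2]. split; simpl.
  - eapply Rd_eq; [apply Rd_mult; [apply Rd_exp, H1 | apply Rd_cos, H2]|]. cbv beta; ring.
  - eapply Rd_eq; [apply Rd_mult; [apply Rd_exp, H1 | apply Rd_sin, H2]|]. cbv beta; ring.
Qed.

(** The exponential series E is identified with the explicit formula because E(t z) exp(- t z) has
    zero derivative in t; modulus and argument are then visible and the power series is available at
    once. *)
Lemma Ent_cexp : Ent cexp /\ quad_approx cexp cexp.
Proof.
  destruct (Ent_of_coeff (fun n => RtoC (/ INR (fact n))) 1 1) as (E & HE & Hs); try lra.
  { intros n. rewrite Cmod_R, pow1. pose proof (fact_pos n).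
    rewrite Rabs_pos_eq by (left; apply Rinv_0_lt_compat; assumption). right. field. lra. }
  assert (Hq : quad_approx E E).
  { apply (series_quad_approx (fun n => RtoC (/ INR (fact n))) 1 1); try lra.
    - intros n. rewrite Cmod_R, pow1. pose proof (fact_pos n).
      rewrite Rabs_pos_eq by (left; apply Rinv_0_lt_compat; assumption). right. field. lra.
    - exact Hs.
    - intros z. refine (cser_ext _ _ _ _ (Hs z)). intros n. f_equal.
      rewrite <- RtoC_mult. f_equal. rewrite fact_simpl, mult_INR. pose proof (fact_pos n).
      assert (INR (S n) <> 0) by (apply not_0_INR; lia). field. split; lra. }
  assert (E0 : E 0 = 1).
  { apply (cser_unique _ _ _ (Hs 0)).
    pose proof (cser_decr (fun n => RtoC (/ INR (fact n))%R * 0 ^ n)%C 0) as H.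
    cbv beta in H. replace (RtoC (/ INR (fact 0))%R * 0 ^ 0 + 0)%C with (RtoC 1) in H by (simpl; rewrite Rinv_1; ring).
    apply H. apply cser_zero. intros n. simpl. ring. }
  assert (Heq : forall z, E z = cexp z).
  { intros z.
    set (g := fun t : R => (E (t * z) * cexp (- (t * z)))%C).
    assert (Hg : forall t, cder g t 0).
    { intros t. unfold g.
      assert (H1 : cder (fun t : R => (t * z)%C) t z).
      { split; simpl.
        - eapply Rd_eq; [apply Rd_minus; apply Rd_mult; [apply Rd_id | apply Rd_const | apply Rd_const | apply Rd_const]|]. cbv beta; simpl; ring.
        - eapply Rd_eq; [apply Rd_plus; apply Rd_mult; [apply Rd_id | apply Rd_const | apply Rd_const | apply Rd_const]|]. cbv beta; simpl; ring. }
      assert (H2 : cder (fun t : R => cexp (- (t * z))) t (- z * cexp (- (t * z)))%C).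
      { apply cder_cexp. replace (- z)%C with (-(1) * z)%C by ring.
        refine (cder_ext (fun t : R => -(1) * (t * z))%C _ _ _ _ _); [intros; ring|]. apply cder_scal, H1. }
      eapply cder_eq; [apply cder_mult; [apply (Cder_curve E (fun t : R => (t * z)%C) t _ _ H1 (quad_approx_Cder _ _ Hq _)) | exact H2]|].
      cbv beta. ring. }
    pose proof (cder_zero_const g Hg 1 0) as H. unfold g in H.
    replace (0 * z)%C with (RtoC 0) in H by ring. replace (1 * z)%C with z in H by ring.
    replace (- 0)%C with (RtoC 0) in H by ring. rewrite E0, cexp_0 in H.
    assert (Hinv : (cexp (- z) * cexp z)%C = 1).
    { rewrite <- cexp_plus. replace (- z + z)%C with (RtoC 0) by ring. apply cexp_0. }
    transitivity (E z * (cexp (- z) * cexp z))%C. { rewrite Hinv. ring. }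
    rewrite Cmult_assoc, H. ring. }
  split.
  - exact (Ent_ext E cexp Heq HE).
  - intros r. destruct (Hq r) as (K & HK & H). exists K. split; [exact HK|].
    intros z h. rewrite <- !Heq. apply H.
Qed.

(** Two derivatives are what the maximum principle on rectangles consumes. Unlike [Ent], the class
    is stable under composition: f(exp s) is in general not of exponential type. *)
Definition Hol2 (h : C -> C) : Prop := exists h1 h2 : C -> C,
  (forall s, Cder h s (h1 s)) /\ (forall s, Cder h1 s (h2 s)).

Lemma Ent_Hol2 (f : C -> C) : Ent f -> Hol2 f.
Proof.
  intros H. destruct (Ent_der f H) as (f1 & H1 & Q1). destruct (Ent_der f1 H1) as (f2 & H2 & Q2).
  exists f1, f2. split; apply quad_approx_Cder; assumption.
Qed.

Lemma Hol2_mult (f g : C -> C) : Hol2 f -> Hol2 g -> Hol2 (fun z => f z * g z)%C.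
Proof.
  intros (f1 & f2 & F1 & F2) (g1 & g2 & G1 & G2).
  exists (fun z => f1 z * g z + f z * g1 z)%C,
    (fun z => (f2 z * g z + f1 z * g1 z) + (f1 z * g1 z + f z * g2 z))%C.
  split; intros s.
  - apply Cder_mult; auto.
  - apply Cder_plus; apply Cder_mult; auto.
Qed.

Lemma Hol2_comp (f g : C -> C) : Hol2 f -> Hol2 g -> Hol2 (fun z => f (g z)).
Proof.
  intros (f1 & f2 & F1 & F2) (g1 & g2 & G1 & G2).
  exists (fun z => g1 z * f1 (g z))%C,
    (fun z => (g2 z * f1 (g z) + g1 z * (g1 z * f2 (g z))))%C.
  split; intros s.
  - apply (Cder_comp f g); auto.
  - apply (Cder_mult g1 (fun z => f1 (g z))); auto. apply (Cder_comp f1 g); auto.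
Qed.

Lemma Hol2_max_rect (h : C -> C) (a b c d M : R) : a <= b -> c <= d -> Hol2 h ->
  (forall x y, a <= x <= b -> c <= y <= d -> (x = a \/ x = b \/ y = c \/ y = d) -> Cmod (h (x, y)) <= M) ->
  forall x y, a <= x <= b -> c <= y <= d -> Cmod (h (x, y)) <= M.
Proof.
  intros Hab Hcd (h1 & h2 & H1 & H2) Hbd.
  apply (max_rect h h1 h2 a b c d M); auto; intros s.
  - apply Cder_hol, H1.
  - apply Cder_hol, H2.
  - apply Cder_c2d with (h1 s), H1.
Qed.

(** Lets the strength e of a damping factor tend to 0 in a bound that holds for each e > 0. *)
Lemma le_of_exp_bounds (x y c : R) : 0 <= x -> 0 <= c -> (forall e, 0 < e -> x <= y * exp (e * c)) -> x <= y.
Proof.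
  intros Hx Hc H. apply Rle_plus_epsilon. intros eta Heta.
  set (d := Rmin (1 / 2) (eta / (x + 1))).
  assert (Hd : 0 < d). { apply Rmin_glb_lt; [lra | apply Rdiv_lt_0_compat; lra]. }
  assert (Hd1 : d <= 1 / 2) by apply Rmin_l.
  assert (Hd2 : d * (x + 1) <= eta).
  { apply Rle_trans with (eta / (x + 1) * (x + 1)).
    - apply Rmult_le_compat_r; [lra | apply Rmin_r].
    - right; field; lra. }
  specialize (H (d / (c + 1)) ltac:(apply Rdiv_lt_0_compat; lra)).
  set (t := d / (c + 1) * c) in *.
  assert (Ht : 0 <= t <= d).
  { unfold t. assert (0 < d / (c + 1)) by (apply Rdiv_lt_0_compat; lra). split; [nra|].
    apply Rle_trans with (d / (c + 1) * (c + 1)); [nra | right; field; lra]. }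
  assert (Hexp : 1 - t <= exp (- t)). { pose proof (exp_ineq1_le (- t)). lra. }
  assert (E : exp t * exp (- t) = 1) by (rewrite <- exp_plus; replace (t + - t) with 0 by ring; apply exp_0).
  pose proof (exp_pos (- t)) as P.
  assert (x * exp (- t) <= y). { apply Rle_trans with (y * exp t * exp (- t)); [apply Rmult_le_compat_r; lra|]. rewrite Rmult_assoc, E. lra. }
  nra.
Qed.

Lemma polar_quadrant (z : C) : 0 <= fst z -> 0 <= snd z -> z <> 0 ->
  exists t, 0 <= t <= PI / 2 /\ z = cexp (ln (Cmod z), t).
Proof.
  intros Hx Hy Hz. assert (Hr : 0 < Cmod z) by (apply Cmod_gt_0, Hz).
  pose proof (Cmod_sqr z) as E. set (r := Cmod z) in *.
  assert (Hc : 0 <= fst z / r <= 1).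
  { split. { apply Rmult_le_pos; [exact Hx | left; apply Rinv_0_lt_compat, Hr]. }
    apply Rmult_le_reg_r with r; [exact Hr|]. unfold Rdiv. rewrite Rmult_assoc, Rinv_l, Rmult_1_r, Rmult_1_l by lra.
    apply Rle_trans with (1 := Rle_abs _). apply fst_le_Cmod. }
  exists (acos (fst z / r)). split.
  - split; [apply acos_bound|].
    destruct (Rle_dec (acos (fst z / r)) (PI / 2)) as [H|H]; [exact H|exfalso].
    pose proof (acos_bound (fst z / r)).
    assert (cos (acos (fst z / r)) < 0) by (apply cos_lt_0; lra).
    rewrite cos_acos in H1; lra.
  - apply C_eq; simpl; rewrite exp_ln by exact Hr.
    + rewrite cos_acos by lra. field. lra.
    + rewrite sin_acos by lra.
      replace (1 - (fst z / r)²) with ((snd z / r) ^ 2).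
      * rewrite sqrt_pow2. { field. lra. } apply Rmult_le_pos; [exact Hy | left; apply Rinv_0_lt_compat, Hr].
      * unfold Rsqr. apply Rmult_eq_reg_r with (r ^ 2); [|apply pow_nonzero; lra].
        transitivity (snd z ^ 2); [field; lra|].
        transitivity (r ^ 2 - fst z ^ 2); [lra | field; lra].
Qed.

(** In the coordinate s = log z the quadrant outside the unit disc is a half strip of height pi/2,
    so the maximum principle on rectangles suffices. The function is divided by z^N and multiplied
    by a damping factor that beats the exponential type on a far edge; the damping is removed at the
    end. *)
Lemma phragmen_lindelof_quadrant (f : C -> C) (N : nat) (A : R) : Ent f ->
  (forall x : R, 1 <= x -> Cmod (f x) <= A * x ^ N) ->
  (forall x : R, 1 <= x -> Cmod (f (Ci * x)%C) <= A * x ^ N) ->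
  exists A', 0 <= A' /\ forall z, 0 <= fst z -> 0 <= snd z -> Cmod (f z) <= A' * (1 + Cmod z) ^ N.
Proof.
  intros Hf Hre Him.
  destruct (Ent_bounded f 1 Hf) as (A1 & HA1 & Hb1).
  destruct (Ent_growth f Hf) as (A2 & B & HA2 & HB & Hg).
  set (A' := Rabs A + A1 + A2).
  assert (HA : A <= A') by (unfold A'; pose proof (Rle_abs A); lra).
  assert (HA1' : A1 <= A') by (unfold A'; pose proof (Rabs_pos A); lra).
  assert (HA2' : A2 <= A') by (unfold A'; pose proof (Rabs_pos A); lra).
  assert (HA' : 0 <= A') by lra.
  exists A'. split; [exact HA'|]. intros z Hx Hy.
  pose proof (Cmod_ge_0 z) as Hz0.
  assert (Hp : 1 <= (1 + Cmod z) ^ N) by (apply pow_R1_Rle; lra).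
  destruct (Rle_dec (Cmod z) 1) as [Hz|Hz].
  { apply Rle_trans with (1 := Hb1 z Hz). nra. }
  destruct (polar_quadrant z Hx Hy) as (t & Ht & Ez). { intros ->. rewrite Cmod_0 in Hz. lra. }
  set (sg := ln (Cmod z)) in *.
  assert (Hsg : 0 <= sg). { unfold sg. rewrite <- ln_1. apply ln_le; lra. }
  assert (Esg : exp sg = Cmod z) by (apply exp_ln; lra).
  assert (Hmain : Cmod (f z) <= A' * Cmod z ^ N).
  2:{ apply Rle_trans with (1 := Hmain). apply Rmult_le_compat_l; [exact HA'|]. apply pow_incr. lra. }
  pose proof PI_RGT_0 as HPI.
  set (kap := cos (3 * PI / 8)).
  assert (Hkap : 0 < kap) by (apply cos_gt_0; lra).
  assert (Hcos : forall t, 0 <= t <= PI / 2 -> kap <= cos (3 / 2 * t - 3 * PI / 8)).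
  { intros u Hu. destruct (Rle_dec 0 (3 / 2 * u - 3 * PI / 8)) as [P|P].
    - apply cos_decr_1; lra.
    - rewrite <- cos_neg. apply cos_decr_1; lra. }
  apply (le_of_exp_bounds _ _ (exp (3 / 2 * sg))); [apply Cmod_ge_0 | left; apply exp_pos|].
  intros del Hdel.
  (* The first term divides by z^N. The second is - del z^(3/2) turned by - 3 pi/8: the exponent 3/2
     exceeds the order 1 of f and is below the critical 2 of a quadrant, and the rotation keeps the
     argument within 3 pi/8 of 0, where the cosine is at least [kap] > 0. *)
  set (p := fun s : C => (- INR N * s + (- del * cexp (0%R, (- (3 * PI / 8))%R)) * cexp ((3 / 2)%R * s))%C).
  assert (Hpent : Ent p).
  { apply Ent_plus; apply Ent_scal; [apply Ent_id|]. apply (Ent_rot (3 / 2)%R cexp), Ent_cexp. }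
  assert (Hpre : forall x y, fst (p (x, y)) = - INR N * x - del * (exp (3 / 2 * x) * cos (3 / 2 * y - 3 * PI / 8))).
  { intros x y. unfold p. rewrite <- Cmult_assoc, <- cexp_plus. simpl.
    replace (0 + (3 / 2 * x - 0 * y)) with (3 / 2 * x) by ring.
    replace (- (3 * PI / 8) + (3 / 2 * y + 0 * x)) with (3 / 2 * y - 3 * PI / 8) by field. ring. }
  set (h := fun s => (f (cexp s) * cexp (p s))%C).
  assert (Hh : Hol2 h).
  { apply Hol2_mult; apply Hol2_comp; apply Ent_Hol2; auto; apply Ent_cexp. }
  assert (Hmod : forall x y, Cmod (h (x, y)) = Cmod (f (cexp (x, y))) * exp (- INR N * x) * exp (- (del * (exp (3 / 2 * x) * cos (3 / 2 * y - 3 * PI / 8))))).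
  { intros x y. unfold h. rewrite Cmod_mult, Cmod_cexp, Hpre. unfold Rminus at 1. rewrite exp_plus. ring. }
  assert (HpowN : forall x, exp (- INR N * x) * exp x ^ N = 1).
  { intros x. rewrite <- Rpower_pow by apply exp_pos. unfold Rpower. rewrite ln_exp, <- exp_plus.
    replace (- INR N * x + INR N * x) with 0 by ring. apply exp_0. }
  assert (HexpN : forall x, 0 <= x -> exp (- INR N * x) <= 1).
  { intros x P. rewrite <- exp_0. apply exp_mono. pose proof (pos_INR N). nra. }
  assert (Hdamp : forall x y, 0 <= y <= PI / 2 -> exp (- (del * (exp (3 / 2 * x) * cos (3 / 2 * y - 3 * PI / 8)))) <= 1).
  { intros x y P. rewrite <- exp_0. apply exp_mono. specialize (Hcos y P). pose proof (exp_pos (3 / 2 * x)).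
    assert (0 <= exp (3 / 2 * x) * cos (3 / 2 * y - 3 * PI / 8)) by (apply Rmult_le_pos; lra). nra. }
  (* The right edge lies beyond the given point and so far out that del kap exp(3 L/2) >= B exp(L):
     there the damping outweighs the type of f. *)
  set (L := Rmax (sg) (2 * (B / (del * kap)))).
  assert (HL1 : sg <= L) by apply Rmax_l. assert (HL2 : 2 * (B / (del * kap)) <= L) by apply Rmax_r.
  assert (HBd : 0 <= B / (del * kap)). { apply Rmult_le_pos; [exact HB|]. left; apply Rinv_0_lt_compat; nra. }
  assert (HEL : B <= del * kap * exp (L / 2)).
  { pose proof (exp_ineq1_le (L / 2)).
    replace B with (del * kap * (B / (del * kap))) at 1 by (field; lra).
    apply Rmult_le_compat_l; [nra | lra]. }
  assert (Hin : Cmod (h (sg, t)) <= A').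
  { apply (Hol2_max_rect h 0 L 0 (PI / 2)); auto; try lra.
    intros x y Hxx Hyy Hb. rewrite Hmod.
    assert (HD := Hdamp x y Hyy). assert (P1 := exp_pos (- INR N * x)).
    assert (P2 := exp_pos (- (del * (exp (3 / 2 * x) * cos (3 / 2 * y - 3 * PI / 8))))).
    assert (P3 := Cmod_ge_0 (f (cexp (x, y)))).
    assert (Hx1 : 1 <= exp x) by (rewrite <- exp_0; apply exp_mono; lra).
    destruct Hb as [ -> |[ -> |[ -> | -> ]]].
    - apply Rle_trans with (Cmod (f (cexp (0, y))) * 1).
      + rewrite Rmult_assoc. apply Rmult_le_compat_l; [exact P3|]. specialize (HexpN 0 (Rle_refl _)). nra.
      + rewrite Rmult_1_r. apply Rle_trans with A1; [|exact HA1']. apply Hb1. rewrite Cmod_cexp. simpl. rewrite exp_0. lra.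
    - apply Rle_trans with (A2 * exp (B * exp L) * 1 * exp (- (del * (exp (3 / 2 * L) * kap)))).
      + apply Rmult_le_compat; [nra | lra | |].
        * apply Rmult_le_compat; [exact P3 | lra | | apply HexpN; lra].
          pose proof (Hg (cexp (L, y))) as G. rewrite Cmod_cexp in G. exact G.
        * apply exp_mono. specialize (Hcos y Hyy). pose proof (exp_pos (3 / 2 * L)).
          apply Ropp_le_contravar. apply Rmult_le_compat_l; [lra|]. apply Rmult_le_compat_l; lra.
      + rewrite Rmult_1_r, Rmult_assoc, <- exp_plus.
        apply Rle_trans with (A2 * 1); [|lra]. apply Rmult_le_compat_l; [exact HA2|].
        rewrite <- exp_0. apply exp_mono.
        replace (3 / 2 * L) with (L + L / 2) by field. rewrite exp_plus. pose proof (exp_pos L). nra.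
    - apply Rle_trans with (A * exp x ^ N * exp (- INR N * x)).
      + rewrite <- (Rmult_1_r (A * exp x ^ N * exp (- INR N * x))).
        assert (G : Cmod (f (cexp (x, 0))) <= A * exp x ^ N).
        { replace (cexp (x, 0)) with (RtoC (exp x)) by (apply C_eq; simpl; rewrite ?cos_0, ?sin_0; ring). apply Hre, Hx1. }
        apply Rmult_le_compat; [nra | lra | | exact HD]. apply Rmult_le_compat_r; lra.
      + rewrite Rmult_assoc, (Rmult_comm (exp x ^ N)), HpowN. lra.
    - apply Rle_trans with (A * exp x ^ N * exp (- INR N * x)).
      + rewrite <- (Rmult_1_r (A * exp x ^ N * exp (- INR N * x))).
        assert (G : Cmod (f (cexp (x, PI / 2))) <= A * exp x ^ N).
        { replace (cexp (x, PI / 2)) with (Ci * RtoC (exp x))%C by (apply C_eq; simpl; rewrite ?cos_PI2, ?sin_PI2; ring). apply Him, Hx1. }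
        apply Rmult_le_compat; [nra | lra | | exact HD]. apply Rmult_le_compat_r; lra.
      + rewrite Rmult_assoc, (Rmult_comm (exp x ^ N)), HpowN. lra. }
  rewrite Hmod, <- Ez in Hin.
  set (D := exp (- (del * (exp (3 / 2 * sg) * cos (3 / 2 * t - 3 * PI / 8))))) in *.
  (* At the fixed point the damping has modulus at least exp(- del |z|^(3/2)); this is the factor
     that tends to 1 with del. *)
  assert (HDinv : / exp (del * exp (3 / 2 * sg)) <= D).
  { rewrite <- exp_Ropp. unfold D. apply exp_mono. apply Ropp_le_contravar.
    pose proof (COS_bound (3 / 2 * t - 3 * PI / 8)). pose proof (exp_pos (3 / 2 * sg)).
    apply Rmult_le_compat_l; [lra|]. nra. }
  pose proof (exp_pos (del * exp (3 / 2 * sg))) as PE. set (E := exp (del * exp (3 / 2 * sg))) in *.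
  specialize (HpowN sg). rewrite Esg in HpowN. pose proof (exp_pos (- INR N * sg)) as PN.
  assert (Hzn : 0 < Cmod z ^ N) by (apply pow_lt; lra).
  assert (HE1 : 1 <= E * D). { apply Rle_trans with (E * / E); [right; field; lra | apply Rmult_le_compat_l; lra]. }
  pose proof (Cmod_ge_0 (f z)) as Pf.
  apply Rle_trans with (Cmod (f z) * (exp (- INR N * sg) * Cmod z ^ N) * (E * D)).
  - rewrite HpowN, Rmult_1_r. nra.
  - replace (Cmod (f z) * (exp (- INR N * sg) * Cmod z ^ N) * (E * D))
      with ((Cmod (f z) * exp (- INR N * sg) * D) * (Cmod z ^ N * E)) by ring.
    rewrite (Rmult_assoc A'). apply Rmult_le_compat_r; [nra | exact Hin].
Qed.

(** The four quadrants are rotated onto the first by the powers of i, which permute the half-axes on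
    which bounds are assumed. *)
Lemma phragmen_lindelof_plane (f : C -> C) (N : nat) (A : R) : Ent f ->
  (forall x : R, 1 <= Rabs x -> Cmod (f x) <= A * Rabs x ^ N) ->
  (forall x : R, 1 <= Rabs x -> Cmod (f (Ci * x)%C) <= A * Rabs x ^ N) ->
  exists A', 0 <= A' /\ forall z, Cmod (f z) <= A' * (1 + Cmod z) ^ N.
Proof.
  intros Hf Hre Him.
  assert (Hrot : forall w : C, (w = 1 \/ w = Ci \/ w = (-(1))%C \/ w = (- Ci)%C) ->
    exists A', 0 <= A' /\ forall z, 0 <= fst z -> 0 <= snd z -> Cmod (f (w * z)%C) <= A' * (1 + Cmod z) ^ N).
  { intros w Hw. apply (phragmen_lindelof_quadrant (fun z => f (w * z)%C) N A).
    - apply Ent_rot, Hf.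
    - intros x Hx. pose proof (Rabs_pos_eq x ltac:(lra)) as E.
      destruct Hw as [ -> |[ -> |[ -> | -> ]]].
      + rewrite <- E at 2. replace (1 * x)%C with (RtoC x) by ring. apply Hre. lra.
      + rewrite <- E at 2. apply Him. lra.
      + rewrite <- E at 2. rewrite <- Rabs_Ropp. replace (-(1) * x)%C with (RtoC (- x)) by (rewrite RtoC_opp; ring). apply Hre. rewrite Rabs_Ropp; lra.
      + rewrite <- E at 2. rewrite <- Rabs_Ropp. replace (- Ci * x)%C with (Ci * RtoC (- x))%C by (rewrite RtoC_opp; ring). apply Him. rewrite Rabs_Ropp; lra.
    - intros x Hx. pose proof (Rabs_pos_eq x ltac:(lra)) as E.
      destruct Hw as [ -> |[ -> |[ -> | -> ]]].
      + rewrite <- E at 2. replace (1 * (Ci * x))%C with (Ci * x)%C by ring. apply Him. lra.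
      + rewrite <- E at 2. rewrite <- Rabs_Ropp. replace (Ci * (Ci * x))%C with (RtoC (- x)) by (apply C_eq; simpl; ring). apply Hre. rewrite Rabs_Ropp; lra.
      + rewrite <- E at 2. rewrite <- Rabs_Ropp. replace (-(1) * (Ci * x))%C with (Ci * RtoC (- x))%C by (rewrite RtoC_opp; ring). apply Him. rewrite Rabs_Ropp; lra.
      + rewrite <- E at 2. replace (- Ci * (Ci * x))%C with (RtoC x) by (apply C_eq; simpl; ring). apply Hre. lra. }
  destruct (Hrot 1 ltac:(tauto)) as (B1 & HB1 & K1).
  destruct (Hrot Ci ltac:(tauto)) as (B2 & HB2 & K2).
  destruct (Hrot (-(1))%C ltac:(tauto)) as (B3 & HB3 & K3).
  destruct (Hrot (- Ci)%C ltac:(tauto)) as (B4 & HB4 & K4).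
  exists (B1 + B2 + B3 + B4). split; [lra|]. intros z.
  assert (P : 0 <= (1 + Cmod z) ^ N) by (apply pow_le; pose proof (Cmod_ge_0 z); lra).
  assert (Q : forall w B, 0 <= B -> B <= B1 + B2 + B3 + B4 -> Cmod w = 1 -> (w * Cconj w)%C = 1 ->
     (forall z, 0 <= fst z -> 0 <= snd z -> Cmod (f (w * z)%C) <= B * (1 + Cmod z) ^ N) ->
     0 <= fst (Cconj w * z)%C -> 0 <= snd (Cconj w * z)%C -> Cmod (f z) <= (B1 + B2 + B3 + B4) * (1 + Cmod z) ^ N).
  { intros w B H1 H2 H3 H4 H5 H6 H7. specialize (H5 _ H6 H7).
    rewrite Cmod_mult, Cmod_conj, H3, Rmult_1_l in H5.
    replace (w * (Cconj w * z))%C with z in H5 by (rewrite Cmult_assoc, H4; ring). nra. }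
  destruct (Rle_dec 0 (fst z)) as [Hx|Hx]; destruct (Rle_dec 0 (snd z)) as [Hy|Hy].
  - apply (Q 1 B1); auto; try lra; try apply Cmod_1; try (apply C_eq; simpl; ring); simpl; lra.
  - apply (Q (- Ci)%C B4); auto; try lra; try (rewrite Cmod_opp; apply Cmod_Ci); try (apply C_eq; simpl; ring); simpl; lra.
  - apply (Q Ci B2); auto; try lra; try apply Cmod_Ci; try (apply C_eq; simpl; ring); simpl; lra.
  - apply (Q (-(1))%C B3); auto; try lra; try (rewrite Cmod_opp; apply Cmod_1); try (apply C_eq; simpl; ring); simpl; lra.
Qed.

(** The square of half-side r around [z0] contains the disc of radius r, and its boundary lies in
    the annulus between r and 2 r. The maximum principle on rectangles therefore serves for
    discs. *)
Lemma Ent_max_annulus (f : C -> C) (z0 : C) (r M : R) : Ent f -> 0 <= r ->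
  (forall z, r <= Cmod (z - z0) <= 2 * r -> Cmod (f z) <= M) ->
  forall z, Cmod (z - z0) <= r -> Cmod (f z) <= M.
Proof.
  intros Hf Hr Hb z Hz.
  assert (H1 : Rabs (fst z - fst z0) <= r) by (apply Rle_trans with (2 := Hz); exact (fst_le_Cmod (z - z0)%C)).
  assert (H2 : Rabs (snd z - snd z0) <= r) by (apply Rle_trans with (2 := Hz); exact (snd_le_Cmod (z - z0)%C)).
  apply Rabs_le_between in H1. apply Rabs_le_between in H2.
  rewrite (surjective_pairing z).
  apply (Hol2_max_rect f (fst z0 - r) (fst z0 + r) (snd z0 - r) (snd z0 + r)); try lra.
  - apply Ent_Hol2, Hf.
  - intros x y Hx Hy B. apply Hb. split.
    + destruct B as [B|[B|B]].
      * apply Rle_trans with (2 := fst_le_Cmod _). simpl. apply Rle_trans with (- (x + - fst z0)); [lra|]. rewrite <- Rabs_Ropp. apply Rle_abs.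
      * apply Rle_trans with (2 := fst_le_Cmod _). simpl. apply Rle_trans with (2 := Rle_abs _). lra.
      * destruct B as [B|B].
        { apply Rle_trans with (2 := snd_le_Cmod _). simpl. apply Rle_trans with (- (y + - snd z0)); [lra|]. rewrite <- Rabs_Ropp. apply Rle_abs. }
        { apply Rle_trans with (2 := snd_le_Cmod _). simpl. apply Rle_trans with (2 := Rle_abs _). lra. }
    + apply Rle_trans with (1 := Cmod_le_abs _). simpl.
      assert (Rabs (x + - fst z0) <= r) by (apply Rabs_le; lra). assert (Rabs (y + - snd z0) <= r) by (apply Rabs_le; lra). lra.
Qed.

Lemma Ent_decay_zero (f : C -> C) (K : R) : Ent f -> (forall z, Cmod z * Cmod (f z) <= K) -> forall z, f z = 0.
Proof.
  intros Hf H z. apply Cmod_eq_0. apply Rle_antisym; [|apply Cmod_ge_0].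
  apply Rle_plus_epsilon. intros eps He. rewrite Rplus_0_l.
  assert (HK : 0 <= K). { specialize (H 0). rewrite Cmod_0, Rmult_0_l in H. exact H. }
  set (r := Cmod z + K / eps + 1).
  assert (HKe : 0 <= K / eps) by (apply Rmult_le_pos; [exact HK | left; apply Rinv_0_lt_compat, He]).
  pose proof (Cmod_ge_0 z) as Hz.
  assert (Hr : 0 < r) by (unfold r; lra).
  apply (Ent_max_annulus f 0 r); auto; try lra.
  - intros w [Hw _]. replace (w - 0)%C with w in Hw by ring. specialize (H w).
    apply Rmult_le_reg_l with r; [exact Hr|].
    apply Rle_trans with (Cmod w * Cmod (f w)).
    { apply Rmult_le_compat_r; [apply Cmod_ge_0 | exact Hw]. }
    apply Rle_trans with (1 := H). apply Rle_trans with (K / eps * eps); [right; field; lra|].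
    apply Rmult_le_compat_r; [lra | unfold r; lra].
  - replace (z - 0)%C with z by ring. unfold r. lra.
Qed.

(** Induction on the degree: in f = f(0) + z q the quotient q has growth of one degree less and is
    still bounded on the real line, hence constant. *)
Lemma liouville_poly (N : nat) : forall (f : C -> C) (A K : R), Ent f ->
  (forall z, Cmod (f z) <= A * (1 + Cmod z) ^ N) -> (forall x : R, Cmod (f x) <= K) ->
  forall z, f z = f 0.
Proof.
  induction N as [|N IH]; intros f A K Hf HA HK z.
  - destruct (Ent_div f 0 Hf) as (q & Hq & E).
    rewrite E. rewrite (Ent_decay_zero q (2 * A) Hq); [ring|].
    intros w. rewrite <- Cmod_mult. replace (w * q w)%C with (f w - f 0)%C by (rewrite (E w); ring).
    pose proof (HA w) as H1. pose proof (HA 0) as H2. simpl in H1, H2.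
    apply Rle_trans with (1 := Cmod_triangle _ _). rewrite Cmod_opp. lra.
  - destruct (Ent_div f 0 Hf) as (q & Hq & E).
    destruct (Ent_bounded q 1 Hq) as (M & HM & Hb).
    assert (Ef : forall w, (w * q w)%C = (f w - f 0)%C) by (intros w; rewrite (E w); ring).
    assert (HA0 : 0 <= A).
    { specialize (HA 0). rewrite Cmod_0, Rplus_0_r, pow1, Rmult_1_r in HA. apply Rle_trans with (2 := HA). apply Cmod_ge_0. }
    assert (Hc : forall z, q z = q 0).
    { apply (IH q (4 * A + M) (2 * K + M) Hq).
      - intros w. pose proof (Cmod_ge_0 w) as Hw.
        assert (P : 1 <= (1 + Cmod w) ^ N) by (apply pow_R1_Rle; lra).
        destruct (Rle_dec (Cmod w) 1) as [L|L]. { specialize (Hb w L). nra. }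
        apply Rmult_le_reg_l with (Cmod w); [lra|]. rewrite <- Cmod_mult, Ef.
        apply Rle_trans with (A * (1 + Cmod w) ^ S N + A * (1 + Cmod w) ^ S N).
        + apply Rle_trans with (1 := Cmod_triangle _ _). rewrite Cmod_opp. apply Rplus_le_compat; [apply HA|].
          apply Rle_trans with (1 := HA 0). apply Rmult_le_compat_l; [exact HA0|]. apply pow_incr. rewrite Cmod_0. lra.
        + simpl pow. apply Rle_trans with (Cmod w * (4 * A) * (1 + Cmod w) ^ N).
          * assert (0 <= A * (1 + Cmod w) ^ N) by nra. nra.
          * assert (0 <= Cmod w * M * (1 + Cmod w) ^ N) by (repeat apply Rmult_le_pos; lra). nra.
      - intros x. destruct (Rle_dec (Cmod x) 1) as [L|L].
        + specialize (Hb x L). specialize (HK x). pose proof (Cmod_ge_0 (f x)). lra.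
        + apply Rle_trans with (Cmod x * Cmod (q x)).
          * pose proof (Cmod_ge_0 (q x)). nra.
          * rewrite <- Cmod_mult, Ef. apply Rle_trans with (1 := Cmod_triangle _ _). rewrite Cmod_opp.
            pose proof (HK x). pose proof (HK 0). lra. }
    (* Now f = f(0) + z q(0), which is bounded on the real line only if q(0) = 0; x is taken just
       large enough to exceed the bound 2 K. *)
    assert (H0 : q 0 = 0).
    { apply Cmod_eq_0. apply Rle_antisym; [|apply Cmod_ge_0]. apply Rnot_lt_le. intros Hpos.
      set (x := (2 * K + 1) / Cmod (q 0)).
      assert (HK0 : 0 <= K) by (apply Rle_trans with (2 := HK 0); apply Cmod_ge_0).
      assert (Hx : 0 < x) by (apply Rdiv_lt_0_compat; lra).
      assert (x * Cmod (q 0) = 2 * K + 1) by (unfold x; field; lra).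
      assert (HH : Cmod (x * q x) <= 2 * K).
      { rewrite Ef. apply Rle_trans with (1 := Cmod_triangle _ _). rewrite Cmod_opp. pose proof (HK x). pose proof (HK 0). lra. }
      rewrite Cmod_mult, Hc, Cmod_R, Rabs_pos_eq in HH by lra. lra. }
    rewrite E, Hc, H0. ring.
Qed.

(** * Zeros of functions of exponential type *)

Fixpoint Pl (L : list C) (z : C) : C :=
  match L with nil => 1 | a :: l => ((z - a) * Pl l z)%C end.

Lemma Ent_linear (a : C) : Ent (fun z => z - a)%C.
Proof. apply Ent_minus; [apply Ent_id | apply Ent_const]. Qed.

(* On the annulus 3R <= |z - z0| <= 6R each factor is twice as large as at z0. *)
Lemma root_count (f q : C -> C) (L : list C) (z0 : C) (r M : R) : 0 < r -> Ent q ->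
  (forall z, f z = (Pl L z * q z)%C) -> (forall a, In a L -> Cmod (a - z0) <= r) ->
  (forall z, Cmod (z - z0) <= 6 * r -> Cmod (f z) <= M) ->
  forall z, Cmod (z - z0) <= 3 * r -> 2 ^ length L * Cmod (Pl L z0) * Cmod (q z) <= M.
Proof.
  intros Hr Hq E HL HM z Hz.
  set (k := 2 ^ length L * Cmod (Pl L z0)).
  assert (Hk : 0 <= k).
  { apply Rmult_le_pos; [apply pow_le; lra | apply Cmod_ge_0]. }
  replace (k * Cmod (q z)) with (Cmod (k * q z)) by (rewrite Cmod_mult, Cmod_R, Rabs_pos_eq; auto).
  apply (Ent_max_annulus (fun z => k * q z)%C z0 (3 * r)); auto; try lra.
  - apply Ent_scal, Hq.
  - intros w Hw. rewrite Cmod_mult, Cmod_R, Rabs_pos_eq by exact Hk.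
    apply Rle_trans with (Cmod (f w)); [|apply HM; lra].
    rewrite E, Cmod_mult. apply Rmult_le_compat_r; [apply Cmod_ge_0|].
    unfold k. clear -HL Hw Hr. induction L as [|a L IH]; simpl.
    { lra. }
    rewrite 2!Cmod_mult.
    assert (H1 : Cmod (a - z0) <= r) by (apply HL; left; reflexivity).
    assert (H2 : 2 * Cmod (z0 - a) <= Cmod (w - a)).
    { rewrite Cmod_minus_sym in H1. pose proof (Cmod_triangle (w - a) (a - z0)) as T.
      replace (w - a + (a - z0))%C with (w - z0)%C in T by ring. rewrite (Cmod_minus_sym a z0) in T. lra. }
    assert (H3 := IH (fun b Hb => HL b (or_intror Hb))).
    replace (2 * 2 ^ length L * (Cmod (z0 - a) * Cmod (Pl L z0)))
      with ((2 * Cmod (z0 - a)) * (2 ^ length L * Cmod (Pl L z0))) by ring.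
    apply Rmult_le_compat; auto.
    + pose proof (Cmod_ge_0 (z0 - a)). lra.
    + apply Rmult_le_pos; [apply pow_le; lra | apply Cmod_ge_0].
Qed.

Lemma pow2_ge (n : nat) : INR n <= 2 ^ n.
Proof.
  induction n. { simpl; lra. } rewrite S_INR. simpl.
  assert (1 <= 2 ^ n) by (apply pow_R1_Rle; lra). lra.
Qed.

Lemma Ent_bounded_at (f : C -> C) (z0 : C) (r : R) : Ent f ->
  exists M, 0 <= M /\ forall z, Cmod (z - z0) <= r -> Cmod (f z) <= M.
Proof.
  intros Hf. destruct (Ent_bounded f (r + Cmod z0) Hf) as (M & HM & H). exists M. split; [exact HM|].
  intros z Hz. apply H. pose proof (Cmod_triangle_inv z z0). lra.
Qed.

(** A crude form of Jensen's inequality: every zero within r of [z0] gains a factor 2 between [z0]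
    and the annulus, so n zeros force 2^n |f(z0)| <= M. It yields the identity theorem and the
    termination of the removal of common zeros. *)
Lemma arbitrarily_many_roots (f : C -> C) (z0 : C) (r : R) : Ent f -> 0 < r ->
  (forall n : nat, exists L q, length L = n /\ Ent q /\ (forall z, f z = (Pl L z * q z)%C) /\
     (forall a, In a L -> Cmod (a - z0) <= r)) -> f z0 = 0.
Proof.
  intros Hf Hr H. apply Cmod_eq_0. apply Rle_antisym; [|apply Cmod_ge_0]. apply Rnot_lt_le. intros Hpos.
  destruct (Ent_bounded_at f z0 (6 * r) Hf) as (M & HM & Hb).
  destruct (INR_unbounded (M / Cmod (f z0))) as (n & Hn).
  destruct (H n) as (L & q & HL & Hq & E & Hin).
  assert (Hz : Cmod (z0 - z0) <= 3 * r). { replace (z0 - z0)%C with (RtoC 0) by ring. rewrite Cmod_0. lra. }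
  pose proof (root_count f q L z0 r M Hr Hq E Hin Hb z0 Hz) as K.
  rewrite Rmult_assoc, <- Cmod_mult, <- E, HL in K.
  pose proof (pow2_ge n).
  assert (M = M / Cmod (f z0) * Cmod (f z0)) by (field; lra). nra.
Qed.

(** The distinct zeros are divided out one after the other, and [arbitrarily_many_roots] is applied
    around any chosen centre with a radius that reaches all of them. *)
Lemma identity_theorem (f : C -> C) (p : nat -> C) (r : R) : Ent f ->
  (forall n m, p n = p m -> n = m) -> (forall n, Cmod (p n) <= r) -> (forall n, f (p n) = 0) ->
  forall z, f z = 0.
Proof.
  intros Hf Hinj Hp H0 z0.
  assert (Hr : 0 <= r) by (apply Rle_trans with (2 := Hp O); apply Cmod_ge_0).
  pose proof (Cmod_ge_0 z0) as Hz0.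
  apply (arbitrarily_many_roots f z0 (r + Cmod z0 + 1) Hf); [lra|].
  assert (K : forall n, exists L q, length L = n /\ Ent q /\ (forall z, f z = (Pl L z * q z)%C) /\
     (forall a, In a L -> exists i, (i < n)%nat /\ a = p i)).
  { induction n as [|n (L & q & HL & Hq & E & Hin)].
    - exists nil, f. repeat split; auto. + intros z; simpl; ring. + intros a [].
    - destruct (Ent_div q (p n) Hq) as (q' & Hq' & E').
      assert (Hqn : q (p n) = 0).
      { assert (Hne : Pl L (p n) <> 0).
        { assert (G : forall L, (forall a, In a L -> a <> p n) -> Pl L (p n) <> 0).
          { clear. induction L as [|a L IH]; intros H; simpl.
            - apply C1_nz.
            - apply Cmult_neq_0.
              + apply Cminus_eq_contra. intros K. apply (H a); [left; reflexivity | symmetry; exact K].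
              + apply IH. intros b Hb. apply H. right; exact Hb. }
          apply G. intros a Ha ->. destruct (Hin _ Ha) as (i & Hi & Ei). apply Hinj in Ei. lia. }
        destruct (classic (q (p n) = 0)) as [Y|Y]; [exact Y|exfalso].
        apply (Cmult_neq_0 _ _ Hne Y). rewrite <- E. apply H0. }
      exists (p n :: L), q'. split; [simpl; lia|]. split; [exact Hq'|]. split.
      + intros z. rewrite E, E', Hqn. simpl. ring.
      + intros a [<-|Ha]; [exists n; split; [lia|reflexivity]|].
        destruct (Hin a Ha) as (i & Hi & Ei). exists i. split; [lia|exact Ei]. }
  intros n. destruct (K n) as (L & q & HL & Hq & E & Hin). exists L, q. repeat split; auto.
  intros a Ha. destruct (Hin a Ha) as (i & _ & ->).
  apply Rle_trans with (1 := Cmod_triangle _ _). rewrite Cmod_opp. specialize (Hp i). lra.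
Qed.

(** * Removal of common zeros *)

Lemma Ent_entire (f : C -> C) : Ent f -> entire f.
Proof.
  intros Hf z. destruct (Ent_der f Hf) as (f' & _ & Hq). exists (f' z). intros eps He.
  destruct (quad_approx_Cder f f' Hq z (eps / 2) ltac:(lra)) as (d & Hd & K).
  exists d. split; [exact Hd|]. intros h Hh Hhd.
  change (Cmod ((f (z + h)%C - f z) / h - f' z)%C < eps).
  assert (Hh0 : h <> RtoC 0) by exact Hh.
  replace ((f (z + h)%C - f z) / h - f' z)%C with ((f (z + h)%C - f z - h * f' z) / h)%C by (field; exact Hh0).
  rewrite Cmod_div by exact Hh0. pose proof (proj1 (Cmod_gt_0 h) Hh0) as P.
  specialize (K h Hhd). apply Rmult_lt_reg_r with (Cmod h); [exact P|].
  unfold Rdiv. rewrite Rmult_assoc, Rinv_l, Rmult_1_r by lra. nra.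
Qed.

Lemma entire_cont (f : C -> C) (z : C) : entire f ->
  forall eps, 0 < eps -> exists delta, 0 < delta /\ forall h : C, Cmod h < delta -> Cmod (f (z + h)%C - f z)%C < eps.
Proof.
  intros Hf eps He. destruct (Hf z) as [L H]. destruct (H 1 Rlt_0_1) as (d & Hd & K).
  pose proof (Cmod_ge_0 L) as HL.
  exists (Rmin d (eps / (Cmod L + 2))). split.
  { apply Rmin_glb_lt; [exact Hd | apply Rdiv_lt_0_compat; lra]. }
  intros h Hh. pose proof (Rmin_l d (eps / (Cmod L + 2))). pose proof (Rmin_r d (eps / (Cmod L + 2))).
  destruct (Ceq_dec h 0) as [->|Hh0].
  { replace (z + 0)%C with z by ring. replace (f z - f z)%C with (RtoC 0) by ring. rewrite Cmod_0. exact He. }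
  specialize (K h Hh0). change (Cmod h < d -> Cmod ((f (z + h)%C - f z) / h - L)%C < 1) in K.
  specialize (K ltac:(lra)). pose proof (proj1 (Cmod_gt_0 h) Hh0) as P.
  replace (f (z + h)%C - f z)%C with (h * (((f (z + h)%C - f z) / h - L) + L))%C by (field; exact Hh0).
  rewrite Cmod_mult. pose proof (Cmod_triangle ((f (z + h)%C - f z) / h - L)%C L) as T.
  apply Rle_lt_trans with (Cmod h * (Cmod L + 1)); [apply Rmult_le_compat_l; lra|].
  apply Rlt_le_trans with (eps / (Cmod L + 2) * (Cmod L + 2)); [nra | right; field; lra].
Qed.

Lemma Defs_Cpow (z : C) n : Defs.Cpow z n = (z ^ n)%C.
Proof. induction n; [reflexivity|]. rewrite Cpow_S, <- IHn. reflexivity. Qed.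

(** Isolates the multiplicity of [z1] in the list from the factors that do not vanish there. *)
Lemma Pl_split (L : list C) (z1 : C) : exists (s : nat) (P : C -> C), Ent P /\ P z1 <> 0 /\
  forall z, Pl L z = ((z - z1) ^ s * P z)%C.
Proof.
  induction L as [|a L (s & P & HP & Hne & E)].
  - exists O, (fun _ => 1). split; [apply Ent_const|]. split; [apply C1_nz|]. intros z. simpl. ring.
  - destruct (Ceq_dec a z1) as [->|N].
    + exists (S s), P. split; [exact HP|]. split; [exact Hne|]. intros z. simpl Pl. rewrite E, Cpow_S. ring.
    + exists s, (fun z => (z - a) * P z)%C. split; [apply Ent_mult; [apply Ent_linear | exact HP]|]. split.
      * apply Cmult_neq_0; [apply Cminus_eq_contra; intros K; apply N; symmetry; exact K | exact Hne].
      * intros z. simpl Pl. rewrite E. ring.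
Qed.

(** If [z1] occurs s times in [L] and [f1] vanishes there, f has order at least s + 1 at [z1], hence
    so has g. Cancelling (z - z1)^s away from [z1] gives P g1 = (z - z1) h with P(z1) nonzero, and
    letting z tend to [z1] gives g1(z1) = 0. The function h comes from [zero_order_ge] with no
    growth bound; only its continuity is used. *)
Lemma zero_transfer (f g f1 g1 : C -> C) (L : list C) (z1 : C) :
  (forall n, zero_order_ge f z1 n -> zero_order_ge g z1 n) -> Ent f1 -> Ent g1 ->
  (forall z, f z = (Pl L z * f1 z)%C) -> (forall z, g z = (Pl L z * g1 z)%C) ->
  f1 z1 = 0 -> g1 z1 = 0.
Proof.
  intros Hz Hf1 Hg1 Ef Eg H0.
  destruct (Pl_split L z1) as (s & P & HP & Hne & EP).
  destruct (Ent_div f1 z1 Hf1) as (f2 & Hf2 & E2).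
  destruct (Hz (S s)) as (h & Hh & Eh).
  { exists (fun z => P z * f2 z)%C. split; [apply Ent_entire, Ent_mult; assumption|].
    intros z. change (f z = (Defs.Cpow (z - z1)%C (S s) * (P z * f2 z))%C).
    rewrite Defs_Cpow, Ef, EP, E2, H0, Cpow_S. ring. }
  assert (Hpg : forall z, z <> z1 -> (P z * g1 z)%C = ((z - z1) * h z)%C).
  { intros z Hzz. specialize (Eh z). change (g z = (Defs.Cpow (z - z1)%C (S s) * h z)%C) in Eh.
    rewrite Defs_Cpow, Eg, EP, Cpow_S in Eh.
    assert (Hn : ((z - z1) ^ s)%C <> 0) by (apply Cpow_nz, Cminus_eq_contra, Hzz).
    transitivity (((z - z1) ^ s * P z * g1 z) / (z - z1) ^ s)%C; [field; exact Hn|].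
    rewrite Eh. field. exact Hn. }
  assert (HK : Ent (fun z => P z * g1 z)%C) by (apply Ent_mult; assumption).
  assert (HK0 : (P z1 * g1 z1)%C = 0).
  { apply Cmod_eq_0. apply Rle_antisym; [|apply Cmod_ge_0]. apply Rle_plus_epsilon. intros eps He. rewrite Rplus_0_l.
    destruct (entire_cont _ z1 (Ent_entire _ HK) (eps / 2) ltac:(lra)) as (d1 & Hd1 & K1).
    destruct (entire_cont h z1 Hh 1 Rlt_0_1) as (d2 & Hd2 & K2).
    pose proof (Cmod_ge_0 (h z1)) as Hhz.
    set (t := Rmin (Rmin d1 d2) (eps / (Cmod (h z1) + 1)) / 2).
    assert (Hm : 0 < Rmin (Rmin d1 d2) (eps / (Cmod (h z1) + 1))).
    { repeat apply Rmin_glb_lt; auto. apply Rdiv_lt_0_compat; lra. }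
    pose proof (Rmin_l (Rmin d1 d2) (eps / (Cmod (h z1) + 1))). pose proof (Rmin_r (Rmin d1 d2) (eps / (Cmod (h z1) + 1))).
    pose proof (Rmin_l d1 d2). pose proof (Rmin_r d1 d2).
    assert (Ht : 0 < t) by (unfold t; lra).
    assert (Hct : Cmod t = t) by (rewrite Cmod_R; apply Rabs_pos_eq; lra).
    assert (Htd : Cmod t < d1) by (rewrite Hct; unfold t; lra).
    assert (Htd2 : Cmod t < d2) by (rewrite Hct; unfold t; lra).
    specialize (K1 t Htd). specialize (K2 t Htd2). cbv beta in K1.
    assert (Hnz : (z1 + t)%C <> z1).
    { intros Q. assert (Q2 : RtoC t = 0) by (transitivity (z1 + t - z1)%C; [ring | rewrite Q; ring]).
      apply RtoC_inj in Q2. lra. }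
    rewrite (Hpg _ Hnz) in K1.
    replace (z1 + t - z1)%C with (RtoC t) in K1 by ring.
    set (hh := h (z1 + t)%C) in *.
    assert (Cmod (t * hh) <= eps / 2).
    { rewrite Cmod_mult, Hct.
      assert (Cmod hh <= Cmod (h z1) + 1). { pose proof (Cmod_triangle_inv hh (h z1)). lra. }
      apply Rle_trans with (t * (Cmod (h z1) + 1)); [apply Rmult_le_compat_l; lra|].
      apply Rle_trans with (eps / (Cmod (h z1) + 1) / 2 * (Cmod (h z1) + 1)).
      - apply Rmult_le_compat_r; [lra|]. unfold t. lra.
      - right. field. lra. }
    pose proof (Cmod_triangle_inv (P z1 * g1 z1)%C (t * hh)%C) as T.
    rewrite Cmod_minus_sym in T. lra. }
  destruct (classic (g1 z1 = 0)) as [Y|Y]; [exact Y|exfalso].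
  apply (Cmult_neq_0 _ _ Hne Y). exact HK0.
Qed.

(** By contradiction: if no finite removal left both quotients free of zeros in the disc, common
    zeros could be removed without end, and [arbitrarily_many_roots] would give f(z0) = 0. *)
Lemma common_division (f g : C -> C) (z0 : C) (r : R) : Ent f -> Ent g -> same_zeros_mult f g ->
  f z0 <> 0 -> 0 < r ->
  exists L f1 g1, Ent f1 /\ Ent g1 /\ (forall z, f z = (Pl L z * f1 z)%C) /\ (forall z, g z = (Pl L z * g1 z)%C) /\
    (forall a, In a L -> Cmod (a - z0) <= r) /\
    (forall z, Cmod (z - z0) <= r -> f1 z <> 0 /\ g1 z <> 0).
Proof.
  intros Hf Hg Hz Hf0 Hr. apply NNPP. intros Hno. apply Hf0.
  apply (arbitrarily_many_roots f z0 r Hf Hr).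
  assert (K : forall n, exists L f1 g1, length L = n /\ Ent f1 /\ Ent g1 /\
    (forall z, f z = (Pl L z * f1 z)%C) /\ (forall z, g z = (Pl L z * g1 z)%C) /\
    (forall a, In a L -> Cmod (a - z0) <= r)).
  { induction n as [|n (L & f1 & g1 & HL & Hf1 & Hg1 & Ef & Eg & Hin)].
    - exists nil, f, g. repeat split; auto; try (intros z; simpl; ring). intros a [].
    - assert (Hz1 : exists z1, Cmod (z1 - z0) <= r /\ f1 z1 = 0 /\ g1 z1 = 0).
      { apply NNPP. intros Hn. apply Hno. exists L, f1, g1. repeat split; auto.
        - intros Y. apply Hn. exists z. repeat split; auto.
          apply (zero_transfer f g f1 g1 L z); auto. intros m; apply Hz.
        - intros Y. apply Hn. exists z. repeat split; auto.
          apply (zero_transfer g f g1 f1 L z); auto. intros m; apply Hz. }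
      destruct Hz1 as (z1 & Hz1 & F1 & G1).
      destruct (Ent_div f1 z1 Hf1) as (f2 & Hf2 & E2). destruct (Ent_div g1 z1 Hg1) as (g2 & Hg2 & E3).
      exists (z1 :: L), f2, g2. split; [simpl; lia|]. repeat split; auto.
      + intros z. rewrite Ef, E2, F1. simpl. ring.
      + intros z. rewrite Eg, E3, G1. simpl. ring.
      + intros a [<-|Ha]; [exact Hz1 | apply Hin, Ha]. }
  intros n. destruct (K n) as (L & f1 & g1 & HL & Hf1 & Hg1 & Ef & Eg & Hin). exists L, f1. auto.
Qed.

(** * Means over circles and the logarithmic derivative *)

(* [HD z0 R0 n h]: h is n times complex differentiable on the open disc. *)
Fixpoint HD (z0 : C) (R0 : R) (n : nat) (h : C -> C) : Prop :=
  match n with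
  | O => True
  | S n => exists h', (forall z, Cmod (z - z0) < R0 -> Cder h z (h' z)) /\ HD z0 R0 n h'
  end.

Lemma HD_le z0 R0 n : forall h, HD z0 R0 (S n) h -> HD z0 R0 n h.
Proof.
  induction n as [|n IH]; intros h (h' & H & K); [exact I|]. exists h'. split; [exact H | apply IH, K].
Qed.

Lemma HD_plus z0 R0 n : forall f g, HD z0 R0 n f -> HD z0 R0 n g -> HD z0 R0 n (fun z => f z + g z)%C.
Proof.
  induction n as [|n IH]; intros f g; [constructor|]. intros (f' & F & F') (g' & G & G').
  exists (fun z => f' z + g' z)%C. split; [|apply IH; assumption]. intros z Hz. apply Cder_plus; auto.
Qed.

Lemma HD_mult z0 R0 n : forall f g, HD z0 R0 n f -> HD z0 R0 n g -> HD z0 R0 n (fun z => f z * g z)%C.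
Proof.
  induction n as [|n IH]; intros f g; [constructor|]. intros HF HG.
  pose proof (HD_le _ _ _ _ HF) as HF0. pose proof (HD_le _ _ _ _ HG) as HG0.
  destruct HF as (f' & F & F'). destruct HG as (g' & G & G').
  exists (fun z => f' z * g z + f z * g' z)%C. split.
  - intros z Hz. apply Cder_mult; auto.
  - apply HD_plus; apply IH; assumption.
Qed.

Lemma Ent_HD z0 R0 n : forall f, Ent f -> HD z0 R0 n f.
Proof.
  induction n as [|n IH]; intros f Hf; [constructor|].
  destruct (Ent_der f Hf) as (f' & Hf' & Q). exists f'. split; [|apply IH, Hf'].
  intros z _. apply quad_approx_Cder, Q.
Qed.

Lemma Cder_inv0 (w : C) : w <> 0 -> Cder Cinv w (-(1) * (/ w * / w))%C.
Proof.
  intros Hw eps He. pose proof (proj1 (Cmod_gt_0 w) Hw) as P.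
  exists (Rmin (Cmod w / 2) (eps * Cmod w ^ 3 / 2)). split.
  { apply Rmin_glb_lt; [lra|]. assert (0 < Cmod w ^ 3) by (apply pow_lt, P). nra. }
  intros h Hh. pose proof (Rmin_l (Cmod w / 2) (eps * Cmod w ^ 3 / 2)). pose proof (Rmin_r (Cmod w / 2) (eps * Cmod w ^ 3 / 2)).
  assert (Hwh : Cmod w / 2 <= Cmod (w + h)).
  { pose proof (Cmod_triangle_inv w (- h)) as T. replace (w - - h)%C with (w + h)%C in T by ring. rewrite Cmod_opp in T. lra. }
  assert (Hnz : (w + h)%C <> 0) by (apply Cmod_gt_0; lra).
  replace (/ (w + h) - / w - h * (-(1) * (/ w * / w)))%C with (h * h * / (w * w) * / (w + h))%C by (field; split; assumption).
  rewrite !Cmod_mult, !Cmod_inv, Cmod_mult; auto using Cmult_neq_0.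
  pose proof (Cmod_ge_0 h) as Hh0.
  apply Rle_trans with (Cmod h * Cmod h * / (Cmod w * Cmod w) * / (Cmod w / 2)).
  - apply Rmult_le_compat_l; [|apply Rinv_le_contravar; lra].
    apply Rmult_le_pos; [nra|]. left. apply Rinv_0_lt_compat. nra.
  - replace (Cmod h * Cmod h * / (Cmod w * Cmod w) * / (Cmod w / 2)) with (Cmod h * 2 / Cmod w ^ 3 * Cmod h) by (field; lra).
    apply Rmult_le_compat_r; [exact Hh0|].
    assert (0 < Cmod w ^ 3) by (apply pow_lt, P).
    apply Rmult_le_reg_r with (Cmod w ^ 3); [assumption|].
    unfold Rdiv. rewrite Rmult_assoc, Rinv_l, Rmult_1_r by lra. lra.
Qed.

Lemma HD_inv z0 R0 n : forall g, HD z0 R0 n g -> (forall z, Cmod (z - z0) < R0 -> g z <> 0) ->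
  HD z0 R0 n (fun z => / g z)%C.
Proof.
  induction n as [|n IH]; intros g HG Hne; [constructor|].
  pose proof (HD_le _ _ _ _ HG) as HG0. destruct HG as (g' & G & G').
  exists (fun z => g' z * (-(1) * (/ g z * / g z)))%C. split.
  - intros z Hz. apply (Cder_comp Cinv g); [apply G, Hz | apply Cder_inv0, Hne, Hz].
  - apply HD_mult; [exact G'|]. apply HD_mult; [apply Ent_HD, Ent_const|].
    apply HD_mult; apply IH; assumption.
Qed.

Definition circ (z0 : C) (r th : R) : C := (z0 + r * cexp (0%R, th))%C.

Lemma Cmod_circ z0 r th : Cmod (circ z0 r th - z0) = Rabs r.
Proof.
  unfold circ. replace (z0 + r * cexp (0%R, th) - z0)%C with (r * cexp (0%R, th))%C by ring.
  rewrite Cmod_mult, Cmod_cexp, Cmod_R. simpl. rewrite exp_0. ring.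
Qed.

Lemma cder_circ_r z0 r th : cder (fun r => circ z0 r th) r (cexp (0%R, th)).
Proof.
  split; simpl; rewrite exp_0.
  - eapply Rd_eq; [apply Rd_plus; [apply Rd_const | apply Rd_minus; apply Rd_mult; [apply Rd_id | apply Rd_const | apply Rd_const | apply Rd_const]]|]. cbv beta; ring.
  - eapply Rd_eq; [apply Rd_plus; [apply Rd_const | apply Rd_plus; apply Rd_mult; [apply Rd_id | apply Rd_const | apply Rd_const | apply Rd_const]]|]. cbv beta; ring.
Qed.

Lemma cder_cexp_th (m th : R) : cder (fun th => cexp (0%R, (m * th)%R)) th (Ci * m * cexp (0%R, (m * th)%R))%C.
Proof.
  eapply cder_eq; [apply (cder_cexp (fun th => (0, m * th))) with (l := (Ci * m)%C)|].
  - split; simpl.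
    + eapply Rd_eq; [apply Rd_const | ring].
    + eapply Rd_eq; [apply Rd_scal, Rd_id | ring].
  - reflexivity.
Qed.

Lemma cder_circ_th z0 r th : cder (fun th => circ z0 r th) th (Ci * (r * cexp (0%R, th)))%C.
Proof.
  unfold circ. eapply cder_eq; [apply cder_plus; [apply cder_const | apply cder_scal]|].
  - apply (cder_ext (fun t => cexp (0, 1 * t))). { intros; rewrite Rmult_1_l; reflexivity. } apply cder_cexp_th.
  - rewrite Rmult_1_l. ring.
Qed.

Definition c2 (F : R -> R -> C) (x y : R) : Prop :=
  continuity_2d_pt (fun u v => fst (F u v)) x y /\ continuity_2d_pt (fun u v => snd (F u v)) x y.

Lemma c2_mult F G x y : c2 F x y -> c2 G x y -> c2 (fun u v => F u v * G u v)%C x y.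
Proof.
  intros [H1 H2] [H3 H4]. split; simpl.
  - apply continuity_2d_pt_minus; apply continuity_2d_pt_mult; assumption.
  - apply continuity_2d_pt_plus; apply continuity_2d_pt_mult; assumption.
Qed.

Lemma c2_plus F G x y : c2 F x y -> c2 G x y -> c2 (fun u v => F u v + G u v)%C x y.
Proof. intros [H1 H2] [H3 H4]. split; simpl; apply continuity_2d_pt_plus; assumption. Qed.

Lemma c2_const a x y : c2 (fun _ _ => a) x y.
Proof. split; apply continuity_2d_pt_const. Qed.

Lemma c2_cexp_th m x y : c2 (fun _ th => cexp (0%R, (m * th)%R)) x y.
Proof.
  split; simpl; apply continuity_2d_pt_mult; try apply continuity_2d_pt_const.
  - apply (continuity_1d_2d_pt_comp cos); [apply continuity_cos|].
    apply continuity_2d_pt_mult; [apply continuity_2d_pt_const | apply continuity_2d_pt_id2].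
  - apply (continuity_1d_2d_pt_comp sin); [apply continuity_sin|].
    apply continuity_2d_pt_mult; [apply continuity_2d_pt_const | apply continuity_2d_pt_id2].
Qed.

Lemma c2_ext F G x y : (forall u v, F u v = G u v) -> c2 F x y -> c2 G x y.
Proof.
  intros E [H1 H2]. split.
  - apply (continuity_2d_pt_ext (fun u v => fst (F u v))); [intros; rewrite E; reflexivity | exact H1].
  - apply (continuity_2d_pt_ext (fun u v => snd (F u v))); [intros; rewrite E; reflexivity | exact H2].
Qed.

Lemma c2_circ z0 x y : c2 (circ z0) x y.
Proof.
  apply (c2_ext (fun r th => z0 + r * cexp (0%R, (1 * th)%R))%C).
  { intros. unfold circ. rewrite Rmult_1_l. reflexivity. }
  apply c2_plus; [apply c2_const|]. apply c2_mult; [|apply c2_cexp_th].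
  split; simpl; [apply continuity_2d_pt_id1 | apply continuity_2d_pt_const].
Qed.

Lemma c2_comp (h : C -> C) F x y l : Cder h (F x y) l -> c2 F x y -> c2 (fun u v => h (F u v)) x y.
Proof.
  intros Hh [H1 H2]. pose proof (Cder_cont h _ l Hh) as K.
  assert (G : forall eps : posreal, locally_2d (fun u v => Cmod (h (F u v) - h (F x y))%C < eps) x y).
  { intros eps. destruct (K eps (cond_pos eps)) as (d & Hd & K').
    assert (Hd2 : 0 < d / 2) by lra.
    pose proof (locally_2d_and _ _ _ _ (H1 (mkposreal _ Hd2)) (H2 (mkposreal _ Hd2))) as L.
    revert L. apply locally_2d_impl. apply locally_2d_forall. intros u v [L1 L2]. simpl in L1, L2.
    replace (F u v) with (F x y + (F u v - F x y))%C by ring. apply K'.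
    apply Rle_lt_trans with (1 := Cmod_le_abs _). simpl. unfold Rminus in *. lra. }
  split; intros eps; generalize (G eps); apply locally_2d_impl; apply locally_2d_forall; intros u v L.
  - apply Rle_lt_trans with (2 := L). exact (fst_le_Cmod (h (F u v) - h (F x y))%C).
  - apply Rle_lt_trans with (2 := L). exact (snd_le_Cmod (h (F u v) - h (F x y))%C).
Qed.

Lemma is_derive_RInt_disc (f f1 : R -> R -> R) (R0 : R) :
  (forall r th, Rabs r < R0 -> is_derive (fun r => f r th) r (f1 r th)) ->
  (forall r th, Rabs r < R0 -> continuity_2d_pt f1 r th) ->
  (forall r, Rabs r < R0 -> ex_RInt (f r) 0 (2 * PI)) ->
  forall r, Rabs r < R0 -> is_derive (fun r => RInt (f r) 0 (2 * PI)) r (RInt (f1 r) 0 (2 * PI)).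
Proof.
  intros H1 H2 H3 r Hr.
  assert (Hloc : locally r (fun x => Rabs x < R0)).
  { assert (Hp : 0 < R0 - Rabs r) by lra. exists (mkposreal _ Hp). intros x Hx.
    change (Rabs (x - r) < R0 - Rabs r) in Hx. pose proof (Rabs_triang_inv x r). lra. }
  eapply Rd_eq.
  - apply (is_derive_RInt_param f 0 (2 * PI) r).
    + revert Hloc. apply filter_imp. intros x Hx t _. exists (f1 x t). apply H1, Hx.
    + intros t _. apply (continuity_2d_pt_ext_loc f1); [|apply H2, Hr].
      destruct Hloc as [d Hd]. exists d. intros u v Hu Hv. symmetry. apply is_derive_unique, H1, Hd, Hu.
    + revert Hloc. apply filter_imp. intros x Hx. apply H3, Hx.
  - apply RInt_ext. intros t _. apply is_derive_unique, H1, Hr.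
Qed.

Lemma cont_ex_RInt (f : R -> R) (a b : R) : (forall x, exists l, is_derive f x l) -> ex_RInt f a b.
Proof.
  intros H. apply (ex_RInt_continuous (V := R_CompleteNormedModule)). intros x _.
  apply (ex_derive_continuous (V := R_NormedModule)). exact (H x).
Qed.

Lemma c2_ex_RInt (F : R -> R -> R) (r a b : R) : (forall th, continuity_2d_pt F r th) -> ex_RInt (F r) a b.
Proof.
  intros H. apply (ex_RInt_continuous (V := R_CompleteNormedModule)). intros x _.
  apply continuity_pt_filterlim. intros eps He. destruct (H x (mkposreal eps He)) as [d Hd].
  exists d. split; [apply cond_pos|]. intros y [_ Hy]. apply Hd; [|exact Hy].
  replace (r - r) with 0 by ring. rewrite Rabs_R0. apply cond_pos.
Qed.

Section Disc.
Variables (z0 : C) (R0 : R).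

Lemma circ_in r th : Rabs r < R0 -> Cmod (circ z0 r th - z0) < R0.
Proof. rewrite Cmod_circ. auto. Qed.

Lemma circ_periodic r : circ z0 r (2 * PI) = circ z0 r 0.
Proof. unfold circ, cexp. simpl. rewrite cos_2PI, sin_2PI, cos_0, sin_0. reflexivity. Qed.

Lemma circ_0 th : circ z0 0 th = z0.
Proof. unfold circ. ring. Qed.

Lemma HD_c2 h n : HD z0 R0 (S n) h -> forall r th, Rabs r < R0 -> c2 (fun u v => h (circ z0 u v)) r th.
Proof.
  intros (h' & H & _) r th Hr. apply (c2_comp h (circ z0) r th (h' (circ z0 r th))); [|apply c2_circ].
  apply H, circ_in, Hr.
Qed.

(** The slope is prescribed only for r > 0, where a factor r can be cancelled; at 0
    differentiability supplies the continuity that the mean value theorem needs. *)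
Lemma disc_const (J : R -> R) (c : R) : (forall r, Rabs r < R0 -> exists l, is_derive J r l /\ (0 < r -> l = c)) ->
  forall r, 0 <= r < R0 -> J r = J 0 + r * c.
Proof.
  intros H r Hr.
  assert (K : J r - c * r = J 0 - c * 0).
  { apply (R_zero_derive_const (fun t => J t - c * t)); [| |lra].
    - intros x Hx. destruct (H x) as (l & Hl & Hlc). { rewrite Rabs_pos_eq; lra. }
      eapply Rd_eq; [apply Rd_minus; [exact Hl | apply Rd_scal, Rd_id]|]. rewrite Hlc by lra. ring.
    - intros x Hx. destruct (H x) as (l & Hl & _). { rewrite Rabs_pos_eq; lra. }
      eapply is_derive_continuity_pt. apply Rd_minus; [exact Hl | apply Rd_scal, Rd_id]. }
  lra.
Qed.

(** The radial derivative of the circular mean is the integral of Re(exp(i th) h'). Multiplied by r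
    this integrand is the derivative of Im h along the circle, so its integral over a period
    vanishes. *)
Lemma mean_value (h : C -> C) : HD z0 R0 2 h -> forall r, 0 <= r < R0 ->
  is_RInt (fun th => fst (h (circ z0 r th))) 0 (2 * PI) (2 * PI * fst (h z0)).
Proof.
  intros Hh r Hr. pose proof Hh as Hh0. destruct Hh as (h' & H1 & H2).
  assert (Hc2 : forall r th, Rabs r < R0 -> c2 (fun u v => (cexp (0%R, v) * h' (circ z0 u v))%C) r th).
  { intros x th Hx. apply c2_mult; [|apply (HD_c2 h' 0); assumption].
    apply (c2_ext (fun _ th => cexp (0, 1 * th))); [intros; rewrite Rmult_1_l; reflexivity | apply c2_cexp_th]. }
  assert (Hint : forall r, Rabs r < R0 -> ex_RInt (fun th => fst (h (circ z0 r th))) 0 (2 * PI)).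
  { intros x Hx. apply (c2_ex_RInt (fun r th => fst (h (circ z0 r th)))). intros th. apply (HD_c2 h 1 Hh0 x th Hx). }
  set (J := fun r => RInt (fun th => fst (h (circ z0 r th))) 0 (2 * PI)).
  assert (HJ : J r = 2 * PI * fst (h z0)).
  { transitivity (J 0 + r * 0).
    - apply disc_const; [|exact Hr]. intros x Hx. eexists. split.
      + apply (is_derive_RInt_disc (fun r th => fst (h (circ z0 r th)))
          (fun r th => fst (cexp (0%R, th) * h' (circ z0 r th))%C) R0); auto.
        * intros r' th Hr'. apply (Cder_curve h (fun r => circ z0 r th) r' _ _ (cder_circ_r z0 r' th)).
          apply H1, circ_in, Hr'.
        * intros r' th Hr'. apply Hc2, Hr'.
      + intros Hx0. apply Rmult_eq_reg_l with x; [|lra]. rewrite Rmult_0_r.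
        assert (D : is_RInt (fun th => x * fst (cexp (0%R, th) * h' (circ z0 x th))%C) 0 (2 * PI)
           (snd (h (circ z0 x (2 * PI))) - snd (h (circ z0 x 0)))).
        { apply (is_RInt_derive (fun th => snd (h (circ z0 x th)))).
          - intros th _. pose proof (Cder_curve h (fun th => circ z0 x th) th _ _ (cder_circ_th z0 x th)
              (H1 _ (circ_in x th Hx))) as [_ D]. eapply Rd_eq; [exact D|]. simpl. ring.
          - intros th _. apply continuity_pt_filterlim.
            intros eps He.
            destruct (continuity_2d_pt_mult (fun u v => u) (fun u v => fst (cexp (0%R, v) * h' (circ z0 u v))%C) x th
              (continuity_2d_pt_id1 _ _) (proj1 (Hc2 x th Hx)) (mkposreal eps He)) as [d Hd].
            exists d. split; [apply cond_pos|]. intros y [_ Hy]. apply Hd; [|exact Hy].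
            replace (x - x) with 0 by ring. rewrite Rabs_R0. apply cond_pos. }
        rewrite circ_periodic, Rminus_diag_eq in D by reflexivity.
        transitivity (RInt (fun th => x * fst (cexp (0%R, th) * h' (circ z0 x th))%C) 0 (2 * PI)).
        2:{ exact (is_RInt_unique _ _ _ _ D). }
        symmetry. apply (RInt_scal (V := R_CompleteNormedModule) (fun th => fst (cexp (0%R, th) * h' (circ z0 x th))%C) 0 (2 * PI) x).
        apply (c2_ex_RInt (fun r th => fst (cexp (0%R, th) * h' (circ z0 r th))%C)). intros th. apply Hc2, Hx.
    - rewrite Rmult_0_r, Rplus_0_r. unfold J. rewrite (RInt_ext _ (fun _ => fst (h z0))).
      + rewrite RInt_const. unfold scal; simpl; unfold mult; simpl. ring.
      + intros th _. rewrite circ_0. reflexivity. }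
  rewrite <- HJ. apply (RInt_correct (V := R_CompleteNormedModule)). apply Hint. rewrite Rabs_pos_eq; lra.
Qed.
End Disc.

(** * The logarithm of a zero-free function on a disc *)

Definition lnmod (z : C) : R := / 2 * ln (fst z ^ 2 + snd z ^ 2).

Lemma norm2_pos (z : C) : z <> 0 -> 0 < fst z ^ 2 + snd z ^ 2.
Proof. intros H. rewrite <- Cmod_sqr. apply pow_lt, Cmod_gt_0, H. Qed.

Lemma lnmod_derive (g : R -> C) (t : R) (l : C) : g t <> 0 -> cder g t l ->
  is_derive (fun x => lnmod (g x)) t (fst (l * / g t)%C).
Proof.
  intros Hne [H1 H2]. pose proof (norm2_pos _ Hne) as P. unfold lnmod.
  eapply Rd_eq.
  - apply Rd_scal. apply (Rd_comp ln (fun x => fst (g x) ^ 2 + snd (g x) ^ 2)).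
    + apply sq_sum_derive; eassumption.
    + apply is_derive_Reals, derivable_pt_lim_ln. exact P.
  - unfold Cmult, Cinv. cbn [fst snd]. field. nra.
Qed.

Lemma Rminus_self (x : R) : x - x = 0.
Proof. ring. Qed.

Lemma int_trig (m : R) (w : C) : m <> 0 -> (exists k : Z, m = IZR k) ->
  is_RInt (fun th => fst (cexp (0%R, (m * th)%R) * w)%C) 0 (2 * PI) 0.
Proof.
  intros Hm (k & Hk).
  assert (D : is_RInt (fun th => fst (cexp (0%R, (m * th)%R) * w)%C) 0 (2 * PI)
    (/ m * snd (cexp (0%R, (m * (2 * PI))%R) * w)%C - / m * snd (cexp (0%R, (m * 0)%R) * w)%C)).
  { apply (is_RInt_derive (fun th => / m * snd (cexp (0%R, (m * th)%R) * w)%C)).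
    - intros x _. destruct (cder_mult _ _ x _ _ (cder_cexp_th m x) (cder_const w x)) as [_ D].
      eapply Rd_eq; [apply Rd_scal; exact D|]. simpl. field. exact Hm.
    - intros x _. apply (ex_derive_continuous (V := R_NormedModule)).
      destruct (cder_mult _ _ x _ _ (cder_cexp_th m x) (cder_const w x)) as [D _]. eexists. exact D. }
  assert (E : cexp (0, m * (2 * PI)) = cexp (0, m * 0)).
  { unfold cexp. simpl. rewrite Hk. replace (IZR k * 0) with 0 by ring.
    replace (IZR k * (2 * PI)) with (0 + 2 * IZR k * PI) by ring.
    rewrite cos_0, sin_0. f_equal; f_equal.
    - transitivity (cos 0); [|apply cos_0]. destruct (Z_le_gt_dec 0 k) as [Q|Q].
      + rewrite <- (Z2Nat.id k Q), <- INR_IZR_INZ. apply cos_period.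
      + rewrite <- (cos_period 0 (Z.to_nat (- k))). rewrite INR_IZR_INZ, Z2Nat.id by lia. rewrite opp_IZR. rewrite <- cos_neg. f_equal. ring.
    - transitivity (sin 0); [|apply sin_0]. destruct (Z_le_gt_dec 0 k) as [Q|Q].
      + rewrite <- (Z2Nat.id k Q), <- INR_IZR_INZ. apply sin_period.
      + replace (0 + 2 * IZR k * PI) with (- (0 + 2 * INR (Z.to_nat (- k)) * PI)).
        * rewrite sin_neg, sin_period, sin_0. ring.
        * rewrite INR_IZR_INZ, Z2Nat.id by lia. rewrite opp_IZR. ring. }
  rewrite E, Rminus_self in D. exact D.
Qed.

Lemma is_RInt_eq (f : R -> R) (a b l l' : R) : is_RInt f a b l -> l = l' -> is_RInt f a b l'.
Proof. intros H <-. exact H. Qed.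

Lemma is_RInt_nonneg (f : R -> R) (a b l : R) : a <= b -> (forall x, 0 <= f x) -> is_RInt f a b l -> 0 <= l.
Proof.
  intros Hab Hf H. rewrite <- (is_RInt_unique _ _ _ _ H). apply RInt_ge_0; [exact Hab | eexists; exact H | intros; apply Hf].
Qed.

Section LogDerivative.
Variables (G G1 G2 : C -> C) (z0 : C) (R0 : R).
Hypothesis HG : Ent G.
Hypothesis HG1 : Ent G1.
Hypothesis HG2 : Ent G2.
Hypothesis D1 : forall z, Cder G z (G1 z).
Hypothesis D2 : forall z, Cder G1 z (G2 z).
Hypothesis Hne : forall z, Cmod (z - z0) < R0 -> G z <> 0.

Let w (z : C) : C := (G1 z * / G z)%C.
Let w1 (z : C) : C := (G2 z * / G z + G1 z * (G1 z * (-(1) * (/ G z * / G z))))%C.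

Lemma w_HD n : HD z0 R0 n w.
Proof. apply HD_mult; [apply Ent_HD, HG1 | apply HD_inv; [apply Ent_HD, HG | exact Hne]]. Qed.

Lemma w1_HD n : HD z0 R0 n w1.
Proof.
  assert (HI : HD z0 R0 n (fun z => / G z)%C) by (apply HD_inv; [apply Ent_HD, HG | exact Hne]).
  apply HD_plus.
  - apply HD_mult; [apply Ent_HD, HG2 | exact HI].
  - apply HD_mult; [apply Ent_HD, HG1|]. apply HD_mult; [apply Ent_HD, HG1|].
    apply HD_mult; [apply Ent_HD, Ent_const|]. apply HD_mult; exact HI.
Qed.

Lemma w_der z : Cmod (z - z0) < R0 -> Cder w z (w1 z).
Proof.
  intros Hz.
  exact (Cder_mult G1 (fun z => / G z)%C z _ _ (D2 z)
    (Cder_comp Cinv G z _ _ (D1 z) (Cder_inv0 _ (Hne z Hz)))).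
Qed.

(** The mean value property of log|G|, with no branch of log G: r times the radial derivative of the
    mean is the mean of Re((z - z0) w), and that function vanishes at the centre. *)
Lemma int_u r : 0 < r < R0 -> is_RInt (fun th => lnmod (G (circ z0 r th))) 0 (2 * PI) (2 * PI * lnmod (G z0)).
Proof.
  intros Hr.
  set (f := fun r th => lnmod (G (circ z0 r th))).
  set (f1 := fun r th => fst (cexp (0%R, th) * w (circ z0 r th))%C).
  assert (Hf1 : forall r th, Rabs r < R0 -> continuity_2d_pt f1 r th).
  { intros x th Hx. apply (c2_mult (fun _ th => cexp (0, th)) (fun r th => w (circ z0 r th))).
    - apply (c2_ext (fun _ th => cexp (0, 1 * th))); [intros; rewrite Rmult_1_l; reflexivity | apply c2_cexp_th].
    - apply (HD_c2 z0 R0 w 0 (w_HD 1) x th Hx). }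
  assert (Hint : forall r, Rabs r < R0 -> ex_RInt (f r) 0 (2 * PI)).
  { intros x Hx. apply cont_ex_RInt. intros th. eexists.
    apply (lnmod_derive (fun th => G (circ z0 x th))).
    - apply Hne, circ_in, Hx.
    - apply (Cder_curve G (fun th => circ z0 x th)); [apply cder_circ_th | apply D1]. }
  assert (HJ : RInt (f r) 0 (2 * PI) = 2 * PI * lnmod (G z0)).
  { transitivity (RInt (f 0) 0 (2 * PI) + r * 0).
    - apply (disc_const R0 (fun r => RInt (f r) 0 (2 * PI))); [|lra]. intros x Hx. eexists. split.
      + apply (is_derive_RInt_disc f f1 R0); auto. intros r' th Hr'.
        eapply Rd_eq.
        * apply (lnmod_derive (fun r => G (circ z0 r th))); [apply Hne, circ_in, Hr'|].
          apply (Cder_curve G (fun r => circ z0 r th)); [apply cder_circ_r | apply D1].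
        * unfold f1, w. f_equal. ring.
      + intros Hx0. apply Rmult_eq_reg_l with x; [|lra]. rewrite Rmult_0_r.
        assert (MV : is_RInt (fun th => fst ((circ z0 x th - z0) * w (circ z0 x th))%C) 0 (2 * PI)
            (2 * PI * fst ((z0 - z0) * w z0)%C)).
        { apply (mean_value z0 R0 (fun z => (z - z0) * w z)%C).
          - apply HD_mult; [apply Ent_HD, Ent_linear | apply w_HD].
          - rewrite Rabs_pos_eq in Hx; lra. }
        transitivity (RInt (fun th => fst ((circ z0 x th - z0) * w (circ z0 x th))%C) 0 (2 * PI)).
        * transitivity (RInt (fun th => scal x (f1 x th)) 0 (2 * PI)).
          { symmetry. apply (RInt_scal (V := R_CompleteNormedModule)). apply c2_ex_RInt. intros th. apply Hf1, Hx. }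
          apply RInt_ext. intros th _. unfold f1, scal; simpl; unfold mult; simpl. rewrite exp_0. ring.
        * rewrite (is_RInt_unique _ _ _ _ MV). replace (z0 - z0)%C with (RtoC 0) by ring. rewrite Cmult_0_l. simpl. ring.
    - rewrite Rmult_0_r, Rplus_0_r. rewrite (RInt_ext _ (fun _ => lnmod (G z0))).
      + rewrite RInt_const. unfold scal; simpl; unfold mult; simpl. ring.
      + intros th _. unfold f. rewrite circ_0. reflexivity. }
  rewrite <- HJ. apply (RInt_correct (V := R_CompleteNormedModule)). apply Hint. rewrite Rabs_pos_eq; lra.
Qed.

(** The Fourier coefficient that sees w'(z0): differentiating exp(- i th) w(z0 + r exp(i th)) in r
    leaves [w1] on the circle, whose mean is its central value. *)
Lemma int_w_minus r : 0 < r < R0 ->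
  is_RInt (fun th => fst (cexp (0%R, (-1 * th)%R) * w (circ z0 r th))%C) 0 (2 * PI) (r * (2 * PI * fst (w1 z0))).
Proof.
  intros Hr.
  set (f := fun r th => fst (cexp (0%R, (-1 * th)%R) * w (circ z0 r th))%C).
  set (f1 := fun r th => fst (w1 (circ z0 r th))).
  assert (Hint : forall r, Rabs r < R0 -> ex_RInt (f r) 0 (2 * PI)).
  { intros x Hx. apply c2_ex_RInt. intros th.
    apply (c2_mult (fun _ th => cexp (0, -1 * th)) (fun r th => w (circ z0 r th))); [apply c2_cexp_th|].
    apply (HD_c2 z0 R0 w 0 (w_HD 1) x th Hx). }
  assert (HJ : RInt (f r) 0 (2 * PI) = r * (2 * PI * fst (w1 z0))).
  { transitivity (RInt (f 0) 0 (2 * PI) + r * (2 * PI * fst (w1 z0))).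
    - apply (disc_const R0 (fun r => RInt (f r) 0 (2 * PI))); [|lra]. intros x Hx. eexists. split.
      + apply (is_derive_RInt_disc f f1 R0); auto.
        * intros r' th Hr'.
          pose proof (Cder_curve w (fun r => circ z0 r th) r' _ _ (cder_circ_r z0 r' th) (w_der _ (circ_in z0 R0 r' th Hr'))) as Dw.
          destruct (cder_scal (cexp (0, -1 * th)) _ _ _ Dw) as [Dw1 _].
          eapply Rd_eq; [exact Dw1|]. rewrite Cmult_assoc, <- cexp_plus. unfold f1.
          replace ((0%R, (-1 * th)%R) + (0%R, th))%C with (RtoC 0) by (apply C_eq; simpl; ring).
          rewrite cexp_0, Cmult_1_l. reflexivity.
        * intros r' th Hr'. apply (HD_c2 z0 R0 w1 0 (w1_HD 1) r' th Hr').
      + intros Hx0. apply is_RInt_unique. apply (mean_value z0 R0 w1 (w1_HD 2)). rewrite Rabs_pos_eq in Hx; lra.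
    - replace (RInt (f 0) 0 (2 * PI)) with 0; [apply Rplus_0_l|]. symmetry. apply is_RInt_unique.
      apply (is_RInt_ext (fun th => fst (cexp (0%R, (-1 * th)%R) * w z0)%C)).
      + intros th _. unfold f. rewrite circ_0. reflexivity.
      + apply int_trig; [lra | exists (-1)%Z; reflexivity]. }
  rewrite <- HJ. apply (RInt_correct (V := R_CompleteNormedModule)). apply Hint. rewrite Rabs_pos_eq; lra.
Qed.

(** Multiplied by r^3 the integrand is the real part of (z - z0)^3 w, which vanishes at the
    centre. *)
Lemma int_w_3 r : 0 < r < R0 ->
  is_RInt (fun th => fst (cexp (0%R, (3 * th)%R) * w (circ z0 r th))%C) 0 (2 * PI) 0.
Proof.
  intros Hr.
  assert (MV : is_RInt (fun th => fst ((circ z0 r th - z0) * ((circ z0 r th - z0) * ((circ z0 r th - z0) * w (circ z0 r th))))%C) 0 (2 * PI)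
     (2 * PI * fst ((z0 - z0) * ((z0 - z0) * ((z0 - z0) * w z0)))%C)).
  { apply (mean_value z0 R0 (fun z => (z - z0) * ((z - z0) * ((z - z0) * w z)))%C); [|lra].
    repeat (apply HD_mult; [apply Ent_HD, Ent_linear|]). apply w_HD. }
  apply (is_RInt_scal (V := R_NormedModule) _ _ _ (/ r ^ 3)) in MV.
  eapply is_RInt_ext; [|eapply is_RInt_eq; [exact MV|]].
  - intros th _. unfold scal; simpl; unfold mult; simpl.
    assert (E : (cexp (0%R, (3 * th)%R) = cexp (0%R, th) * (cexp (0%R, th) * cexp (0%R, th)))%C).
    { rewrite <- !cexp_plus. f_equal. apply C_eq; simpl; ring. }
    assert (E2 : (((circ z0 r th - z0) * ((circ z0 r th - z0) * ((circ z0 r th - z0) * w (circ z0 r th))))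
      = (r ^ 3)%R * (cexp (0%R, (3 * th)%R) * w (circ z0 r th)))%C).
    { rewrite E. unfold circ at 1 2 3. rewrite RtoC_pow. simpl Cpow. ring. }
    change (/ r ^ 3 * fst ((circ z0 r th - z0) * ((circ z0 r th - z0) * ((circ z0 r th - z0) * w (circ z0 r th))))%C
      = fst (cexp (0%R, (3 * th)%R) * w (circ z0 r th))%C).
    rewrite E2. set (q := (cexp (0%R, (3 * th)%R) * w (circ z0 r th))%C).
    change (fst ((r ^ 3)%R * q)%C) with (r ^ 3 * fst q - 0 * snd q). field. lra.
  - replace (z0 - z0)%C with (RtoC 0) by ring. rewrite !Cmult_0_l. unfold scal; simpl; unfold mult; simpl. ring.
Qed.

(** Integration by parts moves the derivative onto u = log|G|; along the circle u' is Re(i r exp(i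
    th) w), and its product with sin 2th splits into the frequencies -1 and 3 of the two preceding
    integrals. *)
Lemma int_u_cos2 r : 0 < r < R0 ->
  is_RInt (fun th => lnmod (G (circ z0 r th)) * cos (2 * th)) 0 (2 * PI) (PI / 2 * r ^ 2 * fst (w1 z0)).
Proof.
  intros Hr.
  assert (Hr' : Rabs r < R0) by (rewrite Rabs_pos_eq; lra).
  set (u := fun th => lnmod (G (circ z0 r th))).
  set (du := fun th => fst (Ci * (r * cexp (0%R, th)) * w (circ z0 r th))%C).
  assert (Du : forall th, is_derive u th (du th)).
  { intros th. eapply Rd_eq.
    - apply (lnmod_derive (fun th => G (circ z0 r th))); [apply Hne, circ_in, Hr'|].
      apply (Cder_curve G (fun th => circ z0 r th)); [apply cder_circ_th | apply D1].
    - unfold du, w. f_equal. ring. }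
  assert (D : is_RInt (fun th => du th * sin (2 * th) + u th * (cos (2 * th) * 2)) 0 (2 * PI)
     (u (2 * PI) * sin (2 * (2 * PI)) - u 0 * sin (2 * 0))).
  { apply (is_RInt_derive (fun th => u th * sin (2 * th))).
    - intros th _. eapply Rd_eq; [apply Rd_mult; [apply Du | apply Rd_sin, Rd_scal, Rd_id]|]. cbv beta. ring.
    - intros th _. apply continuity_pt_filterlim. apply continuity_pt_plus; apply continuity_pt_mult.
      + assert (K : c2 (fun u v => (Ci * (u * cexp (0%R, v)) * w (circ z0 u v))%C) r th).
        { apply c2_mult; [|apply (HD_c2 z0 R0 w 0 (w_HD 1) r th Hr')].
          apply c2_mult; [apply c2_const|]. apply c2_mult.
          - split; simpl; [apply continuity_2d_pt_id1 | apply continuity_2d_pt_const].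
          - apply (c2_ext (fun _ th => cexp (0, 1 * th))); [intros; rewrite Rmult_1_l; reflexivity | apply c2_cexp_th]. }
        destruct K as [K _]. intros eps He. destruct (K (mkposreal eps He)) as [d Hd].
        exists d. split; [apply cond_pos|]. intros y [_ Hy]. apply Hd; [|exact Hy].
        rewrite Rminus_self, Rabs_R0. apply cond_pos.
      + eapply is_derive_continuity_pt. apply Rd_sin, Rd_scal, Rd_id.
      + eapply is_derive_continuity_pt. apply Du.
      + eapply is_derive_continuity_pt. apply Rd_mult; [apply Rd_cos, Rd_scal, Rd_id | apply Rd_const]. }
  pose proof (is_RInt_scal (V := R_NormedModule) _ _ _ (/ 2) _ D) as K1.
  pose proof (is_RInt_scal (V := R_NormedModule) _ _ _ (r / 4) _ (int_w_minus r Hr)) as K2.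
  pose proof (is_RInt_scal (V := R_NormedModule) _ _ _ (- (r / 4)) _ (int_w_3 r Hr)) as K3.
  pose proof (is_RInt_plus (V := R_NormedModule) _ _ _ _ _ _ K1 (is_RInt_plus (V := R_NormedModule) _ _ _ _ _ _ K2 K3)) as K.
  eapply is_RInt_ext; [|eapply is_RInt_eq; [exact K|]].
  - intros th _. fold (u th). unfold du. set (w0 := w (circ z0 r th)). clearbody w0. destruct w0 as [a b].
    set (uu := u th). clearbody uu. unfold scal, plus; simpl; unfold mult; simpl. rewrite !exp_0.
    replace (-1 * th) with (- th) by ring. rewrite cos_neg, sin_neg.
    assert (S2 : sin (2 * th) = 2 * sin th * cos th) by apply sin_2a.
    assert (C2' : cos (2 * th) = cos th * cos th - sin th * sin th) by apply cos_2a.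
    assert (S3 : sin (3 * th) = sin (2 * th) * cos th + cos (2 * th) * sin th).
    { rewrite <- sin_plus. f_equal. ring. }
    assert (C3 : cos (3 * th) = cos (2 * th) * cos th - sin (2 * th) * sin th).
    { rewrite <- cos_plus. f_equal. ring. }
    rewrite S3, C3, S2, C2'.
    assert (SC : 1 - cos th * cos th - sin th * sin th = 0).
    { pose proof (sin2_cos2 th) as T. unfold Rsqr in T. lra. }
    set (s := sin th) in *. set (c := cos th) in *.
    transitivity (uu * (c * c - s * s) + r / 4 * (c * a + s * b) * (1 - c * c - s * s)); [field | rewrite SC; ring].
  - set (W := fst (w1 z0)). clearbody W. unfold scal, plus; simpl; unfold mult; simpl.
    replace (2 * 0) with 0 by ring. rewrite sin_0. replace (2 * (2 * PI)) with (0 + 2 * INR 2 * PI) by (simpl; ring).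
    rewrite sin_period, sin_0. field.
Qed.

(** With c = log|G(z0)| + M, the function c - log|G| is nonnegative on the circle and has integral 2
    pi M. Integrating it against the nonnegative weights 1 + cos 2th and 1 - cos 2th bounds its
    second Fourier coefficient. Only an upper bound for |G| enters, as in the Borel-Caratheodory
    inequality. *)
Lemma log_second_derivative_bound (r M : R) : 0 < r < R0 ->
  (forall z, Cmod (z - z0) < R0 -> Cmod (G z) <= Cmod (G z0) * exp M) ->
  r ^ 2 * Rabs (fst (w1 z0)) <= 4 * M.
Proof.
  intros Hr HM.
  assert (Hr' : Rabs r < R0) by (rewrite Rabs_pos_eq; lra).
  assert (Hu : forall th, lnmod (G (circ z0 r th)) <= lnmod (G z0) + M).
  { intros th. unfold lnmod. rewrite <- !Cmod_sqr.
    pose proof (Hne _ (circ_in z0 R0 r th Hr')) as N1. apply Cmod_gt_0 in N1.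
    assert (N2 : 0 < Cmod (G z0)).
    { apply Cmod_gt_0, Hne. replace (z0 - z0)%C with (RtoC 0) by ring. rewrite Cmod_0. lra. }
    specialize (HM _ (circ_in z0 R0 r th Hr')).
    replace (/ 2 * ln (Cmod (G z0) ^ 2) + M) with (/ 2 * ln ((Cmod (G z0) * exp M) ^ 2)).
    - apply Rmult_le_compat_l; [lra|]. apply ln_le; [apply pow_lt, N1|]. apply pow_incr. lra.
    - pose proof (exp_pos M).
      replace ((Cmod (G z0) * exp M) ^ 2) with (Cmod (G z0) ^ 2 * (exp M * exp M)) by ring.
      rewrite ln_mult, <- exp_plus, ln_exp; [field | apply pow_lt, N2 | nra]. }
  set (c := lnmod (G z0) + M) in *.
  pose proof PI_RGT_0 as HPI.
  pose proof (is_RInt_const (V := R_NormedModule) 0 (2 * PI) c) as Kc.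
  assert (Kcos : is_RInt (fun th => c * cos (2 * th)) 0 (2 * PI) 0).
  { assert (T := int_trig 2 (RtoC c) ltac:(lra) (ex_intro _ 2%Z eq_refl)).
    eapply is_RInt_ext; [|exact T]. intros th _. simpl. rewrite exp_0. ring. }
  pose proof (int_u r Hr) as Ku. pose proof (int_u_cos2 r Hr) as Kuc.
  assert (H1 : 0 <= 2 * PI * M - (PI / 2 * r ^ 2 * fst (w1 z0))).
  { pose proof (is_RInt_plus (V := R_NormedModule) _ _ _ _ _ _
      (is_RInt_minus (V := R_NormedModule) _ _ _ _ _ _ Kc Ku)
      (is_RInt_minus (V := R_NormedModule) _ _ _ _ _ _ Kcos Kuc)) as K.
    eapply Rle_trans; [refine (is_RInt_nonneg _ 0 (2 * PI) _ _ _ K); [lra|]|].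
    - intros th. unfold plus, minus, opp; simpl. unfold plus, opp; simpl. specialize (Hu th). pose proof (COS_bound (2 * th)).
      replace (c + - lnmod (G (circ z0 r th)) + (c * cos (2 * th) + - (lnmod (G (circ z0 r th)) * cos (2 * th))))
        with ((c - lnmod (G (circ z0 r th))) * (1 + cos (2 * th))) by ring.
      apply Rmult_le_pos; lra.
    - unfold c, plus, minus, opp, scal; simpl. unfold plus, opp, mult; simpl. right. ring. }
  assert (H2 : 0 <= 2 * PI * M + (PI / 2 * r ^ 2 * fst (w1 z0))).
  { pose proof (is_RInt_minus (V := R_NormedModule) _ _ _ _ _ _
      (is_RInt_minus (V := R_NormedModule) _ _ _ _ _ _ Kc Ku)
      (is_RInt_minus (V := R_NormedModule) _ _ _ _ _ _ Kcos Kuc)) as K.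
    eapply Rle_trans; [refine (is_RInt_nonneg _ 0 (2 * PI) _ _ _ K); [lra|]|].
    - intros th. unfold plus, minus, opp; simpl. unfold plus, opp; simpl. specialize (Hu th). pose proof (COS_bound (2 * th)).
      replace (c + - lnmod (G (circ z0 r th)) + - (c * cos (2 * th) + - (lnmod (G (circ z0 r th)) * cos (2 * th))))
        with ((c - lnmod (G (circ z0 r th))) * (1 - cos (2 * th))) by ring.
      apply Rmult_le_pos; lra.
    - unfold c, plus, minus, opp, scal; simpl. unfold plus, opp, mult; simpl. right. ring. }
  unfold Rabs. destruct Rcase_abs.
  - apply Rmult_le_reg_l with (PI / 2); [lra|]. nra.
  - apply Rmult_le_reg_l with (PI / 2); [lra|]. nra.
Qed.
End LogDerivative.

(** * Even functions with the same zeros *)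

Lemma Cder_unique (f : C -> C) (z l l' : C) : Cder f z l -> Cder f z l' -> l = l'.
Proof.
  intros H H'. apply Ceq_minus. apply Cmod_eq_0. apply Rle_antisym; [|apply Cmod_ge_0].
  apply Rle_plus_epsilon. intros eps He. rewrite Rplus_0_l.
  destruct (H (eps / 2) ltac:(lra)) as (d & Hd & K). destruct (H' (eps / 2) ltac:(lra)) as (d' & Hd' & K').
  set (h := Rmin d d' / 2).
  assert (Hm : 0 < Rmin d d') by (apply Rmin_glb_lt; assumption).
  pose proof (Rmin_l d d'). pose proof (Rmin_r d d').
  assert (Hh : Cmod h = h) by (rewrite Cmod_R; apply Rabs_pos_eq; unfold h; lra).
  assert (Hh0 : 0 < h) by (unfold h; lra).
  specialize (K h ltac:(rewrite Hh; unfold h; lra)). specialize (K' h ltac:(rewrite Hh; unfold h; lra)).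
  assert (T : Cmod (h * (l - l')) <= eps * h).
  { replace (h * (l - l'))%C with ((f (z + h) - f z - h * l') - (f (z + h) - f z - h * l))%C by ring.
    apply Rle_trans with (1 := Cmod_triangle _ _). rewrite Cmod_opp. rewrite Hh in K, K'. lra. }
  rewrite Cmod_mult, Hh in T. nra.
Qed.

(** (log f)'' = f''/f - (f'/f)^2, written in the shape of [w1] so that the bound above applies by
    conversion. *)
Definition logder2 (f f1 f2 : C -> C) (z : C) : C :=
  (f2 z * / f z + f1 z * (f1 z * (-(1) * (/ f z * / f z))))%C.

Lemma logder2_mult (p p1 p2 F F1 F2 f f1 f2 : C -> C) (z : C) :
  (forall z, Cder p z (p1 z)) -> (forall z, Cder p1 z (p2 z)) ->
  (forall z, Cder F z (F1 z)) -> (forall z, Cder F1 z (F2 z)) ->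
  (forall z, Cder f z (f1 z)) -> (forall z, Cder f1 z (f2 z)) ->
  (forall z, f z = (p z * F z)%C) -> p z <> 0 -> F z <> 0 ->
  logder2 f f1 f2 z = (logder2 p p1 p2 z + logder2 F F1 F2 z)%C.
Proof.
  intros Hp Hp1 HF HF1 Hf Hf1 E Np NF.
  assert (E1 : forall z, f1 z = (p1 z * F z + p z * F1 z)%C).
  { intros x. apply (Cder_unique f x); [apply Hf|]. apply (Cder_ext (fun z => p z * F z)%C).
    - intros y. symmetry. apply E.
    - apply Cder_mult; auto. }
  assert (E2 : forall z, f2 z = ((p2 z * F z + p1 z * F1 z) + (p1 z * F1 z + p z * F2 z))%C).
  { intros x. apply (Cder_unique f1 x); [apply Hf1|]. apply (Cder_ext (fun z => p1 z * F z + p z * F1 z)%C).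
    - intros y. symmetry. apply E1.
    - apply Cder_plus; apply Cder_mult; auto. }
  unfold logder2. rewrite E2, E1, E. field. split; assumption.
Qed.

Lemma Ent_Pl (L : list C) : Ent (Pl L).
Proof.
  induction L as [|a L IH].
  - apply Ent_const.
  - apply (Ent_mult (fun z => z - a)%C (Pl L)); [apply Ent_linear | exact IH].
Qed.

(** The constants are fixed before r and L. [root_count] bounds |Pl L z0| |q z|, and division by |f
    z0| = |Pl L z0| |q z0| removes every trace of the number of zeros. *)
Lemma quotient_growth (f : C -> C) (z0 : C) : Ent f -> f z0 <> 0 -> exists A B, 0 <= A /\ 0 <= B /\
  forall r L q, 0 < r -> Ent q -> (forall z, f z = (Pl L z * q z)%C) -> (forall a, In a L -> Cmod (a - z0) <= r) ->
  forall z, Cmod (z - z0) <= r -> Cmod (q z) <= Cmod (q z0) * exp (A + B * r).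
Proof.
  intros Hf H0. destruct (Ent_growth f Hf) as (A & B & HA & HB & Hg).
  pose proof (proj1 (Cmod_gt_0 _) H0) as P0.
  (* Moves the prefactor into the exponent, since K <= exp K. *)
  set (K := A * exp (B * Cmod z0) / Cmod (f z0)).
  assert (HK : 0 <= K).
  { apply Rmult_le_pos; [apply Rmult_le_pos; [exact HA | left; apply exp_pos] | left; apply Rinv_0_lt_compat, P0]. }
  exists K, (6 * B). split; [exact HK|]. split; [lra|].
  intros r L q Hr Hq E HL z Hz.
  pose proof (Cmod_ge_0 z0) as Hz0.
  pose proof (root_count f q L z0 r (A * exp (B * (Cmod z0 + 6 * r))) Hr Hq E HL) as H.
  assert (H1 : forall z, Cmod (z - z0) <= 6 * r -> Cmod (f z) <= A * exp (B * (Cmod z0 + 6 * r))).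
  { intros x Hx. apply Rle_trans with (1 := Hg x). apply Rmult_le_compat_l; [exact HA|]. apply exp_mono.
    apply Rmult_le_compat_l; [exact HB|]. pose proof (Cmod_triangle_inv x z0). lra. }
  specialize (H H1 z ltac:(lra)).
  assert (P2 : 1 <= 2 ^ length L) by (apply pow_R1_Rle; lra).
  assert (NP : Pl L z0 <> 0). { intros Y. apply H0. rewrite E, Y. ring. }
  apply Cmod_gt_0 in NP.
  assert (EF : Cmod (f z0) = Cmod (Pl L z0) * Cmod (q z0)) by (rewrite E; apply Cmod_mult).
  pose proof (Cmod_ge_0 (q z)) as Q.
  assert (H2 : Cmod (Pl L z0) * Cmod (q z) <= A * exp (B * (Cmod z0 + 6 * r))).
  { apply Rle_trans with (2 := H). rewrite Rmult_assoc.
    assert (0 <= Cmod (Pl L z0) * Cmod (q z)) by (apply Rmult_le_pos; lra). nra. }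
  assert (H3 : A * exp (B * (Cmod z0 + 6 * r)) <= Cmod (f z0) * exp (K + 6 * B * r)).
  { replace (B * (Cmod z0 + 6 * r)) with (B * Cmod z0 + 6 * B * r) by ring. rewrite 2!exp_plus.
    pose proof (exp_pos (6 * B * r)). rewrite <- 2!Rmult_assoc. apply Rmult_le_compat_r; [lra|].
    replace (A * exp (B * Cmod z0)) with (Cmod (f z0) * K) by (unfold K; field; lra).
    apply Rmult_le_compat_l; [lra|]. pose proof (exp_ineq1_le K). lra. }
  apply Rmult_le_reg_l with (Cmod (Pl L z0)); [exact NP|].
  rewrite <- Rmult_assoc, <- EF. lra.
Qed.

Lemma Cmod_Ci_mult (t : R) : Cmod (Ci * t) = Rabs t.
Proof. rewrite Cmod_mult, Cmod_Ci, Cmod_R. ring. Qed.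

Lemma ray_identity (f : C -> C) (T : R) : Ent f -> (forall t : R, T < t -> f (Ci * t)%C = 0) -> forall z, f z = 0.
Proof.
  intros Hf H.
  apply (identity_theorem f (fun n => Ci * RtoC (T + / (INR n + 1)))%C (Rabs T + 1)); auto.
  - intros n m E.
    assert (E2 : T + / (INR n + 1) = T + / (INR m + 1)).
    { apply (f_equal snd) in E. simpl in E. lra. }
    pose proof (pos_INR n). pose proof (pos_INR m).
    assert (E3 : / (INR n + 1) = / (INR m + 1)) by lra. apply (f_equal Rinv) in E3. rewrite 2!Rinv_inv in E3.
    apply INR_eq. lra.
  - intros n. rewrite Cmod_Ci_mult. apply Rle_trans with (1 := Rabs_triang _ _). apply Rplus_le_compat_l.
    pose proof (pos_INR n). rewrite Rabs_pos_eq by (left; apply Rinv_0_lt_compat; lra).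
    rewrite <- Rinv_1. apply Rinv_le_contravar; lra.
  - intros n. apply H. pose proof (pos_INR n). assert (0 < / (INR n + 1)) by (apply Rinv_0_lt_compat; lra). lra.
Qed.

(** The removed polynomial contributes the same amount to both sides, and the radius is arbitrary.
    Only real parts are compared, since they are what log|G| controls; on the imaginary axis, where
    this is applied to functions real there, nothing is lost. *)
Lemma same_zeros_logder2 (f f1 f2 g g1 g2 : C -> C) (z0 : C) : Ent f -> Ent g -> same_zeros_mult f g ->
  (forall z, Cder f z (f1 z)) -> (forall z, Cder f1 z (f2 z)) ->
  (forall z, Cder g z (g1 z)) -> (forall z, Cder g1 z (g2 z)) ->
  f z0 <> 0 -> g z0 <> 0 -> fst (logder2 f f1 f2 z0) = fst (logder2 g g1 g2 z0).
Proof.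
  intros Hf Hg Hz Df Df1 Dg Dg1 Nf Ng.
  destruct (quotient_growth f z0 Hf Nf) as (A & B & HA & HB & Gf).
  destruct (quotient_growth g z0 Hg Ng) as (A' & B' & HA' & HB' & Gg).
  (* The bound 4 M is used at radius r/2, strictly inside the zero-free disc, whence 16 M / r^2; and
     M = A + B r <= (A + B) r for r >= 1. *)
  set (K := 16 * (A + A' + B + B')).
  assert (HK : 0 <= K) by (unfold K; lra).
  assert (Hr : forall r, 1 <= r -> r * Rabs (fst (logder2 f f1 f2 z0) - fst (logder2 g g1 g2 z0)) <= K).
  { intros r Hr.
    destruct (common_division f g z0 r Hf Hg Hz Nf ltac:(lra)) as (L & F & G & HF & HG & Ef & Eg & HL & Hne).
    destruct (Ent_der F HF) as (F1 & HF1 & QF). destruct (Ent_der F1 HF1) as (F2 & HF2 & QF1).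
    destruct (Ent_der G HG) as (G1 & HG1 & QG). destruct (Ent_der G1 HG1) as (G2 & HG2 & QG1).
    destruct (Ent_der (Pl L) (Ent_Pl L)) as (p1 & Hp1 & Qp). destruct (Ent_der p1 Hp1) as (p2 & Hp2 & Qp1).
    assert (Hz0 : Cmod (z0 - z0) <= r). { replace (z0 - z0)%C with (RtoC 0) by ring. rewrite Cmod_0. lra. }
    assert (NP : Pl L z0 <> 0). { intros Y. apply Nf. rewrite Ef, Y. ring. }
    pose proof (logder2_mult (Pl L) p1 p2 F F1 F2 f f1 f2 z0 (quad_approx_Cder _ _ Qp) (quad_approx_Cder _ _ Qp1)
      (quad_approx_Cder _ _ QF) (quad_approx_Cder _ _ QF1) Df Df1 Ef NP (proj1 (Hne z0 Hz0))) as EF.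
    pose proof (logder2_mult (Pl L) p1 p2 G G1 G2 g g1 g2 z0 (quad_approx_Cder _ _ Qp) (quad_approx_Cder _ _ Qp1)
      (quad_approx_Cder _ _ QG) (quad_approx_Cder _ _ QG1) Dg Dg1 Eg NP (proj2 (Hne z0 Hz0))) as EG.
    rewrite EF, EG.
    pose proof (log_second_derivative_bound F F1 F2 z0 r HF HF1 HF2 (quad_approx_Cder _ _ QF) (quad_approx_Cder _ _ QF1)
      (fun z Hz => proj1 (Hne z (Rlt_le _ _ Hz))) (r / 2) (A + B * r) ltac:(lra)
      (fun z Hz => Gf r L F ltac:(lra) HF Ef HL z (Rlt_le _ _ Hz))) as BF.
    pose proof (log_second_derivative_bound G G1 G2 z0 r HG HG1 HG2 (quad_approx_Cder _ _ QG) (quad_approx_Cder _ _ QG1)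
      (fun z Hz => proj2 (Hne z (Rlt_le _ _ Hz))) (r / 2) (A' + B' * r) ltac:(lra)
      (fun z Hz => Gg r L G ltac:(lra) HG Eg HL z (Rlt_le _ _ Hz))) as BG.
    change (fst _) with (fst (logder2 F F1 F2 z0)) in BF. change (fst _) with (fst (logder2 G G1 G2 z0)) in BG.
    set (a := logder2 F F1 F2 z0) in *. set (b := logder2 G G1 G2 z0) in *. set (c := logder2 (Pl L) p1 p2 z0) in *.
    replace (fst (c + a)%C - fst (c + b)%C) with (fst a - fst b) by (simpl; ring).
    assert (T : Rabs (fst a - fst b) <= Rabs (fst a) + Rabs (fst b)).
    { unfold Rminus. apply Rle_trans with (1 := Rabs_triang _ _). rewrite Rabs_Ropp. lra. }
    apply Rmult_le_reg_l with r; [lra|].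
    apply Rle_trans with (r ^ 2 * (Rabs (fst a) + Rabs (fst b))).
    - rewrite <- Rmult_assoc. replace (r * r) with (r ^ 2) by ring. apply Rmult_le_compat_l; [nra | exact T].
    - unfold K. nra. }
  apply Rminus_diag_uniq. set (x := fst (logder2 f f1 f2 z0) - fst (logder2 g g1 g2 z0)) in *.
  destruct (Req_dec x 0) as [Y|Y]; [exact Y|exfalso].
  apply Rabs_pos_lt in Y.
  specialize (Hr (1 + (K + 1) / Rabs x)).
  assert (P : 0 < (K + 1) / Rabs x) by (apply Rdiv_lt_0_compat; lra).
  specialize (Hr ltac:(lra)).
  assert (E : (K + 1) / Rabs x * Rabs x = K + 1) by (field; lra). nra.
Qed.

Lemma cder_imag (f f1 : C -> C) (t : R) : (forall z, Cder f z (f1 z)) ->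
  cder (fun t : R => f (Ci * t)%C) t (Ci * f1 (Ci * t))%C.
Proof.
  intros H. apply (Cder_curve f (fun t : R => (Ci * t)%C)); [|apply H].
  split.
  - apply (Rd_ext (fun _ => 0)); [intros x; simpl; ring | apply Rd_const].
  - apply (Rd_ext (fun x => x)); [intros x; simpl; ring | apply Rd_id].
Qed.

Lemma real_on_imag (f f1 f2 : C -> C) : (forall z, Cder f z (f1 z)) -> (forall z, Cder f1 z (f2 z)) ->
  (forall t : R, snd (f (Ci * t)%C) = 0) ->
  forall t : R, fst (f1 (Ci * t)%C) = 0 /\ snd (f2 (Ci * t)%C) = 0.
Proof.
  intros H H1 H0.
  assert (E1 : forall t : R, fst (f1 (Ci * t)%C) = 0).
  { intros t. destruct (cder_imag f f1 t H) as [_ D].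
    transitivity (snd (Ci * f1 (Ci * t)%C)%C); [simpl; ring|].
    rewrite <- (is_derive_unique _ _ _ D). apply is_derive_unique.
    apply (Rd_ext (fun _ => 0)); [intros; symmetry; apply H0 | apply Rd_const]. }
  intros t. split; [apply E1|].
  destruct (cder_imag f1 f2 t H1) as [D _].
  assert (E : fst (Ci * f2 (Ci * t)%C)%C = 0).
  { rewrite <- (is_derive_unique _ _ _ D). apply is_derive_unique.
    apply (Rd_ext (fun _ => 0)); [intros; symmetry; apply E1 | apply Rd_const]. }
  simpl in E. lra.
Qed.

Lemma even_der_odd (f f1 : C -> C) : (forall z, Cder f z (f1 z)) -> (forall z, f (- z)%C = f z) ->
  forall z, f1 (- z)%C = (- f1 z)%C.
Proof.
  intros H He z.
  assert (D : Cder (fun z => f (-(1) * z)%C) z (-(1) * f1 (-(1) * z))%C).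
  { apply (Cder_comp f (fun z => -(1) * z)%C); [|apply H].
    eapply Cder_eq; [apply (Cder_mult (fun _ => -(1))%C (fun z => z)); [apply Cder_const | apply Cder_id]|]. cbv beta. ring. }
  apply (Cder_ext _ f) in D.
  - pose proof (Cder_unique f z _ _ (H z) D) as E. rewrite E.
    replace (-(1) * z)%C with (- z)%C by ring. ring.
  - intros x. rewrite <- (He x). f_equal. ring.
Qed.

Lemma open_ray_const (f : R -> R) (T : R) : (forall t, T < t -> is_derive f t 0) -> forall t, T < t -> f t = f (T + 1).
Proof.
  intros H t Ht. assert (K : forall a b, T < a -> a <= b -> f b = f a).
  { intros a b Ha Hab. apply R_zero_derive_const; auto.
    - intros x Hx. apply H. lra.
    - intros x Hx. apply is_derive_continuity_pt with 0. apply H. lra. }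
  destruct (Rle_dec t (T + 1)); [symmetry|]; apply K; lra.
Qed.

(** For p(t) = f(it) and q(t) = g(it) the equality of second logarithmic derivatives gives p'/p -
    q'/q = B, a constant, on the ray where neither vanishes. This is an identity between entire
    functions, so it extends to the plane, where evenness can act on it. *)
Theorem even_same_zeros_proportional (f g : C -> C) (T : R) : Ent f -> Ent g -> same_zeros_mult f g ->
  (forall z, f (- z)%C = f z) -> (forall z, g (- z)%C = g z) ->
  (forall t : R, snd (f (Ci * t)%C) = 0) -> (forall t : R, snd (g (Ci * t)%C) = 0) ->
  (forall t : R, T < t -> f (Ci * t)%C <> 0) -> (forall t : R, T < t -> g (Ci * t)%C <> 0) ->
  exists c : R, c <> 0 /\ forall z, f z = (c * g z)%C.
Proof.
  intros Hf Hg Hz Ef Eg Rf Rg Nf Ng.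
  destruct (Ent_der f Hf) as (f1 & Hf1 & Q1). destruct (Ent_der f1 Hf1) as (f2 & Hf2 & Q2).
  destruct (Ent_der g Hg) as (g1 & Hg1 & Q3). destruct (Ent_der g1 Hg1) as (g2 & Hg2 & Q4).
  pose proof (quad_approx_Cder _ _ Q1) as Df. pose proof (quad_approx_Cder _ _ Q2) as Df1.
  pose proof (quad_approx_Cder _ _ Q3) as Dg. pose proof (quad_approx_Cder _ _ Q4) as Dg1.
  set (p := fun t : R => fst (f (Ci * t)%C)). set (p1 := fun t : R => - snd (f1 (Ci * t)%C)).
  set (p2 := fun t : R => - fst (f2 (Ci * t)%C)).
  set (q := fun t : R => fst (g (Ci * t)%C)). set (q1 := fun t : R => - snd (g1 (Ci * t)%C)).
  set (q2 := fun t : R => - fst (g2 (Ci * t)%C)).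
  assert (Dp : forall t, is_derive p t (p1 t)).
  { intros t. destruct (cder_imag f f1 t Df) as [D _]. eapply Rd_eq; [exact D|]. unfold p1; simpl; ring. }
  assert (Dp1 : forall t, is_derive p1 t (p2 t)).
  { intros t. destruct (cder_imag f1 f2 t Df1) as [_ D]. eapply Rd_eq; [apply Rd_opp; exact D|]. unfold p2; simpl; ring. }
  assert (Dq : forall t, is_derive q t (q1 t)).
  { intros t. destruct (cder_imag g g1 t Dg) as [D _]. eapply Rd_eq; [exact D|]. unfold q1; simpl; ring. }
  assert (Dq1 : forall t, is_derive q1 t (q2 t)).
  { intros t. destruct (cder_imag g1 g2 t Dg1) as [_ D]. eapply Rd_eq; [apply Rd_opp; exact D|]. unfold q2; simpl; ring. }
  assert (Ff : forall t : R, f (Ci * t)%C = RtoC (p t)) by (intros t; apply C_eq; [reflexivity | apply Rf]).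
  assert (Gf : forall t : R, g (Ci * t)%C = RtoC (q t)) by (intros t; apply C_eq; [reflexivity | apply Rg]).
  pose proof (real_on_imag f f1 f2 Df Df1 Rf) as If. pose proof (real_on_imag g g1 g2 Dg Dg1 Rg) as Ig.
  assert (F1f : forall t : R, f1 (Ci * t)%C = (- Ci * p1 t)%C).
  { intros t. apply C_eq; simpl; unfold p1; [rewrite (proj1 (If t))|]; ring. }
  assert (G1f : forall t : R, g1 (Ci * t)%C = (- Ci * q1 t)%C).
  { intros t. apply C_eq; simpl; unfold q1; [rewrite (proj1 (Ig t))|]; ring. }
  assert (F2f : forall t : R, f2 (Ci * t)%C = RtoC (- p2 t)).
  { intros t. apply C_eq; simpl; unfold p2; [ring | apply If]. }
  assert (G2f : forall t : R, g2 (Ci * t)%C = RtoC (- q2 t)).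
  { intros t. apply C_eq; simpl; unfold q2; [ring | apply Ig]. }
  assert (Np : forall t, T < t -> p t <> 0).
  { intros t Ht Y. apply (Nf t Ht). rewrite Ff, Y. reflexivity. }
  assert (Nq : forall t, T < t -> q t <> 0).
  { intros t Ht Y. apply (Ng t Ht). rewrite Gf, Y. reflexivity. }
  assert (Hlog : forall t, T < t -> (p2 t * p t - p1 t * p1 t) / (p t * p t) = (q2 t * q t - q1 t * q1 t) / (q t * q t)).
  { intros t Ht.
    pose proof (same_zeros_logder2 f f1 f2 g g1 g2 (Ci * t)%C Hf Hg Hz Df Df1 Dg Dg1 (Nf t Ht) (Ng t Ht)) as E.
    assert (L : forall (a b c : R), a <> 0 -> fst (RtoC (- c) * / RtoC a + (- Ci * b) * ((- Ci * b) * (-(1) * (/ RtoC a * / RtoC a))))%C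
       = - ((c * a - b * b) / (a * a))).
    { intros a b c Ha. rewrite <- RtoC_inv by exact Ha. simpl. field. exact Ha. }
    unfold logder2 in E. rewrite Ff, Gf, F1f, G1f, F2f, G2f, 2!L in E by auto. lra. }
  set (B := p1 (T + 1) / p (T + 1) - q1 (T + 1) / q (T + 1)).
  assert (HB : forall t, T < t -> p1 t * q t - p t * q1 t = B * (p t * q t)).
  { intros t Ht.
    assert (E : p1 t / p t - q1 t / q t = B).
    { apply (open_ray_const (fun t => p1 t / p t - q1 t / q t) T); [|exact Ht].
      intros x Hx. eapply Rd_eq.
      - apply Rd_minus; apply (is_derive_div); auto.
      - pose proof (Hlog x Hx) as E. pose proof (Np x Hx). pose proof (Nq x Hx).
        replace ((p2 x * p x - p1 x * p1 x) / p x ^ 2) with ((p2 x * p x - p1 x * p1 x) / (p x * p x)) by (field; auto).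
        replace ((q2 x * q x - q1 x * q1 x) / q x ^ 2) with ((q2 x * q x - q1 x * q1 x) / (q x * q x)) by (field; auto).
        rewrite E. ring. }
    rewrite <- E. field. split; auto. }
  set (Psi := fun z => (f1 z * g z - f z * g1 z + Ci * B * (f z * g z))%C).
  assert (HPsi : forall z, Psi z = 0).
  { apply (ray_identity Psi T).
    - unfold Psi. apply Ent_plus; [apply Ent_minus; apply Ent_mult; assumption|].
      apply (Ent_scal (Ci * B)%C (fun z => f z * g z)%C). apply Ent_mult; assumption.
    - intros t Ht. unfold Psi. rewrite Ff, Gf, F1f, G1f.
      replace (- Ci * p1 t * q t - p t * (- Ci * q1 t) + Ci * B * (p t * q t))%C
        with (Ci * RtoC (B * (p t * q t) - (p1 t * q t - p t * q1 t)))%C.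
      + rewrite HB by exact Ht. replace (B * (p t * q t) - B * (p t * q t)) with 0 by ring. ring.
      + rewrite !RtoC_minus, !RtoC_mult. ring. }
  (* At - z the Wronskian changes sign and the term with B does not; subtracting the two identities
     leaves the Wronskian alone. *)
  assert (HW : forall z, (f1 z * g z - f z * g1 z)%C = 0).
  { intros z. pose proof (HPsi z) as E1. pose proof (HPsi (- z)%C) as E2. unfold Psi in E1, E2.
    rewrite Ef, Eg, (even_der_odd f f1 Df Ef), (even_der_odd g g1 Dg Eg) in E2.
    assert (E3 : (2 * (f1 z * g z - f z * g1 z) = 0)%C).
    { replace (2 * (f1 z * g z - f z * g1 z))%C with
       ((f1 z * g z - f z * g1 z + Ci * B * (f z * g z)) - (- f1 z * g z - f z * - g1 z + Ci * B * (f z * g z)))%C by ring.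
      rewrite E1, E2. ring. }
    replace (f1 z * g z - f z * g1 z)%C with (/ 2 * (2 * (f1 z * g z - f z * g1 z)))%C.
    - rewrite E3. ring.
    - field. }
  assert (Hpq : forall t, T < t -> p t / q t = p (T + 1) / q (T + 1)).
  { apply (open_ray_const (fun t => p t / q t) T). intros t Ht. eapply Rd_eq.
    - apply is_derive_div; auto.
    - pose proof (HW (Ci * t)%C) as E. rewrite Ff, Gf, F1f, G1f in E. apply (f_equal snd) in E. simpl in E.
      pose proof (Nq t Ht). replace (p1 t * q t - p t * q1 t) with 0 by lra. unfold Rdiv. apply Rmult_0_l. }
  exists (p (T + 1) / q (T + 1)). split.
  - apply Rmult_integral_contrapositive. split; [apply Np; lra | apply Rinv_neq_0_compat, Nq; lra].
  - intros z. apply Ceq_minus.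
    apply (ray_identity (fun z => f z - (p (T + 1) / q (T + 1))%R * g z)%C T).
    + apply Ent_minus; [exact Hf | apply Ent_scal, Hg].
    + intros t Ht. rewrite Ff, Gf, <- RtoC_mult, <- RtoC_minus. rewrite <- (Hpq t Ht). f_equal. field. auto.
Qed.

(** * Solutions as entire functions of the spectral parameter *)

(** Differentiation term by term: the remainders are eps |h| times a fixed summable majorant, so
    their sum is again small compared with h. *)
Lemma series_cder (F : R -> nat -> C) (F' : nat -> C) (S : R -> C) (s' : C) (r : R) (M : nat -> R) (m : R) :
  (forall n, 0 <= M n) -> is_series M m ->
  (forall eps, 0 < eps -> exists delta, 0 < delta /\ forall h, Rabs h < delta ->
     forall n, Cmod (F (r + h)%R n - F r n - h * F' n)%C <= eps * M n * Rabs h) ->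
  (forall x, cser (F x) (S x)) -> cser F' s' -> cder S r s'.
Proof.
  intros HM0 HM HF HS Hs'. apply cder_eps. intros eps He.
  assert (Hm : 0 <= m).
  { apply (is_series_le (fun _ => 0) M); auto. apply (cser_zero (fun _ => 0)). reflexivity. }
  destruct (HF (eps / (m + 1)) ltac:(apply Rdiv_lt_0_compat; lra)) as (d & Hd & K).
  exists d. split; [exact Hd|]. intros h Hh.
  apply Rle_trans with (eps / (m + 1) * Rabs h * m).
  - refine (cser_le (fun n => F (r + h)%R n - F r n - h * F' n)%C _ (fun n => eps / (m + 1) * Rabs h * M n) _ _ _ _).
    + apply cser_minus; [apply cser_minus; apply HS | apply cser_scal, Hs'].
    + intros n. apply Rle_trans with (1 := K h Hh n). right. ring.
    + exact (is_series_scal (eps / (m + 1) * Rabs h) _ _ HM).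
  - pose proof (Rabs_pos h). apply Rle_trans with (eps / (m + 1) * (m + 1) * Rabs h).
    + assert (0 < eps / (m + 1)) by (apply Rdiv_lt_0_compat; lra). nra.
    + right. field. lra.
Qed.

Lemma le_of_derive_le (f g f' g' : R -> R) (a b : R) : a <= b ->
  (forall x, a <= x <= b -> is_derive f x (f' x)) -> (forall x, a <= x <= b -> is_derive g x (g' x)) ->
  (forall x, a <= x <= b -> f' x <= g' x) -> f b - f a <= g b - g a.
Proof.
  intros Hab Hf Hg H. destruct (Req_dec a b) as [->|N]; [lra|].
  destruct (MVT_cor2 (fun x => g x - f x) (fun x => g' x - f' x) a b) as (c & E & Hc); [lra| |].
  - intros c Hc. apply is_derive_Reals, Rd_minus; auto.
  - specialize (H c ltac:(lra)). nra.
Qed.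

Lemma Rd_pow (n : nat) (x : R) : is_derive (fun t => t ^ n) x (INR n * x ^ pred n).
Proof. apply is_derive_Reals, derivable_pt_lim_pow. Qed.

Lemma power_bound_right (g p : R -> R) (C t : R) (j : nat) : 0 <= t ->
  (forall s, 0 <= s <= t -> is_derive g s (p s)) -> g 0 = 0 ->
  (forall s, 0 <= s <= t -> Rabs (p s) <= C * s ^ j) -> Rabs (g t) <= C * t ^ S j / INR (S j).
Proof.
  intros Ht Hg H0 Hp.
  assert (Hj : INR (S j) <> 0) by (apply not_0_INR; lia).
  assert (D : forall x, is_derive (fun t => C / INR (S j) * t ^ S j) x (C * x ^ j)).
  { intros x. eapply Rd_eq; [apply Rd_scal, Rd_pow|]. simpl pred. field. exact Hj. }
  assert (E0 : C / INR (S j) * 0 ^ S j = 0) by (simpl; ring).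
  replace (C * t ^ S j / INR (S j)) with (C / INR (S j) * t ^ S j) by (field; exact Hj).
  apply Rabs_le. split.
  - pose proof (le_of_derive_le (fun s => - g s) (fun t => C / INR (S j) * t ^ S j) (fun s => - p s) (fun x => C * x ^ j) 0 t Ht) as K.
    assert (- g t - - g 0 <= C / INR (S j) * t ^ S j - C / INR (S j) * 0 ^ S j).
    { apply K; auto. - intros x Hx. apply Rd_opp, Hg, Hx.
      - intros x Hx. specialize (Hp x Hx). apply Rabs_le_between in Hp. lra. }
    lra.
  - pose proof (le_of_derive_le g (fun t => C / INR (S j) * t ^ S j) p (fun x => C * x ^ j) 0 t Ht) as K.
    assert (g t - g 0 <= C / INR (S j) * t ^ S j - C / INR (S j) * 0 ^ S j).
    { apply K; auto. intros x Hx. specialize (Hp x Hx). apply Rabs_le_between in Hp. lra. }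
    lra.
Qed.

Lemma power_bound (g p : R -> R) (b X C r : R) (j : nat) : - X <= b <= X -> - X <= r <= X ->
  (forall s, - X <= s <= X -> is_derive g s (p s)) -> g b = 0 ->
  (forall s, - X <= s <= X -> Rabs (p s) <= C * Rabs (s - b) ^ j) -> Rabs (g r) <= C * Rabs (r - b) ^ S j / INR (S j).
Proof.
  intros Hb Hr Hg H0 Hp. destruct (Rle_dec b r) as [L|L].
  - replace (g r) with (g (b + 1 * (r - b))) by (f_equal; ring). rewrite (Rabs_pos_eq (r - b)) by lra.
    apply (power_bound_right (fun t => g (b + 1 * t)) (fun t => p (b + 1 * t) * (0 + 1 * 1))).
    + lra.
    + intros s Hs. apply (Rd_comp g (fun t => b + 1 * t)); [apply Rd_plus; [apply Rd_const | apply Rd_scal, Rd_id]|]. apply Hg. lra.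
    + replace (b + 1 * 0) with b by ring. exact H0.
    + intros s Hs. specialize (Hp (b + 1 * s) ltac:(lra)). replace (b + 1 * s - b) with s in Hp by ring.
      rewrite (Rabs_pos_eq s) in Hp by lra. replace (p (b + 1 * s) * (0 + 1 * 1)) with (p (b + 1 * s)) by ring. exact Hp.
  - replace (g r) with (g (b + (-1) * (b - r))) by (f_equal; ring). rewrite Rabs_minus_sym, (Rabs_pos_eq (b - r)) by lra.
    apply (power_bound_right (fun t => g (b + (-1) * t)) (fun t => p (b + (-1) * t) * (0 + (-1) * 1))).
    + lra.
    + intros s Hs. apply (Rd_comp g (fun t => b + (-1) * t)); [apply Rd_plus; [apply Rd_const | apply Rd_scal, Rd_id]|]. apply Hg. lra.
    + replace (b + (-1) * 0) with b by ring. exact H0.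
    + intros s Hs. specialize (Hp (b + (-1) * s) ltac:(lra)). replace (b + (-1) * s - b) with (- s) in Hp by ring.
      rewrite Rabs_Ropp, (Rabs_pos_eq s) in Hp by lra. replace (p (b + (-1) * s) * (0 + (-1) * 1)) with (- p (b + (-1) * s)) by ring.
      rewrite Rabs_Ropp. exact Hp.
Qed.

Lemma is_derive_RInt_cont (f : R -> R) (b r : R) : (forall x, continuous f x) -> is_derive (fun r => RInt f b r) r (f r).
Proof.
  intros H. apply (is_derive_RInt f (fun r => RInt f b r) b r).
  - apply filter_forall. intros x. apply (RInt_correct (V := R_CompleteNormedModule)).
    apply (ex_RInt_continuous (V := R_CompleteNormedModule)). intros z _. apply H.
  - apply H.
Qed.

Lemma cont_bounded (f : R -> R) (a b : R) : a <= b -> (forall x, a <= x <= b -> continuous f x) ->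
  exists M, 0 <= M /\ forall x, a <= x <= b -> Rabs (f x) <= M.
Proof.
  intros Hab H.
  destruct (continuity_ab_maj (fun x => Rabs (f x)) a b Hab) as (m & K & _).
  - intros x Hx. apply (continuity_pt_comp f Rabs); [|apply Rcontinuity_abs].
    apply continuity_pt_filterlim. apply H, Hx.
  - exists (Rabs (f m)). split; [apply Rabs_pos | exact K].
Qed.

(* Iterated integrals: the coefficient of k^(2n) in the solution is (-1)^n Zc (2n). *)
Section Series.
Variables (e : R -> R) (b w0 w1 : R).
Hypothesis He : forall x, continuous e x.

(** One factor [e] for every two integrations: [Zc (2n+2)] has second derivative [e] times
    [Zc (2n)], and the odd index in between is its first derivative. *)
Definition wt (j : nat) (s : R) : R := if Nat.even j then e s else 1.

Fixpoint Zc (j : nat) (r : R) : R :=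
  match j with
  | O => w0 + w1 * (r - b)
  | S i => RInt (fun s => wt i s * Zc i s) b r
  end.

Definition Dc (j : nat) (r : R) : R := match j with O => w1 | S i => wt i r * Zc i r end.

Lemma wt_cont j x : continuous (wt j) x.
Proof. unfold wt. destruct Nat.even; [apply He | apply continuous_const]. Qed.

Lemma Zc_derive j r : is_derive (Zc j) r (Dc j r).
Proof.
  revert r. induction j as [|j IH]; intros r.
  - simpl. eapply Rd_eq; [apply Rd_plus; [apply Rd_const | apply Rd_scal, Rd_minus; [apply Rd_id | apply Rd_const]]|]. ring.
  - simpl. apply (is_derive_RInt_cont (fun s => wt j s * Zc j s)). intros x.
    apply (continuous_mult (wt j) (Zc j)); [apply wt_cont|].
    apply (ex_derive_continuous (V := R_NormedModule)). eexists. apply IH.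
Qed.

Lemma Zc_b j : Zc (S j) b = 0.
Proof. exact (RInt_point (V := R_CompleteNormedModule) b (fun s => wt j s * Zc j s)). Qed.

Lemma Zc_bound (X : R) : - X <= b <= X -> exists K H, 0 <= K /\ 1 <= H /\
  (forall r, - X <= r <= X -> Rabs (e r) <= H) /\ Rabs w1 <= K /\
  forall j r, - X <= r <= X -> Rabs (Zc j r) <= K * (H ^ j / INR (fact j)).
Proof.
  intros Hb.
  destruct (cont_bounded e (- X) X) as (H0 & HH0 & HH); [lra | intros; apply He |].
  set (K := Rabs w0 + Rabs w1 * (2 * X + 1)). set (H := H0 + 1).
  assert (HK : 0 <= K). { unfold K. pose proof (Rabs_pos w0). pose proof (Rabs_pos w1). nra. }
  assert (Main : forall j r, - X <= r <= X -> Rabs (Zc j r) <= K * H ^ j / INR (fact j) * Rabs (r - b) ^ j).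
  { induction j as [|j IH]; intros r Hr.
    - simpl. replace (K * 1 / 1 * 1) with K by field. apply Rle_trans with (1 := Rabs_triang _ _).
      rewrite Rabs_mult. unfold K. pose proof (Rabs_pos w1).
      assert (Rabs (r - b) <= 2 * X) by (apply Rabs_le; lra). nra.
    - assert (G : Rabs (Zc (S j) r) <= H * (K * H ^ j / INR (fact j)) * Rabs (r - b) ^ S j / INR (S j)).
      { apply (power_bound (Zc (S j)) (Dc (S j)) b X).
        - exact Hb.
        - exact Hr.
        - intros s _. apply Zc_derive.
        - apply Zc_b.
        - intros s Hs. simpl Dc. rewrite Rabs_mult.
          replace (H * (K * H ^ j / INR (fact j)) * Rabs (s - b) ^ j) with (H * (K * H ^ j / INR (fact j) * Rabs (s - b) ^ j)) by ring.
          apply Rmult_le_compat; [apply Rabs_pos | apply Rabs_pos | | apply IH, Hs].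
          unfold wt. destruct Nat.even; [specialize (HH s Hs); unfold H; lra | rewrite Rabs_R1; unfold H; lra]. }
      apply Rle_trans with (1 := G). right. rewrite fact_simpl, mult_INR. pose proof (fact_pos j).
      assert (INR (S j) <> 0) by (apply not_0_INR; lia). simpl pow. field. split; lra. }
  exists K, (H * (2 * X + 1)). split; [exact HK|].
  assert (H1 : 1 <= H) by (unfold H; lra).
  split; [nra|]. split; [|split].
  - intros r Hr. apply Rle_trans with H; [specialize (HH r Hr); unfold H; lra | nra].
  - unfold K. pose proof (Rabs_pos w0). pose proof (Rabs_pos w1). nra.
  - intros j r Hr. apply Rle_trans with (1 := Main j r Hr).
    rewrite Rpow_mult_distr. pose proof (fact_pos j).
    replace (K * (H ^ j * (2 * X + 1) ^ j / INR (fact j))) with (K * H ^ j / INR (fact j) * (2 * X + 1) ^ j) by (field; lra).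
    apply Rmult_le_compat_l.
    + repeat apply Rmult_le_pos; try lra; [apply pow_le; lra | left; apply Rinv_0_lt_compat; lra].
    + apply pow_incr. split; [apply Rabs_pos | apply Rabs_le; lra].
Qed.

(** (-1)^(j/2) at even j and 0 at odd j. The series in k^2 can thus be indexed by all powers of k,
    as [Ent] expects. *)
Fixpoint sg (j : nat) : R := match j with O => 1 | S O => 0 | S (S i) => - sg i end.

Lemma sg_abs j : Rabs (sg j) <= 1.
Proof.
  enough (Rabs (sg j) <= 1 /\ Rabs (sg (S j)) <= 1) by tauto.
  induction j as [|j [I1 I2]]; simpl.
  - rewrite Rabs_R1, Rabs_R0. lra.
  - split; [exact I2|]. rewrite Rabs_Ropp. exact I1.
Qed.

Lemma sg_odd j : Nat.even j = false -> sg j = 0.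
Proof.
  enough ((Nat.even j = false -> sg j = 0) /\ (Nat.even (S j) = false -> sg (S j) = 0)) by tauto.
  induction j as [|j [I1 I2]].
  - split; [discriminate | reflexivity].
  - split; [exact I2|]. intros E. change (Nat.even j = false) in E. simpl. rewrite I1 by exact E. ring.
Qed.

(* The second r-derivative of sg j * Zc j. *)
Definition Ec (j : nat) (r : R) : R := match j with S (S i) => - (sg i * (e r * Zc i r)) | _ => 0 end.

Lemma sg_Dc j r : sg (S (S j)) * Dc (S (S j)) r = - (sg j * Zc (S j) r).
Proof.
  simpl sg. destruct (Nat.even j) eqn:E.
  - change (Dc (S (S j)) r) with (wt (S j) r * Zc (S j) r). unfold wt. rewrite Nat.even_succ, <- Nat.negb_even, E. simpl negb. ring_simplify. reflexivity.
  - rewrite (sg_odd j E). ring.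
Qed.

(** Raising the index of a factorial bound by d costs only a doubled base, since (i+d)! <= 2^(i+d)
    i! d!. It is needed because the r-derivatives at index j involve [Zc] at j - 1 and j - 2. *)
Lemma pow_le_bump (H : R) (i d : nat) : 1 <= H -> H ^ i / INR (fact i) <= (2 * H) ^ (i + d) * INR (fact d) / INR (fact (i + d)).
Proof.
  intros HH. pose proof (fact_pos i). pose proof (fact_pos (i + d)). pose proof (fact_pos d).
  assert (B : INR (fact (i + d)) <= 2 ^ (i + d) * (INR (fact i) * INR (fact d))).
  { assert (E : INR (fact (i + d)) = Binomial.C (i + d) i * (INR (fact i) * INR (fact d))).
    { unfold Binomial.C. replace (i + d - i)%nat with d by lia. field. lra. }
    rewrite E. apply Rmult_le_compat_r; [nra|].
    replace 2 with (1 + 1) by ring. rewrite binomial.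
    apply Rle_trans with (Binomial.C (i + d) i * 1 ^ i * 1 ^ (i + d - i)); [rewrite !pow1; lra|].
    assert (G : forall (u : nat -> R) n k, (forall m, 0 <= u m) -> (k <= n)%nat -> u k <= sum_f_R0 u n).
    { intros u n k Hu. induction n; intros Hk.
      - replace k with O by lia. simpl. lra.
      - simpl. destruct (Nat.eq_dec k (S n)) as [->|N].
        + pose proof (cond_pos_sum u n Hu). lra.
        + specialize (IHn ltac:(lia)). specialize (Hu (S n)). lra. }
    apply (G (fun k => Binomial.C (i + d) k * 1 ^ k * 1 ^ (i + d - k))); [|lia].
    intros m. rewrite !pow1, !Rmult_1_r. unfold Binomial.C.
    apply Rmult_le_pos; [apply pos_INR|]. left. apply Rinv_0_lt_compat. apply Rmult_lt_0_compat; apply fact_pos. }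
  rewrite Rpow_mult_distr.
  apply Rmult_le_reg_r with (INR (fact i) * INR (fact (i + d))); [nra|].
  replace (H ^ i / INR (fact i) * (INR (fact i) * INR (fact (i + d)))) with (H ^ i * INR (fact (i + d))) by (field; lra).
  replace (2 ^ (i + d) * H ^ (i + d) * INR (fact d) / INR (fact (i + d)) * (INR (fact i) * INR (fact (i + d))))
    with (H ^ (i + d) * (2 ^ (i + d) * (INR (fact i) * INR (fact d)))) by (field; lra).
  apply Rmult_le_compat; [apply pow_le; lra | lra | apply Rle_pow; [exact HH | lia] | exact B].
Qed.

Lemma Dc_bound (X : R) : - X <= b <= X -> exists K H, 0 <= K /\ 1 <= H /\
  forall j r, - X <= r <= X -> Rabs (Zc j r) <= K * (H ^ j / INR (fact j)) /\
     Rabs (sg j * Dc j r) <= K * (H ^ j / INR (fact j)) /\ Rabs (Ec j r) <= K * (H ^ j / INR (fact j)) /\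
     Rabs (e r) <= H.
Proof.
  intros Hb. destruct (Zc_bound X Hb) as (K & H & HK & HH & He' & Hw & Hz).
  exists (K * (2 * H)), (2 * H). split; [nra|]. split; [lra|]. intros j r Hr.
  assert (Hbump : forall i d, K * (H ^ i / INR (fact i)) <= K * ((2 * H) ^ (i + d) * INR (fact d) / INR (fact (i + d)))).
  { intros i d. apply Rmult_le_compat_l; [exact HK | apply pow_le_bump, HH]. }
  assert (Hpos : forall j, 0 <= K * ((2 * H) ^ j / INR (fact j))).
  { intros i. apply Rmult_le_pos; [exact HK|]. apply Rmult_le_pos; [apply pow_le; lra | left; apply Rinv_0_lt_compat, fact_pos]. }
  assert (Hup : forall j, K * ((2 * H) ^ j / INR (fact j)) <= K * (2 * H) * ((2 * H) ^ j / INR (fact j))).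
  { intros i. specialize (Hpos i). nra. }
  assert (Hup2 : forall j, 0 <= K * (2 * H) * ((2 * H) ^ j / INR (fact j))).
  { intros i. apply Rle_trans with (2 := Hup i). apply Hpos. }
  split; [|split; [|split]].
  - apply Rle_trans with (1 := Hz j r Hr). apply Rle_trans with (2 := Hup j).
    specialize (Hbump j O). rewrite Nat.add_0_r in Hbump. simpl (INR (fact 0)) in Hbump. rewrite Rmult_1_r in Hbump. exact Hbump.
  - destruct j as [|[|j]].
    + simpl. rewrite Rmult_1_l. apply Rle_trans with (1 := Hw). nra.
    + simpl sg. rewrite Rmult_0_l, Rabs_R0. apply Hup2.
    + rewrite sg_Dc, Rabs_Ropp, Rabs_mult. apply Rle_trans with (1 * (K * (H ^ S j / INR (fact (S j))))).
      { apply Rmult_le_compat; [apply Rabs_pos | apply Rabs_pos | apply sg_abs | apply Hz, Hr]. }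
      rewrite Rmult_1_l. apply Rle_trans with (2 := Hup (S (S j))).
      specialize (Hbump (S j) 1%nat). replace (S j + 1)%nat with (S (S j)) in Hbump by lia.
      change (INR (fact 1)) with 1 in Hbump. rewrite Rmult_1_r in Hbump. exact Hbump.
  - destruct j as [|[|j]].
    + simpl Ec. rewrite Rabs_R0. apply Hup2.
    + simpl Ec. rewrite Rabs_R0. apply Hup2.
    + simpl Ec. rewrite Rabs_Ropp, 2!Rabs_mult.
      apply Rle_trans with (1 * (H * (K * (H ^ j / INR (fact j))))).
      { apply Rmult_le_compat; [apply Rabs_pos | | apply sg_abs |].
        - apply Rmult_le_pos; apply Rabs_pos.
        - apply Rmult_le_compat; [apply Rabs_pos | apply Rabs_pos | apply He', Hr | apply Hz, Hr]. }
      rewrite Rmult_1_l. specialize (Hbump j 2%nat). replace (j + 2)%nat with (S (S j)) in Hbump by lia.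
      change (INR (fact 2)) with 2 in Hbump.
      apply Rle_trans with (H * (K * ((2 * H) ^ S (S j) * 2 / INR (fact (S (S j)))))).
      { apply Rmult_le_compat_l; [lra | exact Hbump]. }
      right. unfold Rdiv. ring.
  - specialize (He' r Hr). lra.
Qed.
End Series.

(** * Construction of the solutions for all k *)

Lemma mvt_step (f f' : R -> R) (r h : R) : (forall x, is_derive f x (f' x)) ->
  exists x, Rabs (x - r) <= Rabs h /\ f (r + h) - f r = h * f' x.
Proof.
  intros H. destruct (MVT_gen f r (r + h) f') as (c & Hc & E).
  - intros x _. apply H.
  - intros x _. apply is_derive_continuity_pt with (f' x), H.
  - exists c. split; [|rewrite E; ring].
    unfold Rmin, Rmax in Hc. destruct Rle_dec; unfold Rabs; repeat destruct Rcase_abs; lra.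
Qed.

Lemma Cmod_RC (a : R) (z : C) : Cmod (a * z) = Rabs a * Cmod z.
Proof. rewrite Cmod_mult, Cmod_R. reflexivity. Qed.

Lemma sg_pow_real (k : C) (j : nat) : snd (k * k)%C = 0 -> snd (sg j * k ^ j)%C = 0.
Proof.
  intros Hk. enough (snd (sg j * k ^ j)%C = 0 /\ snd (sg (S j) * k ^ S j)%C = 0) by tauto.
  induction j as [|j [I1 I2]].
  - split; [simpl; ring | change (sg 1) with 0; rewrite Cmult_0_l; reflexivity].
  - split; [exact I2|]. change (sg (S (S j))) with (- sg j). rewrite 2!Cpow_S, RtoC_opp.
    replace (- sg j * (k * (k * k ^ j)))%C with (- ((k * k) * (sg j * k ^ j)))%C by ring.
    set (u := (k * k)%C) in *. set (v := (sg j * k ^ j)%C) in *. change (- (fst u * snd v + snd u * fst v) = 0). rewrite Hk, I1. ring.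
Qed.

Lemma cser_snd_zero (a : nat -> C) (s : C) : (forall n, snd (a n) = 0) -> cser a s -> snd s = 0.
Proof.
  intros H [_ H2]. destruct (cser_zero (fun n => RtoC (snd (a n)))) as [Z _].
  { intros n. rewrite H. reflexivity. }
  transitivity (Series (fun n => snd (a n))); [symmetry; apply is_series_unique, H2|].
  exact (is_series_unique _ _ Z).
Qed.

Lemma RtoC_scal_pow_real (a : R) (u : C) : snd u = 0 -> snd (a * u)%C = 0.
Proof. intros H. simpl. rewrite H. ring. Qed.

(** The solution with Cauchy data [w0], [w1] at [b], together with what is used of its dependence on
    k. Reality is stated for real k^2, which covers both axes at once. *)
Record ode_family (e : R -> R) (b w0 w1 : R) (y yp : R -> C -> C) : Prop := {
  of_ent : forall r, Ent (y r);
  of_entp : forall r, Ent (yp r);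
  of_b : forall k, y b k = w0;
  of_bp : forall k, yp b k = w1;
  of_d : forall k r, cder (fun r => y r k) r (yp r k);
  of_dp : forall k r, cder (fun r => yp r k) r (- (k * k * (e r * y r k)))%C;
  of_even : forall r k, y r (- k)%C = y r k;
  of_evenp : forall r k, yp r (- k)%C = yp r k;
  of_real : forall r k, snd (k * k)%C = 0 -> snd (y r k) = 0;
  of_realp : forall r k, snd (k * k)%C = 0 -> snd (yp r k) = 0 }.

Theorem ode_solution (e : R -> R) (b w0 w1 : R) : (forall x, continuous e x) ->
  exists y yp : R -> C -> C, ode_family e b w0 w1 y yp.
Proof.
  intros He.
  set (Z := Zc e b w0 w1). set (D := Dc e b w0 w1). set (E := Ec e b w0 w1).
  assert (Hbound : forall r0, exists K H, 0 <= K /\ 1 <= H /\ forall j r, Rabs (r - r0) <= 1 ->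
     Rabs (Z j r) <= K * (H ^ j / INR (fact j)) /\ Rabs (sg j * D j r) <= K * (H ^ j / INR (fact j)) /\
     Rabs (E j r) <= K * (H ^ j / INR (fact j)) /\ Rabs (e r) <= H).
  { intros r0. destruct (Dc_bound e b w0 w1 He (Rabs b + Rabs r0 + 1)) as (K & H & HK & HH & Hall).
    - pose proof (Rabs_pos r0). pose proof (Rle_abs b). pose proof (Rle_abs (- b)). rewrite Rabs_Ropp in *. lra.
    - exists K, H. split; [exact HK|]. split; [exact HH|]. intros j r Hr. apply Hall.
      apply Rabs_le_between in Hr. pose proof (Rabs_pos b). pose proof (Rle_abs r0). pose proof (Rle_abs (- r0)). rewrite Rabs_Ropp in *. lra. }
  assert (Hself : forall r : R, Rabs (r - r) <= 1) by (intros r; replace (r - r) with 0 by ring; rewrite Rabs_R0; lra).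
  assert (HsgZ : forall r0 K H j r, 0 <= K -> 1 <= H -> (forall j r, Rabs (r - r0) <= 1 ->
     Rabs (Z j r) <= K * (H ^ j / INR (fact j)) /\ Rabs (sg j * D j r) <= K * (H ^ j / INR (fact j)) /\
     Rabs (E j r) <= K * (H ^ j / INR (fact j)) /\ Rabs (e r) <= H) -> Rabs (r - r0) <= 1 -> Rabs (sg j * Z j r) <= K * (H ^ j / INR (fact j))).
  { intros r0 K H j r HK HH Hall Hr. rewrite Rabs_mult. rewrite <- (Rmult_1_l (K * _)).
    apply Rmult_le_compat; [apply Rabs_pos | apply Rabs_pos | apply sg_abs | apply Hall, Hr]. }
  assert (Hy : forall r, exists f, Ent f /\ forall k, cser (fun j => RtoC (sg j * Z j r) * k ^ j)%C (f k)).
  { intros r. destruct (Hbound r) as (K & H & HK & HH & Hall). apply (Ent_of_coeff _ K H); [exact HK | lra |].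
    intros n. rewrite Cmod_R. eapply HsgZ; eauto. }
  assert (Hyp : forall r, exists f, Ent f /\ forall k, cser (fun j => RtoC (sg j * D j r) * k ^ j)%C (f k)).
  { intros r. destruct (Hbound r) as (K & H & HK & HH & Hall). apply (Ent_of_coeff _ K H); [exact HK | lra |].
    intros n. rewrite Cmod_R. apply Hall, Hself. }
  set (y := fun r => proj1_sig (constructive_indefinite_description _ (Hy r))).
  set (yp := fun r => proj1_sig (constructive_indefinite_description _ (Hyp r))).
  assert (Sy : forall r, Ent (y r) /\ forall k, cser (fun j => RtoC (sg j * Z j r) * k ^ j)%C (y r k)).
  { intros r. exact (proj2_sig (constructive_indefinite_description _ (Hy r))). }
  assert (Syp : forall r, Ent (yp r) /\ forall k, cser (fun j => RtoC (sg j * D j r) * k ^ j)%C (yp r k)).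
  { intros r. exact (proj2_sig (constructive_indefinite_description _ (Hyp r))). }
  assert (DZ : forall j x, is_derive (fun s => sg j * Z j s) x (sg j * D j x)).
  { intros j x. apply Rd_scal. apply Zc_derive, He. }
  assert (DD : forall j x, is_derive (fun s => sg j * D j s) x (E j x)).
  { intros [|[|j]] x.
    - apply (Rd_ext (fun _ => 1 * w1)); [reflexivity | apply Rd_const].
    - apply (Rd_ext (fun _ => 0)); [intros; simpl; ring | apply Rd_const].
    - apply (Rd_ext (fun s => - (sg j * Z (S j) s))); [intros; symmetry; apply sg_Dc|].
      eapply Rd_eq; [apply Rd_opp, Rd_scal, Zc_derive, He|].
      unfold E. cbn [Ec]. change (Dc e b w0 w1 (S j) x) with (wt e j x * Zc e b w0 w1 j x).
      unfold wt. destruct (Nat.even j) eqn:Ev; [reflexivity|]. rewrite (sg_odd j Ev). ring. }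
  exists y, yp. split.
  - intros r; apply Sy.
  - intros r; apply Syp.
  - intros k. apply (cser_unique _ _ _ (proj2 (Sy b) k)).
    pose proof (cser_decr (fun j => RtoC (sg j * Z j b) * k ^ j)%C 0) as H. cbv beta in H.
    replace (RtoC (sg 0 * Z 0%nat b) * k ^ 0 + 0)%C with (RtoC w0) in H.
    + apply H. apply cser_zero. intros n. unfold Z. rewrite Zc_b, Rmult_0_r. ring.
    + apply C_eq; simpl; ring.
  - intros k. apply (cser_unique _ _ _ (proj2 (Syp b) k)).
    pose proof (cser_decr (fun j => RtoC (sg j * D j b) * k ^ j)%C 0) as H. cbv beta in H.
    replace (RtoC (sg 0 * D 0%nat b) * k ^ 0 + 0)%C with (RtoC w1) in H.
    + apply H. apply cser_zero. intros [|n].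
      * simpl sg. rewrite Rmult_0_l. ring.
      * unfold D. rewrite sg_Dc, Zc_b, Rmult_0_r, Ropp_0. ring.
    + apply C_eq; simpl; ring.
  - intros k r. destruct (Hbound r) as (K & H & HK & HH & Hall).
    apply (series_cder (fun r j => RtoC (sg j * Z j r) * k ^ j)%C (fun j => RtoC (sg j * D j r) * k ^ j)%C _ _ r
      (fun j => K * ((H * Cmod k) ^ j / INR (fact j))) (K * exp (H * Cmod k))).
    + intros n. apply Rmult_le_pos; [exact HK|]. apply Rmult_le_pos.
      * apply pow_le. apply Rmult_le_pos; [lra | apply Cmod_ge_0].
      * left. apply Rinv_0_lt_compat, fact_pos.
    + apply exp_series_scal.
    + intros eps Heps. exists (Rmin 1 eps). split; [apply Rmin_glb_lt; lra|]. intros h Hh n.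
      pose proof (Rmin_l 1 eps). pose proof (Rmin_r 1 eps).
      (* Two mean value steps write the remainder as h (x - r) times a second derivative, with |x -
         r| <= |h|. *)
      destruct (mvt_step _ _ r h (DZ n)) as (x & Hx & E1).
      destruct (mvt_step _ _ r (x - r) (DD n)) as (x' & Hx' & E2).
      replace (r + (x - r)) with x in E2 by ring.
      replace (RtoC (sg n * Z n (r + h)%R) * k ^ n - RtoC (sg n * Z n r) * k ^ n - h * (RtoC (sg n * D n r) * k ^ n))%C
        with (RtoC (h * ((x - r) * E n x')) * k ^ n)%C.
      2:{ replace (h * ((x - r) * E n x')) with ((sg n * Z n (r + h) - sg n * Z n r) - h * (sg n * D n r)).
          - rewrite !RtoC_minus, (RtoC_mult h). ring.
          - rewrite E1, <- E2. ring. }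
      rewrite Cmod_RC, Cmod_pow, !Rabs_mult, Rpow_mult_distr.
      assert (BE : Rabs (E n x') <= K * (H ^ n / INR (fact n))) by (apply Hall; lra).
      pose proof (pow_le (Cmod k) n (Cmod_ge_0 k)) as Pk. pose proof (Rabs_pos h) as Ph. pose proof (Rabs_pos (x - r)).
      pose proof (Rabs_pos (E n x')).
      apply Rle_trans with (Rabs h * (eps * (K * (H ^ n / INR (fact n)))) * Cmod k ^ n).
      * apply Rmult_le_compat_r; [exact Pk|]. apply Rmult_le_compat_l; [exact Ph|]. apply Rmult_le_compat; lra.
      * right. unfold Rdiv. ring.
    + intros x. apply Sy.
    + apply Syp.
  - intros k r. destruct (Hbound r) as (K & H & HK & HH & Hall).
    apply (series_cder (fun r j => RtoC (sg j * D j r) * k ^ j)%C (fun j => RtoC (E j r) * k ^ j)%C _ _ r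
      (fun j => 2 * K * ((2 * H * Cmod k) ^ j / INR (fact j))) (2 * K * exp (2 * H * Cmod k))).
    + intros n. apply Rmult_le_pos; [lra|]. apply Rmult_le_pos.
      * apply pow_le. apply Rmult_le_pos; [lra | apply Cmod_ge_0].
      * left. apply Rinv_0_lt_compat, fact_pos.
    + apply exp_series_scal.
    + intros eps Heps.
      (* The second derivative contains [e], which is only continuous, so its modulus of continuity
         controls the remainder of the derivative series. *)
      assert (Hcont : exists d, 0 < d /\ forall x, Rabs (x - r) < d -> Rabs (e x - e r) < eps / 2).
      { pose proof (proj2 (continuity_pt_filterlim e r) (He r)) as C0.
        destruct (C0 (eps / 2)) as (d & Hd & Kd); [lra|]. exists d. split; [exact Hd|]. intros x Hx.
        destruct (Req_dec x r) as [->|N]; [rewrite Rminus_self || replace (e r - e r) with 0 by ring; rewrite Rabs_R0; lra|].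
        apply Kd. split; [split; [exact I | auto] | exact Hx]. }
      destruct Hcont as (d & Hd & Hcont).
      exists (Rmin (Rmin 1 d) (eps / 2 / H)). split.
      { repeat apply Rmin_glb_lt; try lra. apply Rdiv_lt_0_compat; lra. }
      intros h Hh n.
      pose proof (Rmin_l (Rmin 1 d) (eps / 2 / H)). pose proof (Rmin_r (Rmin 1 d) (eps / 2 / H)).
      pose proof (Rmin_l 1 d). pose proof (Rmin_r 1 d).
      destruct (mvt_step _ _ r h (DD n)) as (x & Hx & E1).
      replace (RtoC (sg n * D n (r + h)%R) * k ^ n - RtoC (sg n * D n r) * k ^ n - h * (RtoC (E n r) * k ^ n))%C
        with (RtoC (h * (E n x - E n r)) * k ^ n)%C.
      2:{ replace (h * (E n x - E n r)) with ((sg n * D n (r + h) - sg n * D n r) - h * E n r).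
          - rewrite !RtoC_minus, (RtoC_mult h). ring.
          - rewrite E1. ring. }
      rewrite Cmod_RC, Cmod_pow, Rabs_mult.
      pose proof (pow_le (Cmod k) n (Cmod_ge_0 k)) as Pk. pose proof (Rabs_pos h) as Ph.
      assert (G : Rabs (E n x - E n r) <= eps * (2 * K * ((2 * H) ^ n / INR (fact n)))).
      { destruct n as [|[|j]].
        - simpl E. replace (0 - 0) with 0 by ring. rewrite Rabs_R0. simpl. nra.
        - simpl E. replace (0 - 0) with 0 by ring. rewrite Rabs_R0. simpl. assert (0 <= eps * K * H) by (apply Rmult_le_pos; nra). lra.
        - destruct (mvt_step _ _ r (x - r) (DZ j)) as (x' & Hx' & E2). replace (r + (x - r)) with x in E2 by ring.
          assert (EE : E (S (S j)) x - E (S (S j)) r = - ((e x - e r) * (sg j * Z j x) + e r * ((x - r) * (sg j * D j x')))).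
          { rewrite <- E2. unfold E, Z. simpl Ec. ring. }
          rewrite EE, Rabs_Ropp.
          assert (B1 : Rabs (sg j * Z j x) <= K * (H ^ j / INR (fact j))) by (eapply HsgZ; eauto; lra).
          assert (B2 : Rabs (sg j * D j x') <= K * (H ^ j / INR (fact j))) by (apply Hall; lra).
          assert (B3 : Rabs (e r) <= H) by (apply (Hall O); apply Hself).
          assert (B4 : Rabs (e x - e r) <= eps / 2) by (left; apply Hcont; lra).
          assert (B5 : Rabs (x - r) * H <= eps / 2).
          { apply Rle_trans with (eps / 2 / H * H); [apply Rmult_le_compat_r; lra | right; field; lra]. }
          set (q := K * (H ^ j / INR (fact j))) in *.
          assert (Q0 : 0 <= q) by (apply Rle_trans with (2 := B1); apply Rabs_pos).
          apply Rle_trans with (eps * q).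
          + apply Rle_trans with (1 := Rabs_triang _ _). rewrite !Rabs_mult.
            pose proof (Rabs_pos (e x - e r)). pose proof (Rabs_pos (e r)). pose proof (Rabs_pos (x - r)).
            assert (T1 : Rabs (e x - e r) * (Rabs (sg j) * Rabs (Z j x)) <= eps / 2 * q).
            { apply Rmult_le_compat; try lra; rewrite <- Rabs_mult; [apply Rabs_pos | exact B1]. }
            assert (T2 : Rabs (e r) * (Rabs (x - r) * (Rabs (sg j) * Rabs (D j x'))) <= eps / 2 * q).
            { rewrite <- (Rabs_mult (sg j)), <- Rmult_assoc. apply Rmult_le_compat; try apply Rabs_pos; try assumption.
              - apply Rmult_le_pos; lra.
              - apply Rle_trans with (H * Rabs (x - r)); [apply Rmult_le_compat_r; lra | lra]. }
            lra.
          + apply Rmult_le_compat_l; [lra|]. unfold q. rewrite (Rmult_comm 2 K), Rmult_assoc. apply Rmult_le_compat_l; [exact HK|].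
            apply Rle_trans with (1 := pow_le_bump H j 2 HH). replace (j + 2)%nat with (S (S j)) by lia.
            change (INR (fact 2)) with 2. right. unfold Rdiv. ring. }
      apply Rle_trans with (Rabs h * (eps * (2 * K * ((2 * H) ^ n / INR (fact n)))) * Cmod k ^ n).
      * apply Rmult_le_compat_r; [exact Pk|]. apply Rmult_le_compat_l; [exact Ph | exact G].
      * right. rewrite (Rpow_mult_distr (2 * H) (Cmod k)). unfold Rdiv. ring.
    + intros x. apply Syp.
    (* The series of second derivatives starts at index 2: two zero terms are split off, and what
       follows is - k^2 e(r) times the series of y. *)
    + replace (- (k * k * (e r * y r k)))%C with (RtoC (E 0%nat r) * k ^ 0 + (RtoC (E 1%nat r) * k ^ 1 + - (k * k * (e r * y r k))))%C by (simpl; ring).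
      apply (cser_decr (fun j => RtoC (E j r) * k ^ j)%C).
      apply (cser_decr (fun j => RtoC (E (S j) r) * k ^ (S j))%C).
      apply (cser_ext (fun j => (- (k * k * e r)) * (RtoC (sg j * Z j r) * k ^ j))%C).
      * intros j. unfold E, Z. simpl Ec. rewrite RtoC_opp, !RtoC_mult, !Cpow_S. ring.
      * replace (- (k * k * (e r * y r k)))%C with ((- (k * k * e r)) * y r k)%C by ring. apply cser_scal, Sy.
  - intros r k. apply (cser_unique _ _ _ (proj2 (Sy r) (- k)%C)).
    apply (cser_ext (fun j => RtoC (sg j * Z j r) * k ^ j)%C); [|apply Sy]. intros j.
    destruct (Nat.even j) eqn:Ev; [|rewrite (sg_odd j Ev), Rmult_0_l; ring].
    apply Nat.even_spec in Ev. destruct Ev as [i ->]. rewrite !Cpow_mult_r. f_equal. f_equal. simpl. ring.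
  - intros r k. apply (cser_unique _ _ _ (proj2 (Syp r) (- k)%C)).
    apply (cser_ext (fun j => RtoC (sg j * D j r) * k ^ j)%C); [|apply Syp]. intros j.
    destruct (Nat.even j) eqn:Ev; [|rewrite (sg_odd j Ev), Rmult_0_l; ring].
    apply Nat.even_spec in Ev. destruct Ev as [i ->]. rewrite !Cpow_mult_r. f_equal. f_equal. simpl. ring.
  - intros r k Hk. refine (cser_snd_zero _ _ _ (proj2 (Sy r) k)). intros j.
    replace (RtoC (sg j * Z j r) * k ^ j)%C with (RtoC (Z j r) * (sg j * k ^ j))%C by (rewrite RtoC_mult; ring).
    apply RtoC_scal_pow_real, sg_pow_real, Hk.
  - intros r k Hk. refine (cser_snd_zero _ _ _ (proj2 (Syp r) k)). intros j.
    replace (RtoC (sg j * D j r) * k ^ j)%C with (RtoC (D j r) * (sg j * k ^ j))%C by (rewrite RtoC_mult; ring).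
    apply RtoC_scal_pow_real, sg_pow_real, Hk.
Qed.

(** * The coefficient and its given solutions *)

(* Continuing past the end points by tangents turns the one-sided derivatives of [deriv01] into two-sided ones. *)
Definition ext (f f' : R -> R) (x : R) : R := f (clamp 0 1 x) + f' (clamp 0 1 x) * (x - clamp 0 1 x).

Lemma ext_in f f' x : 0 <= x <= 1 -> ext f f' x = f x.
Proof. intros H. unfold ext. rewrite clamp_id by exact H. ring. Qed.

Lemma clamp_lo x : x <= 0 -> clamp 0 1 x = 0.
Proof. intros H. unfold clamp, Rmax, Rmin. repeat destruct Rle_dec; lra. Qed.

Lemma clamp_hi x : 1 <= x -> clamp 0 1 x = 1.
Proof. intros H. unfold clamp, Rmax, Rmin. repeat destruct Rle_dec; lra. Qed.

Lemma is_derive_affine (f : R -> R) (x l d : R) : 0 < d ->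
  (forall h, Rabs h < d -> f (x + h) - f x = h * l) -> is_derive f x l.
Proof.
  intros Hd H. apply is_derive_eps. intros eps He. exists d. split; [exact Hd|]. intros h Hh.
  rewrite H by exact Hh. rewrite Rminus_diag_eq by reflexivity. rewrite Rabs_R0.
  pose proof (Rabs_pos h). nra.
Qed.

Lemma ext_derive f f' : deriv01 f f' -> forall x, is_derive (ext f f') x (f' (clamp 0 1 x)).
Proof.
  intros Hf x.
  destruct (Rlt_dec x 0) as [L|L].
  { apply (is_derive_affine _ _ _ (- x)); [lra|]. intros h Hh. apply Rabs_def2 in Hh.
    unfold ext. rewrite !clamp_lo by lra. ring. }
  destruct (Rlt_dec 1 x) as [U|U].
  { apply (is_derive_affine _ _ _ (x - 1)); [lra|]. intros h Hh. apply Rabs_def2 in Hh.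
    unfold ext. rewrite !clamp_hi by lra. ring. }
  assert (Hx : in01 x) by (unfold in01; lra).
  rewrite clamp_id by exact Hx. apply is_derive_eps. intros eps He.
  destruct (Hf x Hx eps He) as (d & Hd & K).
  (* The radius is shrunk so that x + h can leave [0, 1] only when x is the end point crossed; there
     the extension is affine and the remainder is exactly 0. *)
  set (d' := if Rlt_dec x 1 then Rmin d (1 - x) else d).
  assert (Hd' : 0 < d' /\ d' <= d /\ (x < 1 -> d' <= 1 - x)).
  { unfold d'. destruct Rlt_dec.
    - split; [apply Rmin_glb_lt; lra|]. split; [apply Rmin_l|]. intros _. apply Rmin_r.
    - split; [lra|]. split; [lra|]. lra. }
  clearbody d'. set (d'' := if Rlt_dec 0 x then Rmin d' x else d').
  assert (Hd'' : 0 < d'' /\ d'' <= d' /\ (0 < x -> d'' <= x)).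
  { unfold d''. destruct Rlt_dec.
    - split; [apply Rmin_glb_lt; lra|]. split; [apply Rmin_l|]. intros _. apply Rmin_r.
    - split; [lra|]. split; [lra|]. lra. }
  exists d''. split; [apply Hd''|]. intros h Hh. pose proof (Rabs_pos h) as Ph.
  destruct (Req_dec h 0) as [->|Hh0].
  { rewrite Rplus_0_r. replace (ext f f' x - ext f f' x - 0 * f' x) with 0 by ring. rewrite Rabs_R0. nra. }
  pose proof (Rabs_def2 _ _ Hh) as Hb.
  destruct (Rlt_dec (x + h) 0) as [A|A].
  { assert (x = 0) by (destruct (Rlt_dec 0 x) as [Q|Q]; [destruct Hd'' as (_ & _ & Q2); specialize (Q2 Q); lra | lra]).
    subst x. unfold ext. rewrite !clamp_lo by lra.
    match goal with |- Rabs ?t <= _ => replace t with 0 by ring end. rewrite Rabs_R0. nra. }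
  destruct (Rlt_dec 1 (x + h)) as [A'|A'].
  { assert (x = 1) by (destruct (Rlt_dec x 1) as [Q|Q]; [destruct Hd' as (_ & _ & Q2); specialize (Q2 Q); lra | lra]).
    subst x. unfold ext. rewrite !clamp_hi by lra.
    match goal with |- Rabs ?t <= _ => replace t with 0 by ring end. rewrite Rabs_R0. nra. }
  rewrite !ext_in by (unfold in01 in *; lra).
  specialize (K h Hh0 ltac:(unfold in01; lra) ltac:(lra)).
  replace (f (x + h) - f x - h * f' x) with (((f (x + h) - f x) / h - f' x) * h) by (field; exact Hh0).
  rewrite Rabs_mult. apply Rmult_le_compat_r; [exact Ph | lra].
Qed.

(** The coefficient, continued to the line, with its first two derivatives on [0, 1]. When m = 0 the
    second derivative is the function in [W21], from which a bound is extracted. *)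
Record profile (e e1 e2 : R -> R) : Prop := {
  prof_cont : forall x, continuous e x;
  prof_d1 : forall x, 0 <= x <= 1 -> is_derive e x (e1 x);
  prof_d2 : forall x, 0 <= x <= 1 -> is_derive e1 x (e2 x);
  prof_pos : forall x, 0 <= x <= 1 -> 0 < e x;
  prof_bd : exists K, forall x, 0 <= x <= 1 -> Rabs (e2 x) <= K }.

(** The partition 0 < x < 1 alone gives (f(x) - f(0))^2 / x <= Cst, and x <= 1; at x = 1 the trivial
    partition is used. *)
Lemma W21_bounded f : W21 f -> exists K, forall x, 0 <= x <= 1 -> Rabs (f x) <= K.
Proof.
  intros (Cst & H). exists (Rabs (f 0) + (Cst + 1)).
  assert (Main : forall x, 0 < x <= 1 -> (f x - f 0) ^ 2 <= Cst).
  { intros x Hx. destruct (Req_dec x 1) as [->|N].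
    - specialize (H O (fun i => match i with O => 0 | _ => 1 end) eq_refl eq_refl). simpl in H.
      assert (K := H ltac:(intros i Hi; replace i with O by lia; lra)). unfold Rdiv in K. rewrite Rminus_0_r, Rinv_1 in K. simpl. lra.
    - specialize (H 1%nat (fun i => match i with O => 0 | S O => x | _ => 1 end) eq_refl eq_refl). simpl in H.
      assert (K := H ltac:(intros i Hi; destruct i as [|[|i]]; [lra | lra | lia])).
      rewrite Rmult_1_r, Rmult_1_r, Rminus_0_r in K.
      assert (A : 0 <= (f 1 - f x) * (f 1 - f x) / (1 - x)).
      { apply Rmult_le_pos; [apply (Rle_0_sqr (f 1 - f x)) | left; apply Rinv_0_lt_compat; lra]. }
      assert (B : (f x - f 0) * (f x - f 0) <= (f x - f 0) * (f x - f 0) / x).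
      { assert (1 <= / x) by (rewrite <- Rinv_1; apply Rinv_le_contravar; lra). unfold Rdiv.
        pose proof (Rle_0_sqr (f x - f 0)) as Q. unfold Rsqr in Q. nra. }
      simpl. lra. }
  assert (HC : 0 <= Cst) by (specialize (Main 1 ltac:(lra)); pose proof (pow2_ge_0 (f 1 - f 0)); lra).
  intros x Hx. destruct (Req_dec x 0) as [->|N]; [lra|].
  specialize (Main x ltac:(lra)).
  assert (Rabs (f x - f 0) <= Cst + 1).
  { apply Rabs_le. split; nra. }
  replace (f x) with (f 0 + (f x - f 0)) by ring. apply Rle_trans with (1 := Rabs_triang _ _). lra.
Qed.

Lemma profile_exists (m : nat) (eta : R -> R) (D : nat -> R -> R) :
  (forall r, in01 r -> 0 < eta r) -> W2_derivs m eta D ->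
  exists e e1 e2, profile e e1 e2 /\ (forall x, 0 <= x <= 1 -> e x = eta x) /\ (forall x, 0 <= x <= 1 -> e1 x = D 1%nat x).
Proof.
  intros Hpos (H0 & HD & HW).
  pose proof (HD 0%nat ltac:(lia)) as D0. pose proof (HD 1%nat ltac:(lia)) as D1.
  exists (ext (D 0%nat) (D 1%nat)), (ext (D 1%nat) (D 2%nat)), (D 2%nat). split; [split|split].
  - intros x. apply (ex_derive_continuous (V := R_NormedModule)). eexists. apply (ext_derive _ _ D0).
  - intros x Hx. pose proof (ext_derive _ _ D0 x) as K. rewrite clamp_id in K by exact Hx. rewrite ext_in by exact Hx. exact K.
  - intros x Hx. pose proof (ext_derive _ _ D1 x) as K. rewrite clamp_id in K by exact Hx. exact K.
  - intros x Hx. rewrite ext_in, H0 by exact Hx. apply Hpos, Hx.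
  - destruct m as [|m]; [apply W21_bounded; exact HW|].
    pose proof (HD 2%nat ltac:(lia)) as D2.
    destruct (cont_bounded (ext (D 2%nat) (D 3%nat)) 0 1) as (K & _ & HK); [lra | |].
    + intros x _. apply (ex_derive_continuous (V := R_NormedModule)). eexists. apply (ext_derive _ _ D2).
    + exists K. intros x Hx. specialize (HK x Hx). rewrite ext_in in HK by exact Hx. exact HK.
  - intros x Hx. rewrite ext_in, H0 by exact Hx. reflexivity.
  - intros x Hx. apply ext_in, Hx.
Qed.

(** N exp(- L) is nonincreasing and N exp(L) nondecreasing, so the estimate runs in both directions
    from the base point. *)
Lemma gronwall (N N' L L' : R -> R) (a b : R) :
  (forall x, a <= x <= b -> is_derive N x (N' x)) -> (forall x, a <= x <= b -> is_derive L x (L' x)) ->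
  (forall x, a <= x <= b -> 0 <= N x) -> (forall x, a <= x <= b -> Rabs (N' x) <= L' x * N x) ->
  forall x y, a <= x <= b -> a <= y <= b -> N x <= N y * exp (Rabs (L x - L y)).
Proof.
  intros HN HL H0 H x y Hx Hy.
  assert (Hup : forall s t, a <= s -> s <= t -> t <= b -> N t * exp (- L t) <= N s * exp (- L s)).
  { intros s t Hs Hst Ht.
    pose proof (le_of_derive_le (fun r => N r * exp (- L r)) (fun _ => 0)
      (fun r => N' r * exp (- L r) + N r * (exp (- L r) * - L' r)) (fun _ => 0) s t Hst) as K.
    assert (N t * exp (- L t) - N s * exp (- L s) <= 0 - 0); [apply K|lra].
    - intros r Hr. apply (Rd_mult N (fun r => exp (- L r))); [apply HN; lra | apply (Rd_exp (fun r => - L r)), Rd_opp, HL; lra].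
    - intros r _. apply Rd_const.
    - intros r Hr. specialize (H r ltac:(lra)). apply Rabs_le_between in H. pose proof (exp_pos (- L r)). nra. }
  assert (Hdn : forall s t, a <= s -> s <= t -> t <= b -> N s * exp (L s) <= N t * exp (L t)).
  { intros s t Hs Hst Ht.
    pose proof (le_of_derive_le (fun _ => 0) (fun r => N r * exp (L r)) (fun _ => 0)
      (fun r => N' r * exp (L r) + N r * (exp (L r) * L' r)) s t Hst) as K.
    assert (0 - 0 <= N t * exp (L t) - N s * exp (L s)); [apply K|lra].
    - intros r _. apply Rd_const.
    - intros r Hr. apply (Rd_mult N (fun r => exp (L r))); [apply HN; lra | apply (Rd_exp L), HL; lra].
    - intros r Hr. specialize (H r ltac:(lra)). apply Rabs_le_between in H. pose proof (exp_pos (L r)). nra. }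
  pose proof (H0 y Hy) as Ny.
  destruct (Rle_dec y x) as [Hyx|Hyx].
  - apply Rle_trans with (N y * exp (L x - L y)).
    + specialize (Hup y x ltac:(lra) Hyx ltac:(lra)).
      apply Rmult_le_reg_r with (exp (- L x)); [apply exp_pos|].
      rewrite Rmult_assoc, <- exp_plus. replace (L x - L y + - L x) with (- L y) by ring. exact Hup.
    + apply Rmult_le_compat_l; [exact Ny | apply exp_mono, Rle_abs].
  - apply Rle_trans with (N y * exp (L y - L x)).
    + specialize (Hdn x y ltac:(lra) ltac:(lra) ltac:(lra)).
      apply Rmult_le_reg_r with (exp (L x)); [apply exp_pos|].
      rewrite Rmult_assoc, <- exp_plus. replace (L y - L x + L x) with (L y) by ring. exact Hdn.
    + apply Rmult_le_compat_l; [exact Ny|]. apply exp_mono. rewrite Rabs_minus_sym. apply Rle_abs.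
Qed.

(** The energy |u|^2 + |v|^2 obeys a Gronwall inequality with constant rate and starts from 0; the
    interval may extend to both sides of c. *)
Lemma ode_unique (e : R -> R) (a b c : R) (k : C) (u v : R -> C) : (forall x, continuous e x) ->
  (forall x, a <= x <= b -> cder u x (v x)) ->
  (forall x, a <= x <= b -> cder v x (- (k * k * (e x * u x)))%C) ->
  a <= c <= b -> u c = 0 -> v c = 0 -> forall x, a <= x <= b -> u x = 0 /\ v x = 0.
Proof.
  intros He Hu Hv Hc U0 V0 x Hx.
  destruct (cont_bounded e a b) as (H & HH & Hbd); [lra | intros; apply He|].
  set (Q := Cmod (k * k)). assert (HQ : 0 <= Q) by apply Cmod_ge_0.
  set (N := fun r => fst (u r) ^ 2 + snd (u r) ^ 2 + (fst (v r) ^ 2 + snd (v r) ^ 2)).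
  set (w := fun r => (- (k * k * (e r * u r)))%C).
  set (N' := fun r => 2 * (fst (u r) * fst (v r) + snd (u r) * snd (v r)) + 2 * (fst (v r) * fst (w r) + snd (v r) * snd (w r))).
  assert (Hcs : forall p q : C, Rabs (2 * (fst p * fst q + snd p * snd q)) <= Cmod p ^ 2 + Cmod q ^ 2).
  { intros p q. rewrite 2!Cmod_sqr. apply Rabs_le.
    pose proof (pow2_ge_0 (fst p - fst q)). pose proof (pow2_ge_0 (snd p - snd q)).
    pose proof (pow2_ge_0 (fst p + fst q)). pose proof (pow2_ge_0 (snd p + snd q)). split; nra. }
  assert (G : N x <= N c * exp (Rabs ((1 + (Q * H) ^ 2 + 1) * x - (1 + (Q * H) ^ 2 + 1) * c))).
  { apply (gronwall N N' (fun r => (1 + (Q * H) ^ 2 + 1) * r) (fun _ => (1 + (Q * H) ^ 2 + 1) * 1) a b); auto.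
    - intros r Hr. destruct (Hu r Hr). destruct (Hv r Hr). apply Rd_plus; apply sq_sum_derive; assumption.
    - intros r _. apply Rd_scal, Rd_id.
    - intros r _. unfold N. nra.
    - intros r Hr. unfold N'. apply Rle_trans with (1 := Rabs_triang _ _).
      pose proof (Hcs (u r) (v r)) as H1. pose proof (Hcs (v r) (w r)) as H2.
      assert (Hw : Cmod (w r) <= Q * H * Cmod (u r)).
      { unfold w. rewrite Cmod_opp, Cmod_mult, Cmod_RC. fold Q. specialize (Hbd r Hr). pose proof (Cmod_ge_0 (u r)).
        rewrite Rmult_assoc. apply Rmult_le_compat_l; [exact HQ|]. apply Rmult_le_compat_r; assumption. }
      assert (Hw2 : Cmod (w r) ^ 2 <= (Q * H) ^ 2 * Cmod (u r) ^ 2).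
      { rewrite <- Rpow_mult_distr. apply pow_incr. split; [apply Cmod_ge_0 | exact Hw]. }
      assert (NE : N r = Cmod (u r) ^ 2 + Cmod (v r) ^ 2) by (unfold N; rewrite 2!Cmod_sqr; ring).
      rewrite NE. pose proof (pow2_ge_0 (Cmod (u r))). pose proof (pow2_ge_0 (Cmod (v r))). pose proof (pow2_ge_0 (Q * H)).
      nra. }
  assert (N0 : N c = 0) by (unfold N; rewrite U0, V0; simpl; ring).
  rewrite N0, Rmult_0_l in G. unfold N in G.
  assert (fst (u x) = 0) by nra. assert (snd (u x) = 0) by nra.
  assert (fst (v x) = 0) by nra. assert (snd (v x) = 0) by nra.
  split; apply C_eq; assumption.
Qed.

(** [is_sol] gives derivatives relative to [0, 1] only. The tangent continuation makes them
    two-sided there, after which uniqueness identifies the given pair with the constructed one. *)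
Lemma given_solution (e eta : R -> R) (y yp : R -> C -> C) (k : C) (u v : R -> C) : (forall x, continuous e x) ->
  (forall x, 0 <= x <= 1 -> e x = eta x) -> is_sol eta y yp ->
  (forall x, 0 <= x <= 1 -> cder u x (v x)) ->
  (forall x, 0 <= x <= 1 -> cder v x (- (k * k * (e x * u x)))%C) -> u 0 = 0 -> v 0 = 1 ->
  forall r, 0 <= r <= 1 -> y r k = u r /\ yp r k = v r.
Proof.
  intros He Ee Hs Hu Hv U0 V0 r Hr. destruct (Hs k) as (Y0 & YP0 & [A1 A2] & [B1 B2]).
  set (Y := fun x => (ext (fun r => fst (y r k)) (fun r => fst (yp r k)) x, ext (fun r => snd (y r k)) (fun r => snd (yp r k)) x) : C).
  set (w := fun r => Defs.Copp (Cmul (Cmul k k) (Cmul (Defs.RtoC (eta r)) (y r k)))) in *.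
  set (V := fun x => (ext (fun r => fst (yp r k)) (fun r => fst (w r)) x, ext (fun r => snd (yp r k)) (fun r => snd (w r)) x) : C).
  assert (EY : forall x, 0 <= x <= 1 -> Y x = y x k).
  { intros x Hx. unfold Y. rewrite !ext_in by exact Hx. symmetry. apply surjective_pairing. }
  assert (EV : forall x, 0 <= x <= 1 -> V x = yp x k).
  { intros x Hx. unfold V. rewrite !ext_in by exact Hx. symmetry. apply surjective_pairing. }
  destruct (ode_unique e 0 1 0 k (fun x => Y x - u x)%C (fun x => V x - v x)%C He) with (x := r) as [K1 K2]; auto; try lra.
  - intros x Hx. apply cder_minus; [|apply Hu, Hx].
    pose proof (ext_derive _ _ A1 x) as P1. pose proof (ext_derive _ _ A2 x) as P2.
    rewrite clamp_id in P1, P2 by exact Hx. rewrite EV by exact Hx. split; assumption.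
  - intros x Hx. eapply cder_eq.
    + apply cder_minus; [|apply Hv, Hx].
      instantiate (1 := w x).
      pose proof (ext_derive _ _ B1 x) as P1. pose proof (ext_derive _ _ B2 x) as P2.
      rewrite clamp_id in P1, P2 by exact Hx. split; assumption.
    + rewrite EY by exact Hx. unfold w. rewrite <- Ee by exact Hx.
      change (@eq C (- (k * k * (e x * y x k)) - - (k * k * (e x * u x)))%C (- (k * k * (e x * (y x k - u x))))%C).
      generalize (y x k : C). intros yy. ring.
  - rewrite EY, U0 by lra. rewrite Y0. change (@eq C (RtoC 0 - 0)%C 0). ring.
  - rewrite EV, V0 by lra. rewrite YP0. change (@eq C (RtoC 1 - 1)%C 0). ring.
  - rewrite EY in K1 by exact Hr. rewrite EV in K2 by exact Hr. split; apply Ceq_minus; assumption.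
Qed.

(** * Sine and cosine as solutions for constant coefficient *)

Lemma cder_sin_line (k : C) (r : R) : cder (fun r : R => Csin (r * k)%C) r (k * Ccos (r * k))%C.
Proof.
  assert (D1 : is_derive (fun r : R => r * fst k - 0 * snd k) r (fst k)).
  { eapply Rd_eq; [apply Rd_minus; [apply Rd_mult; [apply Rd_id | apply Rd_const] | apply Rd_const]|]. cbv beta. ring. }
  assert (D2 : is_derive (fun r : R => r * snd k + 0 * fst k) r (snd k)).
  { eapply Rd_eq; [apply Rd_plus; [apply Rd_mult; [apply Rd_id | apply Rd_const] | apply Rd_const]|]. cbv beta. ring. }
  split; simpl.
  - eapply Rd_eq; [apply Rd_mult; [apply Rd_sin, D1 | apply (Rd_comp cosh); [exact D2 | apply is_derive_Reals, derivable_pt_lim_cosh]]|]. cbv beta. ring.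
  - eapply Rd_eq; [apply Rd_mult; [apply Rd_cos, D1 | apply (Rd_comp sinh); [exact D2 | apply is_derive_Reals, derivable_pt_lim_sinh]]|]. cbv beta. ring.
Qed.

Lemma cder_cos_line (k : C) (r : R) : cder (fun r : R => Ccos (r * k)%C) r (- (k * Csin (r * k)))%C.
Proof.
  assert (D1 : is_derive (fun r : R => r * fst k - 0 * snd k) r (fst k)).
  { eapply Rd_eq; [apply Rd_minus; [apply Rd_mult; [apply Rd_id | apply Rd_const] | apply Rd_const]|]. cbv beta. ring. }
  assert (D2 : is_derive (fun r : R => r * snd k + 0 * fst k) r (snd k)).
  { eapply Rd_eq; [apply Rd_plus; [apply Rd_mult; [apply Rd_id | apply Rd_const] | apply Rd_const]|]. cbv beta. ring. }
  split; simpl.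
  - eapply Rd_eq; [apply Rd_mult; [apply Rd_cos, D1 | apply (Rd_comp cosh); [exact D2 | apply is_derive_Reals, derivable_pt_lim_cosh]]|]. cbv beta. ring.
  - eapply Rd_eq; [apply Rd_opp, Rd_mult; [apply Rd_sin, D1 | apply (Rd_comp sinh); [exact D2 | apply is_derive_Reals, derivable_pt_lim_sinh]]|]. cbv beta. ring.
Qed.

Lemma Csin_0 : Csin (RtoC 0) = RtoC 0.
Proof. apply C_eq; simpl; rewrite ?sin_0, ?sinh_0; ring. Qed.

Lemma Ccos_0 : Ccos (RtoC 0) = RtoC 1.
Proof. apply C_eq; simpl; rewrite ?cos_0, ?cosh_0, ?sin_0; ring. Qed.

(** Identifying sin k / k and cos k with the solution for coefficient 1 gives them every property in
    [ode_family]; the removable singularity is the case k = 0, where the solution is r. *)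
Lemma sinc_cos_solution (k : C) (u v : R -> C) :
  (forall x, 0 <= x <= 1 -> cder u x (v x)) ->
  (forall x, 0 <= x <= 1 -> cder v x (- (k * k * (1 * u x)))%C) -> u 0 = 0 -> v 0 = 1 ->
  Csinc k = u 1 /\ Ccos k = v 1.
Proof.
  intros Hu Hv U0 V0.
  assert (Hone : forall x, continuous (fun _ : R => 1) x) by (intros; apply continuous_const).
  unfold Csinc. destruct Req_EM_T as [E|E].
  - change (Cmod k = 0) in E. apply Cmod_eq_0 in E. subst k.
    destruct (ode_unique (fun _ => 1) 0 1 0 0 (fun r => RtoC r - u r)%C (fun r => RtoC 1 - v r)%C Hone) with (x := 1) as [K1 K2]; auto; try lra.
    + intros x Hx. apply cder_minus; [|apply Hu, Hx]. split; simpl; [apply Rd_id | apply Rd_const].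
    + intros x Hx. eapply cder_eq; [apply cder_minus; [apply cder_const | apply Hv, Hx]|]. ring.
    + rewrite U0. ring.
    + rewrite V0. ring.
    + rewrite Ccos_0. split; apply Ceq_minus; assumption.
  - assert (Hk : k <> 0). { intros ->. apply E. exact Cmod_0. }
    destruct (ode_unique (fun _ => 1) 0 1 0 k (fun r => / k * Csin (r * k) - u r)%C (fun r => Ccos (r * k) - v r)%C Hone) with (x := 1) as [K1 K2]; auto; try lra.
    + intros x Hx. apply cder_minus; [|apply Hu, Hx]. eapply cder_eq; [apply cder_scal, cder_sin_line|]. field. exact Hk.
    + intros x Hx. eapply cder_eq; [apply cder_minus; [apply cder_cos_line | apply Hv, Hx]|]. field. exact Hk.
    + rewrite U0, Cmult_0_l, Csin_0. ring.
    + rewrite V0, Cmult_0_l, Ccos_0. ring.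
    + rewrite Cmult_1_l in K1, K2. split; [|apply Ceq_minus; exact K2].
      apply Ceq_minus. rewrite <- K1. change (@eq C (Csin k * / k - u 1)%C (/ k * Csin k - u 1)%C). generalize (Csin k : C). intros sk. ring.
Qed.

(** * Asymptotics of the solutions on the real and imaginary axes *)

Definition phase (e : R -> R) (r : R) : R := RInt (fun s => sqrt (e s)) 0 r.

Lemma phase_derive (e : R -> R) : (forall x, continuous e x) -> forall r, is_derive (phase e) r (sqrt (e r)).
Proof.
  intros He r. apply (is_derive_RInt_cont (fun s => sqrt (e s))). intros x.
  apply (continuous_comp e sqrt); [apply He | apply continuous_sqrt].
Qed.

(* q = e^(1/4), g = q'/q = e'/(4 e), mu = g / q^2 *)
Record wkb (e e1 q g mu mu1 : R -> R) (K : R) : Prop := {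
  wkb_K : 1 <= K;
  wkb_q : forall x, 0 <= x <= 1 -> is_derive q x (g x * q x);
  wkb_q0 : forall x, 0 <= x <= 1 -> 0 < q x;
  wkb_qlo : forall x, 0 <= x <= 1 -> 1 <= K * q x;
  wkb_qhi : forall x, 0 <= x <= 1 -> q x <= K;
  wkb_sqrt : forall x, 0 <= x <= 1 -> sqrt (e x) = q x ^ 2;
  wkb_e : forall x, 0 <= x <= 1 -> e x = q x ^ 4;
  wkb_g : forall x, 0 <= x <= 1 -> Rabs (g x) <= K;
  wkb_ge : forall x, 0 <= x <= 1 -> g x * (4 * e x) = e1 x;
  wkb_mu : forall x, 0 <= x <= 1 -> g x = mu x * q x ^ 2;
  wkb_dmu : forall x, 0 <= x <= 1 -> is_derive mu x (mu1 x);
  wkb_mub : forall x, 0 <= x <= 1 -> Rabs (mu x) <= K;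
  wkb_mu1b : forall x, 0 <= x <= 1 -> Rabs (mu1 x) <= K }.

Lemma Rd_sqrt (f : R -> R) (x l : R) : is_derive f x l -> 0 < f x -> is_derive (fun t => sqrt (f t)) x (l / (2 * sqrt (f x))).
Proof.
  intros H Hp. eapply Rd_eq; [apply (Rd_comp sqrt f x); [exact H | apply is_derive_Reals, derivable_pt_lim_sqrt, Hp]|].
  assert (0 < sqrt (f x)) by (apply sqrt_lt_R0, Hp). field. lra.
Qed.

Lemma Rd_inv (f : R -> R) (x l : R) : is_derive f x l -> f x <> 0 -> is_derive (fun t => / f t) x (- l / f x ^ 2).
Proof. intros. apply is_derive_inv; assumption. Qed.

Lemma is_derive_continuous (f : R -> R) (x l : R) : is_derive f x l -> continuous f x.
Proof. intros H. apply (ex_derive_continuous (V := R_NormedModule)). exists l. exact H. Qed.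

Lemma wkb_exists (e e1 e2 : R -> R) : profile e e1 e2 -> exists q g mu mu1 K, wkb e e1 q g mu mu1 K.
Proof.
  intros [Hc Hd1 Hd2 Hpos (B2 & HB2)].
  set (q := fun x => sqrt (sqrt (e x))). set (g := fun x => e1 x / (4 * e x)).
  set (mu := fun x => e1 x / (4 * e x) * / sqrt (e x)).
  set (mu1 := fun x => e2 x * / (4 * e x) * / sqrt (e x) + e1 x * (- (4 * e1 x) / (4 * e x) ^ 2 * / sqrt (e x)
      + / (4 * e x) * (- (e1 x / (2 * sqrt (e x))) / sqrt (e x) ^ 2))).
  assert (Hs : forall x, 0 <= x <= 1 -> 0 < sqrt (e x)) by (intros; apply sqrt_lt_R0, Hpos; assumption).
  assert (Hq : forall x, 0 <= x <= 1 -> 0 < q x) by (intros; apply sqrt_lt_R0, Hs; assumption).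
  assert (Hq2 : forall x, 0 <= x <= 1 -> sqrt (e x) = q x ^ 2) by (intros x Hx; unfold q; rewrite pow2_sqrt; [reflexivity | left; apply Hs, Hx]).
  assert (He2 : forall x, 0 <= x <= 1 -> e x = sqrt (e x) ^ 2) by (intros x Hx; rewrite pow2_sqrt; [reflexivity | left; apply Hpos, Hx]).
  assert (Ce1 : forall x, 0 <= x <= 1 -> continuous e1 x) by (intros x Hx; apply is_derive_continuous with (e2 x), Hd2, Hx).
  assert (Dq : forall x, 0 <= x <= 1 -> is_derive q x (g x * q x)).
  { intros x Hx. eapply Rd_eq.
    - apply Rd_sqrt; [apply Rd_sqrt; [apply Hd1, Hx | apply Hpos, Hx] | apply Hs, Hx].
    - unfold g. fold (q x). specialize (Hq x Hx). rewrite (He2 x Hx) at 2. rewrite (Hq2 x Hx). field. lra. }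
  assert (Dmu : forall x, 0 <= x <= 1 -> is_derive mu x (mu1 x)).
  { intros x Hx. pose proof (Hpos x Hx). pose proof (Hs x Hx).
    apply (Rd_ext (fun x => e1 x * (/ (4 * e x) * / sqrt (e x)))). { intros; unfold mu, Rdiv; ring. }
    eapply Rd_eq.
    - apply Rd_mult; [apply Hd2, Hx|]. apply Rd_mult.
      + apply Rd_inv; [apply Rd_scal, Hd1, Hx | lra].
      + apply Rd_inv; [apply Rd_sqrt; [apply Hd1, Hx | lra] | lra].
    - unfold mu1. ring. }
  assert (Cinv1 : forall x, 0 <= x <= 1 -> continuous (fun x => / q x) x).
  { intros x Hx. eapply is_derive_continuous. apply Rd_inv; [apply Dq, Hx|]. specialize (Hq x Hx). lra. }
  destruct (cont_bounded q 0 1) as (K1 & _ & HK1); [lra | intros x Hx; apply is_derive_continuous with (g x * q x), Dq, Hx |].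
  destruct (cont_bounded (fun x => / q x) 0 1) as (K2 & _ & HK2); [lra | exact Cinv1 |].
  destruct (cont_bounded e1 0 1) as (K3 & K3p & HK3); [lra | exact Ce1 |].
  destruct (cont_bounded mu 0 1) as (K5 & _ & HK5); [lra | intros x Hx; apply is_derive_continuous with (mu1 x), Dmu, Hx |].
  assert (Dinv : forall x, 0 <= x <= 1 -> continuous (fun x => / e x) x).
  { intros x Hx. eapply is_derive_continuous. apply Rd_inv; [apply Hd1, Hx|]. specialize (Hpos x Hx). lra. }
  assert (Dsinv : forall x, 0 <= x <= 1 -> continuous (fun x => / sqrt (e x)) x).
  { intros x Hx. eapply is_derive_continuous. apply Rd_inv; [apply Rd_sqrt; [apply Hd1, Hx | apply Hpos, Hx]|]. specialize (Hs x Hx). lra. }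
  destruct (cont_bounded (fun x => / e x) 0 1) as (I1 & I1p & HI1); [lra | exact Dinv |].
  destruct (cont_bounded (fun x => / sqrt (e x)) 0 1) as (I2 & I2p & HI2); [lra | exact Dsinv |].
  assert (B2p : 0 <= B2) by (apply Rle_trans with (2 := HB2 0 ltac:(lra)); apply Rabs_pos).
  set (K6 := B2 * I1 * I2 + K3 * (K3 * (I1 * I1) * I2 + I1 * (K3 * (I2 * (I2 * I2))))).
  assert (K6p : 0 <= K6).
  { unfold K6. assert (0 <= B2 * I1 * I2) by (repeat apply Rmult_le_pos; auto).
    assert (0 <= K3 * (I1 * I1) * I2 + I1 * (K3 * (I2 * (I2 * I2)))).
    { apply Rplus_le_le_0_compat; repeat apply Rmult_le_pos; auto. }
    nra. }
  assert (K1p : 0 <= K1) by (apply Rle_trans with (2 := HK1 0 ltac:(lra)); apply Rabs_pos).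
  assert (K2p : 0 <= K2) by (apply Rle_trans with (2 := HK2 0 ltac:(lra)); apply Rabs_pos).
  assert (K5p : 0 <= K5) by (apply Rle_trans with (2 := HK5 0 ltac:(lra)); apply Rabs_pos).
  assert (K4p : 0 <= K3 * I1) by (apply Rmult_le_pos; auto).
  exists q, g, mu, mu1, (1 + K1 + K2 + K3 * I1 + K5 + K6). split.
  - lra.
  - exact Dq.
  - exact Hq.
  - intros x Hx. specialize (HK2 x Hx). specialize (Hq x Hx). rewrite Rabs_pos_eq in HK2 by (left; apply Rinv_0_lt_compat; lra).
    apply Rle_trans with (/ q x * q x); [right; field; lra|]. apply Rmult_le_compat_r; lra.
  - intros x Hx. specialize (HK1 x Hx). apply Rle_trans with (1 := Rle_abs _). lra.
  - exact Hq2.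
  - intros x Hx. rewrite (He2 x Hx), (Hq2 x Hx). ring.
  - intros x Hx. apply Rle_trans with (K3 * I1); [|lra]. unfold g.
    replace (e1 x / (4 * e x)) with (/ 4 * (e1 x * / e x)) by (field; specialize (Hpos x Hx); lra).
    rewrite 2!Rabs_mult, Rabs_pos_eq by lra.
    assert (Rabs (e1 x) * Rabs (/ e x) <= K3 * I1) by (apply Rmult_le_compat; auto using Rabs_pos).
    pose proof (Rabs_pos (e1 x)). pose proof (Rabs_pos (/ e x)). nra.
  - intros x Hx. unfold g. field. specialize (Hpos x Hx). lra.
  - intros x Hx. unfold g, mu. rewrite <- (Hq2 x Hx). field. specialize (Hpos x Hx). specialize (Hs x Hx). lra.
  - exact Dmu.
  - intros x Hx. apply Rle_trans with (1 := HK5 x Hx). lra.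
  - intros x Hx. apply Rle_trans with K6; [|lra]. unfold mu1.
    pose proof (Hpos x Hx) as P. pose proof (Hs x Hx) as P'.
    replace (e2 x * / (4 * e x) * / sqrt (e x) + e1 x * (- (4 * e1 x) / (4 * e x) ^ 2 * / sqrt (e x)
      + / (4 * e x) * (- (e1 x / (2 * sqrt (e x))) / sqrt (e x) ^ 2)))
      with (/ 4 * (e2 x * / e x * / sqrt (e x)) + e1 x * (- / 4 * (e1 x * (/ e x * / e x) * / sqrt (e x))
      + - / 8 * (/ e x * (e1 x * (/ sqrt (e x) * (/ sqrt (e x) * / sqrt (e x))))))) by (field; lra).
    specialize (HB2 x Hx). specialize (HI1 x Hx). specialize (HI2 x Hx). specialize (HK3 x Hx).
    assert (Sc : forall c t B, Rabs c <= 1 -> Rabs t <= B -> Rabs (c * t) <= B).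
    { intros c t B Hcc Ht. rewrite Rabs_mult. pose proof (Rabs_pos t). pose proof (Rabs_pos c). nra. }
    assert (Pr : forall s t A B, Rabs s <= A -> Rabs t <= B -> Rabs (s * t) <= A * B).
    { intros s t A B Hs' Ht. rewrite Rabs_mult. apply Rmult_le_compat; auto using Rabs_pos. }
    assert (Sm : forall s t A B, Rabs s <= A -> Rabs t <= B -> Rabs (s + t) <= A + B).
    { intros s t A B Hs' Ht. apply Rle_trans with (1 := Rabs_triang _ _). lra. }
    unfold K6. apply Sm.
    + apply Sc; [rewrite Rabs_pos_eq; lra|]. apply Pr; auto.
    + apply Pr; [auto|]. apply Sm.
      * apply Sc; [rewrite Rabs_Ropp, Rabs_pos_eq; lra|]. auto.
      * apply Sc; [rewrite Rabs_Ropp, Rabs_pos_eq; lra|]. auto.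
Qed.

(** * Bounds and asymptotics for real k *)

Section Axes.
Variables (e e1 q g mu mu1 : R -> R) (K : R).
Hypothesis He : forall x, continuous e x.
Hypothesis W : wkb e e1 q g mu mu1 K.

Lemma le_of_sqr (a b c : R) : 0 <= b -> c <= b ^ 2 -> a ^ 2 <= c -> Rabs a <= b.
Proof. intros Hb Hc Ha. apply Rabs_le. split; nra. Qed.

(** Shared by both axes: since 1/K <= q <= K, the energy (k q y)^2 + (y'/q)^2 is comparable with k^2
    y^2 + y'^2. The growth factor E appears squared because it multiplies an energy. *)
Lemma energy_bounds (k y yp y0 yp0 x c E : R) : 0 <= x <= 1 -> 0 <= c <= 1 -> 0 <= E ->
  (k * q x * y) ^ 2 + (yp / q x) ^ 2 <= ((k * q c * y0) ^ 2 + (yp0 / q c) ^ 2) * E ^ 2 ->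
  Rabs (k * y) <= K ^ 2 * E * (Rabs (k * y0) + Rabs yp0) /\ Rabs yp <= K ^ 2 * E * (Rabs (k * y0) + Rabs yp0).
Proof.
  intros Hx Hc HE H.
  destruct W as [HK _ Hq Hlo Hhi _ _ _ _ _ _ _ _].
  pose proof (Hq x Hx) as Qx. pose proof (Hq c Hc) as Qc. pose proof (Hlo x Hx). pose proof (Hhi x Hx).
  pose proof (Hlo c Hc). pose proof (Hhi c Hc).
  set (B := Rabs (k * y0) + Rabs yp0).
  pose proof (Rabs_pos (k * y0)) as A1. pose proof (Rabs_pos yp0) as A2.
  assert (HB : 0 <= B) by (unfold B; lra).
  assert (N0 : (k * q c * y0) ^ 2 + (yp0 / q c) ^ 2 <= (K * B) ^ 2).
  { assert (T1 : (k * q c * y0) ^ 2 <= (K * Rabs (k * y0)) ^ 2).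
    { replace (k * q c * y0) with (q c * (k * y0)) by ring. rewrite (Rpow_mult_distr (q c)), (Rpow_mult_distr K), pow2_abs.
      apply Rmult_le_compat_r; [apply pow2_ge_0|]. apply pow_incr. lra. }
    assert (T2 : (yp0 / q c) ^ 2 <= (K * Rabs yp0) ^ 2).
    { unfold Rdiv. rewrite (Rpow_mult_distr yp0), (Rpow_mult_distr K), pow2_abs, Rmult_comm.
      apply Rmult_le_compat_r; [apply pow2_ge_0|]. apply pow_incr. split; [left; apply Rinv_0_lt_compat, Qc|].
      apply Rmult_le_reg_r with (q c); [exact Qc|]. rewrite Rinv_l by lra. lra. }
    apply Rle_trans with (1 := Rplus_le_compat _ _ _ _ T1 T2).
    unfold B. assert (0 <= K * Rabs (k * y0) * (K * Rabs yp0)) by (apply Rmult_le_pos; nra). nra. }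
  assert (HKE : 0 <= K * B * E) by (apply Rmult_le_pos; [nra | exact HE]).
  assert (N1 : (k * q x * y) ^ 2 + (yp / q x) ^ 2 <= (K * B * E) ^ 2).
  { apply Rle_trans with (1 := H). rewrite (Rpow_mult_distr (K * B) E). apply Rmult_le_compat_r; [apply pow2_ge_0 | exact N0]. }
  pose proof (pow2_ge_0 (k * q x * y)). pose proof (pow2_ge_0 (yp / q x)).
  assert (U : Rabs (k * q x * y) <= K * B * E) by (apply (le_of_sqr _ _ ((K * B * E) ^ 2)); lra).
  assert (V : Rabs (yp / q x) <= K * B * E) by (apply (le_of_sqr _ _ ((K * B * E) ^ 2)); lra).
  split.
  - replace (k * q x * y) with (q x * (k * y)) in U by ring. rewrite Rabs_mult, (Rabs_pos_eq (q x)) in U by lra.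
    pose proof (Rabs_pos (k * y)). apply Rle_trans with (K * (q x * Rabs (k * y))); nra.
  - unfold Rdiv in V. rewrite Rabs_mult, (Rabs_pos_eq (/ q x)) in V by (left; apply Rinv_0_lt_compat, Qx).
    pose proof (Rabs_pos yp). replace (Rabs yp) with (q x * (Rabs yp * / q x)) by (field; lra).
    assert (0 <= Rabs yp * / q x) by (apply Rmult_le_pos; [lra | left; apply Rinv_0_lt_compat, Qx]).
    apply Rle_trans with (K * (K * B * E)); [apply Rmult_le_compat; lra | right; ring].
Qed.

Section RealAxis.
Variables (k : R) (y yp : R -> R).
Hypothesis Dy : forall x, 0 <= x <= 1 -> is_derive y x (yp x).
Hypothesis Dyp : forall x, 0 <= x <= 1 -> is_derive yp x (- (k * k * (e x * y x))).

(** With U = k q y and V = y'/q the equation is a rotation of speed k q^2, which is k times the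
    derivative of the phase, perturbed by g U and - g V. The rotation drops out of U^2 + V^2, so the
    growth on the real axis is bounded uniformly in k. *)
Lemma dU x : 0 <= x <= 1 -> is_derive (fun x => k * q x * y x) x (k * q x ^ 2 * (yp x / q x) + g x * (k * q x * y x)).
Proof.
  intros Hx. pose proof W as [HK Dq Hq Hlo Hhi Hsq Hee Hg Hge Hmu Dmu Hmub Hmu1]. eapply Rd_eq; [apply Rd_mult; [apply Rd_scal; auto | auto]|].
  specialize (Hq x Hx). cbv beta. field. lra.
Qed.

Lemma dV x : 0 <= x <= 1 -> is_derive (fun x => yp x / q x) x (- (k * q x ^ 2 * (k * q x * y x)) - g x * (yp x / q x)).
Proof.
  intros Hx. pose proof W as [HK Dq Hq Hlo Hhi Hsq Hee Hg Hge Hmu Dmu Hmub Hmu1]. specialize (Hq x Hx).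
  eapply Rd_eq; [apply Rd_mult; [auto | apply Rd_inv; [auto | lra]]|].
  cbv beta. rewrite (Hee x Hx). field. lra.
Qed.

Lemma real_axis_bound c x : 0 <= c <= 1 -> 0 <= x <= 1 ->
  Rabs (k * y x) <= K ^ 2 * exp K * (Rabs (k * y c) + Rabs (yp c)) /\ Rabs (yp x) <= K ^ 2 * exp K * (Rabs (k * y c) + Rabs (yp c)).
Proof.
  intros Hc Hx. pose proof W as [HK _ _ _ _ _ _ Hg _ _ _ _ _].
  apply (energy_bounds k (y x) (yp x) (y c) (yp c) x c); auto. { left; apply exp_pos. }
  apply Rle_trans with (((k * q c * y c) ^ 2 + (yp c / q c) ^ 2) * exp (Rabs (2 * K * x - 2 * K * c))).
  - apply (gronwall (fun x => (k * q x * y x) ^ 2 + (yp x / q x) ^ 2)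
      (fun x => 2 * ((k * q x * y x) * (k * q x ^ 2 * (yp x / q x) + g x * (k * q x * y x)) + (yp x / q x) * (- (k * q x ^ 2 * (k * q x * y x)) - g x * (yp x / q x))))
      (fun x => 2 * K * x) (fun _ => 2 * K * 1) 0 1); auto.
    + intros r Hr. apply (sq_sum_derive (fun x => k * q x * y x) (fun x => yp x / q x)); [apply dU, Hr | apply dV, Hr].
    + intros r _. apply Rd_scal, Rd_id.
    + intros r _. pose proof (pow2_ge_0 (k * q r * y r)). pose proof (pow2_ge_0 (yp r / q r)). lra.
    + intros r Hr. specialize (Hg r Hr). set (U := k * q r * y r). set (V := yp r / q r).
      replace (2 * (U * (k * q r ^ 2 * V + g r * U) + V * (- (k * q r ^ 2 * U) - g r * V))) with (g r * (2 * (U ^ 2 - V ^ 2))) by ring.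
      rewrite Rabs_mult. pose proof (pow2_ge_0 U). pose proof (pow2_ge_0 V).
      replace (2 * K * 1 * (U ^ 2 + V ^ 2)) with (K * (2 * (U ^ 2 + V ^ 2))) by ring.
      apply Rmult_le_compat; auto using Rabs_pos. apply Rabs_le. lra.
  - apply Rmult_le_compat_l.
    + pose proof (pow2_ge_0 (k * q c * y c)). pose proof (pow2_ge_0 (yp c / q c)). lra.
    + simpl. rewrite Rmult_1_r, <- exp_plus. apply exp_mono. apply Rabs_le. nra.
Qed.

(** In a frame turned by psi the rotation disappears and Th' = g (sin psi U - cos psi V), bounded
    but not small. It oscillates, and one integration by parts gains 1/k. The combination on the
    left is the one in which F is expressed for real k. *)
Lemma real_axis_asymptotics : 0 < k -> e 1 = 1 -> y 0 = 0 -> yp 0 = 1 ->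
  Rabs (k * sin k * y 1 + cos k * yp 1 - cos (k * (phase e 1 - 1)) / q 0) <= 4 * K ^ 5 * exp K / k.
Proof.
  intros Hk He1 Y0 YP0. pose proof W as [HK Dq Hq Hlo Hhi Hsq Hee Hg _ Hmu Dmu Hmub Hmu1].
  (* Normalised so that psi(1) = k and psi(0) = - k (a - 1): the former produces sin k and cos k,
     the latter the cosine in the limit. *)
  set (a := phase e 1). set (psi := fun x => k * (phase e x - (a - 1))).
  set (U := fun x => k * q x * y x). set (V := fun x => yp x / q x).
  assert (Dpsi : forall x, 0 <= x <= 1 -> is_derive psi x (k * q x ^ 2)).
  { intros x Hx. eapply Rd_eq; [apply Rd_scal, Rd_minus; [apply phase_derive, He | apply Rd_const]|]. rewrite Hsq by exact Hx. ring. }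
  assert (Q1 : q 1 = 1).
  { assert (H1 : q 1 ^ 2 = 1) by (rewrite <- Hsq, He1 by lra; apply sqrt_1). pose proof (Hq 1 ltac:(lra)). nra. }
  set (Th := fun x => cos (psi x) * V x + sin (psi x) * U x).
  set (A := fun x => sin (psi x) * V x + cos (psi x) * U x).
  (* The integration by parts. A' = 2 k q^2 (cos psi V - sin psi U) + g (cos psi U - sin psi V) and
     g = mu q^2, so mu A / (2 k) cancels Th' and every remaining term carries 1/k. *)
  set (Co := fun x => Th x + / (2 * k) * (mu x * A x)).
  set (Co' := fun x => / (2 * k) * (mu1 x * A x + mu x * (g x * (cos (psi x) * U x - sin (psi x) * V x)))).
  assert (DCo : forall x, 0 <= x <= 1 -> is_derive Co x (Co' x)).
  { intros x Hx. pose proof (dU x Hx) as dUx. pose proof (dV x Hx) as dVx. fold U in dUx. fold V in dVx.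
    eapply Rd_eq.
    - apply Rd_plus.
      + apply Rd_plus; apply Rd_mult; [apply Rd_cos, Dpsi, Hx | exact dVx | apply Rd_sin, Dpsi, Hx | exact dUx].
      + apply Rd_scal, Rd_mult; [apply Dmu, Hx|].
        apply Rd_plus; apply Rd_mult; [apply Rd_sin, Dpsi, Hx | exact dVx | apply Rd_cos, Dpsi, Hx | exact dUx].
    - unfold Co', A. fold (U x). fold (V x). rewrite (Hmu x Hx). field. lra. }
  set (M := K ^ 2 * exp K).
  assert (HM : 0 <= M) by (unfold M; apply Rmult_le_pos; [apply pow2_ge_0 | left; apply exp_pos]).
  assert (HUV : forall x, 0 <= x <= 1 -> Rabs (U x) + Rabs (V x) <= 2 * K * M).
  { intros x Hx. destruct (real_axis_bound 0 x ltac:(lra) Hx) as [B1 B2]. fold M in B1, B2.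
    rewrite Y0, YP0, Rmult_0_r, Rabs_R0, Rabs_R1 in B1, B2.
    assert (Rabs (U x) <= K * M).
    { unfold U. replace (k * q x * y x) with (q x * (k * y x)) by ring. rewrite Rabs_mult, (Rabs_pos_eq (q x)) by (left; apply Hq, Hx).
      apply Rmult_le_compat; auto using Rabs_pos; [left; apply Hq, Hx | lra]. }
    assert (Rabs (V x) <= K * M).
    { unfold V, Rdiv. rewrite Rabs_mult, Rmult_comm. pose proof (Hq x Hx).
      rewrite Rabs_pos_eq by (left; apply Rinv_0_lt_compat; lra).
      apply Rmult_le_compat; auto using Rabs_pos; [left; apply Rinv_0_lt_compat; lra | | lra].
      specialize (Hlo x Hx). apply Rmult_le_reg_r with (q x); [lra|]. rewrite Rinv_l by lra. lra. }
    lra. }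
  assert (Htr : forall s t c d, Rabs c <= 1 -> Rabs d <= 1 -> Rabs (c * s + d * t) <= Rabs s + Rabs t).
  { intros s t c d Hc Hd. apply Rle_trans with (1 := Rabs_triang _ _). rewrite 2!Rabs_mult.
    pose proof (Rabs_pos s). pose proof (Rabs_pos t). nra. }
  assert (Hsin : forall t, Rabs (sin t) <= 1) by (intros; apply Rabs_le, SIN_bound).
  assert (Hcos : forall t, Rabs (cos t) <= 1) by (intros; apply Rabs_le, COS_bound).
  assert (HA : forall x, 0 <= x <= 1 -> Rabs (A x) <= 2 * K * M).
  { intros x Hx. apply Rle_trans with (2 := HUV x Hx). rewrite Rplus_comm. apply Htr; auto. }
  assert (HB : forall x, 0 <= x <= 1 -> Rabs (cos (psi x) * U x - sin (psi x) * V x) <= 2 * K * M).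
  { intros x Hx. apply Rle_trans with (2 := HUV x Hx).
    replace (cos (psi x) * U x - sin (psi x) * V x) with (cos (psi x) * U x + (- sin (psi x)) * V x) by ring.
    apply Htr; auto. rewrite Rabs_Ropp. apply Hsin. }
  set (b := / (2 * k) * (2 * K ^ 3 * (2 * M))).
  assert (H2k : 0 < / (2 * k)) by (apply Rinv_0_lt_compat; lra).
  assert (HCo' : forall x, 0 <= x <= 1 -> Rabs (Co' x) <= b).
  { intros x Hx. unfold Co', b. rewrite Rabs_mult, (Rabs_pos_eq (/ (2 * k))) by lra.
    apply Rmult_le_compat_l; [lra|]. apply Rle_trans with (1 := Rabs_triang _ _). rewrite !Rabs_mult.
    specialize (HA x Hx). specialize (HB x Hx). specialize (Hmub x Hx). specialize (Hmu1 x Hx). specialize (Hg x Hx).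
    assert (T1 : Rabs (mu1 x) * Rabs (A x) <= K * (2 * K * M)) by (apply Rmult_le_compat; auto using Rabs_pos).
    assert (T2 : Rabs (mu x) * (Rabs (g x) * Rabs (cos (psi x) * U x - sin (psi x) * V x)) <= K * (K * (2 * K * M))).
    { apply Rmult_le_compat; auto using Rabs_pos; [apply Rmult_le_pos; apply Rabs_pos|]. apply Rmult_le_compat; auto using Rabs_pos. }
    assert (0 <= K * K * M) by (apply Rmult_le_pos; nra). nra. }
  assert (HD : Rabs (Co 1 - Co 0) <= b).
  { pose proof (le_of_derive_le Co (fun x => b * x) Co' (fun _ => b * 1) 0 1 ltac:(lra) DCo (fun x _ => Rd_scal b _ x 1 (Rd_id x))
      ltac:(intros x Hx; specialize (HCo' x Hx); apply Rabs_le_between in HCo'; lra)) as L1.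
    pose proof (le_of_derive_le (fun x => - Co x) (fun x => b * x) (fun x => - Co' x) (fun _ => b * 1) 0 1 ltac:(lra)
      (fun x Hx => Rd_opp _ _ _ (DCo x Hx)) (fun x _ => Rd_scal b _ x 1 (Rd_id x))
      ltac:(intros x Hx; specialize (HCo' x Hx); apply Rabs_le_between in HCo'; lra)) as L2.
    apply Rabs_le. lra. }
  assert (HE : forall x, 0 <= x <= 1 -> Rabs (/ (2 * k) * (mu x * A x)) <= / (2 * k) * (K * (2 * K * M))).
  { intros x Hx. rewrite 2!Rabs_mult, (Rabs_pos_eq (/ (2 * k))) by lra. apply Rmult_le_compat_l; [lra|].
    apply Rmult_le_compat; auto using Rabs_pos. }
  assert (T1 : Th 1 = k * sin k * y 1 + cos k * yp 1).
  { unfold Th, U, V, psi. fold a. replace (k * (a - (a - 1))) with k by ring. rewrite Q1. field. }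
  assert (T0 : Th 0 = cos (k * (a - 1)) / q 0).
  { unfold Th, U, V, psi. rewrite Y0, YP0. unfold phase. rewrite RInt_point. unfold zero; simpl.
    replace (k * (0 - (a - 1))) with (- (k * (a - 1))) by ring. rewrite cos_neg. unfold Rdiv. ring. }
  rewrite <- T1, <- T0.
  replace (Th 1 - Th 0) with ((Co 1 - Co 0) + (/ (2 * k) * (mu 0 * A 0) - / (2 * k) * (mu 1 * A 1))) by (unfold Co; ring).
  pose proof (HE 0 ltac:(lra)) as E0. pose proof (HE 1 ltac:(lra)) as E1.
  apply Rle_trans with (1 := Rabs_triang _ _).
  assert (E2 : Rabs (/ (2 * k) * (mu 0 * A 0) - / (2 * k) * (mu 1 * A 1)) <= 2 * (/ (2 * k) * (K * (2 * K * M)))).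
  { unfold Rminus. apply Rle_trans with (1 := Rabs_triang _ _). rewrite Rabs_Ropp. lra. }
  apply Rle_trans with (b + 2 * (/ (2 * k) * (K * (2 * K * M)))); [lra|].
  unfold b. replace (4 * K ^ 5 * exp K / k) with (/ (2 * k) * (8 * (K ^ 3 * M))) by (unfold M; field; lra).
  replace (/ (2 * k) * (2 * K ^ 3 * (2 * M)) + 2 * (/ (2 * k) * (K * (2 * K * M))))
    with (/ (2 * k) * (4 * (K ^ 3 * M) + 4 * (K ^ 2 * M))) by ring.
  apply Rmult_le_compat_l; [lra|].
  assert (K ^ 2 * M <= K ^ 3 * M). { apply Rmult_le_compat_r; [exact HM|]. apply Rle_pow; [exact HK | lia]. }
  lra.
Qed.
End RealAxis.
End Axes.

(** * Growth for imaginary k *)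

Lemma pow_exp_small (n : nat) (del c : R) : 0 < del -> 0 < c ->
  exists t0, 0 < t0 /\ forall t, t0 <= t -> t ^ n * exp (- (del * t)) <= c.
Proof.
  intros Hd Hc. set (N := INR (S n)). assert (HN : 0 < N) by (apply lt_0_INR; lia).
  set (M := (N / del) ^ S n). assert (HM : 0 < M) by (apply pow_lt, Rdiv_lt_0_compat; assumption).
  exists (M / c). split; [apply Rdiv_lt_0_compat; assumption|]. intros t Ht.
  assert (Ht0 : 0 < t) by (apply Rlt_le_trans with (2 := Ht), Rdiv_lt_0_compat; assumption).
  assert (E : exp (del * t) = exp (del * t / N) ^ S n).
  { rewrite <- Rpower_pow by apply exp_pos. unfold Rpower. rewrite ln_exp. f_equal. fold N. field. lra. }
  assert (L : (del * t / N) ^ S n <= exp (del * t)).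
  { rewrite E. apply pow_incr. split.
    - left. apply Rdiv_lt_0_compat; [nra | lra].
    - pose proof (exp_ineq1_le (del * t / N)). lra. }
  rewrite exp_Ropp. apply Rmult_le_reg_r with (exp (del * t)); [apply exp_pos|].
  pose proof (exp_pos (del * t)). rewrite Rmult_assoc, Rinv_l, Rmult_1_r by lra.
  apply Rle_trans with (c * (del * t / N) ^ S n); [|apply Rmult_le_compat_l; lra].
  replace (c * (del * t / N) ^ S n) with (c * t / M * t ^ n).
  - assert (1 <= c * t / M).
    { apply Rmult_le_reg_r with M; [exact HM|]. unfold Rdiv. rewrite Rmult_assoc, Rinv_l, Rmult_1_r by lra.
      apply Rle_trans with (c * (M / c)); [right; field; lra | apply Rmult_le_compat_l; lra]. }
    assert (0 <= t ^ n) by (apply pow_le; lra). nra.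
  - unfold M. replace (del * t / N) with (t / (N / del)) by (field; lra).
    set (A := N / del). unfold Rdiv. rewrite (Rpow_mult_distr t), pow_inv. change (t ^ S n) with (t * t ^ n). ring.
Qed.

Section Imag.
Variables (e e1 q g mu mu1 : R -> R) (K : R).
Hypothesis He : forall x, continuous e x.
Hypothesis W : wkb e e1 q g mu mu1 K.

Lemma phase_mono x y : 0 <= x -> x <= y -> y <= 1 -> phase e x <= phase e y.
Proof.
  intros Hx Hxy Hy.
  pose proof (le_of_derive_le (fun _ => 0) (phase e) (fun _ => 0) (fun r => sqrt (e r)) x y Hxy
    (fun r _ => Rd_const 0 r) (fun r _ => phase_derive e He r) (fun r _ => sqrt_pos (e r))) as L. lra.
Qed.

Lemma phase_lip x y : 0 <= x -> x <= y -> y <= 1 -> phase e y - phase e x <= K ^ 2 * (y - x).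
Proof.
  intros Hx Hxy Hy. pose proof W as [HK Dq Hq Hlo Hhi Hsq Hee Hg Hge Hmu Dmu Hmub Hmu1].
  pose proof (le_of_derive_le (phase e) (fun t => K ^ 2 * t) (fun r => sqrt (e r)) (fun _ => K ^ 2 * 1) x y Hxy
    (fun r _ => phase_derive e He r) (fun r _ => Rd_scal (K ^ 2) _ r 1 (Rd_id r))) as L.
  assert (phase e y - phase e x <= K ^ 2 * y - K ^ 2 * x); [|lra].
  apply L. intros r Hr. rewrite Hsq by lra. rewrite Rmult_1_r. apply pow_incr.
  split; [left; apply Hq; lra | apply Hhi; lra].
Qed.

Lemma phase_strict x : 0 <= x < 1 -> phase e x < phase e 1.
Proof.
  intros Hx. pose proof W as [HK Dq Hq Hlo Hhi Hsq Hee Hg Hge Hmu Dmu Hmub Hmu1].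
  pose proof (le_of_derive_le (fun t => (/ K) ^ 2 * t) (phase e) (fun _ => (/ K) ^ 2 * 1) (fun r => sqrt (e r)) x 1 ltac:(lra)
    (fun r _ => Rd_scal ((/ K) ^ 2) _ r 1 (Rd_id r)) (fun r _ => phase_derive e He r)) as L.
  assert (Kp : 0 < / K) by (apply Rinv_0_lt_compat; lra).
  assert (L' : (/ K) ^ 2 * 1 - (/ K) ^ 2 * x <= phase e 1 - phase e x).
  { apply L. intros r Hr. rewrite Hsq by lra. rewrite Rmult_1_r. apply pow_incr. split; [lra|].
    specialize (Hlo r ltac:(lra)). apply Rmult_le_reg_l with K; [lra|]. rewrite Rinv_r by lra. exact Hlo. }
  assert (0 < (/ K) ^ 2) by (apply pow_lt, Kp). nra.
Qed.

Section Solution.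
Variables (t : R) (y yp : R -> R).
Hypothesis Ht : 0 < t.
Hypothesis Dy : forall x, 0 <= x <= 1 -> is_derive y x (yp x).
Hypothesis Dyp : forall x, 0 <= x <= 1 -> is_derive yp x (t * t * (e x * y x)).

Let P (x : R) : R := t * q x * y x.
Let V (x : R) : R := yp x / q x.

Lemma dP x : 0 <= x <= 1 -> is_derive P x (t * q x ^ 2 * V x + g x * P x).
Proof.
  intros Hx. pose proof W as [HK Dq Hq Hlo Hhi Hsq Hee Hg Hge Hmu Dmu Hmub Hmu1]. unfold P, V. eapply Rd_eq; [apply Rd_mult; [apply Rd_scal; auto | auto]|].
  specialize (Hq x Hx). cbv beta. field. lra.
Qed.

Lemma dVi x : 0 <= x <= 1 -> is_derive V x (t * q x ^ 2 * P x - g x * V x).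
Proof.
  intros Hx. pose proof W as [HK Dq Hq Hlo Hhi Hsq Hee Hg Hge Hmu Dmu Hmub Hmu1]. specialize (Hq x Hx). unfold V, P.
  eapply Rd_eq; [apply Rd_mult; [auto | apply Rd_inv; [auto | lra]]|].
  cbv beta. rewrite (Hee x Hx). field. lra.
Qed.

Lemma imag_energy c x : 0 <= c <= 1 -> 0 <= x <= 1 ->
  P x ^ 2 + V x ^ 2 <= (P c ^ 2 + V c ^ 2) * exp (Rabs ((2 * t * phase e x + 2 * K * x) - (2 * t * phase e c + 2 * K * c))).
Proof.
  intros Hc Hx. pose proof W as [HK _ _ _ _ Hsq _ Hg _ _ _ _ _].
  apply (gronwall (fun x => P x ^ 2 + V x ^ 2)
      (fun x => 2 * (P x * (t * q x ^ 2 * V x + g x * P x) + V x * (t * q x ^ 2 * P x - g x * V x)))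
      (fun x => 2 * t * phase e x + 2 * K * x) (fun x => 2 * t * sqrt (e x) + 2 * K * 1) 0 1); auto.
  - intros r Hr. apply (sq_sum_derive P V); [apply dP, Hr | apply dVi, Hr].
  - intros r _. apply Rd_plus; apply Rd_scal; [apply phase_derive, He | apply Rd_id].
  - intros r _. pose proof (pow2_ge_0 (P r)). pose proof (pow2_ge_0 (V r)). lra.
  - intros r Hr. rewrite Hsq by exact Hr. specialize (Hg r Hr).
    replace (2 * (P r * (t * q r ^ 2 * V r + g r * P r) + V r * (t * q r ^ 2 * P r - g r * V r)))
      with (t * q r ^ 2 * (2 * (2 * P r * V r)) + g r * (2 * (P r ^ 2 - V r ^ 2))) by ring.
    apply Rle_trans with (1 := Rabs_triang _ _). rewrite (Rabs_mult (t * q r ^ 2)), (Rabs_mult (g r)).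
    assert (Htq : 0 <= t * q r ^ 2) by (apply Rmult_le_pos; [lra | apply pow2_ge_0]).
    rewrite (Rabs_pos_eq (t * q r ^ 2)) by exact Htq.
    pose proof (pow2_ge_0 (P r)). pose proof (pow2_ge_0 (V r)).
    pose proof (pow2_ge_0 (P r - V r)). pose proof (pow2_ge_0 (P r + V r)).
    assert (T1 : t * q r ^ 2 * Rabs (2 * (2 * P r * V r)) <= t * q r ^ 2 * (2 * (P r ^ 2 + V r ^ 2))).
    { apply Rmult_le_compat_l; [exact Htq|]. apply Rabs_le. nra. }
    assert (T2 : Rabs (g r) * Rabs (2 * (P r ^ 2 - V r ^ 2)) <= K * (2 * (P r ^ 2 + V r ^ 2))).
    { apply Rmult_le_compat; auto using Rabs_pos. apply Rabs_le. lra. }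
    lra.
Qed.

Lemma imag_axis_bound c x : 0 <= c <= 1 -> 0 <= x <= 1 ->
  Rabs (t * y x) <= K ^ 2 * exp (K + t * Rabs (phase e x - phase e c)) * (Rabs (t * y c) + Rabs (yp c)) /\
  Rabs (yp x) <= K ^ 2 * exp (K + t * Rabs (phase e x - phase e c)) * (Rabs (t * y c) + Rabs (yp c)).
Proof.
  intros Hc Hx. pose proof W as [HK _ _ _ _ _ _ _ _ _ _ _ _].
  apply (energy_bounds e e1 q g mu mu1 K W t (y x) (yp x) (y c) (yp c) x c); auto. { left; apply exp_pos. }
  apply Rle_trans with (1 := imag_energy c x Hc Hx).
  apply Rmult_le_compat_l.
  - change (0 <= P c ^ 2 + V c ^ 2). pose proof (pow2_ge_0 (P c)). pose proof (pow2_ge_0 (V c)). lra.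
  - simpl. rewrite Rmult_1_r, <- exp_plus. apply exp_mono.
    replace (2 * t * phase e x + 2 * K * x - (2 * t * phase e c + 2 * K * c)) with (2 * (t * (phase e x - phase e c)) + 2 * K * (x - c)) by ring.
    apply Rle_trans with (1 := Rabs_triang _ _). rewrite !Rabs_mult, (Rabs_pos_eq 2), (Rabs_pos_eq t), (Rabs_pos_eq K) by lra.
    assert (Rabs (x - c) <= 1) by (apply Rabs_le; lra).
    assert (K * Rabs (x - c) <= K * 1) by (apply Rmult_le_compat_l; lra). lra.
Qed.

Hypothesis Y0 : y 0 = 0.
Hypothesis YP0 : yp 0 = 1.

(** The growing and the decaying mode: each has its own rate, + or - t q^2, and g couples them.
    Where q = 1, as at the end point, [Tf] is y' - t y, the factor of exp(t) in d(it). *)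
Let Sf (x : R) : R := V x + P x.
Let Tf (x : R) : R := V x - P x.

Lemma dS x : 0 <= x <= 1 -> is_derive Sf x (t * q x ^ 2 * Sf x - g x * Tf x).
Proof. intros Hx. unfold Sf, Tf. eapply Rd_eq; [apply Rd_plus; [apply dVi, Hx | apply dP, Hx]|]. ring. Qed.

Lemma dT x : 0 <= x <= 1 -> is_derive Tf x (- (t * q x ^ 2 * Tf x) - g x * Sf x).
Proof. intros Hx. unfold Sf, Tf. eapply Rd_eq; [apply Rd_minus; [apply dVi, Hx | apply dP, Hx]|]. ring. Qed.

(** The coupling cancels in (P V)' = t q^2 (P^2 + V^2), and P vanishes at 0. As Sf^2 - Tf^2 = 4 P V,
    the growing mode dominates. *)
Lemma PV_nonneg x : 0 <= x <= 1 -> 0 <= P x * V x.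
Proof.
  intros Hx.
  pose proof (le_of_derive_le (fun _ => 0) (fun x => P x * V x) (fun _ => 0) (fun x => t * q x ^ 2 * (P x ^ 2 + V x ^ 2)) 0 x ltac:(lra)
    (fun r _ => Rd_const 0 r)) as L.
  assert (0 - 0 <= P x * V x - P 0 * V 0).
  { apply L.
    - intros r Hr. eapply Rd_eq; [apply Rd_mult; [apply dP | apply dVi]; lra|]. ring.
    - intros r Hr. apply Rmult_le_pos; [apply Rmult_le_pos; [lra | apply pow2_ge_0]|].
      pose proof (pow2_ge_0 (P r)). pose proof (pow2_ge_0 (V r)). lra. }
  assert (P 0 = 0) by (unfold P; rewrite Y0; ring). nra.
Qed.

Lemma T_le_S x : 0 <= x <= 1 -> Rabs (Tf x) <= Rabs (Sf x).
Proof.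
  intros Hx. apply Rsqr_le_abs_0. pose proof (PV_nonneg x Hx). unfold Rsqr, Tf, Sf. nra.
Qed.

(** Since |T| <= |S|, the coupling lowers the growth rate by at most K, so S^2 exp(- 2 t phase + 2 K
    x) is nondecreasing. This controls S^2 and shows that S never vanishes; being positive at 0, it
    stays positive. *)
Lemma S_lower x : 0 <= x <= 1 -> / q 0 * exp (t * phase e x - K * x) <= Sf x.
Proof.
  pose proof W as [HK _ Hq _ _ Hsq _ Hg _ _ _ _ _].
  assert (S0 : Sf 0 = / q 0). { unfold Sf, V, P. rewrite Y0, YP0. unfold Rdiv. ring. }
  assert (S0p : 0 < Sf 0). { rewrite S0. apply Rinv_0_lt_compat, Hq. lra. }
  assert (Ph0 : phase e 0 = 0). { unfold phase. rewrite RInt_point. reflexivity. }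
  assert (Hsqr : forall x, 0 <= x <= 1 -> (Sf 0 * exp (t * phase e x - K * x)) ^ 2 <= Sf x ^ 2).
  { intros z Hz. set (L := fun x => - (2 * (t * phase e x)) + 2 * K * x).
    pose proof (le_of_derive_le (fun _ => 0) (fun x => Sf x * Sf x * exp (L x)) (fun _ => 0)
      (fun x => exp (L x) * (2 * (K * (Sf x * Sf x) - g x * (Tf x * Sf x)))) 0 z ltac:(lra) (fun r _ => Rd_const 0 r)) as D.
    assert (D' : 0 - 0 <= Sf z * Sf z * exp (L z) - Sf 0 * Sf 0 * exp (L 0)).
    { apply D.
      - intros r Hr. pose proof (dS r ltac:(lra)) as DS. eapply Rd_eq.
        + apply Rd_mult; [apply Rd_mult; exact DS|]. apply Rd_exp. apply Rd_plus; [apply Rd_opp, Rd_scal, Rd_scal, phase_derive, He | apply Rd_scal, Rd_id].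
        + cbv beta. fold (L r). rewrite (Hsq r ltac:(lra)). ring.
      - intros r Hr. pose proof (exp_pos (L r)). pose proof (T_le_S r ltac:(lra)) as TS. specialize (Hg r ltac:(lra)).
        assert (G : g r * (Tf r * Sf r) <= K * (Sf r * Sf r)).
        { apply Rle_trans with (1 := Rle_abs _). rewrite 2!Rabs_mult.
          replace (Sf r * Sf r) with (Rabs (Sf r) * Rabs (Sf r)) by (rewrite <- Rabs_mult; apply Rabs_pos_eq; nra).
          apply Rmult_le_compat; auto using Rabs_pos. { apply Rmult_le_pos; apply Rabs_pos. }
          apply Rmult_le_compat_r; [apply Rabs_pos | exact TS]. }
        nra. }
    assert (L0 : L 0 = 0) by (unfold L; rewrite Ph0; ring). rewrite L0, exp_0 in D'.
    assert (EL : exp (L z) * (exp (t * phase e z - K * z) * exp (t * phase e z - K * z)) = 1).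
    { rewrite <- !exp_plus. replace (L z + (t * phase e z - K * z + (t * phase e z - K * z))) with 0 by (unfold L; ring). apply exp_0. }
    set (E := exp (t * phase e z - K * z)) in *. pose proof (exp_pos (L z)).
    assert (0 <= E * E) by (pose proof (Rle_0_sqr E); unfold Rsqr in *; lra).
    replace ((Sf 0 * E) ^ 2) with (Sf 0 * Sf 0 * (E * E)) by ring.
    replace (Sf z ^ 2) with (Sf z * Sf z * (exp (L z) * (E * E))) by (rewrite EL; ring).
    assert (Sf 0 * Sf 0 <= Sf z * Sf z * exp (L z)) by lra. nra. }
  assert (Hne : forall x, 0 <= x <= 1 -> Sf x <> 0).
  { intros z Hz Y. specialize (Hsqr z Hz). rewrite Y in Hsqr. pose proof (exp_pos (t * phase e z - K * z)).
    assert (0 < Sf 0 * exp (t * phase e z - K * z)) by nra. nra. }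
  assert (Hpos : forall x, 0 <= x <= 1 -> 0 < Sf x).
  { intros z Hz. destruct (Rlt_dec 0 (Sf z)) as [Q|Q]; [exact Q|exfalso].
    assert (Sf z < 0) by (specialize (Hne z Hz); lra).
    assert (z <> 0) by (intros ->; lra).
    destruct (Ranalysis5.IVT_interv (fun x => - Sf x) 0 z) as (w & Hw & Ew); try lra.
    - intros r Hr. apply continuity_pt_opp. eapply is_derive_continuity_pt. apply dS. lra.
    - apply (Hne w); lra. }
  intros Hx. rewrite <- S0. specialize (Hsqr x Hx). specialize (Hpos x Hx).
  pose proof (exp_pos (t * phase e x - K * x)).
  apply Rnot_lt_le. intros Q. assert (0 < Sf 0 * exp (t * phase e x - K * x)) by nra. nra.
Qed.

(* Near r = 1 the coupling g has a sign, so T(1) cannot be smaller than the first reflection. *)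
Lemma T_lower (n : nat) (s c0 r0 : R) : (s = 1 \/ s = -1) -> 0 < c0 -> 0 <= r0 < 1 -> 1 <= t -> 2 <= t * (1 - r0) ->
  (forall x, r0 <= x <= 1 -> c0 * (1 - x) ^ n <= - (s * g x)) ->
  c0 / K * exp (- K - 4 * K ^ 2) / t ^ S n * exp (t * phase e 1) - 2 * K ^ 4 * exp K * exp (t * (2 * phase e r0 - phase e 1)) <= Rabs (Tf 1).
Proof.
  intros Hs Hc0 Hr0 Ht1 Ht2 Hsg.
  pose proof W as [HK Dq Hq Hlo Hhi Hsq _ Hg _ _ _ _ _].
  set (a := phase e 1).
  (* The exponential is the integrating factor against the decay of T, and the sign s makes h'
     nonnegative on [r0, 1]. *)
  set (h := fun x => s * (exp (t * phase e x) * Tf x)).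
  set (h' := fun x => - (s * g x) * (exp (t * phase e x) * Sf x)).
  assert (Dh : forall x, 0 <= x <= 1 -> is_derive h x (h' x)).
  { intros x Hx. eapply Rd_eq.
    - apply Rd_scal, Rd_mult; [apply Rd_exp, Rd_scal, phase_derive, He | apply dT, Hx].
    - unfold h'. rewrite (Hsq x Hx). ring. }
  assert (Hq0 : / K <= / q 0). { apply Rinv_le_contravar; [apply Hq; lra | apply Hhi; lra]. }
  assert (HKp : 0 < / K) by (apply Rinv_0_lt_compat; lra).
  assert (Hlow : forall x, r0 <= x <= 1 -> c0 * (1 - x) ^ n * (/ K * exp (- K) * exp (2 * (t * phase e x))) <= h' x).
  { intros x Hx. unfold h'. apply Rmult_le_compat.
    - apply Rmult_le_pos; [lra | apply pow_le; lra].
    - repeat apply Rmult_le_pos; try lra; left; apply exp_pos.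
    - apply Hsg, Hx.
    - pose proof (S_lower x ltac:(lra)) as SL.
      replace (2 * (t * phase e x)) with (t * phase e x + t * phase e x) by ring. rewrite exp_plus.
      pose proof (exp_pos (t * phase e x)).
      apply Rle_trans with (exp (t * phase e x) * (/ q 0 * exp (t * phase e x - K * x))); [|apply Rmult_le_compat_l; lra].
      unfold Rminus. rewrite exp_plus. assert (Ek : exp (- K) <= exp (- (K * x))) by (apply exp_mono; nra).
      pose proof (exp_pos (- K)).
      assert (/ K * exp (- K) <= / q 0 * exp (- (K * x))) by (apply Rmult_le_compat; lra).
      set (E := exp (t * phase e x)) in *. replace (/ K * exp (- K) * (E * E)) with (E * E * (/ K * exp (- K))) by ring.
      replace (E * (/ q 0 * (E * exp (- (K * x))))) with (E * E * (/ q 0 * exp (- (K * x)))) by ring.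
      apply Rmult_le_compat_l; nra. }
  assert (Hh'0 : forall x, r0 <= x <= 1 -> 0 <= h' x).
  { intros x Hx. apply Rle_trans with (2 := Hlow x Hx). apply Rmult_le_pos.
    - apply Rmult_le_pos; [lra | apply pow_le; lra].
    - repeat apply Rmult_le_pos; try lra; left; apply exp_pos. }
  assert (Hmono : forall x z, r0 <= x -> x <= z -> z <= 1 -> h x <= h z).
  { intros x z H1 H2 H3.
    pose proof (le_of_derive_le (fun _ => 0) h (fun _ => 0) h' x z H2 (fun r _ => Rd_const 0 r)
      (fun r Hr => Dh r ltac:(lra)) (fun r Hr => Hh'0 r ltac:(lra))). lra. }
  assert (Hti : 0 < / t) by (apply Rinv_0_lt_compat; lra).
  assert (Hti2 : 2 * / t <= 1 - r0).
  { apply Rmult_le_reg_l with t; [lra|]. replace (t * (2 * / t)) with 2 by (field; lra). exact Ht2. }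
  (* On [1 - 2/t, 1 - 1/t] one has 1 - x >= 1/t, so the coupling is at least c0 / t^n, while the
     phase differs from a by at most 2 K^2 / t; doubled and multiplied by t this is the 4 K^2 in
     [low]. The condition on t puts x1 to the right of r0. *)
  set (x1 := 1 - 2 * / t). set (x2 := 1 - / t).
  set (low := c0 * (/ t) ^ n * (/ K * exp (- K) * exp (2 * (t * a) - 4 * K ^ 2))).
  assert (Hstep : low * (/ t) <= h x2 - h x1).
  { pose proof (le_of_derive_le (fun x => low * x) h (fun _ => low * 1) h' x1 x2 ltac:(unfold x1, x2; lra)
      (fun r _ => Rd_scal low _ r 1 (Rd_id r)) (fun r Hr => Dh r ltac:(unfold x1, x2 in Hr; lra))) as L.
    assert (low * x2 - low * x1 <= h x2 - h x1).
    { apply L. intros r Hr. unfold x1, x2 in Hr. rewrite Rmult_1_r. apply Rle_trans with (2 := Hlow r ltac:(lra)).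
      unfold low. apply Rmult_le_compat.
      - apply Rmult_le_pos; [lra | apply pow_le; lra].
      - repeat apply Rmult_le_pos; try lra; left; apply exp_pos.
      - apply Rmult_le_compat_l; [lra|]. apply pow_incr. lra.
      - apply Rmult_le_compat_l; [apply Rmult_le_pos; [lra | left; apply exp_pos]|]. apply exp_mono.
        pose proof (phase_lip r 1 ltac:(lra) ltac:(lra) ltac:(lra)) as PL. fold a in PL.
        assert (PL2 : K ^ 2 * (1 - r) <= K ^ 2 * (2 * / t)) by (apply Rmult_le_compat_l; [apply pow2_ge_0 | lra]).
        assert (PL3 : t * (a - phase e r) <= t * (K ^ 2 * (2 * / t))) by (apply Rmult_le_compat_l; lra).
        replace (t * (K ^ 2 * (2 * / t))) with (2 * K ^ 2) in PL3 by (field; lra). lra. }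
    unfold x1, x2 in *. lra. }
  assert (Hh1 : h r0 + low * / t <= h 1).
  { pose proof (Hmono r0 x1 ltac:(lra) ltac:(unfold x1; lra) ltac:(unfold x1; lra)).
    pose proof (Hmono x2 1 ltac:(unfold x2; lra) ltac:(unfold x2; lra) ltac:(lra)). lra. }
  (* On [0, r0] the sign of g is unknown and only the crude growth bound is available; it is
     exponentially smaller than exp(2 t a) because phase(r0) < a. *)
  assert (Hr0b : - (2 * K ^ 4 * exp K * exp (2 * (t * phase e r0))) <= h r0).
  { assert (Ph0 : phase e 0 = 0) by (unfold phase; rewrite RInt_point; reflexivity).
    destruct (imag_axis_bound 0 r0 ltac:(lra) ltac:(lra)) as [B1 B2].
    rewrite Y0, YP0, Ph0, Rmult_0_r, Rabs_R0, Rabs_R1, Rplus_0_l, Rmult_1_r, Rminus_0_r in B1, B2.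
    assert (Phr : 0 <= phase e r0) by (rewrite <- Ph0; apply phase_mono; lra).
    rewrite (Rabs_pos_eq (phase e r0)), exp_plus in B1, B2 by exact Phr.
    set (E := exp (t * phase e r0)) in *. assert (EP : 0 < E) by apply exp_pos.
    assert (BT : Rabs (Tf r0) <= 2 * K ^ 3 * (exp K * E)).
    { unfold Tf, V, P, Rminus. apply Rle_trans with (1 := Rabs_triang _ _). rewrite Rabs_Ropp.
      pose proof (Hq r0 ltac:(lra)) as Q. pose proof (Hhi r0 ltac:(lra)). pose proof (Hlo r0 ltac:(lra)).
      assert (Qi : / q r0 <= K). { apply Rmult_le_reg_r with (q r0); [lra|]. rewrite Rinv_l by lra. lra. }
      assert (Qi0 : 0 < / q r0) by (apply Rinv_0_lt_compat, Q).
      unfold Rdiv. replace (t * q r0 * y r0) with (q r0 * (t * y r0)) by ring. rewrite 2!Rabs_mult.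
      rewrite (Rabs_pos_eq (/ q r0)), (Rabs_pos_eq (q r0)) by lra.
      assert (U1 : Rabs (yp r0) * / q r0 <= K ^ 2 * (exp K * E) * K) by (apply Rmult_le_compat; auto using Rabs_pos; lra).
      assert (U2 : q r0 * Rabs (t * y r0) <= K * (K ^ 2 * (exp K * E))) by (apply Rmult_le_compat; auto using Rabs_pos; lra).
      simpl in *. lra. }
    assert (Bh : Rabs (h r0) <= 2 * K ^ 4 * exp K * exp (2 * (t * phase e r0))).
    { unfold h. fold E. rewrite 2!Rabs_mult, (Rabs_pos_eq E) by lra.
      replace (2 * (t * phase e r0)) with (t * phase e r0 + t * phase e r0) by ring. rewrite exp_plus. fold E.
      assert (Rs : Rabs s = 1) by (destruct Hs as [-> | ->]; [apply Rabs_R1 | rewrite Rabs_left; lra]).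
      rewrite Rs, Rmult_1_l.
      apply Rle_trans with (E * (2 * K ^ 3 * (exp K * E))); [apply Rmult_le_compat_l; lra|].
      replace (E * (2 * K ^ 3 * (exp K * E))) with (K ^ 3 * (2 * (exp K * (E * E)))) by ring.
      replace (2 * K ^ 4 * exp K * (E * E)) with (K ^ 4 * (2 * (exp K * (E * E)))) by ring.
      apply Rmult_le_compat_r; [pose proof (exp_pos K); assert (0 <= exp K * (E * E)) by (repeat apply Rmult_le_pos; lra); lra|].
      apply Rle_pow; [exact HK | lia]. }
    apply Rabs_le_between in Bh. lra. }
  assert (Hh1T : h 1 <= exp (t * a) * Rabs (Tf 1)).
  { unfold h. fold a. apply Rle_trans with (1 := Rle_abs _). rewrite 2!Rabs_mult, (Rabs_pos_eq (exp (t * a))) by (left; apply exp_pos).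
    assert (Rs : Rabs s = 1) by (destruct Hs as [-> | ->]; [apply Rabs_R1 | rewrite Rabs_left; lra]).
    rewrite Rs. lra. }
  apply Rmult_le_reg_l with (exp (t * a)); [apply exp_pos|].
  apply Rle_trans with (2 := Hh1T). apply Rle_trans with (2 := Hh1).
  assert (E1 : exp (t * a) * (c0 / K * exp (- K - 4 * K ^ 2) / t ^ S n * exp (t * a)) = low * / t).
  { unfold low, Rminus. rewrite !exp_plus. replace (2 * (t * a)) with (t * a + t * a) by ring. rewrite exp_plus, pow_inv.
    simpl (t ^ S n). field. repeat split; try lra. apply pow_nonzero; lra. }
  assert (E2 : exp (t * a) * (2 * K ^ 4 * exp K * exp (t * (2 * phase e r0 - a))) = 2 * K ^ 4 * exp K * exp (2 * (t * phase e r0))).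
  { replace (2 * (t * phase e r0)) with (t * a + t * (2 * phase e r0 - a)) by ring. rewrite exp_plus. ring. }
  rewrite Rmult_minus_distr_l, E1, E2. lra.
Qed.
End Solution.
End Imag.

(** Near 1 the derivative of order m + 1 behaves like a nonzero multiple of 1 - x. Integrating down
    from 1, where the lower derivatives vanish, gains a power and flips the sign at each stage. The
    outcome is the one-signed coupling required by [T_lower]. *)
Lemma flat_sign (m : nat) (eta : R -> R) (D : nat -> R -> R) : W2_derivs m eta D ->
  (forall u, (1 <= u <= m + 1)%nat -> D u 1 = 0) -> D (m + 2)%nat 1 <> 0 ->
  exists s c r0, (s = 1 \/ s = -1) /\ 0 < c /\ 0 <= r0 < 1 /\
    forall x, r0 <= x <= 1 -> c * (1 - x) ^ (m + 1) <= s * D 1%nat x.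
Proof.
  intros (_ & HD & _) H0 Htop.
  assert (Main : forall j, (j <= m)%nat -> exists s c r0, (s = 1 \/ s = -1) /\ 0 < c /\ 0 <= r0 < 1 /\
    forall x, r0 <= x <= 1 -> c * (1 - x) ^ (S j) <= s * D (m + 1 - j)%nat x).
  { induction j as [|j IH]; intros Hj.
    - replace (m + 1 - 0)%nat with (m + 1)%nat by lia.
      pose proof (HD (m + 1)%nat ltac:(lia)) as Hd. replace (S (m + 1)) with (m + 2)%nat in Hd by lia.
      set (L := D (m + 2)%nat 1) in *. pose proof (Rabs_pos_lt L Htop) as LP.
      destruct (Hd 1 ltac:(unfold in01; lra) (Rabs L / 2) ltac:(lra)) as (d & Hdp & K).
      (* D(m+1) is close to L (x - 1) = - L (1 - x), hence the sign opposite to that of L; half of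
         |L| is given up to the error. *)
      exists (if Rlt_dec L 0 then 1 else -1), (Rabs L / 2), (1 - Rmin d 1 / 2).
      assert (Hm : 0 < Rmin d 1) by (apply Rmin_glb_lt; lra). pose proof (Rmin_l d 1). pose proof (Rmin_r d 1).
      split; [destruct Rlt_dec; auto|]. split; [lra|]. split; [lra|]. intros x Hx.
      destruct (Req_dec x 1) as [->|N]. { rewrite H0 by lia. simpl. right. ring. }
      specialize (K (x - 1) ltac:(lra) ltac:(unfold in01; lra)). replace (1 + (x - 1)) with x in K by ring.
      rewrite Rabs_left in K by lra. specialize (K ltac:(lra)). rewrite H0 in K by lia.
      fold L in K.
      set (z := (D (m + 1)%nat x - 0) / (x - 1)) in *.
      assert (Ez : D (m + 1)%nat x = - (z * (1 - x))) by (unfold z; field; lra).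
      apply Rabs_def2 in K. rewrite Ez. simpl pow. rewrite Rmult_1_r.
      unfold Rabs in *. destruct (Rcase_abs L), (Rlt_dec L 0); try lra; nra.
    - destruct (IH ltac:(lia)) as (s & c & r0 & Hs & Hc & Hr0 & Hlow).
      set (u := (m + 1 - S j)%nat) in *. replace (m + 1 - j)%nat with (S u) in Hlow by (unfold u; lia).
      pose proof (HD u ltac:(unfold u; lia)) as Hd.
      assert (Hu1 : D u 1 = 0) by (apply H0; unfold u; lia).
      exists (- s), (c / INR (S (S j))), r0. split; [lra|].
      assert (HN : 0 < INR (S (S j))) by (apply lt_0_INR; lia).
      split; [apply Rdiv_lt_0_compat; assumption|]. split; [exact Hr0|]. intros x Hx.
      pose proof (le_of_derive_le (fun z => - (c / INR (S (S j)) * (1 - z) ^ S (S j))) (fun z => s * ext (D u) (D (S u)) z)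
        (fun z => c * (1 - z) ^ S j) (fun z => s * D (S u) z) x 1 ltac:(lra)) as L.
      assert (L' : - (c / INR (S (S j)) * (1 - 1) ^ S (S j)) - - (c / INR (S (S j)) * (1 - x) ^ S (S j)) <= s * ext (D u) (D (S u)) 1 - s * ext (D u) (D (S u)) x).
      { apply L.
        - intros z Hz. eapply Rd_eq.
          + apply Rd_opp, Rd_scal. apply (Rd_comp (fun w => w ^ S (S j)) (fun z => 1 - z)); [apply Rd_minus; [apply Rd_const | apply Rd_id] | apply Rd_pow].
          + simpl pred. field. lra.
        - intros z Hz. pose proof (ext_derive _ _ Hd z) as DE. rewrite clamp_id in DE by lra. apply Rd_scal, DE.
        - intros z Hz. apply Hlow. lra. }
      rewrite !ext_in in L' by lra. rewrite Hu1 in L'.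
      replace (1 - 1) with 0 in L' by ring. rewrite pow_i in L' by lia. lra. }
  destruct (Main m (le_n m)) as (s & c & r0 & Hs & Hc & Hr0 & H). exists s, c, r0.
  repeat split; try tauto; try lra. replace (m + 1 - m)%nat with 1%nat in H by lia. replace (m + 1)%nat with (S m) by lia. exact H.
Qed.

(** * Solution families restricted to the two axes *)

Lemma Cmod_real (z : C) : snd z = 0 -> Cmod z = Rabs (fst z).
Proof. intros H. rewrite <- Cmod_R. f_equal. apply C_eq; [reflexivity | exact H]. Qed.

Lemma real_sqr_R (k : R) : snd (RtoC k * RtoC k)%C = 0.
Proof. simpl. ring. Qed.

Lemma real_sqr_I (t : R) : snd ((Ci * t) * (Ci * t))%C = 0.
Proof. simpl. ring. Qed.

Section Family.
Variables (e : R -> R) (b w0 w1 : R) (y yp : R -> C -> C).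
Hypothesis F : ode_family e b w0 w1 y yp.

Lemma family_real_d (k r : R) : is_derive (fun r => fst (y r k)) r (fst (yp r k)) /\
  is_derive (fun r => fst (yp r k)) r (- (k * k * (e r * fst (y r k)))).
Proof.
  split; [apply (of_d _ _ _ _ _ _ F k r)|].
  eapply Rd_eq; [apply (of_dp _ _ _ _ _ _ F k r)|]. simpl. ring.
Qed.

Lemma family_imag_d (t r : R) : is_derive (fun r => fst (y r (Ci * t)%C)) r (fst (yp r (Ci * t)%C)) /\
  is_derive (fun r => fst (yp r (Ci * t)%C)) r (t * t * (e r * fst (y r (Ci * t)%C))).
Proof.
  split; [apply (of_d _ _ _ _ _ _ F (Ci * t)%C r)|].
  eapply Rd_eq; [apply (of_dp _ _ _ _ _ _ F (Ci * t)%C r)|]. simpl. ring.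
Qed.

Lemma family_unique (a c x0 : R) (k : C) (u v : R -> C) : (forall x, continuous e x) ->
  (forall x, a <= x <= c -> cder u x (v x)) ->
  (forall x, a <= x <= c -> cder v x (- (k * k * (e x * u x)))%C) ->
  a <= x0 <= c -> u x0 = y x0 k -> v x0 = yp x0 k -> forall x, a <= x <= c -> u x = y x k /\ v x = yp x k.
Proof.
  intros He Hu Hv Hx0 U V x Hx.
  destruct (ode_unique e a c x0 k (fun x => u x - y x k)%C (fun x => v x - yp x k)%C He) with (x := x) as [K1 K2]; auto.
  - intros z Hz. apply cder_minus; [apply Hu, Hz | apply (of_d _ _ _ _ _ _ F)].
  - intros z Hz. eapply cder_eq; [apply cder_minus; [apply Hv, Hz | apply (of_dp _ _ _ _ _ _ F)]|]. ring.
  - rewrite U. ring.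
  - rewrite V. ring.
  - split; apply Ceq_minus; assumption.
Qed.

Lemma family_at_zero : (forall x, continuous e x) -> 0 <= b <= 1 -> forall r, 0 <= r <= 1 ->
  y r 0 = (w0 + w1 * (r - b))%R /\ yp r 0 = w1.
Proof.
  intros He Hb r Hr.
  destruct (family_unique 0 1 b 0 (fun r => RtoC (w0 + w1 * (r - b))%R) (fun _ => RtoC w1) He) with (x := r) as [K1 K2]; auto.
  - intros x _. split; simpl; [|apply Rd_const].
    eapply Rd_eq; [apply Rd_plus; [apply Rd_const | apply Rd_scal, Rd_minus; [apply Rd_id | apply Rd_const]]|]. ring.
  - intros x _. eapply cder_eq; [apply cder_const|]. ring.
  - rewrite (of_b _ _ _ _ _ _ F). f_equal. ring.
  - rewrite (of_bp _ _ _ _ _ _ F). reflexivity.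
Qed.

Variables (e1 q g mu mu1 : R -> R) (K : R).
Hypothesis He : forall x, continuous e x.
Hypothesis W : wkb e e1 q g mu mu1 K.
Hypothesis Hb : 0 <= b <= 1.

Lemma family_real_bound (k r : R) : 0 <= r <= 1 ->
  Cmod (k * y r k) <= K ^ 2 * exp K * (Rabs (k * w0) + Rabs w1) /\
  Cmod (yp r k) <= K ^ 2 * exp K * (Rabs (k * w0) + Rabs w1).
Proof.
  intros Hr.
  destruct (real_axis_bound e e1 q g mu mu1 K W k (fun r => fst (y r k)) (fun r => fst (yp r k))
    (fun x _ => proj1 (family_real_d k x)) (fun x _ => proj2 (family_real_d k x)) b r Hb Hr) as [B1 B2].
  rewrite (of_b _ _ _ _ _ _ F), (of_bp _ _ _ _ _ _ F) in B1, B2. simpl in B1, B2.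
  rewrite Cmod_mult, Cmod_R, (Cmod_real (y r k)), (Cmod_real (yp r k)), <- Rabs_mult.
  - split; assumption.
  - apply (of_realp _ _ _ _ _ _ F), real_sqr_R.
  - apply (of_real _ _ _ _ _ _ F), real_sqr_R.
Qed.

Lemma family_imag_bound (t r : R) : 0 < t -> 0 <= r <= 1 ->
  t * Cmod (y r (Ci * t)%C) <= K ^ 2 * exp (K + t * Rabs (phase e r - phase e b)) * (Rabs (t * w0) + Rabs w1) /\
  Cmod (yp r (Ci * t)%C) <= K ^ 2 * exp (K + t * Rabs (phase e r - phase e b)) * (Rabs (t * w0) + Rabs w1).
Proof.
  intros Ht Hr.
  destruct (imag_axis_bound e e1 q g mu mu1 K He W t (fun r => fst (y r (Ci * t)%C)) (fun r => fst (yp r (Ci * t)%C)) Ht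
    (fun x _ => proj1 (family_imag_d t x)) (fun x _ => proj2 (family_imag_d t x)) b r Hb Hr) as [B1 B2].
  rewrite (of_b _ _ _ _ _ _ F), (of_bp _ _ _ _ _ _ F) in B1, B2.
  change (fst (RtoC w0)) with w0 in B1, B2. change (fst (RtoC w1)) with w1 in B1, B2.
  rewrite (Cmod_real (y r (Ci * t)%C)), (Cmod_real (yp r (Ci * t)%C)).
  - rewrite Rabs_mult, (Rabs_pos_eq t) in B1 by lra. split; assumption.
  - apply (of_realp _ _ _ _ _ _ F), real_sqr_I.
  - apply (of_real _ _ _ _ _ _ F), real_sqr_I.
Qed.
End Family.

(** * The characteristic function *)

(* [sc k] and [cc k] are the entire functions sin k / k and cos k. *)
Definition char_ent (y yp : R -> C -> C) (sc cc : C -> C) (k : C) : C := (yp 1 k * sc k - y 1 k * cc k)%C.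

Lemma Csinc_imag (t : R) : 0 < t -> Csinc (Ci * t)%C = RtoC (sinh t / t).
Proof.
  intros Ht. unfold Csinc. destruct Req_EM_T as [E|E].
  - exfalso. change (Cmod (Ci * t) = 0) in E. rewrite Cmod_mult, Cmod_Ci, Cmod_R, Rabs_pos_eq in E by lra. lra.
  - change (Csin (Ci * t)%C / (Ci * t) = RtoC (sinh t / t))%C.
    replace (Csin (Ci * t)%C) with (Ci * sinh t)%C.
    + rewrite RtoC_div by lra. field. split; [intros Y; apply RtoC_inj in Y; lra | apply Ci_nz].
    + apply C_eq; simpl; replace (0 * t - 1 * 0) with 0 by ring; replace (0 * 0 + 1 * t) with t by ring;
      rewrite ?sin_0, ?cos_0; ring.
Qed.

Lemma Ccos_imag (t : R) : Ccos (Ci * t)%C = RtoC (cosh t).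
Proof.
  apply C_eq; simpl; replace (0 * t - 1 * 0) with 0 by ring; replace (0 * 0 + 1 * t) with t by ring;
  rewrite ?sin_0, ?cos_0; ring.
Qed.

Lemma Csinc_real (k : R) : 0 < k -> Csinc (RtoC k) = RtoC (sin k / k).
Proof.
  intros Hk. unfold Csinc. destruct Req_EM_T as [E|E].
  - exfalso. change (Cmod k = 0) in E. rewrite Cmod_R, Rabs_pos_eq in E by lra. lra.
  - change (Csin (RtoC k) / k = RtoC (sin k / k))%C.
    replace (Csin (RtoC k)) with (RtoC (sin k)).
    + symmetry. apply RtoC_div. lra.
    + apply C_eq; simpl; rewrite ?cosh_0, ?sinh_0; ring.
Qed.

Lemma Ccos_real (k : R) : Ccos (RtoC k) = RtoC (cos k).
Proof. apply C_eq; simpl; rewrite ?cosh_0, ?sinh_0; ring. Qed.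

Section Char.
Variables (e e1 q g mu mu1 : R -> R) (K : R) (y yp : R -> C -> C) (sc cc : C -> C).
Hypothesis He : forall x, continuous e x.
Hypothesis W : wkb e e1 q g mu mu1 K.
Hypothesis F : ode_family e 0 0 1 y yp.
Hypothesis Hsc : forall k, Csinc k = sc k.
Hypothesis Hcc : forall k, Ccos k = cc k.

Lemma phase_0 (f : R -> R) : phase f 0 = 0.
Proof. unfold phase. rewrite RInt_point. reflexivity. Qed.

Lemma phase_nonneg r : 0 <= r <= 1 -> 0 <= phase e r.
Proof. intros Hr. rewrite <- (phase_0 e). apply phase_mono; auto; lra. Qed.

Lemma family_imag_bound0 (t r : R) : 0 < t -> 0 <= r <= 1 ->
  t * Cmod (y r (Ci * t)%C) <= K ^ 2 * exp K * exp (t * phase e r) /\ Cmod (yp r (Ci * t)%C) <= K ^ 2 * exp K * exp (t * phase e r).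
Proof.
  intros Ht Hr. destruct (family_imag_bound e 0 0 1 y yp F e1 q g mu mu1 K He W ltac:(lra) t r Ht Hr) as [B1 B2].
  rewrite phase_0, Rminus_0_r, (Rabs_pos_eq (phase e r)) in B1, B2 by (apply phase_nonneg, Hr).
  rewrite Rmult_0_r, Rabs_R0, Rabs_R1, Rplus_0_l, Rmult_1_r, exp_plus, <- Rmult_assoc in B1, B2. split; assumption.
Qed.

(** Separating exp(t) from exp(- t) exhibits y' - t y as the leading coefficient: d(it) is exactly
    as large as the decaying mode at 1 allows. *)
Lemma char_imag (t : R) : 0 < t ->
  char_ent y yp sc cc (Ci * t)%C =
  RtoC ((exp t * (fst (yp 1 (Ci * t)%C) - t * fst (y 1 (Ci * t)%C)) - exp (- t) * (fst (yp 1 (Ci * t)%C) + t * fst (y 1 (Ci * t)%C))) / (2 * t)).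
Proof.
  intros Ht. unfold char_ent. rewrite <- Hsc, <- Hcc, Csinc_imag, Ccos_imag by exact Ht.
  pose proof (of_real _ _ _ _ _ _ F 1 (Ci * t)%C (real_sqr_I t)) as R1.
  pose proof (of_realp _ _ _ _ _ _ F 1 (Ci * t)%C (real_sqr_I t)) as R2.
  set (u := y 1 (Ci * t)%C) in *. set (v := yp 1 (Ci * t)%C) in *.
  apply C_eq; simpl; rewrite R1, R2; unfold sinh, cosh; field; lra.
Qed.

Lemma char_upper (t : R) : 1 <= t -> Cmod (char_ent y yp sc cc (Ci * t)%C) <= 2 * K ^ 2 * exp K * exp (t * (phase e 1 + 1)).
Proof.
  intros Ht. rewrite char_imag by lra. rewrite Cmod_R.
  destruct (family_imag_bound0 t 1 ltac:(lra) ltac:(lra)) as [B1 B2].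
  rewrite (Cmod_real (y 1 (Ci * t)%C)) in B1 by (apply (of_real _ _ _ _ _ _ F), real_sqr_I).
  rewrite (Cmod_real (yp 1 (Ci * t)%C)) in B2 by (apply (of_realp _ _ _ _ _ _ F), real_sqr_I).
  set (u := fst (y 1 (Ci * t)%C)) in *. set (v := fst (yp 1 (Ci * t)%C)) in *.
  set (M := K ^ 2 * exp K * exp (t * phase e 1)) in *.
  assert (B1' : Rabs (t * u) <= M) by (rewrite Rabs_mult, (Rabs_pos_eq t) by lra; exact B1).
  apply Rabs_le_between in B1'. apply Rabs_le_between in B2.
  pose proof (exp_pos t) as E1. assert (E2 : exp (- t) <= exp t) by (apply exp_mono; lra). pose proof (exp_pos (- t)).
  replace (2 * K ^ 2 * exp K * exp (t * (phase e 1 + 1))) with (2 * M * exp t)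
    by (unfold M; rewrite Rmult_plus_distr_l, Rmult_1_r, exp_plus; ring).
  assert (HM : 0 <= M) by lra.
  unfold Rdiv. rewrite Rabs_mult, (Rabs_pos_eq (/ (2 * t))) by (left; apply Rinv_0_lt_compat; lra).
  assert (N : Rabs (exp t * (v - t * u) - exp (- t) * (v + t * u)) <= 4 * M * exp t).
  { unfold Rminus at 1. apply Rle_trans with (1 := Rabs_triang _ _). rewrite Rabs_Ropp, 2!Rabs_mult.
    rewrite (Rabs_pos_eq (exp t)), (Rabs_pos_eq (exp (- t))) by lra.
    assert (A1 : Rabs (v - t * u) <= 2 * M) by (apply Rabs_le; lra).
    assert (A2 : Rabs (v + t * u) <= 2 * M) by (apply Rabs_le; lra).
    pose proof (Rabs_pos (v + t * u)).
    assert (exp (- t) * Rabs (v + t * u) <= exp t * (2 * M)) by (apply Rmult_le_compat; lra).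
    assert (exp t * Rabs (v - t * u) <= exp t * (2 * M)) by (apply Rmult_le_compat_l; lra). lra. }
  assert (I : / (2 * t) <= / 2) by (apply Rinv_le_contravar; lra).
  assert (I0 : 0 < / (2 * t)) by (apply Rinv_0_lt_compat; lra).
  apply Rle_trans with (4 * M * exp t * / 2); [|lra].
  apply Rmult_le_compat; auto using Rabs_pos; lra.
Qed.

(** Of the n + 2 powers of t, n + 1 are lost in [T_lower] and one through the factor 1/(2 t). The
    crude contribution of [0, r0] and the term with exp(- t) are both exponentially small compared
    with the main one. *)
Lemma char_lower (n : nat) (s c r0 : R) : e 1 = 1 -> (s = 1 \/ s = -1) -> 0 < c -> 0 <= r0 < 1 ->
  (forall x, r0 <= x <= 1 -> c * (1 - x) ^ n <= s * e1 x) ->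
  exists c1 t0, 0 < c1 /\ 1 <= t0 /\ forall t, t0 <= t ->
    c1 * exp (t * (phase e 1 + 1)) <= t ^ (S (S n)) * Cmod (char_ent y yp sc cc (Ci * t)%C).
Proof.
  intros He1 Hs Hc Hr0 Hsign.
  pose proof W as [HK Dq Hq Hlo Hhi Hsq Hee Hg Hge Hmu Dmu Hmub Hmu1].
  assert (Q1 : q 1 = 1).
  { assert (H1 : q 1 ^ 2 = 1) by (rewrite <- Hsq, He1 by lra; apply sqrt_1). pose proof (Hq 1 ltac:(lra)). nra. }
  assert (K4 : 1 <= K ^ 4) by (apply pow_R1_Rle; lra).
  (* From e1 = 4 e g and e <= K^4. The sign is reversed below because [T_lower] asks for a lower
     bound on - s g. *)
  set (c0 := c / (4 * K ^ 4)). assert (Hc0 : 0 < c0) by (apply Rdiv_lt_0_compat; lra).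
  assert (Hs' : - s = 1 \/ - s = -1) by lra.
  assert (Hg' : forall x, r0 <= x <= 1 -> c0 * (1 - x) ^ n <= - (- s * g x)).
  { intros x Hx. replace (- (- s * g x)) with (s * g x) by ring.
    assert (Ex : 0 < e x <= K ^ 4).
    { rewrite Hee by lra. pose proof (Hq x ltac:(lra)). pose proof (Hhi x ltac:(lra)). split; [apply pow_lt; lra | apply pow_incr; lra]. }
    specialize (Hsign x Hx). rewrite <- (Hge x) in Hsign by lra.
    assert (P : 0 <= (1 - x) ^ n) by (apply pow_le; lra).
    apply Rmult_le_reg_r with (4 * e x); [lra|].
    apply Rle_trans with (c * (1 - x) ^ n); [|lra].
    unfold c0. replace (c / (4 * K ^ 4) * (1 - x) ^ n * (4 * e x)) with (c * (1 - x) ^ n * (e x / K ^ 4)) by (field; lra).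
    rewrite <- (Rmult_1_r (c * (1 - x) ^ n)) at 2. apply Rmult_le_compat_l; [apply Rmult_le_pos; lra|].
    apply Rmult_le_reg_r with (K ^ 4); [lra|]. unfold Rdiv. rewrite Rmult_assoc, Rinv_l by lra. lra. }
  set (a := phase e 1). set (A := c0 / K * exp (- K - 4 * K ^ 2)).
  assert (HA : 0 < A). { unfold A. apply Rmult_lt_0_compat; [apply Rdiv_lt_0_compat; lra | apply exp_pos]. }
  set (B := 2 * K ^ 4 * exp K). assert (HB : 0 < B) by (unfold B; pose proof (exp_pos K); nra).
  set (M := K ^ 2 * exp K). assert (HM : 0 < M) by (unfold M; pose proof (exp_pos K); nra).
  assert (Hdel : 0 < 2 * (a - phase e r0)).
  { pose proof (phase_strict e e1 q g mu mu1 K He W r0 Hr0) as L. fold a in L. lra. }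
  (* Beyond these thresholds each of the two errors takes at most a quarter of the constant A; the
     half that is left is halved again by 1/(2 t), whence A/4. *)
  destruct (pow_exp_small (S n) (2 * (a - phase e r0)) (A / (4 * B)) Hdel ltac:(apply Rdiv_lt_0_compat; lra)) as (t1 & Ht1 & S1).
  destruct (pow_exp_small (S n) 2 (A / (8 * M)) ltac:(lra) ltac:(apply Rdiv_lt_0_compat; lra)) as (t2 & Ht2 & S2).
  exists (A / 4), (t1 + t2 + 1 + 2 / (1 - r0)).
  assert (H2r : 0 < 2 / (1 - r0)) by (apply Rdiv_lt_0_compat; lra).
  split; [lra|]. split; [lra|]. intros t Ht.
  specialize (S1 t ltac:(lra)). specialize (S2 t ltac:(lra)).
  assert (Htr : 2 <= t * (1 - r0)).
  { apply Rle_trans with (2 / (1 - r0) * (1 - r0)); [right; field; lra | apply Rmult_le_compat_r; lra]. }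
  pose proof (T_lower e e1 q g mu mu1 K He W t (fun r => fst (y r (Ci * t)%C)) (fun r => fst (yp r (Ci * t)%C)) ltac:(lra)
    (fun x _ => proj1 (family_imag_d _ _ _ _ _ _ F t x)) (fun x _ => proj2 (family_imag_d _ _ _ _ _ _ F t x))
    (f_equal fst (of_b _ _ _ _ _ _ F (Ci * t)%C)) (f_equal fst (of_bp _ _ _ _ _ _ F (Ci * t)%C))
    n (- s) c0 r0 Hs' Hc0 Hr0 ltac:(lra) Htr Hg') as TL.
  rewrite char_imag by lra. rewrite Cmod_R.
  destruct (family_imag_bound0 t 1 ltac:(lra) ltac:(lra)) as [B1 B2].
  rewrite (Cmod_real (y 1 (Ci * t)%C)) in B1 by (apply (of_real _ _ _ _ _ _ F), real_sqr_I).
  rewrite (Cmod_real (yp 1 (Ci * t)%C)) in B2 by (apply (of_realp _ _ _ _ _ _ F), real_sqr_I).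
  cbv beta in TL. rewrite Q1 in TL. fold a in TL, B1, B2. fold M in B1, B2. fold A B in TL.
  set (u := fst (y 1 (Ci * t)%C)) in *. set (v := fst (yp 1 (Ci * t)%C)) in *.
  replace (v / 1 - t * 1 * u) with (v - t * u) in TL by field.
  assert (Htp : 0 < t ^ S n) by (apply pow_lt; lra).
  set (E := exp (t * a)) in *. assert (HE : 0 < E) by apply exp_pos.
  pose proof (exp_pos t) as Et.
  assert (X1 : exp (t * (2 * phase e r0 - a)) = E * exp (- (2 * (a - phase e r0) * t))).
  { unfold E. rewrite <- exp_plus. f_equal. ring. }
  assert (X2 : exp (- t) = exp t * exp (- (2 * t))) by (rewrite <- exp_plus; f_equal; ring).
  rewrite X1 in TL. set (d1 := exp (- (2 * (a - phase e r0) * t))) in *. set (d2 := exp (- (2 * t))) in *.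
  assert (Hd2 : 0 < d2) by apply exp_pos.
  assert (B1' : Rabs (t * u) <= M * E) by (rewrite Rabs_mult, (Rabs_pos_eq t) by lra; exact B1).
  assert (BS : Rabs (v + t * u) <= 2 * M * E). { apply Rle_trans with (1 := Rabs_triang _ _). lra. }
  assert (TL2 : A * E - A / 4 * E <= t ^ S n * Rabs (v - t * u)).
  { assert (t ^ S n * (A / t ^ S n * E - B * (E * d1)) <= t ^ S n * Rabs (v - t * u)) by (apply Rmult_le_compat_l; lra).
    replace (t ^ S n * (A / t ^ S n * E - B * (E * d1))) with (A * E - B * E * (t ^ S n * d1)) in H by (field; lra).
    assert (B * E * (t ^ S n * d1) <= B * E * (A / (4 * B))) by (apply Rmult_le_compat_l; [nra | exact S1]).
    replace (B * E * (A / (4 * B))) with (A / 4 * E) in H0 by (field; lra). lra. }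
  assert (BS2 : t ^ S n * (d2 * Rabs (v + t * u)) <= A / 4 * E).
  { apply Rle_trans with (t ^ S n * (d2 * (2 * M * E))).
    - apply Rmult_le_compat_l; [lra|]. apply Rmult_le_compat_l; lra.
    - replace (t ^ S n * (d2 * (2 * M * E))) with (2 * M * E * (t ^ S n * d2)) by ring.
      apply Rle_trans with (2 * M * E * (A / (8 * M))); [apply Rmult_le_compat_l; [nra | exact S2] | right; field; lra]. }
  replace (t * (a + 1)) with (t * a + t) by ring. rewrite exp_plus. fold E.
  unfold Rdiv. rewrite (Rabs_mult _ (/ (2 * t))), (Rabs_pos_eq (/ (2 * t))) by (left; apply Rinv_0_lt_compat; lra).
  change (t ^ S (S n)) with (t * t ^ S n).
  rewrite X2.
  assert (Tr : exp t * (Rabs (v - t * u) - d2 * Rabs (v + t * u)) <= Rabs (exp t * (v - t * u) - exp t * d2 * (v + t * u))).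
  { replace (exp t * (v - t * u) - exp t * d2 * (v + t * u)) with (exp t * ((v - t * u) - d2 * (v + t * u))) by ring.
    rewrite (Rabs_mult (exp t)), (Rabs_pos_eq (exp t)) by lra. apply Rmult_le_compat_l; [lra|].
    apply Rle_trans with (2 := Rabs_triang_inv _ _). rewrite (Rabs_mult d2), (Rabs_pos_eq d2) by lra. lra. }
  set (Z := Rabs (exp t * (v - t * u) - exp t * d2 * (v + t * u))) in *.
  replace (t * t ^ S n * (Z * / (2 * t))) with (/ 2 * (t ^ S n * Z)) by (field; lra).
  assert (Fin : t ^ S n * (exp t * (Rabs (v - t * u) - d2 * Rabs (v + t * u))) <= t ^ S n * Z) by (apply Rmult_le_compat_l; lra).
  replace (t ^ S n * (exp t * (Rabs (v - t * u) - d2 * Rabs (v + t * u))))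
    with (exp t * (t ^ S n * Rabs (v - t * u) - t ^ S n * (d2 * Rabs (v + t * u)))) in Fin by ring.
  assert (exp t * (A / 2 * E) <= exp t * (t ^ S n * Rabs (v - t * u) - t ^ S n * (d2 * Rabs (v + t * u)))) by (apply Rmult_le_compat_l; lra).
  lra.
Qed.
End Char.

(** A power of t cannot make up for a gap between exponential rates; this is how the total phases of
    the two coefficients are compared. *)
Lemma growth_compare (a b c M t0 : R) (N : nat) : 0 < c -> 0 <= M -> (forall t, t0 <= t -> c * exp (t * a) <= t ^ N * (M * exp (t * b))) -> a <= b.
Proof.
  intros Hc HM H. apply Rnot_lt_le. intros L.
  destruct (pow_exp_small N (a - b) (c / (2 * (M + 1))) ltac:(lra) ltac:(apply Rdiv_lt_0_compat; lra)) as (t1 & Ht1 & S1).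
  set (t := Rmax t0 t1). specialize (H t (Rmax_l _ _)). specialize (S1 t (Rmax_r _ _)).
  assert (E : exp (t * b) = exp (t * a) * exp (- ((a - b) * t))) by (rewrite <- exp_plus; f_equal; ring).
  rewrite E in H. pose proof (exp_pos (t * a)). set (x := t ^ N * exp (- ((a - b) * t))) in *.
  replace (t ^ N * (M * (exp (t * a) * exp (- ((a - b) * t))))) with (M * x * exp (t * a)) in H by (unfold x; ring).
  assert (c <= M * x) by (apply Rmult_le_reg_r with (exp (t * a)); lra).
  assert (M * x <= M * (c / (2 * (M + 1)))) by (apply Rmult_le_compat_l; assumption).
  assert (M * (c / (2 * (M + 1))) < c).
  { apply Rmult_lt_reg_r with (2 * (M + 1)); [lra|]. field_simplify; lra || nra. }
  lra.
Qed.

(** * Recovering the coefficient *)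

Lemma cder_zero_interval (f : R -> C) (a b : R) : a <= b -> (forall t, a <= t <= b -> cder f t 0) -> f b = f a.
Proof.
  intros Hab H. apply C_eq.
  - apply (R_zero_derive_const (fun x => fst (f x))); auto; intros x Hx.
    + apply (H x). lra.
    + apply is_derive_continuity_pt with 0. apply (H x Hx).
  - apply (R_zero_derive_const (fun x => snd (f x))); auto; intros x Hx.
    + apply (H x). lra.
    + apply is_derive_continuity_pt with 0. apply (H x Hx).
Qed.

(** At k b = 2 pi n and k b = 2 pi n + pi the cosine is 1 and -1; adding the two estimates
    eliminates kap and leaves 2 |p| = O(1/n). It is applied with b = a - 1. *)
Lemma cos_limit_zero (p kap b M : R) : 0 < b -> 0 <= M -> (forall k, 0 < k -> Rabs (p - kap * cos (k * b)) <= M / k) -> p = 0.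
Proof.
  intros Hb HM H. destruct (Req_dec p 0) as [E|E]; [exact E|exfalso].
  apply Rabs_pos_lt in E. pose proof PI_RGT_0 as HP.
  destruct (INR_unbounded (M * b / (PI * Rabs p))) as (n & Hn).
  assert (Hn0 : 0 < INR n).
  { apply Rle_lt_trans with (2 := Hn). apply Rmult_le_pos; [nra | left; apply Rinv_0_lt_compat; nra]. }
  assert (Hk1 : 0 < 2 * INR n * PI / b) by (apply Rdiv_lt_0_compat; nra).
  assert (Hk2 : 0 < (2 * INR n * PI + PI) / b) by (apply Rdiv_lt_0_compat; nra).
  pose proof (H _ Hk1) as H1. pose proof (H _ Hk2) as H2.
  replace (2 * INR n * PI / b * b) with (0 + 2 * INR n * PI) in H1 by (field; lra).
  replace ((2 * INR n * PI + PI) / b * b) with ((0 + 2 * INR n * PI) + PI) in H2 by (field; lra).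
  rewrite neg_cos in H2. rewrite cos_period, cos_0 in H1, H2.
  assert (Hb1 : M / (2 * INR n * PI / b) < Rabs p).
  { replace (M / (2 * INR n * PI / b)) with (M * b / (PI * Rabs p) * (Rabs p / (2 * INR n))) by (field; repeat split; lra).
    apply Rle_lt_trans with (INR n * (Rabs p / (2 * INR n))).
    - apply Rmult_le_compat_r; [left; apply Rdiv_lt_0_compat; lra | lra].
    - replace (INR n * (Rabs p / (2 * INR n))) with (Rabs p / 2) by (field; lra). lra. }
  assert (Hb2 : M / ((2 * INR n * PI + PI) / b) <= M / (2 * INR n * PI / b)).
  { apply Rmult_le_compat_l; [exact HM|]. apply Rinv_le_contravar; [exact Hk1|].
    apply Rmult_le_compat_r; [left; apply Rinv_0_lt_compat, Hb | lra]. }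
  assert (T : Rabs (2 * p) <= Rabs (p - kap * 1) + Rabs (p - kap * - (1))).
  { replace (2 * p) with ((p - kap * 1) + (p - kap * - (1))) by ring. apply Rabs_triang. }
  rewrite Rabs_mult, (Rabs_pos_eq 2) in T by lra. lra.
Qed.

Lemma sqr_sum_bound (u v : R) : u * u + v * v = 1 -> Rabs u <= 1 /\ Rabs v <= 1.
Proof. intros H. split; apply Rabs_le; nra. Qed.

Section Pair.
Variables (e e1 q g mu mu1 : R -> R) (K : R) (e' e1' q' g' mu' mu1' : R -> R) (K' : R).
Hypothesis He : forall x, continuous e x.
Hypothesis W : wkb e e1 q g mu mu1 K.
Hypothesis He' : forall x, continuous e' x.
Hypothesis W' : wkb e' e1' q' g' mu' mu1' K'.
Variables (y yp y' yp' s sp : R -> C -> C).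
Hypothesis F : ode_family e 0 0 1 y yp.
Hypothesis F' : ode_family e' 0 0 1 y' yp'.
Hypothesis Fs : ode_family (fun _ => 1) 0 0 1 s sp.
Variable eps : R.
Hypothesis Heps : 0 < eps < 1.

Let M := K ^ 2 * exp K.
Let M' := K' ^ 2 * exp K'.

Lemma M_pos : 0 < M.
Proof. pose proof W as [HK _ _ _ _ _ _ _ _ _ _ _ _]. apply Rmult_lt_0_compat; [apply pow_lt; lra | apply exp_pos]. Qed.

Lemma M'_pos : 0 < M'.
Proof. pose proof W' as [HK _ _ _ _ _ _ _ _ _ _ _ _]. apply Rmult_lt_0_compat; [apply pow_lt; lra | apply exp_pos]. Qed.

Lemma sinc_cos_pythagoras (k : C) : (k * k * (s 1 k * s 1 k) + sp 1 k * sp 1 k)%C = 1.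
Proof.
  transitivity (k * k * (s 0 k * s 0 k) + sp 0 k * sp 0 k)%C.
  - apply (cder_zero_interval (fun r => k * k * (s r k * s r k) + sp r k * sp r k)%C 0 1); [lra|]. intros t _.
    eapply cder_eq.
    + apply cder_plus; [apply cder_scal, cder_mult; apply (of_d _ _ _ _ _ _ Fs) | apply cder_mult; apply (of_dp _ _ _ _ _ _ Fs)].
    + cbv beta. ring.
  - rewrite (of_b _ _ _ _ _ _ Fs), (of_bp _ _ _ _ _ _ Fs). ring.
Qed.

Lemma wronskian_const (k : C) : (forall r, eps <= r <= 1 -> e r = e' r) ->
  (y 1 k * yp' 1 k - yp 1 k * y' 1 k)%C = (y eps k * yp' eps k - yp eps k * y' eps k)%C.
Proof.
  intros Heq. apply (cder_zero_interval (fun r => y r k * yp' r k - yp r k * y' r k)%C eps 1); [lra|]. intros t Ht.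
  eapply cder_eq.
  - apply cder_minus; apply cder_mult.
    + apply (of_d _ _ _ _ _ _ F).
    + apply (of_dp _ _ _ _ _ _ F').
    + apply (of_dp _ _ _ _ _ _ F).
    + apply (of_d _ _ _ _ _ _ F').
  - rewrite (Heq t Ht). ring.
Qed.

Lemma half_interval_data (c c1 t0 a : R) (N : nat) :
  (forall r, eps <= r <= 1 -> e r = e' r) -> e 1 = 1 ->
  (forall k, char_ent y yp (s 1) (sp 1) k = (c * char_ent y' yp' (s 1) (sp 1) k)%C) ->
  (forall k, Csinc k = s 1 k) -> (forall k, Ccos k = sp 1 k) ->
  1 < a -> phase e 1 = a -> phase e' 1 = a -> phase e eps = (a + 1) / 2 -> phase e' eps = (a + 1) / 2 ->
  0 < c1 -> 1 <= t0 ->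
  (forall t, t0 <= t -> c1 * exp (t * (phase e 1 + 1)) <= t ^ N * Cmod (char_ent y yp (s 1) (sp 1) (Ci * t)%C)) ->
  forall k, y eps k = y' eps k /\ yp eps k = yp' eps k.
Proof.
  intros Heq He1 Hd Hsc Hcc Ha Hpa Hpa' Hpe Hpe' Hc1 Ht0 Hlow.
  pose proof M_pos as PM. pose proof M'_pos as PM'.
  set (Y := fun k => (y 1 k - c * y' 1 k)%C). set (Yp := fun k => (yp 1 k - c * yp' 1 k)%C).
  (* F is defined without division: here s(1,k) is sin k / k and sp(1,k) is cos k, so Fn = k sin k Y
     + cos k Y' is entire at once, and the Pythagorean identity inverts the relation. *)
  set (Fn := fun k => (k * k * (s 1 k * Y k) + sp 1 k * Yp k)%C).
  assert (HY : Ent Y) by (apply Ent_minus; [apply (of_ent _ _ _ _ _ _ F) | apply Ent_scal, (of_ent _ _ _ _ _ _ F')]).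
  assert (HYp : Ent Yp) by (apply Ent_minus; [apply (of_entp _ _ _ _ _ _ F) | apply Ent_scal, (of_entp _ _ _ _ _ _ F')]).
  assert (HFn : Ent Fn).
  { apply Ent_plus.
    - apply Ent_mult; [apply Ent_mult; apply Ent_id | apply Ent_mult; [apply (of_ent _ _ _ _ _ _ Fs) | exact HY]].
    - apply Ent_mult; [apply (of_entp _ _ _ _ _ _ Fs) | exact HYp]. }
  assert (Rel : forall k, (Yp k * s 1 k)%C = (Y k * sp 1 k)%C).
  { intros k. apply Ceq_minus. unfold Y, Yp. specialize (Hd k). unfold char_ent in Hd.
    transitivity ((yp 1 k * s 1 k - y 1 k * sp 1 k) - c * (yp' 1 k * s 1 k - y' 1 k * sp 1 k))%C; [ring|].
    rewrite Hd. ring. }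
  assert (EY : forall k, Y k = (Fn k * s 1 k)%C).
  { intros k. unfold Fn.
    transitivity (k * k * (s 1 k * s 1 k) * Y k + sp 1 k * (Yp k * s 1 k))%C; [|ring].
    rewrite Rel. transitivity ((k * k * (s 1 k * s 1 k) + sp 1 k * sp 1 k) * Y k)%C; [rewrite sinc_cos_pythagoras|]; ring. }
  assert (EYp : forall k, Yp k = (Fn k * sp 1 k)%C).
  { intros k. unfold Fn.
    transitivity (k * k * s 1 k * (Y k * sp 1 k) + sp 1 k * sp 1 k * Yp k)%C; [|ring].
    rewrite <- Rel. transitivity ((k * k * (s 1 k * s 1 k) + sp 1 k * sp 1 k) * Yp k)%C; [rewrite sinc_cos_pythagoras|]; ring. }
  assert (Feven : forall k, Fn (- k)%C = Fn k).
  { intros k. unfold Fn, Y, Yp. rewrite (of_even _ _ _ _ _ _ F), (of_even _ _ _ _ _ _ F'), (of_even _ _ _ _ _ _ Fs),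
      (of_evenp _ _ _ _ _ _ F), (of_evenp _ _ _ _ _ _ F'), (of_evenp _ _ _ _ _ _ Fs). ring. }
  assert (FD : forall k, (Fn k * char_ent y yp (s 1) (sp 1) k)%C = (c * (y eps k * yp' eps k - yp eps k * y' eps k))%C).
  { intros k. rewrite <- wronskian_const by exact Heq. unfold char_ent.
    transitivity (yp 1 k * (Fn k * s 1 k) - y 1 k * (Fn k * sp 1 k))%C; [ring|].
    rewrite <- EY, <- EYp. unfold Y, Yp. ring. }
  set (Cb := Rabs c * (2 * M * M') / c1).
  assert (HCb : 0 <= Cb).
  { apply Rmult_le_pos; [apply Rmult_le_pos; [apply Rabs_pos | nra] | left; apply Rinv_0_lt_compat, Hc1]. }
  (* Both the Wronskian at eps and the lower bound for d carry the exponential E * E, which cancels;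
     only the power t^N lost in the lower bound remains. *)
  assert (Him : forall t, t0 <= t -> Cmod (Fn (Ci * t)%C) <= Cb * t ^ N).
  { intros t Ht. specialize (Hlow t Ht). specialize (FD (Ci * t)%C). apply (f_equal Cmod) in FD.
    rewrite 2!Cmod_mult, Cmod_R in FD.
    destruct (family_imag_bound0 e e1 q g mu mu1 K y yp He W F t eps ltac:(lra) ltac:(lra)) as [B1 B2].
    destruct (family_imag_bound0 e' e1' q' g' mu' mu1' K' y' yp' He' W' F' t eps ltac:(lra) ltac:(lra)) as [B3 B4].
    fold M in B1, B2. fold M' in B3, B4. rewrite Hpe in B1, B2. rewrite Hpe' in B3, B4. rewrite Hpa in Hlow.
    set (E := exp (t * ((a + 1) / 2))) in *. assert (HE : 0 < E) by apply exp_pos.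
    assert (EE : exp (t * (a + 1)) = E * E) by (unfold E; rewrite <- exp_plus; f_equal; field). rewrite EE in Hlow.
    set (u := y eps (Ci * t)%C) in *. set (v := yp eps (Ci * t)%C) in *.
    set (u' := y' eps (Ci * t)%C) in *. set (v' := yp' eps (Ci * t)%C) in *.
    pose proof (Cmod_ge_0 u). pose proof (Cmod_ge_0 v). pose proof (Cmod_ge_0 u'). pose proof (Cmod_ge_0 v').
    assert (A1 : Cmod u <= M * E) by nra. assert (A3 : Cmod u' <= M' * E) by nra.
    assert (Wb : Cmod (u * v' - v * u') <= 2 * M * M' * (E * E)).
    { apply Rle_trans with (1 := Cmod_triangle _ _). rewrite Cmod_opp, 2!Cmod_mult.
      assert (Cmod u * Cmod v' <= (M * E) * (M' * E)) by (apply Rmult_le_compat; assumption).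
      assert (Cmod v * Cmod u' <= (M * E) * (M' * E)) by (apply Rmult_le_compat; assumption). lra. }
    set (d := Cmod (char_ent y yp (s 1) (sp 1) (Ci * t)%C)) in *. set (f := Cmod (Fn (Ci * t)%C)) in *.
    assert (Hf : 0 <= f) by apply Cmod_ge_0.
    assert (Htn : 0 <= t ^ N) by (apply pow_le; lra).
    apply Rmult_le_reg_r with (c1 * (E * E)); [apply Rmult_lt_0_compat; nra|].
    apply Rle_trans with (f * (t ^ N * d)); [apply Rmult_le_compat_l; assumption|].
    replace (f * (t ^ N * d)) with (t ^ N * (f * d)) by ring. rewrite FD.
    replace (Cb * t ^ N * (c1 * (E * E))) with (t ^ N * (Rabs c * (2 * M * M' * (E * E)))) by (unfold Cb; field; lra).
    apply Rmult_le_compat_l; [exact Htn|]. apply Rmult_le_compat_l; [apply Rabs_pos | exact Wb]. }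
  destruct (Ent_bounded Fn t0 HFn) as (M0 & HM0 & Hb0).
  set (B := M + Rabs c * M'). assert (HB : 0 <= B) by (unfold B; pose proof (Rabs_pos c); nra).
  assert (Hre : forall x : R, 1 <= Rabs x -> Cmod (Fn x) <= 2 * B).
  { intros x Hx.
    assert (Pyth : Rabs (x * fst (s 1 x)) <= 1 /\ Rabs (fst (sp 1 x)) <= 1).
    { apply sqr_sum_bound. pose proof (sinc_cos_pythagoras x) as T. apply (f_equal fst) in T. simpl in T.
      rewrite (of_real _ _ _ _ _ _ Fs 1 x (real_sqr_R x)), (of_realp _ _ _ _ _ _ Fs 1 x (real_sqr_R x)) in T. lra. }
    destruct Pyth as [P1 P2].
    assert (Q1 : Cmod (x * s 1 x) <= 1).
    { rewrite Cmod_mult, (Cmod_real (s 1 x)), Cmod_R, <- Rabs_mult; [exact P1|]. apply (of_real _ _ _ _ _ _ Fs), real_sqr_R. }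
    assert (Q2 : Cmod (sp 1 x) <= 1).
    { rewrite (Cmod_real (sp 1 x)); [exact P2|]. apply (of_realp _ _ _ _ _ _ Fs), real_sqr_R. }
    destruct (family_real_bound e 0 0 1 y yp F e1 q g mu mu1 K W ltac:(lra) x 1 ltac:(lra)) as [B1 B2].
    destruct (family_real_bound e' 0 0 1 y' yp' F' e1' q' g' mu' mu1' K' W' ltac:(lra) x 1 ltac:(lra)) as [B3 B4].
    rewrite Rmult_0_r, Rabs_R0, Rabs_R1, Rplus_0_l, Rmult_1_r in B1, B2, B3, B4. fold M in B1, B2. fold M' in B3, B4.
    assert (YB : Cmod (x * Y x) <= B).
    { unfold Y, B. replace (x * (y 1 x - c * y' 1 x))%C with (x * y 1 x - c * (x * y' 1 x))%C by ring.
      apply Rle_trans with (1 := Cmod_triangle _ _). rewrite Cmod_opp, (Cmod_mult c), Cmod_R. pose proof (Rabs_pos c). nra. }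
    assert (YpB : Cmod (Yp x) <= B).
    { unfold Yp, B. apply Rle_trans with (1 := Cmod_triangle _ _). rewrite Cmod_opp, (Cmod_mult c), Cmod_R. pose proof (Rabs_pos c). nra. }
    unfold Fn. replace (x * x * (s 1 x * Y x))%C with ((x * s 1 x) * (x * Y x))%C by ring.
    apply Rle_trans with (1 := Cmod_triangle _ _). rewrite (Cmod_mult (x * s 1 x)), (Cmod_mult (sp 1 x)).
    pose proof (Cmod_ge_0 (x * s 1 x)). pose proof (Cmod_ge_0 (sp 1 x)).
    pose proof (Cmod_ge_0 (x * Y x)). pose proof (Cmod_ge_0 (Yp x)). nra. }
  assert (Hconst : forall z, Fn z = Fn 0).
  { destruct (phragmen_lindelof_plane Fn N (2 * B + Cb + M0) HFn) as (A' & HA' & HA).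
    - intros x Hx. apply Rle_trans with (1 := Hre x Hx). assert (1 <= Rabs x ^ N) by (apply pow_R1_Rle; exact Hx). nra.
    - intros x Hx.
      assert (Hx' : Cmod (Fn (Ci * x)%C) <= Cb * Rabs x ^ N \/ Cmod (Fn (Ci * x)%C) <= M0).
      { destruct (Rle_dec t0 (Rabs x)) as [L|L].
        - left. specialize (Him (Rabs x) L). unfold Rabs in Him at 1. destruct Rcase_abs.
          + rewrite <- Feven. replace (- (Ci * x))%C with (Ci * RtoC (- x))%C by (rewrite RtoC_opp; ring). exact Him.
          + exact Him.
        - right. apply Hb0. rewrite Cmod_Ci_mult. lra. }
      assert (1 <= Rabs x ^ N) by (apply pow_R1_Rle; exact Hx). destruct Hx'; nra.
    - apply (liouville_poly N Fn A' (2 * B + M0) HFn HA). intros x.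
      destruct (Rle_dec 1 (Rabs x)) as [L|L].
      + specialize (Hre x L). lra.
      + apply Rle_trans with M0; [apply Hb0; rewrite Cmod_R; lra | lra]. }
  assert (He1' : e' 1 = 1) by (rewrite <- Heq by lra; exact He1).
  (* Being constant, F may be evaluated at any real k, where it is (1/q(0) - c/q'(0)) cos(k (a - 1))
     up to O(1/k), with q' the quantity for the second coefficient. *)
  assert (Hfst : fst (Fn 0) = 0).
  { apply (cos_limit_zero (fst (Fn 0)) (/ q 0 - c / q' 0) (a - 1)
      (4 * K ^ 5 * exp K + Rabs c * (4 * K' ^ 5 * exp K'))).
    - lra.
    - pose proof (wkb_K _ _ _ _ _ _ _ W). pose proof (wkb_K _ _ _ _ _ _ _ W'). assert (0 <= 4 * K ^ 5 * exp K).
      { apply Rmult_le_pos; [apply Rmult_le_pos; [lra | apply pow_le; lra] | left; apply exp_pos]. }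
      assert (0 <= 4 * K' ^ 5 * exp K').
      { apply Rmult_le_pos; [apply Rmult_le_pos; [lra | apply pow_le; lra] | left; apply exp_pos]. }
      pose proof (Rabs_pos c). nra.
    - intros k Hk. rewrite <- (Hconst k).
      pose proof (real_axis_asymptotics e e1 q g mu mu1 K He W k (fun r => fst (y r k)) (fun r => fst (yp r k))
        (fun x _ => proj1 (family_real_d _ _ _ _ _ _ F k x)) (fun x _ => proj2 (family_real_d _ _ _ _ _ _ F k x)) Hk He1
        (f_equal fst (of_b _ _ _ _ _ _ F k)) (f_equal fst (of_bp _ _ _ _ _ _ F k))) as R1.
      pose proof (real_axis_asymptotics e' e1' q' g' mu' mu1' K' He' W' k (fun r => fst (y' r k)) (fun r => fst (yp' r k))
        (fun x _ => proj1 (family_real_d _ _ _ _ _ _ F' k x)) (fun x _ => proj2 (family_real_d _ _ _ _ _ _ F' k x)) Hk He1'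
        (f_equal fst (of_b _ _ _ _ _ _ F' k)) (f_equal fst (of_bp _ _ _ _ _ _ F' k))) as R2.
      cbv beta in R1, R2. rewrite Hpa in R1. rewrite Hpa' in R2.
      assert (EF : fst (Fn k) = (k * sin k * fst (y 1 k) + cos k * fst (yp 1 k)) - c * (k * sin k * fst (y' 1 k) + cos k * fst (yp' 1 k))).
      { unfold Fn. rewrite <- Hsc, <- Hcc, Csinc_real, Ccos_real by exact Hk. unfold Y, Yp.
        simpl. field. lra. }
      rewrite EF. set (w := k * sin k * fst (y 1 k) + cos k * fst (yp 1 k)) in *.
      set (w' := k * sin k * fst (y' 1 k) + cos k * fst (yp' 1 k)) in *. set (cs := cos (k * (a - 1))) in *.
      replace (w - c * w' - (/ q 0 - c / q' 0) * cs) with ((w - cs / q 0) - c * (w' - cs / q' 0)) by (unfold Rdiv; ring).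
      unfold Rminus at 1. apply Rle_trans with (1 := Rabs_triang _ _). rewrite Rabs_Ropp, (Rabs_mult c).
      replace ((4 * K ^ 5 * exp K + Rabs c * (4 * K' ^ 5 * exp K')) / k) with (4 * K ^ 5 * exp K / k + Rabs c * (4 * K' ^ 5 * exp K' / k)) by (field; lra).
      apply Rplus_le_compat; [exact R1|]. apply Rmult_le_compat_l; [apply Rabs_pos | exact R2]. }
  assert (Hsnd : snd (Fn 0) = 0).
  { unfold Fn, Yp. simpl.
    rewrite (of_realp _ _ _ _ _ _ Fs 1 0 (real_sqr_R 0)), (of_realp _ _ _ _ _ _ F 1 0 (real_sqr_R 0)), (of_realp _ _ _ _ _ _ F' 1 0 (real_sqr_R 0)). ring. }
  assert (HF0 : forall k, Fn k = 0).
  { intros k. rewrite Hconst. apply C_eq; assumption. }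
  assert (E1 : forall k, y 1 k = (c * y' 1 k)%C).
  { intros k. apply Ceq_minus. change (Y k = 0). rewrite EY, HF0. ring. }
  assert (E2 : forall k, yp 1 k = (c * yp' 1 k)%C).
  { intros k. apply Ceq_minus. change (Yp k = 0). rewrite EYp, HF0. ring. }
  assert (Hc : RtoC c = 1).
  { specialize (E2 0). destruct (family_at_zero _ _ _ _ _ _ F He ltac:(lra) 1 ltac:(lra)) as [_ Z1].
    destruct (family_at_zero _ _ _ _ _ _ F' He' ltac:(lra) 1 ltac:(lra)) as [_ Z2]. rewrite Z1, Z2 in E2. rewrite E2. ring. }
  intros k.
  (* With c = 1 the Cauchy data agree at 1, and both equations have the same coefficient on
     [eps, 1], so the solutions agree back to eps. *)
  destruct (family_unique e 0 0 1 y yp F eps 1 1 k (fun r => y' r k) (fun r => yp' r k) He) with (x := eps) as [U V].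
  - intros x _. apply (of_d _ _ _ _ _ _ F').
  - intros x Hx. rewrite (Heq x Hx). apply (of_dp _ _ _ _ _ _ F').
  - lra.
  - rewrite E1, Hc. ring.
  - rewrite E2, Hc. ring.
  - lra.
  - split; symmetry; assumption.
Qed.

(** Comparing at equal phases rather than at equal points makes the exponential rates on the two
    sides match, although the coefficients on [0, eps] are not yet known to be related. *)
Lemma cauchy_data_phase (r : R) : phase e eps = phase e' eps ->
  (forall k, y eps k = y' eps k /\ yp eps k = yp' eps k) -> 0 < r < eps -> phase e r = phase e' r.
Proof.
  intros Hph Hdata Hr.
  pose proof M_pos as PM. pose proof M'_pos as PM'.
  assert (Mono : forall x z, 0 <= x -> x <= z -> z <= 1 -> phase e x <= phase e z).
  { intros x z; apply phase_mono; exact He. }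
  assert (Mono' : forall x z, 0 <= x -> x <= z -> z <= 1 -> phase e' x <= phase e' z).
  { intros x z; apply phase_mono; exact He'. }
  destruct (IVT_gen (phase e') 0 eps (phase e r)) as (r' & Hr' & Er').
  { intros x. eapply is_derive_continuity_pt. apply (phase_derive e' He'). }
  { rewrite phase_0, <- Hph. pose proof (Mono 0 r ltac:(lra) ltac:(lra) ltac:(lra)) as A1. rewrite phase_0 in A1.
    pose proof (Mono r eps ltac:(lra) ltac:(lra) ltac:(lra)).
    rewrite Rmin_left, Rmax_right by lra. lra. }
  rewrite Rmin_left, Rmax_right in Hr' by lra.
  destruct (ode_solution e eps 1 0 He) as (u & up & Fu). destruct (ode_solution e eps 0 1 He) as (z & zp & Fz).
  destruct (ode_solution e' eps 1 0 He') as (u' & up' & Fu'). destruct (ode_solution e' eps 0 1 He') as (z' & zp' & Fz').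
  set (E := fun k => (u r k * z' r' k - z r k * u' r' k)%C).
  assert (HE : Ent E).
  { apply Ent_minus; apply Ent_mult.
    - apply (of_ent _ _ _ _ _ _ Fu).
    - apply (of_ent _ _ _ _ _ _ Fz').
    - apply (of_ent _ _ _ _ _ _ Fz).
    - apply (of_ent _ _ _ _ _ _ Fu'). }
  assert (Eeven : forall k, E (- k)%C = E k).
  { intros k. unfold E. rewrite (of_even _ _ _ _ _ _ Fu), (of_even _ _ _ _ _ _ Fu'), (of_even _ _ _ _ _ _ Fz), (of_even _ _ _ _ _ _ Fz'). reflexivity. }
  assert (Dec : forall k, y r k = (y eps k * u r k + yp eps k * z r k)%C).
  { intros k. symmetry.
    apply (family_unique e 0 0 1 y yp F 0 1 eps k (fun r => y eps k * u r k + yp eps k * z r k)%C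
      (fun r => y eps k * up r k + yp eps k * zp r k)%C He); try lra.
    - intros x _. apply cder_plus; apply cder_scal; [apply (of_d _ _ _ _ _ _ Fu) | apply (of_d _ _ _ _ _ _ Fz)].
    - intros x _. eapply cder_eq; [apply cder_plus; apply cder_scal; [apply (of_dp _ _ _ _ _ _ Fu) | apply (of_dp _ _ _ _ _ _ Fz)]|]. ring.
    - rewrite (of_b _ _ _ _ _ _ Fu), (of_b _ _ _ _ _ _ Fz). ring.
    - rewrite (of_bp _ _ _ _ _ _ Fu), (of_bp _ _ _ _ _ _ Fz). ring. }
  assert (Dec' : forall k, y' r' k = (y eps k * u' r' k + yp eps k * z' r' k)%C).
  { intros k. symmetry. destruct (Hdata k) as [D1 D2].
    apply (family_unique e' 0 0 1 y' yp' F' 0 1 eps k (fun r => y eps k * u' r k + yp eps k * z' r k)%C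
      (fun r => y eps k * up' r k + yp eps k * zp' r k)%C He'); try lra.
    - intros x _. apply cder_plus; apply cder_scal; [apply (of_d _ _ _ _ _ _ Fu') | apply (of_d _ _ _ _ _ _ Fz')].
    - intros x _. eapply cder_eq; [apply cder_plus; apply cder_scal; [apply (of_dp _ _ _ _ _ _ Fu') | apply (of_dp _ _ _ _ _ _ Fz')]|]. ring.
    - rewrite (of_b _ _ _ _ _ _ Fu'), (of_b _ _ _ _ _ _ Fz'), D1. ring.
    - rewrite (of_bp _ _ _ _ _ _ Fu'), (of_bp _ _ _ _ _ _ Fz'), D2. ring. }
  assert (EA : forall k, (y eps k * E k = y r k * z' r' k - z r k * y' r' k)%C).
  { intros k. rewrite Dec, Dec'. unfold E. ring. }
  assert (EB : forall k, (yp eps k * E k = u r k * y' r' k - y r k * u' r' k)%C).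
  { intros k. rewrite Dec, Dec'. unfold E. ring. }
  (* For real x the solutions with data (1,0) are bounded and those with data (0,1) are O(1/|x|);
     each product in E contains one of each. *)
  assert (Hre : forall x : R, x <> 0 -> Cmod (E x) <= 2 * M * M' / Rabs x).
  { intros x Hx. apply Rabs_pos_lt in Hx.
    destruct (family_real_bound _ _ _ _ _ _ Fu e1 q g mu mu1 K W ltac:(lra) x r ltac:(lra)) as [B1 _].
    destruct (family_real_bound _ _ _ _ _ _ Fz e1 q g mu mu1 K W ltac:(lra) x r ltac:(lra)) as [B2 _].
    destruct (family_real_bound _ _ _ _ _ _ Fu' e1' q' g' mu' mu1' K' W' ltac:(lra) x r' ltac:(lra)) as [B3 _].
    destruct (family_real_bound _ _ _ _ _ _ Fz' e1' q' g' mu' mu1' K' W' ltac:(lra) x r' ltac:(lra)) as [B4 _].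
    rewrite Cmod_mult, Cmod_R in B1, B2, B3, B4.
    rewrite Rmult_1_r, Rabs_R0, Rplus_0_r in B1, B3. rewrite Rmult_0_r, Rabs_R0, Rabs_R1, Rplus_0_l, Rmult_1_r in B2, B4.
    fold M in B1, B2. fold M' in B3, B4.
    set (ax := Rabs x) in *.
    assert (U1 : Cmod (u r x) <= M) by (apply Rmult_le_reg_l with ax; lra).
    assert (U3 : Cmod (u' r' x) <= M') by (apply Rmult_le_reg_l with ax; lra).
    pose proof (Cmod_ge_0 (u r x)). pose proof (Cmod_ge_0 (z r x)). pose proof (Cmod_ge_0 (u' r' x)). pose proof (Cmod_ge_0 (z' r' x)).
    apply Rmult_le_reg_l with ax; [exact Hx|]. replace (ax * (2 * M * M' / ax)) with (2 * M * M') by (field; lra).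
    apply Rle_trans with (ax * (Cmod (u r x) * Cmod (z' r' x) + Cmod (z r x) * Cmod (u' r' x))).
    - apply Rmult_le_compat_l; [lra|]. unfold E. apply Rle_trans with (1 := Cmod_triangle _ _). rewrite Cmod_opp, 2!Cmod_mult. lra.
    - assert (Cmod (u r x) * (ax * Cmod (z' r' x)) <= M * M') by (apply Rmult_le_compat; nra).
      assert ((ax * Cmod (z r x)) * Cmod (u' r' x) <= M * M') by (apply Rmult_le_compat; nra). lra. }
  pose proof W as [HK _ Hq Hlo Hhi _ _ _ _ _ _ _ _].
  set (s0 := / q 0 * exp (- (K * eps))).
  assert (Hs0 : 0 < s0). { apply Rmult_lt_0_compat; [apply Rinv_0_lt_compat, Hq; lra | apply exp_pos]. }
  set (Ci0 := K * (4 * M * M') / s0).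
  assert (HCi0 : 0 <= Ci0). { apply Rmult_le_pos; [|left; apply Rinv_0_lt_compat, Hs0]. apply Rmult_le_pos; [lra | nra]. }
  assert (Him : forall t, 1 <= t -> Cmod (E (Ci * t)%C) <= Ci0).
  { intros t Ht.
    pose proof (S_lower e e1 q g mu mu1 K He W t (fun r => fst (y r (Ci * t)%C)) (fun r => fst (yp r (Ci * t)%C)) ltac:(lra)
      (fun x _ => proj1 (family_imag_d _ _ _ _ _ _ F t x)) (fun x _ => proj2 (family_imag_d _ _ _ _ _ _ F t x))
      (f_equal fst (of_b _ _ _ _ _ _ F (Ci * t)%C)) (f_equal fst (of_bp _ _ _ _ _ _ F (Ci * t)%C)) eps ltac:(lra)) as SL.
    cbv beta in SL.
    destruct (family_imag_bound0 e e1 q g mu mu1 K y yp He W F t r ltac:(lra) ltac:(lra)) as [B1 _].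
    destruct (family_imag_bound0 e' e1' q' g' mu' mu1' K' y' yp' He' W' F' t r' ltac:(lra) ltac:(lra)) as [B2 _].
    destruct (family_imag_bound _ _ _ _ _ _ Fu e1 q g mu mu1 K He W ltac:(lra) t r ltac:(lra) ltac:(lra)) as [B3 _].
    destruct (family_imag_bound _ _ _ _ _ _ Fz e1 q g mu mu1 K He W ltac:(lra) t r ltac:(lra) ltac:(lra)) as [B4 _].
    destruct (family_imag_bound _ _ _ _ _ _ Fu' e1' q' g' mu' mu1' K' He' W' ltac:(lra) t r' ltac:(lra) ltac:(lra)) as [B5 _].
    destruct (family_imag_bound _ _ _ _ _ _ Fz' e1' q' g' mu' mu1' K' He' W' ltac:(lra) t r' ltac:(lra) ltac:(lra)) as [B6 _].
    pose proof (Mono r eps ltac:(lra) ltac:(lra) ltac:(lra)) as Mr.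
    rewrite Er' in B2, B5, B6. rewrite <- Hph in B5, B6.
    rewrite (Rabs_left1 (phase e r - phase e eps)) in B3, B4, B5, B6 by lra.
    rewrite Rmult_1_r, Rabs_R0, Rplus_0_r, (Rabs_pos_eq t) in B3, B5 by lra.
    rewrite Rmult_0_r, Rabs_R0, Rabs_R1, Rplus_0_l, Rmult_1_r in B4, B6.
    rewrite exp_plus, <- Rmult_assoc in B3, B4, B5, B6. fold M in B1, B3, B4. fold M' in B2, B5, B6.
    (* A solution started at 0 has size X at r, and at r' for the second equation; one started at
       eps has size X2. The product X * X2 = exp(t phase(eps)) does not depend on r and is the order
       to be divided out. *)
    set (X := exp (t * phase e r)) in *. set (X2 := exp (t * - (phase e r - phase e eps))) in *.
    assert (XX : X * X2 = exp (t * phase e eps)) by (unfold X, X2; rewrite <- exp_plus; f_equal; ring).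
    assert (PX : 0 < X) by apply exp_pos. assert (PX2 : 0 < X2) by apply exp_pos.
    assert (Emod : t * phase e eps - K * eps = t * phase e eps + - (K * eps)) by ring.
    rewrite Emod, exp_plus, <- XX in SL.
    pose proof (EA (Ci * t)%C) as A1. pose proof (EB (Ci * t)%C) as A2. apply (f_equal Cmod) in A1. apply (f_equal Cmod) in A2.
    rewrite Cmod_mult in A1, A2.
    pose proof (of_real _ _ _ _ _ _ F eps (Ci * t)%C (real_sqr_I t)) as RA.
    pose proof (of_realp _ _ _ _ _ _ F eps (Ci * t)%C (real_sqr_I t)) as RB.
    rewrite (Cmod_real (y eps (Ci * t)%C) RA) in A1. rewrite (Cmod_real (yp eps (Ci * t)%C) RB) in A2.
    set (a := fst (y eps (Ci * t)%C)) in *. set (b := fst (yp eps (Ci * t)%C)) in *.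
    set (ee := Cmod (E (Ci * t)%C)) in *.
    set (my := Cmod (y r (Ci * t)%C)) in *. set (my' := Cmod (y' r' (Ci * t)%C)) in *.
    set (mu0 := Cmod (u r (Ci * t)%C)) in *. set (mu0' := Cmod (u' r' (Ci * t)%C)) in *.
    set (mz := Cmod (z r (Ci * t)%C)) in *. set (mz' := Cmod (z' r' (Ci * t)%C)) in *.
    assert (Pee : 0 <= ee) by apply Cmod_ge_0. assert (P1 : 0 <= my) by apply Cmod_ge_0. assert (P2 : 0 <= my') by apply Cmod_ge_0.
    assert (P3 : 0 <= mu0) by apply Cmod_ge_0. assert (P4 : 0 <= mu0') by apply Cmod_ge_0.
    assert (P5 : 0 <= mz) by apply Cmod_ge_0. assert (P6 : 0 <= mz') by apply Cmod_ge_0.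
    assert (U3 : mu0 <= M * X2) by (apply Rmult_le_reg_l with t; lra).
    assert (U5 : mu0' <= M' * X2) by (apply Rmult_le_reg_l with t; lra).
    set (XE := X * X2) in *. assert (PXE : 0 < XE) by (unfold XE; apply Rmult_lt_0_compat; assumption).
    assert (TA : t * (t * (Rabs a * ee)) <= 2 * M * M' * XE).
    { rewrite A1. apply Rle_trans with (t * (t * (my * mz' + mz * my'))).
      - apply Rmult_le_compat_l; [lra|]. apply Rmult_le_compat_l; [lra|].
        apply Rle_trans with (1 := Cmod_triangle _ _). rewrite Cmod_opp, 2!Cmod_mult. unfold my, mz, my', mz'. lra.
      - assert ((t * my) * (t * mz') <= (M * X) * (M' * X2)) by (apply Rmult_le_compat; auto; apply Rmult_le_pos; lra).
        assert ((t * mz) * (t * my') <= (M * X2) * (M' * X)) by (apply Rmult_le_compat; auto; apply Rmult_le_pos; lra).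
        unfold XE. lra. }
    assert (TB : t * (Rabs b * ee) <= 2 * M * M' * XE).
    { rewrite A2. apply Rle_trans with (t * (mu0 * my' + my * mu0')).
      - apply Rmult_le_compat_l; [lra|].
        apply Rle_trans with (1 := Cmod_triangle _ _). rewrite Cmod_opp, 2!Cmod_mult. unfold my, mu0, my', mu0'. lra.
      - assert (mu0 * (t * my') <= (M * X2) * (M' * X)) by (apply Rmult_le_compat; auto; apply Rmult_le_pos; lra).
        assert ((t * my) * mu0' <= (M * X) * (M' * X2)) by (apply Rmult_le_compat; auto; apply Rmult_le_pos; lra).
        unfold XE. lra. }
    assert (Qe : 0 < q eps) by (apply Hq; lra). pose proof (Hlo eps ltac:(lra)) as Ql. pose proof (Hhi eps ltac:(lra)) as Qh.
    assert (Qi : / q eps <= K). { apply Rmult_le_reg_r with (q eps); [lra|]. rewrite Rinv_l by lra. lra. }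
    assert (Qi0 : 0 < / q eps) by (apply Rinv_0_lt_compat, Qe).
    (* [S_lower] bounds only the combination y'/q + t q y from below at eps, not y or y' separately,
       so the estimates for both products with E have to be added. *)
    assert (SU : s0 * XE <= K * (Rabs b + t * Rabs a)).
    { unfold s0. apply Rle_trans with (b / q eps + t * q eps * a); [lra|].
      unfold Rdiv. pose proof (Rle_abs a). pose proof (Rle_abs b). pose proof (Rabs_pos a). pose proof (Rabs_pos b).
      assert (b * / q eps <= Rabs b * K).
      { apply Rle_trans with (Rabs b * / q eps); [apply Rmult_le_compat_r; lra | apply Rmult_le_compat_l; lra]. }
      assert (t * q eps * a <= t * (K * Rabs a)).
      { rewrite Rmult_assoc. apply Rmult_le_compat_l; [lra|].
        apply Rle_trans with (q eps * Rabs a); [apply Rmult_le_compat_l; lra | apply Rmult_le_compat_r; lra]. }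
      lra. }
    apply Rmult_le_reg_r with (s0 * XE); [apply Rmult_lt_0_compat; assumption|].
    apply Rle_trans with (ee * (K * (Rabs b + t * Rabs a))); [apply Rmult_le_compat_l; assumption|].
    unfold Ci0. replace (K * (4 * M * M') / s0 * (s0 * XE)) with (K * (2 * M * M' * XE + 2 * M * M' * XE)) by (field; lra).
    replace (ee * (K * (Rabs b + t * Rabs a))) with (K * (Rabs b * ee + t * (Rabs a * ee))) by ring.
    apply Rmult_le_compat_l; [lra|].
    pose proof (Rabs_pos a). pose proof (Rabs_pos b).
    assert (0 <= Rabs b * ee) by (apply Rmult_le_pos; assumption). assert (0 <= t * (Rabs a * ee)) by (repeat apply Rmult_le_pos; lra).
    nra. }
  assert (Hconst : forall k, E k = E 0).
  { destruct (phragmen_lindelof_plane E 0 (2 * M * M' + Ci0) HE) as (A' & HA' & HA).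
    - intros x Hx. simpl. apply Rle_trans with (2 * M * M' / Rabs x).
      + apply Hre. intros ->. rewrite Rabs_R0 in Hx. lra.
      + apply Rle_trans with (2 * M * M'); [|lra]. assert (0 <= 2 * M * M') by nra.
        apply Rmult_le_reg_r with (Rabs x); [lra|]. unfold Rdiv. rewrite Rmult_assoc, Rinv_l by lra. nra.
    - intros x Hx. simpl. assert (0 <= 2 * M * M') by nra.
      apply Rle_trans with Ci0; [|lra].
      specialize (Him (Rabs x) Hx). unfold Rabs in Him at 1. destruct Rcase_abs.
      + rewrite <- Eeven. replace (- (Ci * x))%C with (Ci * RtoC (- x))%C by (rewrite RtoC_opp; ring). exact Him.
      + exact Him.
    - apply (liouville_poly 0 E A' A' HE HA). intros x. specialize (HA x). simpl in HA. lra. }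
  assert (E0 : E 0 = 0).
  { apply Cmod_eq_0. apply Rle_antisym; [|apply Cmod_ge_0]. apply Rle_plus_epsilon. intros et Het. rewrite Rplus_0_l.
    assert (P0 : 0 < 2 * M * M') by (apply Rmult_lt_0_compat; lra).
    assert (P : 0 < 2 * M * M' / et) by (apply Rdiv_lt_0_compat; assumption).
    rewrite <- (Hconst (RtoC (2 * M * M' / et))).
    apply Rle_trans with (1 := Hre _ (Rgt_not_eq _ _ P)).
    rewrite Rabs_pos_eq by lra. right. field. repeat split; lra. }
  unfold E in E0.
  rewrite (proj1 (family_at_zero _ _ _ _ _ _ Fu He ltac:(lra) r ltac:(lra))), (proj1 (family_at_zero _ _ _ _ _ _ Fz He ltac:(lra) r ltac:(lra))),
    (proj1 (family_at_zero _ _ _ _ _ _ Fu' He' ltac:(lra) r' ltac:(lra))), (proj1 (family_at_zero _ _ _ _ _ _ Fz' He' ltac:(lra) r' ltac:(lra))) in E0.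
  apply (f_equal fst) in E0. simpl in E0.
  assert (r' = r) by lra. subst r'. symmetry. exact Er'.
Qed.
End Pair.

(** * From the hypotheses to the entire functions and phases *)

Lemma trig_solution : exists s sp, ode_family (fun _ => 1) 0 0 1 s sp /\ (forall k, Csinc k = s 1 k) /\ (forall k, Ccos k = sp 1 k).
Proof.
  destruct (ode_solution (fun _ => 1) 0 0 1 (fun x => continuous_const 1 x)) as (s & sp & Fs).
  assert (T : forall k, Csinc k = s 1 k /\ Ccos k = sp 1 k).
  { intros k. apply (sinc_cos_solution k (fun r => s r k) (fun r => sp r k)).
    - intros x _. apply (of_d _ _ _ _ _ _ Fs).
    - intros x _. apply (of_dp _ _ _ _ _ _ Fs).
    - apply (of_b _ _ _ _ _ _ Fs).
    - apply (of_bp _ _ _ _ _ _ Fs). }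
  exists s, sp. split; [exact Fs|]. split; intros k; apply T.
Qed.

(** Everything required of one coefficient, used once for each. The two characteristic functions are
    identified as functions, so that the identity can be rewritten inside [same_zeros_mult]. *)
Lemma char_setup (m : nat) (eta : R -> R) (D : nat -> R -> R) (y yp : R -> C -> C) (s sp : R -> C -> C) :
  (forall r, in01 r -> 0 < eta r) -> W2_derivs m eta D -> eta 1 = 1 ->
  (forall u, (1 <= u <= m + 1)%nat -> D u 1 = 0) -> D (m + 2)%nat 1 <> 0 -> is_sol eta y yp ->
  ode_family (fun _ => 1) 0 0 1 s sp -> (forall k, Csinc k = s 1 k) -> (forall k, Ccos k = sp 1 k) ->
  exists e e1 q g mu mu1 K u v c1 t0,
    (forall x, continuous e x) /\ wkb e e1 q g mu mu1 K /\ ode_family e 0 0 1 u v /\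
    (forall x, 0 <= x <= 1 -> e x = eta x) /\
    charfun y yp = char_ent u v (s 1) (sp 1) /\
    0 < c1 /\ 1 <= t0 /\
    forall t, t0 <= t ->
      c1 * exp (t * (phase e 1 + 1)) <= t ^ S (S (m + 1)) * Cmod (char_ent u v (s 1) (sp 1) (Ci * t)%C).
Proof.
  intros Hpos HW H1 Hder Htop Hsol Fs Hsc Hcc.
  destruct (profile_exists m eta D Hpos HW) as (e & e1 & e2 & Hp & Ee & Ee1).
  destruct (wkb_exists e e1 e2 Hp) as (q & g & mu & mu1 & K & W).
  pose proof (prof_cont _ _ _ Hp) as He.
  destruct (ode_solution e 0 0 1 He) as (u & v & F).
  destruct (flat_sign m eta D HW Hder Htop) as (sg & c & r0 & Hsg & Hc & Hr0 & Hs).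
  destruct (char_lower e e1 q g mu mu1 K u v (s 1) (sp 1) He W F Hsc Hcc (m + 1) sg c r0) as (c1 & t0 & Hc1 & Ht0 & HL); auto.
  - rewrite Ee by lra. exact H1.
  - intros x Hx. rewrite Ee1 by lra. apply Hs, Hx.
  - exists e, e1, q, g, mu, mu1, K, u, v, c1, t0. do 4 (split; [assumption|]). split; [|repeat split; assumption].
    apply functional_extensionality. intros k.
    destruct (given_solution e eta y yp k (fun r => u r k) (fun r => v r k) He Ee Hsol) with (r := 1) as [A B].
    + intros x _. apply (of_d _ _ _ _ _ _ F).
    + intros x _. apply (of_dp _ _ _ _ _ _ F).
    + apply (of_b _ _ _ _ _ _ F).
    + apply (of_bp _ _ _ _ _ _ F).
    + lra.
    + unfold charfun, char_ent. rewrite A, B, Hsc, Hcc. reflexivity.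
Qed.

Lemma char_ent_Ent (e e' : R -> R) (b b' w0 w1 w0' w1' : R) (u v s sp : R -> C -> C) (r r' : R) :
  ode_family e b w0 w1 u v -> ode_family e' b' w0' w1' s sp ->
  let d := char_ent u v (s r') (sp r') in
  Ent d /\ (forall z, d (- z)%C = d z) /\ forall t : R, snd (d (Ci * t)%C) = 0.
Proof.
  intros F G. split; [|split].
  - apply Ent_minus; apply Ent_mult.
    + apply (of_entp _ _ _ _ _ _ F).
    + apply (of_ent _ _ _ _ _ _ G).
    + apply (of_ent _ _ _ _ _ _ F).
    + apply (of_entp _ _ _ _ _ _ G).
  - intros z. unfold char_ent.
    rewrite (of_even _ _ _ _ _ _ F), (of_evenp _ _ _ _ _ _ F), (of_even _ _ _ _ _ _ G), (of_evenp _ _ _ _ _ _ G). reflexivity.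
  - intros t. unfold char_ent. simpl.
    rewrite (of_real _ _ _ _ _ _ F _ _ (real_sqr_I t)), (of_realp _ _ _ _ _ _ F _ _ (real_sqr_I t)),
      (of_real _ _ _ _ _ _ G _ _ (real_sqr_I t)), (of_realp _ _ _ _ _ _ G _ _ (real_sqr_I t)). ring.
Qed.

Lemma lower_nonzero (c a t x : R) (N : nat) : 0 < c -> c * exp a <= t ^ N * x -> x <> 0.
Proof. intros Hc H ->. pose proof (exp_pos a). nra. Qed.

Lemma phase_Riemann (e f : R -> R) (a b : R) (pr : Riemann_integrable (fun r => sqrt (f r)) a b) :
  (forall x, continuous e x) -> a <= b -> (forall x, a <= x <= b -> e x = f x) -> RiemannInt pr = phase e b - phase e a.
Proof.
  intros He Hab E. rewrite <- RInt_Reals.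
  assert (Hi : forall a b, ex_RInt (fun r => sqrt (e r)) a b).
  { intros x z. apply (ex_RInt_continuous (V := R_CompleteNormedModule)). intros w _. apply (continuous_comp e sqrt); [apply He | apply continuous_sqrt]. }
  unfold phase. rewrite (RInt_ext _ (fun r => sqrt (e r))).
  - pose proof (RInt_Chasles (fun r => sqrt (e r)) 0 a b (Hi 0 a) (Hi a b)) as Ch.
    change (RInt (fun r => sqrt (e r)) 0 a + RInt (fun r => sqrt (e r)) a b = RInt (fun r => sqrt (e r)) 0 b) in Ch. lra.
  - intros x; rewrite Rmin_left, Rmax_right by exact Hab. intros Hx. rewrite E by lra. reflexivity.
Qed.

(** The lower growth of one characteristic function is set against the upper growth of the other.
    Used with c and with 1/c, it makes the total phases equal. *)
Lemma char_phase_le (e : R -> R) (u v : R -> C -> C) (e' e1' q' g' mu' mu1' : R -> R) (K' : R)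
  (u' v' s sp : R -> C -> C) (c c1 t0 : R) (N : nat) :
  (forall x, continuous e' x) -> wkb e' e1' q' g' mu' mu1' K' -> ode_family e' 0 0 1 u' v' ->
  (forall k, Csinc k = s 1 k) -> (forall k, Ccos k = sp 1 k) ->
  (forall k, char_ent u v (s 1) (sp 1) k = (c * char_ent u' v' (s 1) (sp 1) k)%C) ->
  0 < c1 -> 1 <= t0 ->
  (forall t, t0 <= t -> c1 * exp (t * (phase e 1 + 1)) <= t ^ N * Cmod (char_ent u v (s 1) (sp 1) (Ci * t)%C)) ->
  phase e 1 <= phase e' 1.
Proof.
  intros He' W' F' Hsc Hcc Hd Hc1 Ht0 HL.
  pose proof (wkb_K _ _ _ _ _ _ _ W') as HK.
  assert (HM : 0 <= Rabs c * (2 * K' ^ 2 * exp K')).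
  { apply Rmult_le_pos; [apply Rabs_pos|]. apply Rmult_le_pos; [|left; apply exp_pos]. apply Rmult_le_pos; [lra | apply pow_le; lra]. }
  enough (phase e 1 + 1 <= phase e' 1 + 1) by lra.
  apply (growth_compare _ _ c1 _ t0 N Hc1 HM). intros t Ht. apply Rle_trans with (1 := HL t Ht).
  apply Rmult_le_compat_l; [apply pow_le; lra|]. rewrite Hd, Cmod_mult, Cmod_R, Rmult_assoc.
  apply Rmult_le_compat_l; [apply Rabs_pos|].
  apply (char_upper e' e1' q' g' mu' mu1' K' u' v' (s 1) (sp 1) He' W' F' Hsc Hcc). lra.
Qed.

(** Differentiating the phases gives equal square roots inside the interval; the end point 0 follows
    by continuity. *)
Lemma phase_determines (e e' : R -> R) (b : R) : (forall x, continuous e x) -> (forall x, continuous e' x) ->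
  (forall x, 0 <= x <= b -> 0 < e x) -> (forall x, 0 <= x <= b -> 0 < e' x) ->
  (forall r, 0 < r < b -> phase e r = phase e' r) -> forall r, 0 <= r < b -> e r = e' r.
Proof.
  intros He He' P P' H.
  assert (I : forall r, 0 < r < b -> e r = e' r).
  { intros r Hr. rewrite <- (sqrt_sqrt (e r)), <- (sqrt_sqrt (e' r)) by (left; first [apply P | apply P']; lra).
    assert (E : sqrt (e r) = sqrt (e' r)).
    { rewrite <- (is_derive_unique _ _ _ (phase_derive e' He' r)). symmetry. apply is_derive_unique.
      apply (is_derive_ext_loc (phase e)); [|apply phase_derive, He].
      apply (locally_interval _ r 0 b); simpl; try lra. intros x H1 H2. apply H. lra. }
    rewrite E. reflexivity. }
  intros r Hr. destruct (Req_dec r 0) as [->|N]; [|apply I; lra].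
  apply Rminus_diag_uniq. apply Rabs_eq_0. apply Rle_antisym; [|apply Rabs_pos].
  apply Rle_plus_epsilon. intros ep Hep. rewrite Rplus_0_l.
  assert (Hc : continuous (fun x => e x - e' x) 0) by (apply (continuous_minus e e'); auto).
  apply continuity_pt_filterlim in Hc. destruct (Hc ep Hep) as (d & Hd & Hx).
  set (x := Rmin d b / 2).
  assert (0 < Rmin d b) by (apply Rmin_glb_lt; lra). pose proof (Rmin_l d b). pose proof (Rmin_r d b).
  assert (Hx0 : 0 < x < b) by (unfold x; lra).
  specialize (Hx x). simpl in Hx. unfold R_dist in Hx.
  rewrite (I x Hx0) in Hx. replace (e' x - e' x - (e 0 - e' 0)) with (- (e 0 - e' 0)) in Hx by ring. rewrite Rabs_Ropp in Hx.
  left. apply Hx. split; [split; [exact Logic.I | lra]|]. rewrite Rminus_0_r, Rabs_pos_eq by lra. unfold x; lra.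
Qed.

Theorem theorem1p2
  (m : nat) (eta etat : R -> R) (D Dt : nat -> R -> R)
  (y yp yt ypt : R -> Cx -> Cx) (eps : R)
  (Heta_pos : forall r, in01 r -> 0 < eta r)
  (Hetat_pos : forall r, in01 r -> 0 < etat r)
  (HW : W2_derivs m eta D)
  (HWt : W2_derivs m etat Dt)
  (H1 : eta 1 = 1) (Ht1 : etat 1 = 1)
  (Hder : forall u, (1 <= u <= m + 1)%nat -> D u 1 = 0)
  (Hdert : forall u, (1 <= u <= m + 1)%nat -> Dt u 1 = 0)
  (Htop : D (m + 2)%nat 1 <> 0)
  (Htopt : Dt (m + 2)%nat 1 <> 0)
  (Ha : exists pr : Riemann_integrable (fun r => sqrt (eta r)) 0 1, RiemannInt pr > 1)
  (Heps : 0 < eps < 1)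
  (Heps_def : exists (pr1 : Riemann_integrable (fun r => sqrt (eta r)) eps 1)
                     (pr : Riemann_integrable (fun r => sqrt (eta r)) 0 1),
                RiemannInt pr1 = (RiemannInt pr - 1) / 2)
  (Heq : forall r, eps <= r <= 1 -> etat r = eta r)
  (Hsol : is_sol eta y yp)
  (Hsolt : is_sol etat yt ypt)
  (Hzeros : same_zeros_mult (charfun y yp) (charfun yt ypt)) :
  forall r, in01 r -> etat r = eta r.
Proof.
  destruct trig_solution as (s & sp & Fs & Hsc & Hcc).
  destruct (char_setup m eta D y yp s sp Heta_pos HW H1 Hder Htop Hsol Fs Hsc Hcc)
    as (e & e1 & q & g & mu & mu1 & K & u & v & c1 & t1 & He & W & F & Ee & Ed & Hc1 & Hlo1 & L).
  destruct (char_setup m etat Dt yt ypt s sp Hetat_pos HWt Ht1 Hdert Htopt Hsolt Fs Hsc Hcc)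
    as (e' & e1' & q' & g' & mu' & mu1' & K' & u' & v' & c1' & t1' & He' & W' & F' & Ee' & Ed' & Hc1' & Hlo1' & L').
  rewrite Ed, Ed' in Hzeros.
  destruct (char_ent_Ent _ _ _ _ _ _ _ _ u v s sp 1 1 F Fs) as (En & Ev & Re).
  destruct (char_ent_Ent _ _ _ _ _ _ _ _ u' v' s sp 1 1 F' Fs) as (En' & Ev' & Re').
  destruct (even_same_zeros_proportional _ _ (Rmax t1 t1') En En' Hzeros Ev Ev' Re Re') as (c & Hc & Hd).
  - intros t Ht E. specialize (L t). apply lower_nonzero in L; [|exact Hc1| pose proof (Rmax_l t1 t1'); lra].
    apply L. rewrite E. apply Cmod_0.
  - intros t Ht E. specialize (L' t). apply lower_nonzero in L'; [|exact Hc1'| pose proof (Rmax_r t1 t1'); lra].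
    apply L'. rewrite E. apply Cmod_0.
  - assert (Hd' : forall k, char_ent u' v' (s 1) (sp 1) k = ((/ c)%R * char_ent u v (s 1) (sp 1) k)%C).
    { intros k. rewrite Hd, RtoC_inv by exact Hc. field. intros Y. apply Hc. apply RtoC_inj, Y. }
    assert (Hph : phase e' 1 = phase e 1).
    { apply Rle_antisym.
      - exact (char_phase_le e' u' v' e e1 q g mu mu1 K u v s sp (/ c) c1' t1' _ He W F Hsc Hcc Hd' Hc1' Hlo1' L').
      - exact (char_phase_le e u v e' e1' q' g' mu' mu1' K' u' v' s sp c c1 t1 _ He' W' F' Hsc Hcc Hd Hc1 Hlo1 L). }
    assert (Eee : forall r, eps <= r <= 1 -> e r = e' r).
    { intros r Hr. rewrite Ee, Ee' by lra. symmetry. apply Heq, Hr. }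
    destruct Ha as (pr0 & Ha). rewrite (phase_Riemann e eta 0 1) in Ha by (auto; lra). rewrite phase_0 in Ha.
    destruct Heps_def as (pr1 & pr & Hep).
    (* The integral over [eps, 1] is a phase increment of either coefficient, as they agree there.
       With equal total phases a, both phases at eps are (a + 1)/2. *)
    rewrite (phase_Riemann e' eta eps 1 pr1) in Hep.
    2: exact He'. 2: lra. 2: { intros x Hx. rewrite <- Eee by exact Hx. apply Ee. lra. }
    pose proof (phase_Riemann e' eta eps 1 pr1 He' ltac:(lra)) as Q1.
    pose proof (phase_Riemann e eta eps 1 pr1 He ltac:(lra) (fun x Hx => Ee x ltac:(lra))) as Q2.
    rewrite Q1 in Q2 by (intros x Hx; rewrite <- Eee by exact Hx; apply Ee; lra).
    rewrite (phase_Riemann e eta 0 1 pr He ltac:(lra) Ee), phase_0 in Hep.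
    assert (Hdata : forall k, u eps k = u' eps k /\ v eps k = v' eps k).
    { apply (half_interval_data e e1 q g mu mu1 K e' e1' q' g' mu' mu1' K' He W He' W' u v u' v' s sp F F' Fs eps Heps
        c c1 t1 (phase e 1) (S (S (m + 1)))); auto; try lra. rewrite Ee by lra. exact H1. }
    intros r Hr. unfold in01 in Hr. destruct (Rle_dec eps r) as [C'|C']; [apply Heq; lra|].
    rewrite <- Ee, <- Ee' by exact Hr. symmetry.
    apply (phase_determines e e' eps He He'); [| | |lra].
    + intros x Hx. rewrite Ee by lra. apply Heta_pos. unfold in01; lra.
    + intros x Hx. rewrite Ee' by lra. apply Hetat_pos. unfold in01; lra.
    + intros x Hx. apply (cauchy_data_phase e e1 q g mu mu1 K e' e1' q' g' mu' mu1' K' He W He' W' u v u' v' F F' eps Heps); auto. lra.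
Qed.
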